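(* Let $0<\sigma_0<\Sigma$, and let $q\ge1$ and $D\ge1$ be integers. Let $a^{(j)}$, $1\le j\le7$, be $(\Sigma,C^q)$-analytic, and let $P$ be a differential operator of order $2D$ satisfying the hypotheses (i)-(iii) of the context. Then there are $\sigma\in(0,\sigma_0]$ and $C>0$ such that, for every $(\sigma_0,H^q)$-analytic $f$ and every $(\sigma_0,H^{q+2D})$-analytic $\phi^{(\mathrm{IC})}$ of the form $$\phi^{(\mathrm{IC})}=\sum_{m=0}^\infty\rho^m\left(\phi_{m0}(s)e^{-\mathrm im\theta}+\phi_{mm}(s)e^{\mathrm im\theta}\right),$$ there is a unique $(\sigma,H^{q+2D})$-analytic near-axis solution $\phi$ of $$\Delta_\perp(1+P)\phi=f+L^{(a)}\phi$$ with initial data $\phi^{(\mathrm{IC})}$. Moreover, the solution operator is continuous in the coefficients $a^{(j)}$ (with respect to the $(\Sigma,C^q)$-analytic norms on the $a^{(j)}$ and the $(\sigma,H^{q+2D})$-analytic norm on $\phi$), and $$\|\phi\|_{\sigma,H^{q+2D}}\le C\|f\|_{\sigma_0,H^q}+C\|\phi^{(\mathrm{IC})}\|_{\sigma_0,H^{q+2D}}.$$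
   Context: $\mathbb T=\mathbb R/2\pi\mathbb Z$. For $\sigma>0$, $\Omega^0_\sigma=[0,\sigma)\times\mathbb T^2$ with coordinates $(\rho,\theta,s)$ is the solid torus. For a Banach space $W$ of functions on $\mathbb T^2$, a function $f$ on $\Omega_\sigma^0$ is $(\sigma,W)$-analytic if it has a convergent expansion $f=\sum_{m\ge0}f_m(\theta,s)\rho^m$ with $f_m(\theta,s)=\sum_{n=0}^mf_{mn}(s)e^{(2n-m)\mathrm i\theta}$ (convergence in $W$ for each fixed $\rho<\sigma$) and $\|f\|_{\sigma,W}=\sup_m\sigma^m\|f_m\|_W<\infty$. $H^q$ and $C^q$ denote $H^q(\mathbb T^2)$ and $C^q(\mathbb T^2)$ in the variables $(\theta,s)$. For a series $g=\sum_m g_m\rho^m$, $(g)_m=g_m$. Perpendicular Laplacian: $\Delta_\perp\phi=\frac1\rho\partial_\rho(\rho\,\partial_\rho\phi)+\frac1{\rho^2}\partial_\theta^2\phi$. The operator $L^{(a)}$: $$L^{(a)}\phi=a^{(1)}\phi+\partial_\rho a^{(2)}\,\partial_\rho\phi+\tfrac1{\rho^2}\partial_\theta a^{(2)}\,\partial_\theta\phi+a^{(3)}\partial_\theta\phi+a^{(4)}\partial_s\phi+a^{(5)}\partial_\theta^2\phi+a^{(6)}\partial_\theta\partial_s\phi+a^{(7)}\partial_s^2\phi.$$ Hypotheses on $P$: (i) $P=\sum_{m=0}^{2D}\sum_{n=0}^mP^{(mn)}(s)\,\partial_s^{m-n}\partial_\theta^n$ with $P^{(mn)}\in C^q(\mathbb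 T)$ (coefficients independent of $\theta$ and $\rho$); (ii) $P$ is strongly elliptic: for some $C>0$, for all $s$ and all $(x,y)\in\mathbb R^2\setminus\{0\}$, $(-1)^D\sum_{n=0}^{2D}P^{(2D,n)}(s)x^{2D-n}y^n\ge C(x^2+y^2)^D$; (iii) $P$ is self-adjoint and positive semidefinite: $\langle f,Pg\rangle=\langle Pf,g\rangle$ and $\langle f,Pf\rangle\ge0$ for $f,g\in H^{2D}(\mathbb T^2)$, where $\langle f,g\rangle=\int_{\mathbb T^2}fg\,d\theta\,ds$. $P$ acts on series coefficientwise. Near-axis solution with initial data $\phi^{(\mathrm{IC})}$: a series $\phi=\sum_m\rho^m\phi_m$, $\phi_m=\sum_{n=0}^m\phi_{mn}(s)e^{(2n-m)\mathrm i\theta}$, satisfying the equation at every order in $\rho$ and whose coefficients of $e^{\pm\mathrm im\theta}$ in $\phi_m$ are those of $\phi^{(\mathrm{IC})}$; equivalently, for all $m\ge0$, $$\phi_m=\phi^{(\mathrm{IC})}_m+\big((1+P)^{-1}\Delta_\perp^+[f+L^{(a)}\phi]\big)_m,$$ where $\Delta_\perp^+$ is the linear map, extended coefficientwise in $s$, with $\Delta_\perp^+(\rho^me^{\mathrm i(2n-m)\theta})=\frac{1}{(m+2)^2-(2n-m)^2}\rho^{m+2}e^{\mathrm i(2n-m)\theta}$, $0\le n\le m$. (The right-hand side at order $m$ involves only $\phi_k$ with $k<m$.) Continuity in the coefficients is meant locally: near given coefficients $(a^{(1)},\dots,a^{(7)})$ the same $\sigma$ can be used, and for fixed $f,\phi^{(\mathrm{IC})}$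 the solution $\phi$ depends continuously on the coefficients there. *)

(* Defs.v *)
From HB Require Import structures.
From mathcomp Require Import all_boot all_order all_algebra.
From mathcomp.real_closed Require Import complex.
From mathcomp Require Import all_classical all_reals all_analysis.

Set Implicit Arguments.
Unset Strict Implicit.
Unset Printing Implicit Defensive.

Import Order.TTheory GRing.Theory Num.Theory.
Import numFieldNormedType.Exports.

Local Open Scope classical_set_scope.
Local Open Scope ring_scope.

Section Torus.
Context {R : realType}.
Implicit Types (u v f g psi : R * R -> R) (z : R * R).

(* A function on the torus is a function of z = (theta, s) that is 2pi-periodic
   in both variables.  All functions of theta and s are real-valued, whereas
   their Fourier coefficients in theta are complex. *)
Definition periodic2 f : Prop :=
  forall x y, f (x + 2 * pi, y) = f (x, y) /\ f (x, y + 2 * pi) = f (x, y).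

Definition area :
    {measure set (measurableTypeR R * measurableTypeR R)%type -> \bar R} :=
  (@lebesgue_measure R \x @lebesgue_measure R)%E.

Definition circle : set R := `[0, 2 * pi]%classic.

Definition cell : set (R * R) := circle `*` circle.

Definition integral2 f : R := \int[area]_(z in cell) f z.

Definition aeeq u v : Prop := {ae area, forall z, u z = v z}.

Definition dtheta f z : R := derive1 (fun x => f (x, z.2)) z.1.
Definition ds f z : R := derive1 (fun y => f (z.1, y)) z.2.

(* [pd i j] is d_s^j d_theta^i *)
Definition pd (i j : nat) f : R * R -> R := iter j ds (iter i dtheta f).

Fixpoint is_Cq (q : nat) f : Prop :=
  [/\ periodic2 f, continuous f &
    if q is q'.+1 then
      [/\ forall z, derivable (fun x => f (x, z.2)) z.1 1,
          forall z, derivable (fun y => f (z.1, y)) z.2 1,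
          is_Cq q' (dtheta f) & is_Cq q' (ds f)]
    else True].

Definition Cq_norm (q : nat) f : R :=
  \sum_(i < q.+1) \sum_(j < (q - i).+1) sup (range (fun z => `|pd i j f z|)).

Definition is_L2 u : Prop :=
  [/\ periodic2 u, measurable_fun setT u &
      area.-integrable cell (fun z => (u z ^+ 2)%:E)].

Definition weak_dtheta u v : Prop :=
  is_L2 v /\ forall psi, is_Cq 1 psi ->
    integral2 (fun z => u z * dtheta psi z) = - integral2 (fun z => v z * psi z).
Definition weak_ds u v : Prop :=
  is_L2 v /\ forall psi, is_Cq 1 psi ->
    integral2 (fun z => u z * ds psi z) = - integral2 (fun z => v z * psi z).

(* A representative of the weak derivative (unique almost everywhere) if it
   exists in L^2, and 0 otherwise *)
Definition wdtheta u : R * R -> R := xget (fun=> 0) [set v | weak_dtheta u v].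
Definition wds u : R * R -> R := xget (fun=> 0) [set v | weak_ds u v].

(* [wd i j] is d_s^j d_theta^i *)
Definition wd (i j : nat) u : R * R -> R := iter j wds (iter i wdtheta u).

Fixpoint is_Hq (q : nat) u : Prop :=
  is_L2 u /\
  if q is q'.+1 then
    [/\ weak_dtheta u (wdtheta u), weak_ds u (wds u),
        is_Hq q' (wdtheta u) & is_Hq q' (wds u)]
  else True.

Definition Hq_norm (q : nat) u : R :=
  Num.sqrt (\sum_(i < q.+1) \sum_(j < (q - i).+1)
              integral2 (fun z => wd i j u z ^+ 2)).

Definition is_Cq1 (q : nat) (p : R -> R) : Prop :=
  [/\ forall s, p (s + 2 * pi) = p s,
      forall k, (k < q)%N -> forall s, derivable (derive1n k p) s 1 &
      forall k, (k <= q)%N -> continuous (derive1n k p)].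

Definition expi (k : int) (theta : R) : R[i] :=
  (cos (k%:~R * theta) +i* sin (k%:~R * theta))%C.

Definition fourier_theta u (k : int) (s : R) : R[i] :=
  ((2 * pi)^-1 * (\int[@lebesgue_measure R]_(x in circle)
                    (u (x, s) * cos (k%:~R * x)))
   -i* ((2 * pi)^-1 * (\int[@lebesgue_measure R]_(x in circle)
                    (u (x, s) * sin (k%:~R * x)))))%C.

End Torus.

Record function_space (R : realType) := FunctionSpace {
  in_space : (R * R -> R) -> Prop;
  space_norm : (R * R -> R) -> R }.

Definition Cq_space (R : realType) (q : nat) : function_space R :=
  FunctionSpace (is_Cq q) (Cq_norm q).
Definition Hq_space (R : realType) (q : nat) : function_space R :=
  FunctionSpace (is_Hq q) (Hq_norm q).

(* [f : rho_series R] stands for sum_m rho^m f_m(theta, s). *)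
Definition rho_series (R : realType) := nat -> R * R -> R.

Section Series.
Context {R : realType}.
Implicit Types (f g phi : rho_series R) (a b : nat -> rho_series R).
Implicit Types (P : nat -> nat -> R -> R).

Definition series_sub f g : rho_series R := fun m z => f m z - g m z.

(* Elements of H^q are only determined almost everywhere; for elements of C^q
   equality almost everywhere is equality. *)
Definition has_modes f : Prop :=
  forall m, exists c : nat -> R -> R[i],
    {ae area, forall z : R * R, ((f m z)%:C)%C =
      \sum_(n < m.+1) c n z.2 * expi (n%:Z *+ 2 - m%:Z) z.1}.

Definition analytic_norm (sigma : R) (W : function_space R) f : \bar R :=
  ereal_sup (range (fun m => (sigma ^+ m * space_norm W (f m))%:E)).

Definition analytic (sigma : R) (W : function_space R) f : Prop :=
  [/\ forall m, in_space W (f m),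
      has_modes f,
      forall rho : R, 0 <= rho < sigma -> exists2 w, in_space W w &
        (fun N : nat =>
           space_norm W (fun z => w z - \sum_(m < N) rho ^+ m * f m z))
          @ \oo --> (0 : R) &
      (analytic_norm sigma W f < +oo)%E].

Definition drho f : rho_series R := fun m z => (m.+1)%:R * f m.+1 z.

Definition series_mul f g : rho_series R :=
  fun m z => \sum_(k < m.+1) f k z * g (m - k)%N z.

(* Division by rho^2.  In the uses below the coefficients of order 0 and 1 that
   are dropped vanish, because of [has_modes]. *)
Definition div_rho2 f : rho_series R := fun m => f m.+2.

(* (1/rho) d_rho (rho d_rho phi) + (1/rho^2) d_theta^2 phi, where the
   coefficient of rho^m in rho d_rho phi is m phi_m *)
Definition laplace_perp phi : rho_series R :=
  div_rho2 (fun m z => m%:R ^+ 2 * phi m z + wd 2 0 (phi m) z).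

(* The coefficient [P m n] multiplies d_s^(m-n) d_theta^n. *)
Definition apply_P (D : nat) P (u : R * R -> R) : R * R -> R :=
  fun z => \sum_(m < (2 * D).+1) \sum_(n < m.+1) P m n z.2 * wd n (m - n) u z.

Definition one_plus_P (D : nat) P phi : rho_series R :=
  fun m z => phi m z + apply_P D P (phi m) z.

(* The derivatives of the coefficients a are classical, those of phi weak. *)
Definition apply_L a phi : rho_series R := fun m z =>
  series_mul (a 1%N) phi m z
  + series_mul (drho (a 2%N)) (drho phi) m z
  + div_rho2 (series_mul (fun k => dtheta (a 2%N k)) (fun k => wd 1 0 (phi k))) m z
  + series_mul (a 3%N) (fun k => wd 1 0 (phi k)) m z
  + series_mul (a 4%N) (fun k => wd 0 1 (phi k)) m z
  + series_mul (a 5%N) (fun k => wd 2 0 (phi k)) m z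
  + series_mul (a 6%N) (fun k => wd 1 1 (phi k)) m z
  + series_mul (a 7%N) (fun k => wd 0 2 (phi k)) m z.

Definition strongly_elliptic (D : nat) P : Prop :=
  exists2 C : R, 0 < C & forall s x y : R, (x, y) != (0, 0) ->
    C * (x ^+ 2 + y ^+ 2) ^+ D <=
    (-1) ^+ D * \sum_(n < (2 * D).+1)
                  P (2 * D)%N n s * x ^+ (2 * D - n) * y ^+ n.

Definition selfadjoint (D : nat) P : Prop :=
  forall u v : R * R -> R, is_Hq (2 * D) u -> is_Hq (2 * D) v ->
    integral2 (fun z => u z * apply_P D P v z) =
    integral2 (fun z => apply_P D P u z * v z).

Definition positive_semidefinite (D : nat) P : Prop :=
  forall u : R * R -> R, is_Hq (2 * D) u ->
    0 <= integral2 (fun z => u z * apply_P D P u z).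

Definition extremal_modes f : Prop :=
  forall m, exists c0 c1 : R -> R[i],
    {ae area, forall z : R * R, ((f m z)%:C)%C =
      c0 z.2 * expi (- m%:Z) z.1 + c1 z.2 * expi m%:Z z.1}.

Definition same_initial_data phi phiIC : Prop :=
  forall m, {ae @lebesgue_measure R, forall s,
    fourier_theta (phi m) (- m%:Z) s = fourier_theta (phiIC m) (- m%:Z) s /\
    fourier_theta (phi m) m%:Z s = fourier_theta (phiIC m) m%:Z s}.

Definition near_axis_solution (D : nat) P a f phiIC phi : Prop :=
  [/\ has_modes phi,
      forall m, aeeq (laplace_perp (one_plus_P D P phi) m)
                     (fun z => f m z + apply_L a phi m z) &
      same_initial_data phi phiIC].

Definition analytic_solution (sigma : R) (q D : nat) P a f phiIC phi : Prop :=
  analytic sigma (Hq_space R (q + 2 * D)) phi /\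
  near_axis_solution D P a f phiIC phi.

(* Only the entries 1, ..., 7 of [a : nat -> rho_series R] are used. *)
Definition coefficients (Sigma : R) (q : nat) a : Prop :=
  forall j, (1 <= j <= 7)%N -> analytic Sigma (Cq_space R q) (a j).

Definition coefficients_close (Sigma : R) (q : nat) (delta : R) a b : Prop :=
  forall j, (1 <= j <= 7)%N ->
    (analytic_norm Sigma (Cq_space R q) (series_sub (b j) (a j)) < delta%:E)%E.

End Series.

(* Main.v *)
(* At order [m + 2] the equation determines the new coefficient, up to its
   prescribed extreme frequencies, by inverting [1 + P] after division by the
   eigenvalues [(m + 2)^2 - k^2] of [Delta_perp]; as [1 + P] preserves the finitely
   many theta-frequencies allowed, everything reduces to a bound for its inverse
   on [H^q] that does not depend on [m], and to surjectivity.

   The bound: an elliptic operator with constant coefficients is a product of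
   factors [d_s - z d_theta] with [z] away from the real line, each bounded below;
   freezing the coefficients on small arcs in [s] gives the estimate up to lower
   order terms, which interpolation and [<x, (1 + P) x> >= |x|^2] absorb.
   Surjectivity on finitely many frequencies, where ellipticity in [s] alone is
   enough, follows by the method of continuity,
   starting from [(1 - d_s^2)^D].

   Since [(m + 2)^2 - k^2 >= 4 (m + 1)] for [|k| <= m], a theta-derivative of
   coefficients, which costs a factor of the order [m], is compensated, and the
   weighted bounds on [s^m phi_m] close once [s] is small. The same estimate for
   the difference of two solutions gives uniqueness and continuity. *)

From HB Require Import structures.
Require Import Defs.
From mathcomp Require Import all_boot all_order all_algebra.
From mathcomp.real_closed Require Import complex.
From mathcomp Require Import all_classical all_reals all_analysis.
From mathcomp Require Import measurable_realfun ring lra zify.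

Set Implicit Arguments.
Unset Strict Implicit.
Unset Printing Implicit Defensive.

Import Order.TTheory GRing.Theory Num.Theory.
Import numFieldNormedType.Exports.

Local Open Scope classical_set_scope.
Local Open Scope ring_scope.

(** * Integration on the torus *)

(** Two estimates of different nature are needed. The inverse of [1 + P] must be bounded
    independently of the order [m], which uses ellipticity in both variables; surjectivity is needed
    for one [m] at a time, with constants that may grow with [m]. The term of [L^(a)] with [a^(2)]
    is the delicate one. Its radial and angular parts separately contain the frequencies [m + 2] and
    [-(m + 2)], at which [(m + 2)^2 - k^2] vanishes; in each pair of a coefficient and an unknown
    they cancel. Moreover [d_theta a^(2)] seems to be only [C^(q-1)]; but the coefficient of order
    [k] is a trigonometric polynomial in theta of degree at most [k], so its theta-derivative is a
    combination of translates and stays in [C^q], at the cost of a factor [2 (k + 1)^2]. Factors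
    polynomial in [k] are absorbed by raising the growth rate [1/Sigma] to [4/Sigma + 1]; only a
    factor [m + 1], from the radial derivative of [phi], is left for [Delta_perp] to compensate. The
    work is done on classes modulo null sets, where weak derivatives are maps. *)

Lemma restrict_setX (T1 T2 : Type) (R : numDomainType) (D1 : set T1) (D2 : set T2)
    (f : T1 * T2 -> \bar R) x y :
  (f \_ (D1 `*` D2)) (x, y) = ((fun x' => ((fun y' => f (x', y')) \_ D2) y) \_ D1) x.
Proof.
rewrite !patchE /= in_setX /=.
by case: (x \in D1); case: (y \in D2).
Qed.

Lemma abse_fine_le (R : realDomainType) (x : \bar R) : (`|(fine x)%:E| <= `|x|)%E.
Proof. by case: x => [r||] //=; rewrite normr0 leey. Qed.

Section ProductIntegrals.
Local Open Scope ereal_scope.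
Context d1 d2 {T1 : measurableType d1} {T2 : measurableType d2} {R : realType}.
Variables (m1 : {sigma_finite_measure set T1 -> \bar R})
          (m2 : {sigma_finite_measure set T2 -> \bar R}).
Variables (D1 : set T1) (D2 : set T2).
Hypotheses (mD1 : measurable D1) (mD2 : measurable D2).
Implicit Types f : T1 * T2 -> R.

Let mD : measurable (D1 `*` D2). Proof. exact: measurableX. Qed.

Lemma tonelli_setX1 (f : T1 * T2 -> \bar R) : measurable_fun [set: T1 * T2] f ->
  (forall z, 0 <= f z)%E ->
  (\int[m1 \x m2]_(z in D1 `*` D2) f z = \int[m1]_(x in D1) \int[m2]_(y in D2) f (x, y))%E.
Proof.
move=> mf f0.
rewrite integral_mkcond fubini_tonelli1; last 2 first.
- by apply/(measurable_restrictT _ _).1 => //; exact: measurable_funTS.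
- by move=> z; rewrite patchE; case: ifP.
rewrite [RHS]integral_mkcond; apply: eq_integral => x _.
rewrite /fubini_F [RHS]patchE.
under eq_integral do rewrite restrict_setX patchE.
case: ifPn => _.
  by rewrite [RHS]integral_mkcond.
by rewrite integral0.
Qed.

Lemma tonelli_setX2 (f : T1 * T2 -> \bar R) : measurable_fun [set: T1 * T2] f ->
  (forall z, 0 <= f z)%E ->
  (\int[m1 \x m2]_(z in D1 `*` D2) f z = \int[m2]_(y in D2) \int[m1]_(x in D1) f (x, y))%E.
Proof.
move=> mf f0.
rewrite integral_mkcond fubini_tonelli2; last 2 first.
- by apply/(measurable_restrictT _ _).1 => //; exact: measurable_funTS.
- by move=> z; rewrite patchE; case: ifP.
rewrite [RHS]integral_mkcond; apply: eq_integral => y _.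
rewrite /fubini_G [RHS]patchE.
under eq_integral do rewrite restrict_setX.
case: ifPn => yD.
  rewrite [RHS]integral_mkcond; apply: eq_integral => x _.
  by rewrite !patchE yD.
rewrite integral0_eq// => x _.
by rewrite !patchE (negbTE yD); case: ifP.
Qed.

(** Splitting [f] into its positive and negative parts reduces the claim to Tonelli's theorem. No
    integrability is assumed, so sections with an infinite or undefined integral are covered. *)
Lemma measurable_partial_integral (f : T1 * T2 -> \bar R) : measurable_fun [set: T1 * T2] f ->
  measurable_fun setT (fun x => \int[m2]_(y in D2) f (x, y))%E.
Proof.
move=> mf.
under eq_fun do rewrite integralE.
have aux (g : T1 * T2 -> \bar R) : measurable_fun [set: T1 * T2] g -> (forall z, 0 <= g z)%E ->
    measurable_fun setT (fun x => \int[m2]_(y in D2) g (x, y))%E.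
  move=> mg g0.
  pose h : T1 * T2 -> \bar R := (g \_ (setT `*` D2)).
  have -> : (fun x => \int[m2]_(y in D2) g (x, y))%E = fubini_F m2 h.
    apply/funext => x; rewrite /fubini_F [LHS]integral_mkcond; apply: eq_integral => y _.
    by rewrite /h !patchE in_setX /= in_setT.
  apply: measurable_fun_fubini_tonelli_F.
  - apply/(measurable_restrictT _ _).1; first exact: measurableX.
    exact: measurable_funTS.
  - by move=> z; rewrite /h patchE; case: ifP.
apply: emeasurable_funB.
- under eq_fun do under eq_integral do rewrite funepos_comp/=.
  by apply: aux => //; exact: measurable_funepos.
- under eq_fun do under eq_integral do rewrite funeneg_comp/=.
  by apply: aux => //; exact: measurable_funeneg.
Qed.

Section fubini_real.
Variable f : T1 * T2 -> R.
Hypotheses (mf : measurable_fun [set: T1 * T2] f)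
  (intf : (m1 \x m2).-integrable (D1 `*` D2) (EFin \o f)).

Let F : T1 * T2 -> \bar R := (EFin \o f) \_ (D1 `*` D2).
Let intF : (m1 \x m2).-integrable setT F.
Proof. exact: ((integrable_mkcond (EFin \o f) mD).1 intf). Qed.

Let FE x : fubini_F m2 F x = ((fun x => \int[m2]_(y in D2) (f (x, y))%:E) \_ D1) x.
Proof.
rewrite /fubini_F /F patchE.
under eq_integral do rewrite restrict_setX patchE.
case: ifPn => _; first by rewrite [RHS]integral_mkcond.
by rewrite integral0.
Qed.

Lemma ae_integrable_section :
  {ae m1, forall x, D1 x -> m2.-integrable D2 (fun y => (f (x, y))%:E)}.
Proof.
have := ae_integrable1 intF.
apply: filterS => x h D1x.
apply/integrable_mkcond => //; apply: eq_integrable h => // y _.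
by rewrite /F restrict_setX patchE mem_set.
Qed.

Lemma integrable_partial :
  m1.-integrable D1 (fun x => \int[m2]_(y in D2) (f (x, y))%:E).
Proof. by apply/integrable_mkcond => //; apply: eq_integrable (integrable_fubini_F intF). Qed.

Lemma integrable_Rpartial :
  m1.-integrable D1 (fun x => (fine (\int[m2]_(y in D2) (f (x, y))%:E))%:E).
Proof.
have mg : measurable_fun setT (fun x => \int[m2]_(y in D2) (f (x, y))%:E).
  apply: (measurable_partial_integral (f := EFin \o f)).
  exact/measurable_EFinP.
apply: le_integrable integrable_partial => //.
  apply: measurable_funTS; apply/measurable_EFinP.
  by apply: measurableT_comp.
by move=> x _; exact: abse_fine_le.
Qed.

(** Taking real-valued inner integrals changes them only on sections that are not integrable, and
    these form a null set by Fubini's theorem in the extended reals. *)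
Lemma Rfubini : (\int[m1 \x m2]_(z in D1 `*` D2) f z =
  \int[m1]_(x in D1) \int[m2]_(y in D2) f (x, y))%R.
Proof.
rewrite /Rintegral; congr fine.
rewrite integral_mkcond -/F -(integral12_prod_meas1 intF).
rewrite [LHS](eq_integral ((fun x => \int[m2]_(y in D2) (f (x, y))%:E) \_ D1)); last first.
  by move=> x _; exact: FE.
rewrite -integral_mkcond; apply: ae_eq_integral => //.
- exact: measurable_int integrable_partial.
- exact: measurable_int integrable_Rpartial.
- apply: filterS ae_integrable_section => x h D1x.
  by rewrite fineK//; exact: integrable_fin_num (h D1x).
Qed.

End fubini_real.
End ProductIntegrals.

(** * Translations and periodicity *)

Section Translations.
Context {R : realType}.
Local Notation leb := (@lebesgue_measure R).
Implicit Types (t : R).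

Lemma two_pi_gt0 : 0 < 2 * pi :> R.
Proof. by rewrite mulr_gt0// pi_gt0. Qed.

Lemma measurable_circle : measurable (@circle R).
Proof. exact: measurable_itv. Qed.

Lemma measurable_cell : measurable (@cell R).
Proof. exact: measurableX measurable_circle measurable_circle. Qed.

Lemma measurable_shift t : measurable_fun setT ((fun x => x + t) : R -> R).
Proof. by apply: measurable_funD. Qed.

(** The pushforward of Lebesgue measure under a translation gives half-open intervals their length,
    so it is Lebesgue measure by uniqueness. *)
Lemma lebesgue_measure_shift t (A : set R) : measurable A ->
  leb ((fun x => x + t) @^-1` A) = leb A.
Proof.
move=> mA.
have mt : measurable_fun setT ((fun x => x + t) : R -> measurableTypeR R).
  exact: measurable_shift.
apply/esym.
apply: (lebesgue_measure_unique (mu :=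
  measure_function_pushforward__canonical__measure_function_Measure leb mt)) => //= _ [[a b]] _ <-.
rewrite /pushforward/=.
have -> : (fun x : R => x + t) @^-1` `]a, b]%classic = `]a - t, b - t]%classic.
  by apply/seteqP; split => x /=; rewrite !in_itv/= ltrBlDr lerBrDr.
by rewrite !lebesgue_measure_itv/= !lte_fin ltrD2r -!EFinB; case: ifP => // _; congr EFin; ring.
Qed.

End Translations.

Section Periodicity.
Context {R : realType}.
Local Notation leb := (@lebesgue_measure R).

Lemma periodic_int (T : Type) (f : R -> T) : (forall x, f (x + 2 * pi) = f x) ->
  forall (k : int) x, f (x + k%:~R * (2 * pi)) = f x.
Proof.
move=> fp.
have pos (n : nat) x : f (x + n%:R * (2 * pi)) = f x.
  elim: n x => [|n IH] x; first by rewrite mul0r addr0.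
  by rewrite -natr1 mulrDl mul1r addrA fp IH.
case=> n x; first by rewrite -pmulrn.
by rewrite NegzE mulrNz mulNr -[in RHS](subrK (n.+1%:R * (2 * pi)) x) pos.
Qed.

Lemma fundamental_domain (x : R) : exists k : int, 0 <= x - k%:~R * (2 * pi) <= 2 * pi.
Proof.
have p0 := @two_pi_gt0 R.
exists (Num.floor (x / (2 * pi))).
have := floor_le_tmp (x / (2 * pi)); have := lt_succ_floor (x / (2 * pi)).
rewrite ler_pdivlMr// ltr_pdivrMr// intrD mulrDl mul1r.
move=> h1 h2; apply/andP; split; lra.
Qed.

#[global] Instance ae_area_filter : Filter (nbhs (almost_everywhere (@area R))).
Proof. exact: ae_filter_ringOfSetsType. Qed.

Definition shift2 (a b : R) (z : R * R) : R * R := (z.1 + a, z.2 + b).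

Lemma measurable_shift2 a b : measurable_fun setT (shift2 a b).
Proof.
apply/measurable_fun_pairP; split => /=.
  by apply: measurable_funD => //; exact: measurable_fst.
by apply: measurable_funD => //; exact: measurable_snd.
Qed.

Lemma measurable_swap2 : measurable_fun setT (fun z : R * R => (z.2, z.1)).
Proof.
by apply/measurable_fun_pairP; split => /=; [exact: measurable_snd|exact: measurable_fst].
Qed.

Lemma measurable_section1 d (T : measurableType d) (f : R * R -> T) x :
  measurable_fun setT f -> measurable_fun setT (fun y => f (x, y)).
Proof. by move=> mf; apply: (measurableT_comp mf); exact: measurable_pair1. Qed.

Lemma measurable_section2 d (T : measurableType d) (f : R * R -> T) y :
  measurable_fun setT f -> measurable_fun setT (fun x => f (x, y)).
Proof. by move=> mf; apply: (measurableT_comp mf); exact: measurable_pair2. Qed.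

Lemma area_tonelli1 (f : R * R -> \bar R) : measurable_fun setT f ->
  (forall z, 0 <= f z)%E ->
  (\int[area]_(z in cell) f z =
   \int[leb]_(x in circle) \int[leb]_(y in circle) f (x, y))%E.
Proof.
move=> mf f0.
exact: (@tonelli_setX1 _ _ (measurableTypeR R) (measurableTypeR R) R leb leb circle circle
  (@measurable_circle R) (@measurable_circle R) f mf f0).
Qed.

Lemma area_tonelli2 (f : R * R -> \bar R) : measurable_fun setT f ->
  (forall z, 0 <= f z)%E ->
  (\int[area]_(z in cell) f z =
   \int[leb]_(y in circle) \int[leb]_(x in circle) f (x, y))%E.
Proof.
move=> mf f0.
exact: (@tonelli_setX2 _ _ (measurableTypeR R) (measurableTypeR R) R leb leb circle circle
  (@measurable_circle R) (@measurable_circle R) f mf f0).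
Qed.

Lemma ge0_integral_cell_swap (f : R * R -> \bar R) :
  measurable_fun setT f -> (forall z, 0 <= f z)%E ->
  (\int[area]_(z in cell) f (z.2, z.1) = \int[area]_(z in cell) f z)%E.
Proof.
move=> mf f0; have mc := @measurable_circle R.
have mfs : measurable_fun setT (fun z => f (z.2, z.1)).
  exact: measurableT_comp mf measurable_swap2.
by rewrite (area_tonelli1 mf f0) (area_tonelli2 mfs (fun z => f0 _)).
Qed.

(** Integrability and the integral are determined by [|f|], [f^+] and [f^-]. Invariance is therefore
    asked only of non-negative functions that factor through [f]. *)
Lemma integrable_cell_comp (T : R * R -> R * R) (f : R * R -> R) :
  measurable_fun setT T -> measurable_fun setT f ->
  (forall g : R * R -> \bar R, measurable_fun setT g -> (forall z, 0 <= g z)%E ->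
    (forall z z', f z = f z' -> g z = g z') ->
    (\int[area]_(z in cell) g (T z) = \int[area]_(z in cell) g z)%E) ->
  area.-integrable cell (EFin \o f) ->
  area.-integrable cell (EFin \o (f \o T)) /\ integral2 (f \o T) = integral2 f.
Proof.
move=> mT mf inv /integrableP[_ fi].
have mef : measurable_fun setT (EFin \o f) by exact/measurable_EFinP.
split.
  apply/integrableP; split.
    by apply: measurable_funTS; apply/measurable_EFinP; exact: measurableT_comp.
  have mabs : measurable_fun setT (abse \o (EFin \o f)) by exact: measurableT_comp.
  have abs0 z : (0 <= (abse \o (EFin \o f)) z)%E by rewrite /= lee_fin normr_ge0.
  have absp z z' : f z = f z' -> (abse \o (EFin \o f)) z = (abse \o (EFin \o f)) z' by move=> /= ->.
  by have /= -> := inv _ mabs abs0 absp.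
rewrite /integral2 /Rintegral; congr fine.
rewrite integralE [RHS]integralE; congr (_ - _)%E.
- have mp : measurable_fun setT ((EFin \o f)^\+)%E by exact: measurable_funepos.
  have fp z z' : f z = f z' -> ((EFin \o f)^\+)%E z = ((EFin \o f)^\+)%E z'.
    by rewrite !funeposE /= => ->.
  etransitivity; last exact: (inv _ mp (fun z => funepos_ge0 _ _) fp).
  by apply: eq_integral => z _; rewrite !funeposE.
- have mp : measurable_fun setT ((EFin \o f)^\-)%E by exact: measurable_funeneg.
  have fp z z' : f z = f z' -> ((EFin \o f)^\-)%E z = ((EFin \o f)^\-)%E z'.
    by rewrite !funenegE /= => ->.
  etransitivity; last exact: (inv _ mp (fun z => funeneg_ge0 _ _) fp).
  by apply: eq_integral => z _; rewrite !funenegE.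
Qed.

Lemma area_shift2 a b (A : set (R * R)) : measurable A -> area (shift2 a b @^-1` A) = area A.
Proof.
move=> mA; apply/esym.
have msh : measurable_fun setT (shift2 a b :
    (measurableTypeR R * measurableTypeR R)%type -> (measurableTypeR R * measurableTypeR R)%type).
  exact: measurable_shift2.
have uniq := @product_measure_unique _ _ _ _ _ leb leb
  (measure_function_pushforward__canonical__measure_function_Measure area msh).
apply: uniq => //.
move=> B C mB mC; rewrite /= /pushforward.
have -> : shift2 a b @^-1` (B `*` C) = ((fun x => x + a) @^-1` B) `*` ((fun x => x + b) @^-1` C).
  by [].
have mBa : measurable ((fun x : R => x + a) @^-1` B).
  by rewrite -[X in measurable X]setTI; exact: measurable_shift.
have mCb : measurable ((fun x : R => x + b) @^-1` C).
  by rewrite -[X in measurable X]setTI; exact: measurable_shift.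
rewrite /area [LHS]product_measure1E//.
by congr (_ * _)%E; exact: lebesgue_measure_shift.
Qed.

Lemma ae_shift2 a b (P : R * R -> Prop) :
  {ae area, forall z, P z} -> {ae area, forall z, P (shift2 a b z)}.
Proof.
move=> [N [mN N0 PN]]; exists (shift2 a b @^-1` N); split.
- by rewrite -[X in measurable X]setTI; exact: measurable_shift2.
- by rewrite -N0; exact: area_shift2.
- by move=> z /= nP; apply: PN.
Qed.

(** The plane is covered by the translates of the cell by pairs of multiples of [2 * pi]; they are
    countably many, enumerated through [unpickle], and each translate of the exceptional set is
    null. *)
Lemma ae_periodic (P : R * R -> Prop) :
  (forall x y, (P (x + 2 * pi, y) <-> P (x, y)) /\ (P (x, y + 2 * pi) <-> P (x, y))) ->
  {ae area, forall z, cell z -> P z} -> {ae area, forall z, P z}.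
Proof.
move=> Pper aeP.
pose sh (k : int * int) := shift2 (- (k.1%:~R * (2 * pi))) (- (k.2%:~R * (2 * pi))).
have : {ae area, forall z, forall n : nat, forall k : int * int, unpickle n = Some k ->
    cell (sh k z) -> P (sh k z)}.
  apply: (@ae_foralln _ _ _ area (fun n z => forall k : int * int, unpickle n = Some k -> cell (sh k z) -> P (sh k z))).
  move=> n; case: (unpickle n) => [k|]; last exact: aeW.
  have := ae_shift2 (- (k.1%:~R * (2 * pi))) (- (k.2%:~R * (2 * pi))) aeP.
  by apply: filterS => z h k' [<-].
apply: filterS => -[x y] h.
have [k hk] := fundamental_domain x; have [l hl] := fundamental_domain y.
have := h (pickle (k, l)) (k, l) (pickleK _); rewrite /sh /shift2/=.
have P1 : forall y, (fun x => P (x, y)) = (fun x => P (x + 2 * pi, y)).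
  by move=> y'; apply/funext => x'; apply/propext; apply: iff_sym; exact: (Pper _ _).1.
have P2 : forall x, (fun y => P (x, y)) = (fun y => P (x, y + 2 * pi)).
  by move=> x'; apply/funext => y'; apply/propext; apply: iff_sym; exact: (Pper _ _).2.
have e1 y' := periodic_int (f := fun x => P (x, y')) (fun x => esym (congr1 (@^~ x) (P1 y'))).
have e2 x' := periodic_int (f := fun y => P (x', y)) (fun y => esym (congr1 (@^~ y) (P2 x'))).
have -> : P (x - k%:~R * (2 * pi), y - l%:~R * (2 * pi)) = P (x, y).
  rewrite -mulNr -mulrNz (e1 _ (- k)) -mulNr -mulrNz; exact: (e2 _ (- l)).
apply; split; rewrite /circle/= in_itv//=.
Qed.

Lemma integrable_cell_swap (f : R * R -> R) : measurable_fun setT f ->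
  area.-integrable cell (EFin \o f) ->
  area.-integrable cell (EFin \o (fun z => f (z.2, z.1))).
Proof.
move=> mf fi; apply: (integrable_cell_comp measurable_swap2 mf _ fi).1.
by move=> g mg g0 _; exact: ge0_integral_cell_swap.
Qed.

Lemma integral2_swap (f : R * R -> R) : measurable_fun setT f ->
  area.-integrable cell (EFin \o f) ->
  integral2 (fun z => f (z.2, z.1)) = integral2 f.
Proof.
move=> mf fi; apply: (integrable_cell_comp measurable_swap2 mf _ fi).2.
by move=> g mg g0 _; exact: ge0_integral_cell_swap.
Qed.

Lemma ae_swap2 (P : R * R -> Prop) :
  {ae area, forall z, P z} -> {ae area, forall z, P (z.2, z.1)}.
Proof.
move=> [N [mN N0 PN]]; exists ((fun z : R * R => (z.2, z.1)) @^-1` N); split.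
- by rewrite -[X in measurable X]setTI; exact: measurable_swap2.
- rewrite -N0; apply/esym.
  have msw : measurable_fun setT ((fun z => (z.2, z.1)) :
      (measurableTypeR R * measurableTypeR R)%type -> (measurableTypeR R * measurableTypeR R)%type).
    exact: measurable_swap2.
  have uniq := @product_measure_unique _ _ _ _ _ leb leb
    (measure_function_pushforward__canonical__measure_function_Measure area msw).
  apply: uniq => // B C mB mC; rewrite /= /pushforward.
  have -> : (fun z : R * R => (z.2, z.1)) @^-1` (B `*` C) = C `*` B.
    by apply/seteqP; split => -[x y] [].
  by rewrite /area [LHS]product_measure1E// muleC.
- by move=> z /= nP; apply: PN.
Qed.

Lemma area_fubini1 (f : R * R -> R) : measurable_fun setT f ->
  area.-integrable cell (EFin \o f) ->
  integral2 f = \int[leb]_(x in circle) \int[leb]_(y in circle) f (x, y).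
Proof.
move=> mf fi.
exact: (@Rfubini _ _ (measurableTypeR R) (measurableTypeR R) R leb leb circle circle
  (@measurable_circle R) (@measurable_circle R) f mf fi).
Qed.

Lemma area_fubini2 (f : R * R -> R) : measurable_fun setT f ->
  area.-integrable cell (EFin \o f) ->
  integral2 f = \int[leb]_(y in circle) \int[leb]_(x in circle) f (x, y).
Proof.
move=> mf fi; rewrite -(integral2_swap mf fi) area_fubini1//.
  exact: measurableT_comp mf measurable_swap2.
exact: integrable_cell_swap.
Qed.

Lemma integral2_ae (f g : R * R -> R) : measurable_fun setT f -> measurable_fun setT g ->
  aeeq f g -> integral2 f = integral2 g.
Proof.
move=> mf mg fg; rewrite /integral2 /Rintegral; congr fine.
apply: ae_eq_integral => //.
- exact: measurable_cell.
- by apply: measurable_funTS; exact/measurable_EFinP.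
- by apply: measurable_funTS; exact/measurable_EFinP.
- by apply: filterS fg => z -> _.
Qed.

Lemma integrable_cell_ae (f g : R * R -> R) : measurable_fun setT g ->
  aeeq f g -> area.-integrable cell (EFin \o f) -> area.-integrable cell (EFin \o g).
Proof.
move=> mg fg /integrableP[mf fi]; apply/integrableP; split.
  by apply: measurable_funTS; exact/measurable_EFinP.
suff -> : (\int[area]_(x in cell) `|(EFin \o g) x| = \int[area]_(x in cell) `|(EFin \o f) x|)%E by [].
apply: ae_eq_integral.
- exact: measurable_cell.
- by apply: measurableT_comp => //; apply: measurable_funTS; exact/measurable_EFinP.
- exact: measurableT_comp.
- by apply: filterS fg => z /= -> _.
Qed.

Lemma area_cell_lty : (area (@cell R) < +oo)%E.
Proof.
rewrite /area /cell [X in (X < _)%E]product_measure1E; [|exact: measurable_circle..].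
have e : leb circle = (2 * pi)%:E.
  by rewrite /circle lebesgue_measure_itv/= lte_fin two_pi_gt0 oppr0 adde0.
have -> : (lebesgue_measure_lebesgue_measure__canonical__measure_function_Measure R circle *
  lebesgue_measure_lebesgue_measure__canonical__measure_function_SigmaFiniteMeasure R circle)%E
  = (leb circle * leb circle)%E by [].
by rewrite e -EFinM ltry.
Qed.

End Periodicity.

(** * Square-integrable periodic functions and their completeness *)

Section L2.
Context {R : realType}.
Implicit Types (u v w f g : R * R -> R) (c : R).

Definition intc f := area.-integrable (@cell R) (EFin \o f).

Let mcell : measurable (cell : set (measurableTypeR R * measurableTypeR R)%type).
Proof. exact: measurable_cell. Qed.

Lemma eq_intc f g : f =1 g -> intc f -> intc g.
Proof. by move=> /funext ->. Qed.

Lemma aeeq_refl u : aeeq u u. Proof. exact: aeW. Qed.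
Lemma aeeq_sym u v : aeeq u v -> aeeq v u.
Proof. by apply: filterS => z ->. Qed.
Lemma aeeq_trans u v w : aeeq u v -> aeeq v w -> aeeq u w.
Proof. by apply: filterS2 => z -> ->. Qed.

Lemma intcD f g : intc f -> intc g -> intc (fun z => f z + g z).
Proof. by move=> hf hg; have h := integrableD mcell hf hg; exact: h. Qed.
Lemma intcZ c f : intc f -> intc (fun z => c * f z).
Proof. by move=> hf; have h := integrableZl mcell c hf; exact: h. Qed.
Lemma intcN f : intc f -> intc (fun z => - f z).
Proof. by move=> hf; exact: (integrableN hf). Qed.

Lemma integral2D f g : intc f -> intc g ->
  integral2 (fun z => f z + g z) = integral2 f + integral2 g.
Proof. by move=> hf hg; have h := RintegralD mcell hf hg; exact: h. Qed.
Lemma integral2Z c f : intc f -> integral2 (fun z => c * f z) = c * integral2 f.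
Proof. by move=> hf; have h := RintegralZl c mcell hf; exact: h. Qed.
Lemma integral2N f : intc f -> integral2 (fun z => - f z) = - integral2 f.
Proof.
move=> hf; rewrite -mulN1r -integral2Z//.
by congr integral2; apply/funext => z; rewrite mulN1r.
Qed.
Lemma integral2B f g : intc f -> intc g ->
  integral2 (fun z => f z - g z) = integral2 f - integral2 g.
Proof. by move=> hf hg; rewrite integral2D ?integral2N//; exact: intcN. Qed.
Lemma le_integral2 f g : intc f -> intc g -> (forall z, f z <= g z) ->
  integral2 f <= integral2 g.
Proof. by move=> hf hg h; have := le_Rintegral mcell hf hg; apply => z _; exact: h. Qed.
Lemma integral2_ge0 f : (forall z, 0 <= f z) -> 0 <= integral2 f.
Proof. by move=> h; apply: Rintegral_ge0. Qed.
Lemma integral2_0 : integral2 (fun=> 0 : R) = 0.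
Proof. by rewrite /integral2 /Rintegral integral0. Qed.

Lemma le_intc f g : measurable_fun setT f -> (forall z, `|f z| <= `|g z|) -> intc g -> intc f.
Proof.
move=> mf h; apply: le_integrable; first exact: mcell.
  by apply: measurable_funTS; exact/measurable_EFinP.
by move=> z _; rewrite /= lee_fin.
Qed.

Lemma le_integral2_ae f g : measurable_fun setT f -> measurable_fun setT g ->
  intc f -> intc g -> {ae area, forall z, f z <= g z} -> integral2 f <= integral2 g.
Proof.
move=> mf mg hf hg h.
have mM : measurable_fun setT (fun z => Num.max (f z) (g z)) by exact: measurable_maxr.
have e : aeeq g (fun z => Num.max (f z) (g z)).
  by apply: filterS h => z /max_idPr ->.
rewrite (integral2_ae mg mM e); apply: le_integral2 => //.
  exact: integrable_cell_ae mM e hg.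
by move=> z; rewrite le_max lexx.
Qed.

Lemma L2_per u : is_L2 u -> periodic2 u. Proof. by case. Qed.
Lemma L2_meas u : is_L2 u -> measurable_fun setT u. Proof. by case. Qed.
Lemma L2_sq u : is_L2 u -> intc (fun z => u z ^+ 2). Proof. by case. Qed.

Lemma periodic2D u v : periodic2 u -> periodic2 v -> periodic2 (fun z => u z + v z).
Proof. by move=> hu hv x y; case: (hu x y) => -> ->; case: (hv x y) => -> ->. Qed.
Lemma periodic2M u v : periodic2 u -> periodic2 v -> periodic2 (fun z => u z * v z).
Proof. by move=> hu hv x y; case: (hu x y) => -> ->; case: (hv x y) => -> ->. Qed.
Lemma periodic2_cst c : periodic2 (fun=> c). Proof. by []. Qed.

Lemma measurable_sq u : measurable_fun setT u -> measurable_fun setT (fun z => u z ^+ 2).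
Proof. by move=> h; exact: measurable_funX. Qed.

Lemma L2_mul u v : is_L2 u -> is_L2 v -> intc (fun z => u z * v z).
Proof.
move=> [_ mu su] [_ mv sv]; apply: (@le_intc _ (fun z => u z ^+ 2 + v z ^+ 2)).
- exact: measurable_funM.
- move=> z; rewrite ler_norml; have := sqr_ge0 (u z - v z); have := sqr_ge0 (u z + v z).
  have := sqr_ge0 (u z); have := sqr_ge0 (v z) => h1 h2.
  rewrite ger0_norm ?addr_ge0// => h3 h4; apply/andP; split; nra.
- exact: intcD.
Qed.

Lemma L2D u v : is_L2 u -> is_L2 v -> is_L2 (fun z => u z + v z).
Proof.
move=> hu hv; split.
- exact: periodic2D (L2_per hu) (L2_per hv).
- exact: measurable_funD (L2_meas hu) (L2_meas hv).
- suff : intc (fun z => u z ^+ 2 + 2 * (u z * v z) + v z ^+ 2).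
    by apply: eq_intc => z; ring.
  by apply: intcD (L2_sq hv); apply: intcD (L2_sq hu) _; apply: intcZ; exact: L2_mul.
Qed.

Lemma L2Z c u : is_L2 u -> is_L2 (fun z => c * u z).
Proof.
move=> hu; split.
- exact: periodic2M (periodic2_cst c) (L2_per hu).
- exact: measurable_funM (measurable_cst c) (L2_meas hu).
- suff : intc (fun z => c ^+ 2 * u z ^+ 2).
    by apply: eq_intc => z; rewrite exprMn.
  exact: intcZ (L2_sq hu).
Qed.

Lemma L2N u : is_L2 u -> is_L2 (fun z => - u z).
Proof. by move=> /(L2Z (-1)); under eq_fun do rewrite mulN1r. Qed.
Lemma L2B u v : is_L2 u -> is_L2 v -> is_L2 (fun z => u z - v z).
Proof. by move=> hu hv; exact: L2D hu (L2N hv). Qed.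
Lemma L2_0 : is_L2 (fun=> 0 : R).
Proof.
split=> //; suff : intc (fun=> 0 : R) by apply: eq_intc => z; rewrite expr0n.
exact: integrable0.
Qed.

Lemma L2_sum (I : Type) (s : seq I) (P : pred I) (F : I -> R * R -> R) :
  (forall i, P i -> is_L2 (F i)) -> is_L2 (fun z => \sum_(i <- s | P i) F i z).
Proof.
move=> h; elim: s => [|i s IH].
  by under eq_fun do rewrite big_nil; exact: L2_0.
have -> : (fun z => \sum_(j <- i :: s | P j) F j z) =
    if P i then (fun z => F i z + \sum_(j <- s | P j) F j z) else (fun z => \sum_(j <- s | P j) F j z).
  by apply/funext => z; rewrite big_cons; case: ifP.
case: ifP => Pi //; exact: L2D (h _ Pi) IH.
Qed.

Lemma le_L2 u v : periodic2 u -> measurable_fun setT u -> is_L2 v ->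
  (forall z, `|u z| <= `|v z|) -> is_L2 u.
Proof.
move=> pu mu hv h; split=> //; apply: le_intc (L2_sq hv); first exact: measurable_sq.
by move=> z; rewrite !normrX lerXn2r ?nnegrE ?normr_ge0.
Qed.

Lemma L2_mulbdd (M : R) b u : periodic2 b -> measurable_fun setT b ->
  (forall z, `|b z| <= M) -> is_L2 u -> is_L2 (fun z => b z * u z).
Proof.
move=> pb mb bM hu; apply: (le_L2 (v := fun z => M * u z)).
- exact: periodic2M pb (L2_per hu).
- exact: measurable_funM mb (L2_meas hu).
- exact: L2Z.
- by move=> z; rewrite !normrM ler_wpM2r ?normr_ge0// (le_trans (bM z))// ler_norm.
Qed.

Lemma L2_cst c : is_L2 (fun=> c).
Proof.
split=> //; apply/integrableP; split; first exact: measurable_cst.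
rewrite integral_cst; last exact: mcell.
by rewrite lte_mul_pinfty// area_cell_lty.
Qed.

Lemma L2_swap u : is_L2 u -> is_L2 (fun z => u (z.2, z.1)).
Proof.
move=> hu; split.
- by move=> x y /=; case: (L2_per hu y x) => -> ->.
- exact: measurableT_comp (L2_meas hu) measurable_swap2.
- exact: (integrable_cell_swap (measurable_sq (L2_meas hu)) (L2_sq hu)).
Qed.

Definition ip u v := integral2 (fun z => u z * v z).
Definition nrm u := Num.sqrt (ip u u).

Lemma ipC u v : ip u v = ip v u.
Proof. by congr integral2; apply/funext => z; rewrite mulrC. Qed.
Lemma ipDl u v w : is_L2 u -> is_L2 v -> is_L2 w ->
  ip (fun z => u z + v z) w = ip u w + ip v w.
Proof.
move=> hu hv hw; rewrite /ip -integral2D; [|exact: L2_mul..].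
by congr integral2; apply/funext => z; rewrite mulrDl.
Qed.
Lemma ipZl c u v : is_L2 u -> is_L2 v -> ip (fun z => c * u z) v = c * ip u v.
Proof.
move=> hu hv; rewrite /ip -integral2Z; last exact: L2_mul.
by congr integral2; apply/funext => z; rewrite mulrA.
Qed.
Lemma ipDr u v w : is_L2 u -> is_L2 v -> is_L2 w ->
  ip w (fun z => u z + v z) = ip w u + ip w v.
Proof. by move=> *; rewrite ipC ipDl// (ipC u) (ipC v). Qed.
Lemma ipZr c u v : is_L2 u -> is_L2 v -> ip v (fun z => c * u z) = c * ip v u.
Proof. by move=> *; rewrite ipC ipZl// ipC. Qed.

Lemma ip_ae u u' v v' : measurable_fun setT u -> measurable_fun setT u' ->
  measurable_fun setT v -> measurable_fun setT v' ->
  aeeq u u' -> aeeq v v' -> ip u v = ip u' v'.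
Proof.
move=> mu mu' mv mv' uu' vv'; apply: integral2_ae; [exact: measurable_funM..|].
by apply: filterS2 uu' vv' => z -> ->.
Qed.

Lemma ip_ge0 u : 0 <= ip u u.
Proof. by apply: integral2_ge0 => z; rewrite -expr2 sqr_ge0. Qed.

Lemma nrm_ge0 u : 0 <= nrm u. Proof. exact: sqrtr_ge0. Qed.
Lemma sqr_nrm u : nrm u ^+ 2 = ip u u.
Proof. by rewrite sqr_sqrtr// ip_ge0. Qed.

Lemma cauchy_schwarz u v : is_L2 u -> is_L2 v -> `|ip u v| <= nrm u * nrm v.
Proof.
move=> hu hv.
have key a b : 0 <= a ^+ 2 * ip u u + 2 * (a * b) * ip u v + b ^+ 2 * ip v v.
  have := ip_ge0 (fun z => a * u z + b * v z).
  have hau := L2Z a hu; have hbv := L2Z b hv.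
  rewrite ipDl ?ipDr ?ipZl ?ipZr//; [|exact: L2D..].
  by rewrite (ipC v u); congr (_ <= _); ring.
rewrite -(@ler_pXn2r _ 2)// ?nnegrE ?normr_ge0 ?mulr_ge0 ?nrm_ge0//.
rewrite exprMn !sqr_nrm real_normK ?num_real//.
set A := ip u u in key *; set B := ip u v in key *; set C := ip v v in key *.
have A0 : 0 <= A by exact: ip_ge0.
have C0 : 0 <= C by exact: ip_ge0.
have [C00|C00] := eqVneq C 0.
  have k1 := key (- (A + 1) / 2 + (1 - A) / 2) 0.
  have [->|B0] := eqVneq B 0; first by rewrite expr0n/= mulr_ge0.
  (* For [C = 0] and [B != 0] the quadratic form is affine in its second argument and takes the
     value [-1] here. *)
  have := key 1 (- (A + 1) / (2 * B)); rewrite C00.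
  have -> : 1 ^+ 2 * A + 2 * (1 * (- (A + 1) / (2 * B))) * B +
    (- (A + 1) / (2 * B)) ^+ 2 * 0 = - 1 by field.
  by rewrite oppr_ge0 leNgt ltr01.
have := key C (- B).
have -> : C ^+ 2 * A + 2 * (C * - B) * B + (- B) ^+ 2 * C = C * (A * C - B ^+ 2) by ring.
by rewrite pmulr_rge0 ?lt_neqAle ?(eq_sym 0) ?C00// subr_ge0.
Qed.

Lemma nrmD u v : is_L2 u -> is_L2 v -> nrm (fun z => u z + v z) <= nrm u + nrm v.
Proof.
move=> hu hv; rewrite -(@ler_pXn2r _ 2)// ?nnegrE ?addr_ge0 ?nrm_ge0//.
rewrite sqr_nrm sqrrD !sqr_nrm ipDl ?ipDr//; [|exact: L2D..].
rewrite (ipC v u); have := ler_norml (ip u v) (nrm u * nrm v); rewrite cauchy_schwarz// => /esym/andP[_ h].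
rewrite -mulr_natl; lra.
Qed.

Lemma nrmZ c u : is_L2 u -> nrm (fun z => c * u z) = `|c| * nrm u.
Proof.
move=> hu; rewrite /nrm ipZl ?ipZr//; last exact: L2Z.
by rewrite mulrA -expr2 sqrtrM ?sqr_ge0// sqrtr_sqr.
Qed.

Lemma le_nrm_ae u v : is_L2 u -> is_L2 v -> {ae area, forall z, `|u z| <= `|v z|} ->
  nrm u <= nrm v.
Proof.
move=> hu hv h; rewrite ler_wsqrtr//; apply: le_integral2_ae.
- exact: measurable_funM (L2_meas hu) (L2_meas hu).
- exact: measurable_funM (L2_meas hv) (L2_meas hv).
- exact: L2_mul.
- exact: L2_mul.
- apply: filterS h => z h; rewrite -!expr2 -(real_normK (num_real (u z))) -(real_normK (num_real (v z))).
  by rewrite lerXn2r ?nnegrE ?normr_ge0.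
Qed.

Lemma periodic_ae (P : R * R -> Prop) u : periodic2 u -> (forall z z', u z = u z' -> P z -> P z') ->
  {ae area, forall z, cell z -> P z} -> {ae area, forall z, P z}.
Proof.
move=> pu h; apply: ae_periodic => x y; have [h1 h2] := pu x y.
by split; split; apply: h.
Qed.

Lemma nrm_eq0 u : is_L2 u -> nrm u = 0 -> aeeq u (fun=> 0).
Proof.
move=> hu h.
have i0 : integral2 (fun z => u z * u z) = 0.
  by rewrite -[LHS]/(ip u u) -sqr_nrm h expr0n.
have iu := L2_mul hu hu.
have e : (\int[area]_(z in cell) `|(u z * u z)%:E| = 0)%E.
  under eq_integral do rewrite abse_EFin ger0_norm -?expr2 ?sqr_ge0//.
  under eq_integral do rewrite expr2.
  have := integrable_fin_num mcell iu => /fineK <-.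
  by move: i0; rewrite /integral2 /Rintegral /= => ->.
have mu2 : measurable_fun (cell : set (measurableTypeR R * measurableTypeR R)%type)
    (EFin \o (fun z => u z * u z)).
  by apply: measurable_funTS; apply/measurable_EFinP; exact: measurable_funM (L2_meas hu) (L2_meas hu).
have h0 := (ae_eq_integral_abs area mcell mu2).1 e.
apply: (periodic_ae (L2_per hu)) => [z z' -> //|].
apply: filterS h0 => z h0 cz; have := h0 cz.
by move=> [] /eqP; rewrite mulf_eq0 orbb => /eqP.
Qed.

Lemma nrm_mulbdd (M : R) b u : periodic2 b -> measurable_fun setT b ->
  (forall z, `|b z| <= M) -> is_L2 u -> nrm (fun z => b z * u z) <= M * nrm u.
Proof.
move=> pb mb bM hu; have M0 : 0 <= M by exact: le_trans (bM (0, 0)).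
rewrite -[M]ger0_norm// -nrmZ//; apply: le_nrm_ae; [exact: L2_mulbdd bM hu|exact: L2Z|].
apply: aeW => z; rewrite !normrM ler_wpM2r ?normr_ge0// (le_trans (bM z))// ler_norm//.
Qed.

Lemma normr_le_sqr (x y : R) : 0 <= y -> x ^+ 2 <= y ^+ 2 -> `|x| <= y.
Proof.
move=> y0; rewrite -(real_normK (num_real x)).
by rewrite ler_pXn2r// nnegrE.
Qed.

Lemma geometric_cauchy (x : nat -> R) (c q : R) : 0 <= q < 1 ->
  (forall n, `|x n.+1 - x n| <= c * q ^+ n) ->
  exists2 l : R, x @ \oo --> l & forall n, `|l - x n| <= c * q ^+ n / (1 - q).
Proof.
move=> /andP[q0 q1] h.
have q1' : 0 < 1 - q by rewrite subr_gt0.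
have c0 : 0 <= c by have := le_trans (normr_ge0 _) (h 0); rewrite expr0 mulr1.
have key n j : `|x (n + j)%N - x n| <= c * q ^+ n * (1 - q ^+ j) / (1 - q).
  elim: j => [|j IH]; first by rewrite addn0 subrr normr0 expr0 subrr mulr0 mul0r.
  have -> : x (n + j.+1)%N - x n = (x (n + j).+1 - x (n + j)%N) + (x (n + j)%N - x n).
    by rewrite addnS; ring.
  apply: le_trans (ler_normD _ _) _; apply: le_trans (lerD (h _) IH) _.
  rewrite le_eqVlt; apply/orP; left; apply/eqP.
  rewrite exprD exprS; field; exact: lt0r_neq0.
have keyb n j : `|x (n + j)%N - x n| <= c * q ^+ n / (1 - q).
  apply: le_trans (key n j) _; rewrite ler_pM2r ?invr_gt0//.
  by rewrite ler_piMr ?mulr_ge0 ?exprn_ge0// gerBl exprn_ge0.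
have q1n : `|q| < 1 by rewrite ger0_norm.
have cs : cvgn (series (fun n => x n.+1 - x n)).
  apply: normed_cvg; apply: series_le_cvg (h) _ => //.
    by move=> n; rewrite mulr_ge0// exprn_ge0.
  apply/cvg_ex; exists (c / (1 - q)); exact: cvg_geometric_series.
have cx : cvgn x.
  have -> : x = (fun n => x 0%N + series (fun n => x n.+1 - x n) n).
    by apply/funext => n; rewrite [LHS](eq_sum_telescope x n).
  by apply: is_cvgD => //; exact: is_cvg_cst.
exists (limn x) => // n.
have cn : (fun j => `|x (n + j)%N - x n|) @ \oo --> `|limn x - x n|.
  apply: cvg_norm; apply: cvgB; last exact: cvg_cst.
  under eq_fun do rewrite addnC.
  have := cx; rewrite -(cvg_shiftn n); exact.
rewrite -(cvg_lim _ cn)//; apply: limr_le; first by apply/cvg_ex; eexists; exact: cn.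
by apply: nearW => j; exact: keyb.
Qed.

Lemma sum_geometric_le (r : R) n : 0 <= r < 1 -> \sum_(0 <= k < n) r ^+ k <= (1 - r)^-1.
Proof.
move=> /andP[r0 r1]; have r1' : 0 < 1 - r by rewrite subr_gt0.
have -> : \sum_(0 <= k < n) r ^+ k = (1 - r ^+ n) / (1 - r).
  elim: n => [|n IH]; first by rewrite big_geq// expr0 subrr mul0r.
  rewrite big_nat_recr//= IH exprS; field; exact: lt0r_neq0.
by rewrite ler_piMl ?invr_ge0 ?(ltW r1')// gerBl exprn_ge0.
Qed.

(** The sum [G] of the squares of [q^-n (f_{n+1} - f_n)] has a finite integral, the terms
    contributing at most [C^2 q^(2n)]. Where [G] is finite the increments are at most
    [sqrt G * q^n], which gives pointwise convergence and, after integrating the squared tail, the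
    rate [q^n]. Half of the assumed decay is spent on making [G] finite. *)
Lemma L2_complete (f : nat -> R * R -> R) (C q : R) : 0 < q < 1 ->
  (forall n, is_L2 (f n)) ->
  (forall n, nrm (fun z => f n.+1 z - f n z) <= C * (q ^+ 2) ^+ n) ->
  exists g, [/\ is_L2 g, {ae area, forall z, (f ^~ z) @ \oo --> g z} &
    exists K, forall n, nrm (fun z => f n z - g z) <= K * q ^+ n].
Proof.
move=> /andP[q0 q1] hf hd.
have q1' : 0 < 1 - q by rewrite subr_gt0.
pose d n z := f n.+1 z - f n z.
have hdL n : is_L2 (d n) by exact: L2B.
pose h n z := (q ^- n * d n z) ^+ 2.
have hL n : is_L2 (fun z => q ^- n * d n z) by exact: L2Z.
have mh n : measurable_fun setT (h n) by exact: measurable_sq (L2_meas (hL n)).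
have C0 : 0 <= C by have := le_trans (nrm_ge0 _) (hd 0); rewrite expr0 mulr1.
have hint n : (\int[area]_(z in cell) (h n z)%:E <= (C ^+ 2 * (q ^+ 2) ^+ n)%:E)%E.
  have ih : intc (h n) by exact: L2_sq (hL n).
  rewrite -(fineK (integrable_fin_num mcell ih)) lee_fin.
  have -> : fine (\int[area]_(z in cell) (h n z)%:E) = nrm (fun z => q ^- n * d n z) ^+ 2.
    by rewrite sqr_nrm /ip /integral2 /Rintegral; congr fine; apply: eq_integral => z _; rewrite /h expr2.
  rewrite nrmZ// ger0_norm ?invr_ge0 ?exprn_ge0 ?(ltW q0)//.
  have -> : C ^+ 2 * (q ^+ 2) ^+ n = (q ^- n * (C * (q ^+ 2) ^+ n)) ^+ 2.
    have qn : q ^+ n != 0 by rewrite expf_neq0// gt_eqF.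
    by rewrite -!exprM mulnC exprM; field.
  rewrite lerXn2r ?nnegrE ?mulr_ge0 ?invr_ge0 ?exprn_ge0 ?nrm_ge0 ?(ltW q0)//.
  by rewrite ler_wpM2l ?invr_ge0 ?exprn_ge0 ?(ltW q0)//; exact: hd.
pose G z := (\sum_(0 <= n <oo) (h n z)%:E)%E.
have h0 n z : (0 <= (h n z)%:E)%E by rewrite lee_fin sqr_ge0.
have mhE n : measurable_fun (cell : set (measurableTypeR R * measurableTypeR R)%type) (EFin \o h n).
  have m : measurable_fun setT (EFin \o h n) by exact/measurable_EFinP.
  exact: measurable_funTS.
have mG : measurable_fun (cell : set (measurableTypeR R * measurableTypeR R)%type) G.
  have := @ge0_emeasurable_sum _ _ R cell (fun n z => (h n z)%:E) xpredT
    (fun k x _ _ => h0 k x) (fun k _ => mhE k).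
  exact.
have G0 z : (0 <= G z)%E by apply: nneseries_ge0 => n _ _; exact: h0.
have iG : (\int[area]_(z in cell) G z <= (C ^+ 2 / (1 - q ^+ 2))%:E)%E.
  rewrite (@integral_nneseries _ _ _ area cell mcell (fun n z => (h n z)%:E))//.
  apply: lime_le; first by apply: is_cvg_nneseries => n _ _; apply: integral_ge0.
  apply: nearW => n; apply: (@le_trans _ _ (\sum_(0 <= k < n) (C ^+ 2 * (q ^+ 2) ^+ k)%:E)%E).
    by apply: lee_sum => k _; exact: hint.
  rewrite sumEFin lee_fin -mulr_sumr ler_wpM2l ?sqr_ge0//.
  by apply: sum_geometric_le; rewrite sqr_ge0 expr_lt1// ltW.
have iGG : area.-integrable cell G.
  apply/integrableP; split => //.
  under eq_integral do rewrite gee0_abs//.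
  by apply: le_lt_trans iG _; rewrite ltry.
have Gfin : {ae area, forall z, cell z -> G z \is a fin_num} by exact: integrable_ae.
(* An upper limit is measurable and periodic everywhere, with no reference to where the sequence
   converges. *)
pose g z := fine (limn_esup (fun n => (f n z)%:E)).
have mg : measurable_fun setT g.
  apply: measurableT_comp => //; apply: measurable_fun_limn_esup => n.
  by apply/measurable_EFinP; exact: L2_meas.
have pg : periodic2 g.
  move=> x y; rewrite /g; split; congr (fine (limn_esup _)); apply/funext => n.
    by rewrite (L2_per (hf n) x y).1.
  by rewrite (L2_per (hf n) x y).2.
have pt z : G z \is a fin_num -> (f ^~ z) @ \oo --> g z /\
    forall n, (f n z - g z) ^+ 2 <= fine (G z) * (q ^+ 2) ^+ n / (1 - q) ^+ 2.
  move=> Gz; set y := fine (G z).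
  have y0 : 0 <= y by exact: fine_ge0.
  have hb n : `|f n.+1 z - f n z| <= Num.sqrt y * q ^+ n.
    have : h n z <= y.
      rewrite -lee_fin fineK//; apply: le_trans (nneseries_lim_ge n.+1 _) => //.
      rewrite big_nat_recr//= leeDr//; apply: sume_ge0 => k _; exact: h0.
    move=> hh; apply: normr_le_sqr; first by rewrite mulr_ge0 ?sqrtr_ge0 ?exprn_ge0 ?ltW.
    move: hh; rewrite /h !exprMn sqr_sqrtr// exprVn mulrC ler_pdivrMr ?exprn_gt0//.
  have q01 : 0 <= q < 1 by rewrite (ltW q0).
  have [l fl hl] := geometric_cauchy q01 hb.
  have gl : g z = l.
    rewrite /g; have fl' : (fun n => (f n z)%:E) @ \oo --> l%:E.
      by apply: cvg_EFin; [exact: nearW|exact: fl].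
    by rewrite (cvg_limn_einf_sup fl').2.
  rewrite gl; split => // n.
  have -> : (f n z - l) ^+ 2 = `|l - f n z| ^+ 2 by rewrite real_normK ?num_real//; ring.
  have -> : y * (q ^+ 2) ^+ n / (1 - q) ^+ 2 = (Num.sqrt y * q ^+ n / (1 - q)) ^+ 2.
    by rewrite -[in LHS](sqr_sqrtr y0) exprAC; field; rewrite gt_eqF.
  have B0 := le_trans (normr_ge0 _) (hl n).
  rewrite ler_pXn2r ?nnegrE ?normr_ge0//; exact: hl.
have mfg n : measurable_fun setT (fun z => (f n z - g z) ^+ 2).
  by apply: measurable_sq; apply: measurable_funB => //; exact: L2_meas.
have key n : (\int[area]_(z in cell) ((f n z - g z) ^+ 2)%:E <=
    ((q ^+ 2) ^+ n / (1 - q) ^+ 2 * (C ^+ 2 / (1 - q ^+ 2)))%:E)%E.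
  have c0 : 0 <= (q ^+ 2) ^+ n / (1 - q) ^+ 2 by apply: mulr_ge0; [apply: exprn_ge0; exact: sqr_ge0|rewrite invr_ge0; exact: sqr_ge0].
  apply: (@le_trans _ _ (\int[area]_(z in cell) (((q ^+ 2) ^+ n / (1 - q) ^+ 2)%:E * G z))%E); last first.
    have -> := @ge0_integralZl_EFin _ _ _ area cell mcell G (fun z _ => G0 z) mG _ c0.
    by rewrite [X in (_ <= X)%E]EFinM; apply: lee_wpmul2l => //; rewrite lee_fin.
  have mfgE : measurable_fun setT (EFin \o (fun z => (f n z - g z) ^+ 2)) by exact/measurable_EFinP.
  apply: ae_ge0_le_integral; [exact: mcell|by move=> z _; rewrite lee_fin sqr_ge0| | | |].
  - exact: measurable_funTS.
  - by move=> z _; rewrite mule_ge0.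
  - exact: measurable_funeM.
  - apply: filterS Gfin => z Gz cz; have [_ /(_ n)] := pt z (Gz cz).
    rewrite -{2}(fineK (Gz cz)) -EFinM lee_fin => /le_trans; apply.
    by rewrite le_eqVlt; apply/orP; left; apply/eqP; ring.
have L2fg n : is_L2 (fun z => f n z - g z).
  split; [|by apply: measurable_funB => //; exact: L2_meas|].
    by apply: periodic2D (L2_per (hf n)) _ => x y; case: (pg x y) => -> ->.
  apply/integrableP; split.
    have m : measurable_fun setT (EFin \o (fun z => (f n z - g z) ^+ 2)) by exact/measurable_EFinP.
    exact: measurable_funTS.
  under eq_integral do rewrite abse_EFin ger0_norm ?sqr_ge0//.
  by apply: le_lt_trans (key n) _; rewrite ltry.
exists g; split.
- have -> : g = (fun z => f 0 z - (f 0 z - g z)) by apply/funext => z; ring.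
  exact: L2B.
- apply: ae_periodic.
    move=> x y; have fx n := L2_per (hf n) x y; have [px py] := pg x y.
    split; [have -> : f ^~ (x + 2 * pi, y) = f ^~ (x, y) by apply/funext => n; rewrite (fx n).1
           |have -> : f ^~ (x, y + 2 * pi) = f ^~ (x, y) by apply/funext => n; rewrite (fx n).2].
      by rewrite px.
    by rewrite py.
  by apply: filterS Gfin => z Gz cz; case: (pt z (Gz cz)).
- exists (C / ((1 - q) * Num.sqrt (1 - q ^+ 2))) => n.
  have q2 : 0 < 1 - q ^+ 2 by rewrite subr_gt0 expr_lt1// ltW.
  have K0 : 0 <= C / ((1 - q) * Num.sqrt (1 - q ^+ 2)) * q ^+ n.
    apply: mulr_ge0; last by rewrite exprn_ge0 // ltW.
    by apply: mulr_ge0 => //; rewrite invr_ge0 mulr_ge0 ?sqrtr_ge0// ltW.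
  rewrite -(@ler_pXn2r _ 2) ?nnegrE ?nrm_ge0//.
  rewrite sqr_nrm -lee_fin.
  have -> : ((C / ((1 - q) * Num.sqrt (1 - q ^+ 2)) * q ^+ n) ^+ 2) =
     (q ^+ 2) ^+ n / (1 - q) ^+ 2 * (C ^+ 2 / (1 - q ^+ 2)).
    have r0 : Num.sqrt (1 - q ^+ 2) != 0 by rewrite gt_eqF// sqrtr_gt0.
    have r2 : Num.sqrt (1 - q ^+ 2) ^+ 2 = 1 - q ^+ 2 by rewrite sqr_sqrtr// ltW.
    move: r0 r2; set r := Num.sqrt _ => r0 <-; rewrite exprAC; field.
    by rewrite r0 gt_eqF.
  apply: le_trans (key n); rewrite /ip /integral2 /Rintegral fineK.
    by rewrite le_eqVlt; apply/orP; left; apply/eqP; apply: eq_integral => z _; rewrite expr2.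
  exact: (integrable_fin_num mcell (L2_mul (L2fg n) (L2fg n))).
Qed.

End L2.

(** * Classical periodic functions *)

Section ClassicalFunctions.
Context {R : realType}.
Implicit Types (f g a : R * R -> R) (phi chi : R -> R).

Lemma near_prod_ball (x y : R) (P : R * R -> Prop) : (\forall z \near (x, y), P z) ->
  exists2 e : R, 0 < e & forall x' y', `|x - x'| < e -> `|y - y'| < e -> P (x', y').
Proof.
move=> [[A B] /= [nA nB] ABP].
have /nbhs_ballP[e1 /= e10 h1] := nA; have /nbhs_ballP[e2 /= e20 h2] := nB.
exists (Num.min e1 e2); first by rewrite lt_min e10.
move=> x' y'; rewrite !lt_min => /andP[hx _] /andP[_ hy].
by apply: ABP; split; [exact: h1|exact: h2].
Qed.

(** Measurability refers to the product sigma-algebra: an open set is the union of the countably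
    many rational rectangles that it contains. *)
Lemma open_measurable2 (O : set (R * R)) :
  (forall z, O z -> exists2 e : R, 0 < e & forall x' y', `|z.1 - x'| < e -> `|z.2 - y'| < e -> O (x', y')) ->
  measurable O.
Proof.
move=> h.
pose rect (k : (rat * rat) * (rat * rat)) : set (R * R) :=
  `](ratr k.1.1 : R), ratr k.1.2[%classic `*` `](ratr k.2.1 : R), ratr k.2.2[%classic.
have -> : O = \bigcup_(k in [set k | rect k `<=` O]) rect k.
  apply/seteqP; split => [[x y] Oxy|z [k /= kO]]; last exact: kO.
  have [e e0 he] := h _ Oxy.
  have /rat_in_itvoo[p1 /[!in_itv]/= /andP[p1l p1r]] : x - e < x by lra.
  have /rat_in_itvoo[p2 /[!in_itv]/= /andP[p2l p2r]] : x < x + e by lra.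
  have /rat_in_itvoo[q1 /[!in_itv]/= /andP[q1l q1r]] : y - e < y by lra.
  have /rat_in_itvoo[q2 /[!in_itv]/= /andP[q2l q2r]] : y < y + e by lra.
  exists ((p1, p2), (q1, q2)) => /=.
    move=> [x' y'] [/=]; rewrite !in_itv/= => /andP[a1 a2] /andP[b1 b2].
    by apply: he => /=; rewrite ltr_norml; apply/andP; split; lra.
  by split => /=; rewrite in_itv/=; apply/andP; split.
rewrite bigcup_mkcond; apply: countable_bigcupT_measurable; [exact: countableP|move=> k].
case: ifPn => // _; apply: measurableX; exact: measurable_itv.
Qed.

Lemma continuous_measurable2 f : continuous f -> measurable_fun setT f.
Proof.
move=> /continuousP cf; apply: (measurability _ (RGenOpens.measurableE R)).
move=> _ [_ [a [b ->] <-]]; rewrite setTI; apply: open_measurable2 => -[x y] /= fab.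
have /near_prod_ball[e e0 he] : \forall z \near (x, y), (f @^-1` `]a, b[%classic) z.
  by apply: open_nbhs_nbhs; split => //; apply: cf; exact: interval_open.
by exists e.
Qed.

Lemma periodic2_int f (k l : int) x y : periodic2 f ->
  f (x + k%:~R * (2 * pi), y + l%:~R * (2 * pi)) = f (x, y).
Proof.
move=> pf; rewrite (periodic_int (f := fun x' => f (x', y + l%:~R * (2 * pi))) (fun x' => (pf x' _).1)).
exact: (periodic_int (f := fun y' => f (x, y')) (fun y' => (pf x y').2)).
Qed.

Lemma periodic2_cell f z : periodic2 f -> exists2 z', cell z' & f z = f z'.
Proof.
move=> pf; case: z => x y.
have [k hk] := fundamental_domain x; have [l hl] := fundamental_domain y.
exists (x - k%:~R * (2 * pi), y - l%:~R * (2 * pi)).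
  by split; rewrite /circle/= in_itv.
by rewrite -!mulNr -!mulrNz periodic2_int.
Qed.

Lemma continuous_periodic2_bounded f : continuous f -> periodic2 f ->
  exists M, forall z, `|f z| <= M.
Proof.
move=> cf pf.
have cc : compact (@cell R) by apply: compact_setX; exact: segment_compact.
have := continuous_compact (continuous_subspaceT cf) cc.
move=> /compact_bounded[M [_ hM]].
exists (M + 1) => z; have [z' cz' ->] := periodic2_cell z pf.
by apply: (hM (M + 1)); [rewrite ltrDl|exists z'].
Qed.

Lemma is_Cq_per q f : is_Cq q f -> periodic2 f. Proof. by case: q => [|q] []. Qed.
Lemma is_Cq_cont q f : is_Cq q f -> continuous f. Proof. by case: q => [|q] []. Qed.
Lemma is_Cq_meas q f : is_Cq q f -> measurable_fun setT f.
Proof. by move=> /is_Cq_cont; exact: continuous_measurable2. Qed.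
Lemma is_Cq_bounded q f : is_Cq q f -> exists M, forall z, `|f z| <= M.
Proof. by move=> h; apply: continuous_periodic2_bounded; [exact: is_Cq_cont h|exact: is_Cq_per h]. Qed.

Lemma is_Cq_L2 q f : is_Cq q f -> is_L2 f.
Proof.
move=> h; have [M hM] := is_Cq_bounded h.
apply: (le_L2 (v := fun=> M)); [exact: is_Cq_per h|exact: is_Cq_meas h|exact: L2_cst|].
by move=> z; rewrite (le_trans (hM z))// ler_norm.
Qed.

Lemma is_Cq_dtheta q f : is_Cq q.+1 f -> is_Cq q (dtheta f). Proof. by move=> [_ _ []]. Qed.
Lemma is_Cq_ds q f : is_Cq q.+1 f -> is_Cq q (ds f). Proof. by move=> [_ _ []]. Qed.
Lemma is_Cq_derivable1 q f : is_Cq q.+1 f -> forall z, derivable (fun x => f (x, z.2)) z.1 1.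
Proof. by move=> [_ _ [h _ _ _]]; exact: h. Qed.
Arguments is_Cq_derivable1 {q f} _ z.
Lemma is_Cq_derivable2 q f : is_Cq q.+1 f -> forall z, derivable (fun y => f (z.1, y)) z.2 1.
Proof. by move=> [_ _ [_ h _ _]]; exact: h. Qed.
Arguments is_Cq_derivable2 {q f} _ z.

Lemma is_CqW q f : is_Cq q.+1 f -> is_Cq q f.
Proof.
elim: q f => [|q IH] f; first by move=> [].
move=> [pf cf [d1 d2 h1 h2]].
exact: (And3 pf cf (And4 d1 d2 (IH _ h1) (IH _ h2))).
Qed.

Lemma is_Cq_le q q' f : (q' <= q)%N -> is_Cq q f -> is_Cq q' f.
Proof.
move=> /subnK <-; elim: (q - q')%N => [//|k IH]; rewrite addSn => /is_CqW; exact: IH.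
Qed.

Lemma dthetaD q f g : is_Cq q.+1 f -> is_Cq q.+1 g ->
  dtheta (fun z => f z + g z) = (fun z => dtheta f z + dtheta g z).
Proof.
move=> hf hg; apply/funext => z; rewrite /dtheta !derive1E.
have h := deriveD (is_Cq_derivable1 hf z) (is_Cq_derivable1 hg z); exact: h.
Qed.
Lemma dsD q f g : is_Cq q.+1 f -> is_Cq q.+1 g ->
  ds (fun z => f z + g z) = (fun z => ds f z + ds g z).
Proof.
move=> hf hg; apply/funext => z; rewrite /ds !derive1E.
have h := deriveD (is_Cq_derivable2 hf z) (is_Cq_derivable2 hg z); exact: h.
Qed.
Lemma dthetaM q f g : is_Cq q.+1 f -> is_Cq q.+1 g ->
  dtheta (fun z => f z * g z) = (fun z => dtheta f z * g z + f z * dtheta g z).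
Proof.
move=> hf hg; apply/funext => -[x y]; rewrite /dtheta !derive1E/=.
have := deriveM (is_Cq_derivable1 hf (x, y)) (is_Cq_derivable1 hg (x, y)).
move=> /= h; rewrite [LHS]h /GRing.scale/=; ring.
Qed.
Lemma dsM q f g : is_Cq q.+1 f -> is_Cq q.+1 g ->
  ds (fun z => f z * g z) = (fun z => ds f z * g z + f z * ds g z).
Proof.
move=> hf hg; apply/funext => -[x y]; rewrite /ds !derive1E/=.
have := deriveM (is_Cq_derivable2 hf (x, y)) (is_Cq_derivable2 hg (x, y)).
move=> /= h; rewrite [LHS]h /GRing.scale/=; ring.
Qed.

Lemma is_CqD q f g : is_Cq q f -> is_Cq q g -> is_Cq q (fun z => f z + g z).
Proof.
elim: q f g => [|q IH] f g hf hg.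
  split=> //; first exact: periodic2D (is_Cq_per hf) (is_Cq_per hg).
  by move=> z; apply: continuousD; [exact: (is_Cq_cont hf)|exact: (is_Cq_cont hg)].
split; first exact: periodic2D (is_Cq_per hf) (is_Cq_per hg).
  by move=> z; apply: continuousD; [exact: (is_Cq_cont hf)|exact: (is_Cq_cont hg)].
split.
- by move=> z; have h := derivableD (is_Cq_derivable1 hf z) (is_Cq_derivable1 hg z); exact: h.
- by move=> z; have h := derivableD (is_Cq_derivable2 hf z) (is_Cq_derivable2 hg z); exact: h.
- by rewrite (dthetaD hf hg); apply: IH; exact: is_Cq_dtheta.
- by rewrite (dsD hf hg); apply: IH; exact: is_Cq_ds.
Qed.

Lemma is_CqM q f g : is_Cq q f -> is_Cq q g -> is_Cq q (fun z => f z * g z).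
Proof.
elim: q f g => [|q IH] f g hf hg.
  split=> //; first exact: periodic2M (is_Cq_per hf) (is_Cq_per hg).
  by move=> z; apply: continuousM; [exact: (is_Cq_cont hf)|exact: (is_Cq_cont hg)].
split; first exact: periodic2M (is_Cq_per hf) (is_Cq_per hg).
  by move=> z; apply: continuousM; [exact: (is_Cq_cont hf)|exact: (is_Cq_cont hg)].
split.
- by move=> z; have h := derivableM (is_Cq_derivable1 hf z) (is_Cq_derivable1 hg z); exact: h.
- by move=> z; have h := derivableM (is_Cq_derivable2 hf z) (is_Cq_derivable2 hg z); exact: h.
- by rewrite (dthetaM hf hg); apply: is_CqD; apply: IH; first [exact: is_Cq_dtheta|exact: is_CqW].
- by rewrite (dsM hf hg); apply: is_CqD; apply: IH; first [exact: is_Cq_ds|exact: is_CqW].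
Qed.

Lemma is_Cq_cst q (c : R) : is_Cq q (fun=> c).
Proof.
elim: q c => [|q IH] c; first by split=> // z; exact: cst_continuous.
split=> //; first by move=> z; exact: cst_continuous.
split.
- by move=> z; exact: derivable_cst.
- by move=> z; exact: derivable_cst.
- have -> : dtheta (fun=> c) = fun=> 0 by apply/funext => z; exact: (derive1_cst c z.1).
  exact: IH.
- have -> : ds (fun=> c) = fun=> 0 by apply/funext => z; exact: (derive1_cst c z.2).
  exact: IH.
Qed.

Lemma is_CqZ q (c : R) f : is_Cq q f -> is_Cq q (fun z => c * f z).
Proof. by move=> hf; apply: is_CqM hf; exact: is_Cq_cst. Qed.

Lemma is_CqN q f : is_Cq q f -> is_Cq q (fun z => - f z).
Proof.
move=> /(is_CqZ (-1)); have -> // : (fun z => -1 * f z) = (fun z => - f z).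
by apply/funext => z; rewrite mulN1r.
Qed.

Lemma is_CqB q f g : is_Cq q f -> is_Cq q g -> is_Cq q (fun z => f z - g z).
Proof. by move=> hf hg; apply: is_CqD hf _; exact: is_CqN. Qed.

Lemma is_Cq_sum q (I : Type) (s : seq I) (F : I -> R * R -> R) :
  (forall i, is_Cq q (F i)) -> is_Cq q (fun z => \sum_(i <- s) F i z).
Proof.
move=> h; elim: s => [|i s IH].
  by under eq_fun do rewrite big_nil; exact: is_Cq_cst.
by under eq_fun do rewrite big_cons; exact: is_CqD.
Qed.

(** One-variable analogue of [is_Cq] with the same recursion, so that functions of theta or of s
    alone pass to the torus by induction on [q]. *)
Fixpoint per_Cq (q : nat) phi : Prop :=
  [/\ forall s, phi (s + 2 * pi) = phi s, continuous phi &
    if q is q'.+1 then (forall s, derivable phi s 1) /\ per_Cq q' (derive1 phi) else True].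

Lemma per_Cq_per q phi : per_Cq q phi -> forall s, phi (s + 2 * pi) = phi s.
Proof. by case: q => [|q] []. Qed.
Lemma per_Cq_cont q phi : per_Cq q phi -> continuous phi.
Proof. by case: q => [|q] []. Qed.
Lemma per_Cq_derivable q phi s : per_Cq q.+1 phi -> derivable phi s 1.
Proof. by move=> [_ _ []]. Qed.
Lemma per_Cq_derive q phi : per_Cq q.+1 phi -> per_Cq q (derive1 phi).
Proof. by move=> [_ _ []]. Qed.
Lemma per_CqW q phi : per_Cq q.+1 phi -> per_Cq q phi.
Proof.
elim: q phi => [|q IH] phi; first by move=> [].
move=> [pf cf [d1 h1]]; exact: (And3 pf cf (conj d1 (IH _ h1))).
Qed.

Lemma continuous_fst : continuous (fst : R * R -> R). Proof. by move=> z; exact: cvg_fst. Qed.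
Lemma continuous_snd : continuous (snd : R * R -> R). Proof. by move=> z; exact: cvg_snd. Qed.

Lemma per_Cq_fst q phi : per_Cq q phi -> is_Cq q (fun z => phi z.1).
Proof.
have c0 (ph : R -> R) : continuous ph -> continuous (fun z : R * R => ph z.1).
  move=> cph z; apply: (@continuous_comp _ _ _ fst ph); [exact: continuous_fst|exact: cph].
elim: q phi => [|q IH] phi.
  by move=> [p c _]; split; [move=> x y /=; rewrite p|exact: c0|].
move=> [p c [d h]]; split; [by move=> x y /=; rewrite p|exact: c0|split].
- by move=> z /=; exact: d.
- by move=> z /=; exact: derivable_cst.
- exact: (IH (derive1 phi) h).
- have -> : ds (fun z => phi z.1) = fun=> 0 by apply/funext => z; exact: (derive1_cst (phi z.1) z.2).
  exact: is_Cq_cst.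
Qed.

Lemma per_Cq_snd q phi : per_Cq q phi -> is_Cq q (fun z => phi z.2).
Proof.
have c0 (ph : R -> R) : continuous ph -> continuous (fun z : R * R => ph z.2).
  move=> cph z; apply: (@continuous_comp _ _ _ snd ph); [exact: continuous_snd|exact: cph].
elim: q phi => [|q IH] phi.
  by move=> [p c _]; split; [move=> x y /=; rewrite p|exact: c0|].
move=> [p c [d h]]; split; [by move=> x y /=; rewrite p|exact: c0|split].
- by move=> z /=; exact: derivable_cst.
- by move=> z /=; exact: d.
- have -> : dtheta (fun z => phi z.2) = fun=> 0 by apply/funext => z; exact: (derive1_cst (phi z.2) z.1).
  exact: is_Cq_cst.
- exact: (IH (derive1 phi) h).
Qed.

Lemma dtheta_fst phi : dtheta (fun z => phi z.1) = (fun z => (derive1 phi) z.1). Proof. by []. Qed.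
Lemma ds_snd phi : ds (fun z => phi z.2) = (fun z => (derive1 phi) z.2). Proof. by []. Qed.
Lemma dtheta_snd phi : dtheta (fun z => phi z.2) = fun=> 0.
Proof. by apply/funext => z; exact: (derive1_cst (phi z.2) z.1). Qed.
Lemma ds_fst phi : ds (fun z => phi z.1) = fun=> 0.
Proof. by apply/funext => z; exact: (derive1_cst (phi z.1) z.2). Qed.

Lemma per_Cq_cst q (c : R) : per_Cq q (fun=> c).
Proof.
elim: q c => [|q IH] c; first by split=> // z; exact: cst_continuous.
split=> //; first by move=> z; exact: cst_continuous.
split; first by move=> s; exact: derivable_cst.
have -> : derive1 (fun=> c : R) = (fun=> 0 : R) by apply/funext => s; exact: (derive1_cst c s).
exact: IH.
Qed.

(** The span of the cosine and the sine of [k s + c] is stable under differentiation, so the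
    induction on [q] runs over all pairs [a], [b]. *)
Lemma per_Cq_trig q (k a b c : R) : (forall s, cos (k * (s + 2 * pi) + c) = cos (k * s + c)) ->
  (forall s, sin (k * (s + 2 * pi) + c) = sin (k * s + c)) ->
  per_Cq q (fun s => a * cos (k * s + c) + b * sin (k * s + c)).
Proof.
move=> pc ps.
have D (a' b' s : R) : is_derive s (1 : R) (fun s => a' * cos (k * s + c) + b' * sin (k * s + c))
   (b' * k * cos (k * s + c) + (- (a' * k)) * sin (k * s + c)).
  have Dl : is_derive s (1 : R) (fun s : R => k * s + c) k.
    by apply: is_derive_eq; rewrite /GRing.scale/=; ring.
  have Dc := @is_derive1_comp R cos (fun s => k * s + c) s _ _ (is_derive_cos _) Dl.
  have Ds := @is_derive1_comp R sin (fun s => k * s + c) s _ _ (is_derive_sin _) Dl.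
  apply: (is_derive_eq (is_deriveD (is_deriveZ a' Dc) (is_deriveZ b' Ds))).
  by rewrite /GRing.scale/=; ring.
have C (a' b' : R) : continuous (fun s => a' * cos (k * s + c) + b' * sin (k * s + c)).
  by move=> s; apply/differentiable_continuous/derivable1_diffP; have [] := D a' b' s.
have P (a' b' s : R) : a' * cos (k * (s + 2 * pi) + c) + b' * sin (k * (s + 2 * pi) + c) =
    a' * cos (k * s + c) + b' * sin (k * s + c) by rewrite pc ps.
elim: q a b => [|q IH] a b; first exact: (And3 (P a b) (C a b) I).
split; [exact: (P a b)|exact: (C a b)|split].
  by move=> s; have [h _] := D a b s; exact: h.
have -> : derive1 (fun s => a * cos (k * s + c) + b * sin (k * s + c)) =
   (fun s => b * k * cos (k * s + c) + (- (a * k)) * sin (k * s + c)).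
  by apply/funext => s; rewrite derive1E; have [_ ->] := D a b s.
exact: IH.
Qed.

Lemma per_C1_comp (F F' : R -> R) phi : (forall y : R, is_derive y (1 : R) F (F' y)) -> continuous F' ->
  per_Cq 1 phi -> per_Cq 1 (F \o phi).
Proof.
move=> dF cF' [pphi cphi [dphi [pd cd _]]].
have cF : continuous F by move=> y; apply/differentiable_continuous/derivable1_diffP; have [] := dF y.
have D (s : R) : is_derive s (1 : R) (F \o phi) (F' (phi s) * (derive1 phi) s).
  have dp : is_derive s (1 : R) phi (derive1 phi s) by rewrite derive1E; exact/derivableP.
  exact: (is_derive1_comp (dF (phi s)) dp).
have E : derive1 (F \o phi) = (fun s => F' (phi s) * (derive1 phi) s).
  by apply/funext => s; rewrite derive1E; have [_ ->] := D s.
split; [by move=> s /=; rewrite pphi|by move=> s; apply: continuous_comp; [exact: cphi|exact: cF]|split].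
- by move=> s; have [] := D s.
- rewrite E; split=> //; first by move=> s; rewrite pphi pd.
  by move=> s; apply: continuousM; [apply: continuous_comp; [exact: cphi|exact: cF']|exact: cd].
Qed.

End ClassicalFunctions.

(** * Products of test functions separate square-integrable functions *)

Section Separation.
Context {R : realType}.
Implicit Types (v w : R * R -> R) (phi chi : R -> R).

Let mcell : measurable (cell : set (measurableTypeR R * measurableTypeR R)%type).
Proof. exact: measurable_cell. Qed.

Lemma atan_cvg1 (x : nat -> R) : x @ \oo --> +oo -> (fun k => atan (x k) / pi + 2^-1) @ \oo --> (1 : R).
Proof.
move=> xoo.
have p0 := @pi_gt0 R.
suff : (fun k => atan (x k) / pi + 2^-1) @ \oo --> pi / 2 / pi + 2^-1.
  have -> // : pi / 2 / pi + 2^-1 = 1 :> R.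
  by rewrite mulrAC divff ?gt_eqF//; lra.
apply: cvgD; last exact: cvg_cst.
apply: cvgM; last exact: cvg_cst.
exact: (cvg_comp _ _ xoo (@cvgy_atan R)).
Qed.

Lemma cvgy_ge (x : nat -> R) (N : R) : (forall k : nat, N <= k%:R -> k%:R <= x k) -> x @ \oo --> +oo.
Proof.
move=> h; apply/cvgryPge => A; near=> k.
have Ak : A <= k%:R by near: k; exact: nbhs_infty_ger.
apply: le_trans Ak _; apply: h; near: k; exact: nbhs_infty_ger.
Unshelve. all: by end_near. Qed.

(** Smooth approximations of the Heaviside function. The term [- k], negligible against [k^2 g] for
    [g > 0], forces the limit [0] at [g = 0] as well. *)
Lemma atan_step (g : R) :
  (fun k : nat => atan ((k%:R : R) ^+ 2 * g - k%:R) / pi + 2^-1) @ \oo --> (if 0 < g then 1 else 0 : R).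
Proof.
case: ltP => g0.
  apply: atan_cvg1; apply: (@cvgy_ge _ (2 / g)) => k; rewrite ler_pdivrMr// => h.
  rewrite -subr_ge0.
  have -> : (k%:R : R) ^+ 2 * g - k%:R - k%:R = k%:R * (k%:R * g - 2) by ring.
  by rewrite mulr_ge0// subr_ge0.
have h : (fun k : nat => (k%:R : R) - k%:R ^+ 2 * g) @ \oo --> +oo.
  apply: (@cvgy_ge _ 0) => k _; rewrite lerDl oppr_ge0 mulr_ge0_le0// sqr_ge0.
have := atan_cvg1 h => /(cvgB (cvg_cst (1 : R))); rewrite subrr.
apply: cvg_trans; apply: near_eq_cvg; apply: nearW => k /=.
have -> : (k%:R : R) ^+ 2 * g - k%:R = - (k%:R - k%:R ^+ 2 * g) by ring.
rewrite atanN; change (1 - (atan (k%:R - k%:R ^+ 2 * g) / pi + 2^-1) = - atan (k%:R - k%:R ^+ 2 * g) / pi + 2^-1).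
have e : (1 : R) = 2^-1 + 2^-1 by rewrite -[LHS](mul1r 1) [RHS](_ : _ = 1 * 1)//; lra.
rewrite {1}e mulNr; lra.
Qed.

(** On the circle an arc is a superlevel set of a cosine centred at its midpoint; composed with
    [atan_step], this gives periodic test functions converging to the indicator of the arc. *)
Lemma cos_arc (a b t : R) : 0 <= a -> a < b -> b <= 2 * pi -> 0 <= t <= 2 * pi ->
  (0 < cos (t - (a + b) / 2) - cos ((b - a) / 2)) = (a < t < b).
Proof.
move=> a0 ab bp /andP[t0 tp]; have p0 := @pi_gt0 R.
set c := (a + b) / 2; set d := (b - a) / 2.
have -> : cos (t - c) = cos `|t - c| by case: (ler0P (t - c)) => _; rewrite ?cosN.
have -> : (a < t < b) = (`|t - c| < d) by rewrite ltr_norml /c /d; apply/idP/idP => /andP[? ?]; apply/andP; split; lra.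
have ydp : `|t - c| <= 2 * pi - d by rewrite ler_norml /c /d; apply/andP; split; lra.
have y0 := normr_ge0 (t - c); move: ydp y0; set y := `|t - c| => ydp y0.
have dp : 0 <= d <= pi by rewrite /d; apply/andP; split; lra.
rewrite subr_gt0; have [yp|py] := leP y pi.
  by rewrite ltr_cos// in_itv/= ?dp ?y0.
have -> : cos y = cos (2 * pi - y).
  by rewrite -[in LHS](subrK (2 * pi) y) mulr_natl cosD2pi -cosN opprB.
have -> : (y < d) = false by apply/negbTE; rewrite -leNgt; lra.
apply/negbTE; rewrite -leNgt.
have [e|ne] := eqVneq (2 * pi - y) d; first by rewrite e.
have ? : d < 2 * pi - y by rewrite lt_neqAle eq_sym ne/=; lra.
by apply: ltW; rewrite ltr_cos// in_itv/=; apply/andP; split; lra.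
Qed.

Lemma integral2_cvg (f : nat -> R * R -> R) (F g : R * R -> R) :
  (forall n, measurable_fun setT (f n)) -> measurable_fun setT F -> intc g ->
  (forall n z, `|f n z| <= g z) -> (forall z, f ^~ z @ \oo --> F z) ->
  integral2 (f n) @[n --> \oo] --> integral2 F.
Proof.
move=> mf mF ig fg fF.
have mfE n : measurable_fun (cell : set (measurableTypeR R * measurableTypeR R)%type) (EFin \o f n).
  have m : measurable_fun setT (EFin \o f n) by exact/measurable_EFinP.
  exact: measurable_funTS.
have mFE : measurable_fun (cell : set (measurableTypeR R * measurableTypeR R)%type) (EFin \o F).
  have m : measurable_fun setT (EFin \o F) by exact/measurable_EFinP.
  exact: measurable_funTS.
have h1 : {ae area, forall z, cell z -> (EFin \o f n) z @[n --> \oo] --> (EFin \o F) z}.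
  by apply: aeW => z _; apply: cvg_EFin; [exact: nearW|exact: fF].
have h2 : {ae area, forall z n, cell z -> (`|(EFin \o f n) z| <= (EFin \o g) z)%E}.
  by apply: aeW => z n _; rewrite /= lee_fin.
have [iF _ cv] := dominated_convergence mcell mfE mFE h1 ig h2.
apply: fine_cvg; rewrite /integral2 /Rintegral fineK; last exact: (integrable_fin_num mcell iF).
exact: cv.
Qed.

Lemma eq_integral2_cell (f g : R * R -> R) : measurable_fun setT f -> measurable_fun setT g ->
  {ae area, forall z, cell z -> f z = g z} -> integral2 f = integral2 g.
Proof.
move=> mf mg h.
have mE (k : R * R -> R) : measurable_fun setT k ->
    measurable_fun (cell : set (measurableTypeR R * measurableTypeR R)%type) (EFin \o k).
  move=> mk; have m : measurable_fun setT (EFin \o k) by exact/measurable_EFinP.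
  exact: measurable_funTS.
rewrite /integral2 /Rintegral; congr fine.
apply: (@ae_eq_integral _ _ R area cell (EFin \o g) (EFin \o f) mcell (mE _ mf) (mE _ mg)).
by apply: filterS h => z /= h zc; rewrite h.
Qed.

Lemma cos_per (s c : R) : cos (1 * (s + 2 * pi) + c) = cos (1 * s + c).
Proof. by rewrite mulrDr mul1r [in 1 * _]mul1r addrAC mulr_natl cosD2pi. Qed.
Lemma sin_per (s c : R) : sin (1 * (s + 2 * pi) + c) = sin (1 * s + c).
Proof. by rewrite mulrDr mul1r [in 1 * _]mul1r addrAC mulr_natl sinD2pi. Qed.

Lemma per_Cq_cosshift q (c : R) : per_Cq q (fun s => cos (s - c)).
Proof.
have h := @per_Cq_trig R q 1 1 0 (- c) (fun s => cos_per s _) (fun s => sin_per s _).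
by have -> : (fun s => cos (s - c)) = (fun s => 1 * cos (1 * s - c) + 0 * sin (1 * s - c));
  [apply/funext => s; rewrite !mul1r mul0r addr0|].
Qed.

Lemma per_CqD q phi chi : per_Cq q phi -> per_Cq q chi -> per_Cq q (fun s => phi s + chi s).
Proof.
elim: q phi chi => [|q IH] phi chi h1 h2.
  split=> //; first by move=> s; rewrite (per_Cq_per h1) (per_Cq_per h2).
  by move=> s; apply: cvgD; [exact: (per_Cq_cont h1)|exact: (per_Cq_cont h2)].
split; first by move=> s; rewrite (per_Cq_per h1) (per_Cq_per h2).
  by move=> s; apply: cvgD; [exact: (per_Cq_cont h1)|exact: (per_Cq_cont h2)].
split; first by move=> s; have h := derivableD (@per_Cq_derivable _ _ _ s h1) (@per_Cq_derivable _ _ _ s h2); exact: h.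
have -> : derive1 (fun s => phi s + chi s) = (fun s => derive1 phi s + derive1 chi s).
  apply/funext => s; rewrite !derive1E.
  have h := deriveD (@per_Cq_derivable _ _ _ s h1) (@per_Cq_derivable _ _ _ s h2); exact: h.
by apply: IH; exact: per_Cq_derive.
Qed.

Lemma per_CqM q phi chi : per_Cq q phi -> per_Cq q chi -> per_Cq q (fun s => phi s * chi s).
Proof.
elim: q phi chi => [|q IH] phi chi h1 h2.
  split=> //; first by move=> s; rewrite (per_Cq_per h1) (per_Cq_per h2).
  by move=> s; apply: cvgM; [exact: (per_Cq_cont h1)|exact: (per_Cq_cont h2)].
split; first by move=> s; rewrite (per_Cq_per h1) (per_Cq_per h2).
  by move=> s; apply: cvgM; [exact: (per_Cq_cont h1)|exact: (per_Cq_cont h2)].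
split; first by move=> s; have h := derivableM (@per_Cq_derivable _ _ _ s h1) (@per_Cq_derivable _ _ _ s h2); exact: h.
have -> : derive1 (fun s => phi s * chi s) = (fun s => derive1 phi s * chi s + phi s * derive1 chi s).
  apply/funext => s; rewrite !derive1E.
  have := deriveM (@per_Cq_derivable _ _ _ s h1) (@per_Cq_derivable _ _ _ s h2).
  rewrite /GRing.scale/= => h; rewrite [LHS]h addrC; congr (_ + _); exact: mulrC.
apply: per_CqD; apply: IH => //; try exact: per_Cq_derive; exact: per_CqW.
Qed.

Lemma per_CqZ q (c : R) phi : per_Cq q phi -> per_Cq q (fun s => c * phi s).
Proof. by move=> h; apply: per_CqM h; exact: per_Cq_cst. Qed.

Lemma per_C2_comp (F F' F'' : R -> R) phi : (forall y : R, is_derive y (1 : R) F (F' y)) ->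
  (forall y : R, is_derive y (1 : R) F' (F'' y)) -> continuous F'' ->
  per_Cq 2 phi -> per_Cq 2 (F \o phi).
Proof.
move=> dF dF' cF'' h.
have cF' : continuous F' by move=> y; apply/differentiable_continuous/derivable1_diffP; have [] := dF' y.
have [p1 c1 [d1 _]] := per_C1_comp dF cF' (per_CqW h).
have h2 := per_C1_comp dF' cF'' (per_CqW h).
suff h3 : per_Cq 1 (derive1 (F \o phi)) by exact: (And3 p1 c1 (conj d1 h3)).
have -> : derive1 (F \o phi) = (fun s => (F' \o phi) s * derive1 phi s).
  apply/funext => s.
  have D0 : is_derive s (1 : R) phi (derive1 phi s).
    by rewrite derive1E; apply: DeriveDef => //; exact: per_Cq_derivable h.
  have D := @is_derive1_comp R F phi s _ _ (dF _) D0.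
  by rewrite derive1E; have [_ ->] := D; rewrite mulrC.
exact: (@per_CqM 1 _ _ h2 (per_Cq_derive h)).
Qed.

Lemma step_test (k : nat) (c d : R) :
  per_Cq 2 (fun s => atan ((k%:R : R) ^+ 2 * (cos (s - c) - cos d) - k%:R) / pi + 2^-1).
Proof.
pose g (y : R) := (k%:R : R) ^+ 2 * (y - cos d) - k%:R.
pose F (y : R) := atan (g y) / pi + 2^-1.
pose h (y : R) := (1 + g y ^+ 2)^-1.
pose F' (y : R) := (k%:R ^+ 2 / pi) * h y.
pose F'' (y : R) := (k%:R ^+ 2 / pi) * (- (h y ^+ 2) * (2 * g y * k%:R ^+ 2)).
have Dg (y : R) : is_derive y (1 : R) g (k%:R ^+ 2).
  by apply: is_derive_eq; rewrite /GRing.scale/=; ring.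
have h0 y : 1 + g y ^+ 2 != 0 by rewrite gt_eqF// ltr_pwDl// sqr_ge0.
have Dh (y : R) : is_derive y (1 : R) h (- (h y ^+ 2) * (2 * g y * k%:R ^+ 2)).
  have D1 : is_derive y (1 : R) (fun y => 1 + g y ^+ 2) (2 * g y * k%:R ^+ 2).
    have D2 := is_deriveD (is_derive_cst (1 : R) y (1 : R)) (@is_deriveX _ _ g 2 y 1 _ (Dg y)).
    have -> : (fun y => 1 + g y ^+ 2) = (cst 1 + g ^+ 2) by rewrite exprfctE; apply/funext.
    by apply: (is_derive_eq D2); rewrite /GRing.scale/= expr1 -mulrA mulr_natl; ring.
  have D3 := @is_deriveV R (fun y => 1 + g y ^+ 2) y _ 1 (h0 y) D1.
  by apply: (is_derive_eq D3); rewrite /GRing.scale/= /h exprVn.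
apply: (@per_C2_comp F F' F'' (fun s => cos (s - c))); last exact: per_Cq_cosshift.
- move=> y.
  have D2 := @is_derive1_comp R atan g y _ _ (is_derive1_atan _) (Dg y).
  have D3 := is_deriveD (is_deriveZ pi^-1 D2) (is_derive_cst (2^-1 : R) y (1 : R)).
  have -> : F = (pi^-1 \*: (atan \o g) + cst 2^-1).
    by apply/funext => x; rewrite /F mulrC.
  by apply: (is_derive_eq D3); rewrite /GRing.scale/= /F' /h addr0; ring.
- have cg : continuous g by move=> y; apply/differentiable_continuous/derivable1_diffP; have [] := Dg y.
  have ch : continuous h by move=> y; apply/differentiable_continuous/derivable1_diffP; have [] := Dh y.
  move=> y; apply: cvgM; first exact: cvg_cst.
  apply: cvgM; first by apply: cvgN; apply: cvgM; exact: ch.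
  by apply: cvgM; [apply: cvgM; [exact: cvg_cst|exact: cg]|exact: cvg_cst].
Qed.

Lemma step_test_bound (k : nat) (x : R) : `|atan (x : R) / pi + 2^-1| <= 1.
Proof.
have p0 := @pi_gt0 R; have := atan_gtNpi2 x; have := atan_ltpi2 x => h1 h2.
have -> : atan x / pi + 2^-1 = (atan x + pi / 2) / pi.
  by rewrite mulrDl mulrAC divff ?gt_eqF// mul1r.
rewrite ger0_norm; first by rewrite ler_pdivrMr//; lra.
by rewrite divr_ge0//; lra.
Qed.

(** Dominated convergence along the tests [chi k], bounded by 1, which converge to the indicator of
    the arc at every point of the cell. *)
Lemma integral_arc v (a b : R) : measurable_fun setT v -> intc v ->
  (forall chi, per_Cq 2 chi -> integral2 (fun z => v z * chi z.1) = 0) ->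
  0 <= a -> b <= 2 * pi -> integral2 (fun z => v z * (a < z.1 < b)%R%:R) = 0.
Proof.
move=> mv iv h a0 b2; have [ab|ba] := ltP a b; last first.
  have -> : (fun z : R * R => v z * (a < z.1 < b)%R%:R) = fun=> 0.
    apply/funext => z; have -> : a < z.1 < b = false; last by rewrite mulr0.
    by apply/negbTE/negP => /andP[? ?]; lra.
  exact: integral2_0.
pose chi (k : nat) s : R := atan ((k%:R : R) ^+ 2 * (cos (s - (a + b) / 2) - cos ((b - a) / 2)) - k%:R) / pi + 2^-1.
pose G (z : R * R) : R := if 0 < cos (z.1 - (a + b) / 2) - cos ((b - a) / 2) then 1 else 0.
have mchi k : measurable_fun setT (fun z : R * R => chi k z.1).
  exact: is_Cq_meas (per_Cq_fst (step_test k _ _)).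
have mG : measurable_fun setT G.
  apply: measurable_fun_ifT => //; apply: measurable_fun_ltr => //.
  apply: measurable_funB => //; exact: is_Cq_meas (per_Cq_fst (per_Cq_cosshift 0 _)).
have cv := @integral2_cvg (fun k z => v z * chi k z.1) (fun z => v z * G z) (fun z => `|v z|)
  (fun k => measurable_funM mv (mchi k)) (measurable_funM mv mG).
have {cv} : integral2 (fun z => v z * chi k z.1) @[k --> \oo] --> integral2 (fun z => v z * G z).
  apply: cv.
  - apply: le_intc iv; first exact: measurableT_comp.
    by move=> z; rewrite normr_id.
  - by move=> k z; rewrite normrM ler_piMr//; exact: step_test_bound.
  - move=> z; apply: cvgM; first exact: cvg_cst.
    exact: atan_step.
have -> : (fun k => integral2 (fun z => v z * chi k z.1)) = fun=> 0.
  by apply/funext => k; apply: h; exact: step_test.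
move=> /cvg_lim => /(_ (@Rhausdorff R)); rewrite lim_cst// => e.
rewrite e; rewrite /integral2 /Rintegral; congr fine; apply: eq_integral => -[x y] /[!inE] -[/= xc yc].
congr (EFin (_ * _)); rewrite /G/=.
have xc' : 0 <= x <= 2 * pi by move: xc; rewrite /circle/= in_itv.
by rewrite (cos_arc a0 ab b2 xc'); case: (a < x < b)%R.
Qed.

Lemma ae_fst_neq (a : R) : {ae area, forall z : R * R, z.1 != a}.
Proof.
exists ([set a] `*` setT); split.
- exact: measurableX.
- rewrite /area [LHS]product_measure1E; [|exact: measurable_set1|exact: measurableT].
  have -> : lebesgue_measure_lebesgue_measure__canonical__measure_function_Measure R [set a] = 0%E.
    exact: lebesgue_measure_set1.
  by rewrite mul0e.
- by move=> z /= /negP/negPn/eqP.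
Qed.

Lemma indic_measurable_fst (A : set R) : measurable A -> measurable_fun setT (fun z : R * R => \1_A z.1 : R).
Proof.
by move=> mA; exact: (measurableT_comp (measurable_indic mA) measurable_fst).
Qed.

Lemma intc_indic v (E : set (R * R)) : measurable E -> measurable_fun setT v -> intc v ->
  intc (fun z => v z * \1_E z).
Proof.
move=> mE mv; apply: le_intc.
  by apply: measurable_funM => //; exact: measurable_indic.
by move=> z; rewrite normrM indicE; case: (z \in E); rewrite ?normr1 ?normr0 ?mulr1 ?mulr0.
Qed.

Lemma integral_indic_bigcup v (F : nat -> set (R * R)) : measurable_fun setT v -> intc v ->
  (forall k, measurable (F k)) -> trivIset setT F -> (forall k, integral2 (fun z => v z * \1_(F k) z) = 0) ->
  integral2 (fun z => v z * \1_(\bigcup_k F k) z) = 0.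
Proof.
move=> mv iv mF tF vF.
have mUn n : measurable (\big[setU/set0]_(k < n) F k) by exact: bigsetU_measurable.
have mU : measurable (\bigcup_k F k) by exact: bigcup_measurable.
have cv := @integral2_cvg (fun n z => v z * \1_(\big[setU/set0]_(k < n) F k) z)
  (fun z => v z * \1_(\bigcup_k F k) z) (fun z => `|v z|)
  (fun k => measurable_funM mv (measurable_indic (mUn k))) (measurable_funM mv (measurable_indic mU)).
have {cv} : integral2 (fun z => v z * \1_(\big[setU/set0]_(k < n) F k) z) @[n --> \oo] -->
    integral2 (fun z => v z * \1_(\bigcup_k F k) z).
  apply: cv.
  + apply: le_intc iv; first exact: measurableT_comp.
    by move=> z; rewrite normr_id.
  + by move=> n z; rewrite normrM indicE; case: (z \in _); rewrite ?normr1 ?normr0 ?mulr1 ?mulr0.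
  + move=> z; apply: cvgM; first exact: cvg_cst.
    apply: cvg_near_cst; have [[k _ Fkz]|nF] := pselect ((\bigcup_k F k) z).
      near=> n; rewrite !indicE !mem_set//; first by exists k.
      rewrite -bigcup_mkord; exists k => //=; near: n; exact: nbhs_infty_gt.
    apply: nearW => n; rewrite !indicE !memNset//.
    by rewrite -bigcup_mkord => -[k /= _ Fkz]; apply: nF; exists k.
have -> : (fun n => integral2 (fun z => v z * \1_(\big[setU/set0]_(k < n) F k) z)) = fun=> 0.
  apply/funext => n; elim: n => [|n IH].
    rewrite big_ord0; under eq_fun do rewrite indic0 mulr0; exact: integral2_0.
  rewrite big_ord_recr/=.
  have -> : (fun z => v z * \1_(\big[setU/set0]_(i < n) F i `|` F n) z) =
     (fun z => v z * \1_(\big[setU/set0]_(i < n) F i) z + v z * \1_(F n) z).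
    apply/funext => z; rewrite -mulrDr; congr (_ * _); rewrite !indicE in_setU.
    case: (boolP (z \in F n)); last by rewrite orbF addr0.
    rewrite orbT => /set_mem Fnz; rewrite memNset ?add0r//.
    rewrite -bigcup_mkord => -[k /= kn Fkz]; have := tF k n I I.
    move/(_ (ex_intro _ z (conj Fkz Fnz))) => e; move: kn; by rewrite e ltnn.
  rewrite integral2D ?IH ?vF ?addr0//; exact: intc_indic.
move=> /cvg_lim => /(_ (@Rhausdorff R)); rewrite lim_cst//.
Unshelve. all: by end_near.
Qed.

Lemma integral_indic_dynkin v (G : set (set (R * R))) : measurable_fun setT v -> intc v ->
  @measurable _ (R * R)%type = <<s G >> -> setI_closed G ->
  integral2 v = 0 -> (forall E, G E -> integral2 (fun z => v z * \1_E z) = 0) ->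
  forall E, measurable E -> integral2 (fun z => v z * \1_E z) = 0.
Proof.
move=> mv iv GE GI v0 vG E; rewrite GE.
apply: (@dynkin_induction _ _ G (fun E => integral2 (fun z => v z * \1_E z) = 0) GE GI).
- by rewrite -[RHS]v0; congr integral2; apply/funext => z; rewrite indicT mulr1.
- exact: vG.
- move=> S mS vS.
  have -> : (fun z => v z * \1_(~` S) z) = (fun z => v z - v z * \1_S z).
    by apply/funext => z; rewrite !indicE in_setC; case: (_ \in S); rewrite /= ?mulr1 ?mulr0 ?subrr ?subr0.
  rewrite integral2B ?v0 ?vS ?subr0//; exact: intc_indic.
- by move=> F mF tF vF; exact: integral_indic_bigcup.
Qed.

Lemma ocitv_generates : @measurable _ (R : measurableType _) = <<s @ocitv R >>.
Proof. by []. Qed.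

Lemma ocitv_setI : setI_closed (@ocitv R).
Proof. exact: (@measurableI _ (ocitv_type R)). Qed.

Lemma integral_borel1 v (A : set R) : measurable_fun setT v -> intc v ->
  (forall chi, per_Cq 2 chi -> integral2 (fun z => v z * chi z.1) = 0) ->
  measurable A -> integral2 (fun z => v z * \1_A z.1) = 0.
Proof.
move=> mv iv h mA.
have v0 : integral2 v = 0.
  by rewrite -[RHS](h _ (per_Cq_cst 2 1)); congr integral2; apply/funext => z; rewrite mulr1.
pose m' (B : set R) := integral2 (fun z => v z * \1_B z.1).
have mI (B : set R) : measurable B -> measurable_fun setT (fun z : R * R => v z * \1_B z.1).
  by move=> mB; apply: measurable_funM mv _; exact: indic_measurable_fst.
have iI (B : set R) : measurable B -> intc (fun z => v z * \1_B z.1).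
  move=> mB; apply: le_intc iv; first exact: mI.
  by move=> z; rewrite normrM indicE; case: (_ \in _); rewrite ?normr1 ?normr0 ?mulr1 ?mulr0.
suff : m' A = 0 by [].
move: mA; rewrite ocitv_generates; apply: (@dynkin_induction _ _ _ (fun B => m' B = 0) ocitv_generates ocitv_setI).
- by rewrite /m' -[RHS]v0; congr integral2; apply/funext => z; rewrite indicT mulr1.
- move=> _ [[a b] /= ab <-]; rewrite /m'.
  (* On the cell, and off the null lines at [b], [0] and [2 * pi], the half-open interval coincides
     with an open one contained in [[0, 2 * pi]]. *)
  rewrite -(integral_arc (a := Num.max a 0) (b := Num.min b (2 * pi)) mv iv h) ?le_max ?lexx ?orbT// ?ge_min ?lexx ?orbT//.
  have mR : measurable_fun setT (fun z : R * R => v z * (Num.max a 0 < z.1 < Num.min b (2 * pi))%R%:R).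
    have -> : (fun z : R * R => v z * (Num.max a 0 < z.1 < Num.min b (2 * pi))%R%:R) =
       (fun z => v z * \1_(`]Num.max a 0, Num.min b (2 * pi)[%classic) z.1).
      apply/funext => z; congr (_ * _); rewrite indicE; congr (nat_of_bool _)%:R.
      by rewrite mem_setE in_itv.
    by apply: mI; exact: measurable_itv.
  apply: (eq_integral2_cell _ mR); first by apply: mI; exact: measurable_itv.
  move: (ae_fst_neq b) (ae_fst_neq 0) (ae_fst_neq (2 * pi)).
  apply: filterS3 => z zb z0 zp [zc _]; congr (_ * _).
  rewrite indicE mem_setE in_itv/=; congr (nat_of_bool _)%:R.
  move: zc; rewrite /circle/= in_itv/= => /andP[zc1 zc2].
  rewrite gt_max lt_min andbACA [0 < _]lt_neqAle eq_sym z0 zc1 [_ < 2 * pi]lt_neqAle zp zc2 !andbT.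
  by rewrite [RHS]andbC [in RHS]lt_neqAle zb/= andbC.
- move=> S mS vS; rewrite /m'.
  have -> : (fun z => v z * \1_(~` S) z.1) = (fun z => v z - v z * \1_S z.1).
    by apply/funext => z; rewrite !indicE in_setC; case: (_ \in S); rewrite /= ?mulr1 ?mulr0 ?subrr ?subr0.
  by rewrite integral2B ?v0 ?[integral2 _]vS ?subr0//; exact: iI.
- move=> F mF tF vF; rewrite /m'.
  have mFst (B : set R) : measurable B -> measurable (fst @^-1` B : set (R * R)).
    by move=> mB; rewrite -[X in measurable X]setTI; exact: measurable_fst.
  have := @integral_indic_bigcup v (fun k => fst @^-1` F k) mv iv (fun k => mFst _ (mF k)).
  have -> : (fun z : R * R => v z * \1_(\bigcup_k fst @^-1` F k) z) = (fun z => v z * \1_(\bigcup_k F k) z.1).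
    by apply/funext => z; rewrite !indicE.
  apply; last by move=> k; have := vF k; rewrite /m' => <-; congr integral2; apply/funext => z; rewrite !indicE.
  by move=> i j _ _ [z [/= zi zj]]; apply: (tF i j) => //; exists z.1.
Qed.

(** With [phi] fixed, the tests in theta are replaced by indicators of Borel sets; exchanging the
    variables does the same in s, and rectangles generate the measurable sets of the plane. The set
    where [w] is non-negative then gives a vanishing integral of [|w|]. Tests of class [C^2] leave
    one derivative in reserve over what weak derivatives ask. *)
Theorem separation w : is_L2 w ->
  (forall chi phi, per_Cq 2 chi -> per_Cq 2 phi -> integral2 (fun z => w z * (chi z.1 * phi z.2)) = 0) ->
  aeeq w (fun=> 0).
Proof.
move=> w2 h; have mw := L2_meas w2.
have iw : intc w.
  by apply: eq_intc (L2_mul w2 (L2_cst 1)) => z; rewrite mulr1.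
have h1 phi (A : set R) : per_Cq 2 phi -> measurable A -> integral2 (fun z => w z * phi z.2 * \1_A z.1) = 0.
  move=> hphi mA; have hq := is_Cq_L2 (per_Cq_snd hphi).
  apply: integral_borel1 mA.
  - exact: measurable_funM mw (L2_meas hq).
  - exact: L2_mul.
  - move=> chi hchi; rewrite -[RHS](h _ _ hchi hphi); congr integral2; apply/funext => z; ring.
have h2 (A B : set R) : measurable A -> measurable B -> integral2 (fun z => w z * \1_A z.1 * \1_B z.2) = 0.
  move=> mA mB.
  have mwA : measurable_fun setT (fun z => w z * \1_A z.1).
    by apply: measurable_funM mw _; exact: indic_measurable_fst.
  have iwA : intc (fun z => w z * \1_A z.1).
    apply: le_intc iw => // z; rewrite normrM indicE.
    by case: (_ \in _); rewrite ?normr1 ?normr0 ?mulr1 ?mulr0.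
  have msw : measurable_fun setT (fun z : R * R => w (z.2, z.1) * \1_A z.2) := measurableT_comp mwA measurable_swap2.
  have isw : intc (fun z : R * R => w (z.2, z.1) * \1_A z.2) := integrable_cell_swap mwA iwA.
  rewrite -[RHS](integral_borel1 msw isw _ mB); last first.
    move=> phi hphi; rewrite -[RHS](h1 _ _ hphi mA).
    have := @integral2_swap R (fun z => w z * phi z.2 * \1_A z.1).
    have mm : measurable_fun setT (fun z : R * R => w z * phi z.2 * \1_A z.1).
      apply: measurable_funM; last exact: indic_measurable_fst.
      by apply: measurable_funM mw _; exact: L2_meas (is_Cq_L2 (per_Cq_snd hphi)).
    move=> /(_ mm) /=; have im : intc (fun z : R * R => w z * phi z.2 * \1_A z.1).
      apply: le_intc mm _ (L2_mul w2 (is_Cq_L2 (per_Cq_snd hphi))) => z; rewrite normrM indicE.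
      by case: (_ \in _); rewrite ?normr1 ?normr0 ?mulr1 ?mulr0.
    move=> /(_ im) <-; congr integral2; apply/funext => z /=; ring.
  rewrite -[LHS](integral2_swap (f := fun z => w z * \1_A z.1 * \1_B z.2)) //.
    apply: measurable_funM mwA _; exact: (measurableT_comp (measurable_indic mB) measurable_snd).
  apply: le_intc iwA; first by apply: measurable_funM mwA _; exact: (measurableT_comp (measurable_indic mB) measurable_snd).
  by move=> z; rewrite normrM [\1_B _]indicE; case: (_ \in _); rewrite ?normr1 ?normr0 ?mulr1 ?mulr0.
have v0 : integral2 w = 0.
  rewrite -[RHS](h2 setT setT measurableT measurableT); congr integral2; apply/funext => z.
  by rewrite !indicT !mulr1.
have h3 (E : set (R * R)) : measurable E -> integral2 (fun z => w z * \1_E z) = 0.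
  apply: (integral_indic_dynkin mw iw (measurable_prod_measurableType _ _)) => //.
    move=> _ _ [A mA [B mB <-]] [A' mA' [B' mB' <-]]; rewrite -setXI.
    by exists (A `&` A'); [exact: measurableI|exists (B `&` B'); [exact: measurableI|]].
  move=> _ [A mA [B mB <-]]; rewrite -[RHS](h2 _ _ mA mB); congr integral2; apply/funext => z.
  by rewrite !indicE in_setX -mulrA; case: (z.1 \in A); case: (z.2 \in B); rewrite ?mulr1 ?mulr0.
pose E := [set z : R * R | 0 <= w z].
have mE : measurable E.
  rewrite /E -[X in measurable X]setTI; apply: (measurable_fun_ler (measurable_cst _) mw) => //.
have e : integral2 (fun z => `|w z|) = 0.
  have -> : (fun z => `|w z|) = (fun z => 2 * (w z * \1_E z) - w z).
    apply/funext => z; rewrite indicE; case: (boolP (z \in E)) => [/set_mem zE|].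
      rewrite ger0_norm//; change (w z = 2 * (w z * 1) - w z); lra.
    rewrite notin_setE /E/= => /negP; rewrite -ltNge => zE; rewrite ltr0_norm//; change (- w z = 2 * (w z * 0) - w z); lra.
  rewrite integral2B ?integral2Z ?h3 ?v0 ?mulr0 ?subr0//; last exact/intcZ/intc_indic.
  exact: intc_indic.
apply: periodic_ae (L2_per w2) _ _ => [z z' ->//|].
have ia : intc (fun z => `|w z|).
  by apply: le_intc iw; [exact: measurableT_comp|move=> z; rewrite normr_id].
have : (\int[area]_(z in cell) `|(w z)%:E| = 0)%E.
  by move: e; rewrite /integral2 /Rintegral => /eqP; rewrite fine_eq0 ?(integrable_fin_num mcell ia)// => /eqP.
have mwE : measurable_fun (cell : set (measurableTypeR R * measurableTypeR R)%type) (EFin \o w).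
  by apply: measurable_funTS; exact/measurable_EFinP.
move=> /(ae_eq_integral_abs _ mcell mwE); apply: filterS => z /= hz zc.
by have [] := hz zc.
Qed.

End Separation.

(* [canon] and the operations below are sealed so that unification never
   unfolds them. *)
Lemma canon_subproof (R : realType) : {c : (R * R -> R) -> R * R -> R | forall f,
  c f = xget (fun=> 0) [set g | is_L2 g /\ aeeq (if `[< is_L2 f >] then f else fun=> 0) g]}.
Proof. by eexists. Qed.
Definition canon {R : realType} := sval (canon_subproof R).

Lemma canonE {R : realType} (f : R * R -> R) :
  canon f = xget (fun=> 0) [set g | is_L2 g /\ aeeq (if `[< is_L2 f >] then f else fun=> 0) g].
Proof. exact: svalP (canon_subproof R) f. Qed.

Lemma canonP {R : realType} (f : R * R -> R) :
  is_L2 (canon f) /\ aeeq (if `[< is_L2 f >] then f else fun=> 0) (canon f).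
Proof.
rewrite canonE; case: xgetP => [g -> []//|].
case: asboolP => h; [move=> /(_ f)|move=> /(_ (fun=> 0))] => /not_andP[] //.
- by move/(_ (aeeq_refl _)).
- by move/(_ (@L2_0 R)).
- by move/(_ (aeeq_refl _)).
Qed.

Lemma canon_L2 {R : realType} (f : R * R -> R) : is_L2 (canon f).
Proof. by have [] := canonP f. Qed.

Lemma canon_ae {R : realType} (f : R * R -> R) : is_L2 f -> aeeq f (canon f).
Proof. by move=> h; have [_] := canonP f; rewrite asboolT. Qed.

Lemma canon_eq {R : realType} (f g : R * R -> R) : is_L2 f -> is_L2 g -> aeeq f g -> canon f = canon g.
Proof.
move=> hf hg fg; rewrite !canonE !asboolT//; congr xget; apply/funext => h; apply/propext; split => -[? e].
  by split=> //; apply: aeeq_trans e; exact: aeeq_sym.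
by split=> //; exact: aeeq_trans e.
Qed.

Lemma canonK {R : realType} (f : R * R -> R) : canon (canon f) = canon f.
Proof.
wlog h : f / is_L2 f => [H|].
  have [|nh] := pselect (is_L2 f); first exact: H.
  have <- : canon (fun=> 0) = canon f by rewrite !canonE asboolT ?asboolF//; exact: L2_0.
  by apply: H; exact: L2_0.
by apply: canon_eq => //; [exact: canon_L2|apply: aeeq_sym; exact: canon_ae].
Qed.

(* Elements are canonical representatives, so that functions equal almost
   everywhere give classes that are equal in the sense of Leibniz. *)
Record L2class (R : realType) := MkL2class {
  repr2 : R * R -> R;
  repr2P : canon repr2 = repr2 }.

(** * The Hilbert space of square-integrable functions *)

Section L2class.
Context {R : realType}.
Implicit Types (f g : R * R -> R) (x y : L2class R).

HB.instance Definition _ := gen_eqMixin (L2class R).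
HB.instance Definition _ := gen_choiceMixin (L2class R).

Definition cls f : L2class R := MkL2class (canonK f).

Lemma repr2_inj x y : repr2 x = repr2 y -> x = y.
Proof. by case: x y => [f p] [g r] /= e; subst g; rewrite (Prop_irrelevance p r). Qed.

Lemma repr2_L2 x : is_L2 (repr2 x).
Proof. by rewrite -repr2P; exact: canon_L2. Qed.
Hint Resolve repr2_L2 : core.

Lemma cls_ae f : is_L2 f -> aeeq (repr2 (cls f)) f.
Proof. by move=> h; apply: aeeq_sym; exact: canon_ae. Qed.

Lemma repr2K x : cls (repr2 x) = x.
Proof. by apply: repr2_inj; exact: repr2P. Qed.

Lemma cls_eq f g : is_L2 f -> is_L2 g -> aeeq f g -> cls f = cls g.
Proof. by move=> hf hg e; apply: repr2_inj; exact: canon_eq. Qed.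

Lemma cls_inj f g : is_L2 f -> is_L2 g -> cls f = cls g -> aeeq f g.
Proof.
move=> hf hg e; apply: aeeq_trans (cls_ae hg); rewrite -e; apply: aeeq_sym; exact: cls_ae.
Qed.

Lemma addL_subproof : {add : L2class R -> L2class R -> L2class R |
  forall x y, add x y = cls (fun z => repr2 x z + repr2 y z)}.
Proof. by eexists. Qed.
Definition addL := sval addL_subproof.
Lemma addLE x y : addL x y = cls (fun z => repr2 x z + repr2 y z).
Proof. exact: svalP addL_subproof x y. Qed.
Lemma oppL_subproof : {opp : L2class R -> L2class R | forall x, opp x = cls (fun z => - repr2 x z)}.
Proof. by eexists. Qed.
Definition oppL := sval oppL_subproof.
Lemma oppLE x : oppL x = cls (fun z => - repr2 x z).
Proof. exact: svalP oppL_subproof x. Qed.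
Lemma scaleL_subproof : {sc : R -> L2class R -> L2class R | forall c x, sc c x = cls (fun z => c * repr2 x z)}.
Proof. by eexists. Qed.
Definition scaleL := sval scaleL_subproof.
Lemma scaleLE c x : scaleL c x = cls (fun z => c * repr2 x z).
Proof. exact: svalP scaleL_subproof c x. Qed.
Lemma zeroL_subproof : {x : L2class R | x = cls (fun=> 0)}.
Proof. by eexists. Qed.
Definition zeroL := sval zeroL_subproof.
Lemma zeroLE : zeroL = cls (fun=> 0).
Proof. exact: svalP zeroL_subproof. Qed.

Lemma aeeqD f f' g g' : aeeq f f' -> aeeq g g' -> aeeq (fun z => f z + g z) (fun z => f' z + g' z).
Proof. by apply: filterS2 => z /= -> ->. Qed.
Lemma aeeqN f f' : aeeq f f' -> aeeq (fun z => - f z) (fun z => - f' z).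
Proof. by apply: filterS => z /= ->. Qed.
Lemma aeeqM f f' g g' : aeeq f f' -> aeeq g g' -> aeeq (fun z => f z * g z) (fun z => f' z * g' z).
Proof. by apply: filterS2 => z /= -> ->. Qed.

Lemma addLA : associative addL.
Proof.
move=> x y z; rewrite !addLE; apply: cls_eq; [exact/L2D..|].
apply: aeeq_trans (aeeqD (aeeq_refl _) (cls_ae (L2D (repr2_L2 y) (repr2_L2 z)))) _.
apply: aeeq_sym; apply: aeeq_trans (aeeqD (cls_ae (L2D (repr2_L2 x) (repr2_L2 y))) (aeeq_refl _)) _.
by apply: aeW => t; rewrite addrA.
Qed.
Lemma addLC : commutative addL.
Proof. by move=> x y; rewrite !addLE; congr cls; apply/funext => z; rewrite addrC. Qed.
Lemma add0L : left_id zeroL addL.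
Proof.
move=> x; rewrite addLE zeroLE -[RHS]repr2K; apply: cls_eq => //; first exact/L2D.
apply: aeeq_trans (aeeqD (cls_ae L2_0) (aeeq_refl _)) _.
by apply: aeW => t; rewrite add0r.
Qed.
Lemma addNL : left_inverse zeroL oppL addL.
Proof.
move=> x; rewrite addLE oppLE zeroLE; apply: cls_eq; [exact/L2D|exact: L2_0|].
apply: aeeq_trans (aeeqD (cls_ae (L2N (repr2_L2 x))) (aeeq_refl _)) _.
by apply: aeW => t; rewrite addNr.
Qed.

HB.instance Definition _ := GRing.isZmodule.Build (L2class R) addLA addLC add0L addNL.

Lemma clsD f g : is_L2 f -> is_L2 g -> cls (fun z => f z + g z) = cls f + cls g.
Proof.
move=> hf hg; rewrite [RHS]addLE; apply: cls_eq; [exact: L2D|exact/L2D|].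
by apply: aeeq_sym; apply: aeeqD; exact: cls_ae.
Qed.
Lemma clsN f : is_L2 f -> cls (fun z => - f z) = - cls f.
Proof.
by move=> hf; rewrite [RHS]oppLE; apply: cls_eq; [exact: L2N|exact/L2N|apply: aeeq_sym; apply: aeeqN; exact: cls_ae].
Qed.
Lemma cls0 : cls (fun=> 0) = 0. Proof. by rewrite -zeroLE. Qed.
Lemma clsZ_ c f : is_L2 f -> cls (fun z => c * f z) = scaleL c (cls f).
Proof.
move=> hf; rewrite scaleLE; apply: cls_eq; [exact: L2Z|exact/L2Z|].
by apply: aeeq_sym; apply: aeeqM; [exact: aeeq_refl|exact: cls_ae].
Qed.

Lemma scaleLA a b x : scaleL a (scaleL b x) = scaleL (a * b) x.
Proof.
rewrite [scaleL b x]scaleLE -clsZ_; last exact/L2Z.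
by rewrite scaleLE; congr cls; apply/funext => z; rewrite mulrA.
Qed.
Lemma scale1L : left_id 1 scaleL.
Proof. by move=> x; rewrite scaleLE; under eq_fun do rewrite mul1r; rewrite repr2K. Qed.
Lemma scaleLDr : right_distributive scaleL +%R.
Proof.
move=> c x y; rewrite -[x in LHS]repr2K -[y in LHS]repr2K -clsD// -clsZ_; last exact/L2D.
by rewrite !scaleLE -clsD; [|exact/L2Z..]; congr cls; apply/funext => z; rewrite mulrDr.
Qed.
Lemma scaleLDl x : {morph scaleL^~ x : a b / a + b}.
Proof.
move=> a b /=; rewrite !scaleLE -clsD; [|exact/L2Z..].
by congr cls; apply/funext => z; rewrite mulrDl.
Qed.

HB.instance Definition _ := GRing.Zmodule_isLmodule.Build R (L2class R) scaleLA scale1L scaleLDr scaleLDl.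

Lemma clsZ c f : is_L2 f -> cls (fun z => c * f z) = c *: cls f.
Proof. exact: clsZ_. Qed.
Lemma clsB f g : is_L2 f -> is_L2 g -> cls (fun z => f z - g z) = cls f - cls g.
Proof. by move=> hf hg; rewrite clsD ?clsN//; exact: L2N. Qed.
Lemma cls_sum (I : Type) (s : seq I) (P : pred I) (F : I -> R * R -> R) :
  (forall i, P i -> is_L2 (F i)) ->
  cls (fun z => \sum_(i <- s | P i) F i z) = \sum_(i <- s | P i) cls (F i).
Proof.
move=> h; elim: s => [|i s IH]; first by rewrite big_nil; under eq_fun do rewrite big_nil; exact: cls0.
rewrite big_cons; case: (boolP (P i)) => Pi.
  under eq_fun do rewrite big_cons Pi.
  by rewrite clsD ?IH//; [exact: h|exact: L2_sum].
by under eq_fun do rewrite big_cons (negbTE Pi).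
Qed.

Lemma dot_subproof : {d : L2class R -> L2class R -> R | forall x y, d x y = ip (repr2 x) (repr2 y)}.
Proof. by eexists. Qed.
Definition dot := sval dot_subproof.
Lemma dotE x y : dot x y = ip (repr2 x) (repr2 y). Proof. exact: svalP dot_subproof x y. Qed.
Definition nm x := Num.sqrt (dot x x).

Lemma dot_cls f g : is_L2 f -> is_L2 g -> dot (cls f) (cls g) = ip f g.
Proof. by move=> hf hg; rewrite dotE; apply: ip_ae; try (apply: L2_meas); try exact: cls_ae. Qed.
Lemma dot_clsl f y : is_L2 f -> dot (cls f) y = ip f (repr2 y).
Proof. by move=> hf; rewrite -[y in LHS]repr2K dot_cls. Qed.

Lemma dotC x y : dot x y = dot y x. Proof. by rewrite !dotE ipC. Qed.
Lemma dotDl x y w : dot (x + y) w = dot x w + dot y w.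
Proof.
rewrite -[x]repr2K -[y]repr2K -[w]repr2K -clsD// !dot_cls//; last exact: L2D.
exact: ipDl.
Qed.
Lemma dotZl c x w : dot (c *: x) w = c * dot x w.
Proof. by rewrite -[x]repr2K -[w]repr2K -clsZ// !dot_cls//; [exact: ipZl|exact: L2Z]. Qed.
Lemma dotNl x w : dot (- x) w = - dot x w. Proof. by rewrite -scaleN1r dotZl mulN1r. Qed.
Lemma dotBl x y w : dot (x - y) w = dot x w - dot y w. Proof. by rewrite dotDl dotNl. Qed.
Lemma dotDr x y w : dot w (x + y) = dot w x + dot w y. Proof. by rewrite dotC dotDl !(dotC w). Qed.
Lemma dotZr c x w : dot w (c *: x) = c * dot w x. Proof. by rewrite dotC dotZl dotC. Qed.
Lemma dotNr x w : dot w (- x) = - dot w x. Proof. by rewrite dotC dotNl dotC. Qed.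
Lemma dotBr x y w : dot w (x - y) = dot w x - dot w y. Proof. by rewrite dotDr dotNr. Qed.
Lemma dot0l x : dot 0 x = 0. Proof. by rewrite -(scale0r 0) dotZl mul0r. Qed.
Lemma dot0r x : dot x 0 = 0. Proof. by rewrite dotC dot0l. Qed.
Lemma dot_suml (I : Type) (s : seq I) (P : pred I) (F : I -> L2class R) w :
  dot (\sum_(i <- s | P i) F i) w = \sum_(i <- s | P i) dot (F i) w.
Proof. by apply: (big_morph (dot^~ w)) => [x y|]; rewrite ?dotDl ?dot0l. Qed.
Lemma dot_sumr (I : Type) (s : seq I) (P : pred I) (F : I -> L2class R) w :
  dot w (\sum_(i <- s | P i) F i) = \sum_(i <- s | P i) dot w (F i).
Proof. by rewrite dotC dot_suml; apply: eq_bigr => i _; rewrite dotC. Qed.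

Lemma dot_ge0 x : 0 <= dot x x. Proof. by rewrite dotE ip_ge0. Qed.
Lemma nm_ge0 x : 0 <= nm x. Proof. exact: sqrtr_ge0. Qed.
Lemma sqr_nm x : nm x ^+ 2 = dot x x. Proof. by rewrite /nm dotE; exact: sqr_nrm. Qed.
Lemma nm_cls f : is_L2 f -> nm (cls f) = nrm f. Proof. by move=> hf; rewrite /nm dot_cls. Qed.
Lemma nm0 : nm 0 = 0. Proof. by rewrite /nm dot0l sqrtr0. Qed.
Lemma nmZ c x : nm (c *: x) = `|c| * nm x.
Proof. by rewrite -[x]repr2K -clsZ// !nm_cls//; [exact: nrmZ|exact: L2Z]. Qed.
Lemma nmN x : nm (- x) = nm x. Proof. by rewrite -scaleN1r nmZ normrN1 mul1r. Qed.
Lemma nmD x y : nm (x + y) <= nm x + nm y.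
Proof.
rewrite -[x]repr2K -[y]repr2K -clsD// !nm_cls//; [exact: nrmD|exact: L2D].
Qed.
Lemma nmB x y : nm (x - y) <= nm x + nm y. Proof. by rewrite -(nmN y) nmD. Qed.
Lemma nmBC x y : nm (x - y) = nm (y - x). Proof. by rewrite -nmN opprB. Qed.
Lemma nm_sum (I : Type) (s : seq I) (P : pred I) (F : I -> L2class R) :
  nm (\sum_(i <- s | P i) F i) <= \sum_(i <- s | P i) nm (F i).
Proof.
elim/big_ind2: _ => // [|a b c d h1 h2]; first by rewrite nm0.
exact: le_trans (nmD _ _) (lerD h1 h2).
Qed.
Lemma nm_eq0 x : nm x = 0 -> x = 0.
Proof.
move=> h; rewrite -[x]repr2K -cls0; apply: cls_eq => //; first exact: L2_0.
by apply: nrm_eq0 => //; rewrite -nm_cls// repr2K.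
Qed.
Lemma dot_le x y : `|dot x y| <= nm x * nm y. Proof. by rewrite /nm !dotE; exact: cauchy_schwarz. Qed.
Lemma dot_lev x y : dot x y <= nm x * nm y. Proof. exact: le_trans (ler_norm _) (dot_le x y). Qed.
Lemma dot_eq0 x : dot x x = 0 -> x = 0. Proof. by move=> h; apply: nm_eq0; rewrite /nm h sqrtr0. Qed.
Lemma dot_inj x y : (forall w, dot x w = dot y w) -> x = y.
Proof. by move=> h; apply/eqP; rewrite -subr_eq0; apply/eqP/dot_eq0; rewrite dotBl h subrr. Qed.

Lemma L2class_complete (f : nat -> L2class R) (C q : R) : 0 < q < 1 ->
  (forall n, nm (f n.+1 - f n) <= C * (q ^+ 2) ^+ n) ->
  exists (g : L2class R) (K : R), forall n, nm (f n - g) <= K * q ^+ n.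
Proof.
move=> q01 h; have [n|g [hg _ [K hK]]] := L2_complete (f := fun n => repr2 (f n)) q01 (fun n => repr2_L2 (f n)) (C := C).
  by have := h n; rewrite -[f n.+1]repr2K -[f n]repr2K -clsB// nm_cls ?repr2K//; exact: L2B.
exists (cls g), K => n; have := hK n.
by rewrite -[f n]repr2K -clsB// nm_cls ?repr2K//; exact: L2B.
Qed.

(* Minimizing sequences of the distance to a subspace are Cauchy, and the
   residual of the limit is orthogonal to the subspace. *)
Lemma dense_of_orthogonal (S : L2class R -> Prop) x (e : R) : S 0 ->
  (forall c s t, S s -> S t -> S (c *: s + t)) ->
  (forall w, (forall s, S s -> dot w s = 0) -> w = 0) -> 0 < e ->
  exists2 s, S s & nm (x - s) < e.
Proof.
move=> S0 SD Sw; apply: contraPP => nex e0.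
have far s : S s -> e <= nm (x - s).
  by move=> Ss; rewrite leNgt; apply/negP => h; apply: nex; exists s.
pose A := [set dot (x - s) (x - s) | s in S].
have hA : has_inf A.
  by split; [exists (dot (x - 0) (x - 0)), 0|exists 0 => _ [s _ <-]; exact: dot_ge0].
pose d := inf A.
have dle s : S s -> d <= dot (x - s) (x - s).
  by move=> Ss; apply: inf_lbound; [exact: hA.2|exists s].
(* The excess over the infimum is the square of [16^-n], so that the parallelogram identity makes
   successive distances at most [2 * 16^-n], the geometric form that completeness requires with
   [q = 1/4]. *)
have /choice[s hs] : forall n, exists s, S s /\ dot (x - s) (x - s) < d + (4^-1 ^+ 2) ^+ n ^+ 2.
  move=> n; have [|_ [s Ss <-] hs] := @inf_adherent _ A ((4^-1 ^+ 2) ^+ n ^+ 2) _ hA.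
    by rewrite !exprn_gt0.
  by exists s.
have para a b : dot (a - b) (a - b) = 2 * dot a a + 2 * dot b b - 4 * dot (2^-1 *: (a + b)) (2^-1 *: (a + b)).
  rewrite dotZl dotZr !dotBl !dotBr !dotDl !dotDr (dotC b a).
  by move: (dot a a) (dot a b) (dot b b) => u v t; field.
have w4 (a b : nat) : (b <= a)%N -> (4^-1 : R) ^+ a <= 4^-1 ^+ b.
  by move=> ba; apply: ler_wiXn2l ba; lra.
have step n : nm (s n.+1 - s n) <= 2 * (4^-1 ^+ 2) ^+ n.
  have -> : s n.+1 - s n = (x - s n) - (x - s n.+1) by rewrite opprB [RHS]addrC addrA subrK.
  have h := para (x - s n) (x - s n.+1).
  have e1 : 2^-1 *: ((x - s n) + (x - s n.+1)) = x - (2^-1 *: s n + 2^-1 *: s n.+1).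
    by apply: dot_inj => z; rewrite !(dotBl, dotDl, dotZl); lra.
  have Sm : S (2^-1 *: s n + 2^-1 *: s n.+1).
    by apply: (SD); [exact: (hs n).1|rewrite -[_ *: _]addr0; apply: (SD) => //; exact: (hs n.+1).1].
  have h0 := dle _ Sm; rewrite e1 in h.
  have h1 := (hs n).2; have h2 := (hs n.+1).2.
  have h3 : ((4^-1 ^+ 2) ^+ n.+1 ^+ 2 : R) <= (4^-1 ^+ 2) ^+ n ^+ 2.
    by rewrite -!exprM; apply: w4; lia.
  rewrite -(@ler_pXn2r _ 2)// ?nnegrE ?nm_ge0 ?mulr_ge0 ?exprn_ge0//.
  rewrite sqr_nm exprMn h; nra.
have q01 : 0 < (4^-1 : R) < 1 by apply/andP; split; lra.
have [p [K hK]] := L2class_complete q01 step.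
pose w := x - p.
have K0 : 0 <= K by have := le_trans (nm_ge0 _) (hK 0); rewrite expr0 mulr1.
have cv0 (c K' : R) : (forall n : nat, 0 <= c + K' * 4^-1 ^+ n) -> 0 <= c.
  move=> h; have cv : (fun n : nat => c + K' * 4^-1 ^+ n) @ \oo --> (c + K' * 0 : R).
    apply: cvgD; first exact: cvg_cst.
    by apply: cvgM; [exact: cvg_cst|apply: cvg_expr; rewrite ger0_norm; lra].
  have -> : c = c + K' * 0 by rewrite mulr0 addr0.
  rewrite -(cvg_lim (@Rhausdorff R) cv).
  by apply: limr_ge; [apply/cvg_ex; eexists; exact: cv|exact: nearW].
have wfar t : S t -> d <= dot (w - t) (w - t).
  move=> St; have d0 : 0 <= d by apply: lb_le_inf; [exact: hA.1|move=> _ [? _ <-]; exact: dot_ge0].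
  suff : Num.sqrt d <= nm (w - t) by rewrite /nm ler_sqrt// dot_ge0.
  rewrite -subr_ge0; apply: (cv0 _ K) => n; have := hK n.
  have : Num.sqrt d <= nm (x - (s n + t)).
    rewrite /nm ler_sqrt ?dot_ge0//; apply: dle; rewrite addrC -[t]scale1r; apply: (SD) => //; exact: (hs n).1.
  have -> : x - (s n + t) = (w - t) - (s n - p).
    by rewrite /w; apply: dot_inj => ?; rewrite !(dotBl, dotDl); ring.
  have := nmB (w - t) (s n - p); lra.
have wle : dot w w <= d.
  have b n : nm w <= Num.sqrt (d + (4^-1 ^+ 2) ^+ n ^+ 2) + K * 4^-1 ^+ n.
    have -> : w = (x - s n) + (s n - p) by rewrite /w addrA subrK.
    apply: le_trans (nmD _ _) _; apply: lerD => //; rewrite /nm ler_sqrt ?(ltW (hs n).2)//.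
    exact: le_trans (dot_ge0 _) (ltW (hs n).2).
  have d0 : 0 <= d by apply: lb_le_inf; [exact: hA.1|move=> _ [? _ <-]; exact: dot_ge0].
  have b' n : nm w <= Num.sqrt d + (1 + K) * 4^-1 ^+ n.
    apply: le_trans (b n) _; rewrite mulrDl mul1r addrA lerD2r.
    rewrite -(@ler_pXn2r _ 2)// ?nnegrE ?addr_ge0 ?sqrtr_ge0 ?exprn_ge0//.
    rewrite sqr_sqrtr ?addr_ge0 ?exprn_ge0// sqrrD sqr_sqrtr// -!exprM -addrA lerD2l.
    have s0 := sqrtr_ge0 d; have q0 : (0 : R) <= 4^-1 ^+ n by rewrite exprn_ge0.
    have : (4^-1 ^+ (2 * n * 2) : R) <= 4^-1 ^+ (n * 2).
      by apply: w4; lia.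
    have -> : (2 * (n * 2) = 2 * n * 2)%N by lia.
    have : 0 <= Num.sqrt d * 4^-1 ^+ n *+ 2 by rewrite mulrn_wge0// mulr_ge0.
    lra.
  have h : nm w <= Num.sqrt d.
    by rewrite -subr_ge0; apply: (cv0 _ (1 + K)) => n; have := b' n; lra.
  by rewrite -sqr_nm -(sqr_sqrtr d0) ler_pXn2r// ?nnegrE ?nm_ge0 ?sqrtr_ge0.
clearbody w.
have w0 : w = 0.
  apply: Sw => t St; apply/eqP; rewrite -normr_le0; rewrite leNgt; apply/negP => h.
  have t0 : 0 < dot t t.
    by rewrite lt_neqAle dot_ge0 andbT eq_sym; apply/eqP => /dot_eq0 t0; move: h; rewrite t0 dot0r normr0 ltxx.
  (* If [w] were not orthogonal to [t], subtracting its projection onto [t] would bring its squared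
     norm strictly below [d]. *)
  have St' : S (dot w t / dot t t *: t) by rewrite -[_ *: _]addr0; exact: (SD).
  have := wfar _ St'; rewrite !dotBl !dotBr !dotZl !dotZr (dotC t w) => h1.
  have h2 : 0 < dot w t ^+ 2 by rewrite -(real_normK (num_real _)) exprn_gt0.
  have h3 : 0 < dot w t ^+ 2 / dot t t by rewrite divr_gt0.
  move: h1; have -> : dot w t / dot t t * (dot w t / dot t t * dot t t) = dot w t ^+ 2 / dot t t.
    by rewrite divfK ?gt_eqF// mulrAC expr2.
  have -> : dot w t / dot t t * dot w t = dot w t ^+ 2 / dot t t by rewrite mulrAC expr2.
  lra.
have : e ^+ 2 <= d.
  apply: lb_le_inf; first exact: hA.1.
  move=> _ [t St <-]; rewrite -sqr_nm ler_pXn2r ?nnegrE ?nm_ge0//; [exact: far|exact: ltW].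
have := wfar 0 S0; rewrite w0 subr0 dot0l => h1 h2.
have : 0 < e ^+ 2 by rewrite exprn_gt0.
lra.
Qed.

End L2class.

(** * Weak derivatives and Sobolev classes *)

Section CircleODE.
Context {R : realType}.
Implicit Types (f g phi chi psi : R -> R).
Let leb := @lebesgue_measure R.

Definition icirc f : R := \int[leb]_(t in circle) f t.

Lemma continuous_icirc f : continuous f -> leb.-integrable circle (EFin \o f).
Proof.
move=> cf; apply: continuous_compact_integrable; first exact: segment_compact.
exact: continuous_subspaceT.
Qed.

Lemma derive_continuous (F f : R -> R) : (forall t : R, is_derive t (1 : R) F (f t)) -> continuous F.
Proof. by move=> dF t; apply/differentiable_continuous/derivable1_diffP; have [] := dF t. Qed.

Lemma icirc_derive (F f : R -> R) : (forall t : R, is_derive t (1 : R) F (f t)) -> continuous f ->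
  icirc f = F (2 * pi) - F 0.
Proof.
move=> dF cf; have cF := derive_continuous dF.
rewrite /icirc /Rintegral (continuous_FTC2 (F := F))//.
- exact: two_pi_gt0.
- exact: continuous_subspaceT.
- split; first by move=> x _; have [] := dF x.
    by apply: cvg_at_right_filter; exact: cF.
  by apply: cvg_at_left_filter; exact: cF.
- by move=> x _; rewrite derive1E; have [_ ->] := dF x.
Qed.

Lemma is_derive_per q phi (s : R) : per_Cq q.+1 phi -> is_derive s (1 : R) phi (derive1 phi s).
Proof. by move=> h; rewrite derive1E; apply: DeriveDef => //; exact: (@per_Cq_derivable _ _ _ s h). Qed.

Lemma per_Cq_bounded q phi : per_Cq q phi -> exists M, forall s, `|phi s| <= M.
Proof. by move=> /per_Cq_fst /is_Cq_bounded[M hM]; exists M => s; exact: (hM (s, 0)). Qed.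

Lemma icirc_per_derive phi : per_Cq 1 phi -> icirc (derive1 phi) = 0.
Proof.
move=> h; rewrite (icirc_derive (fun t => is_derive_per t h)); last exact: per_Cq_cont (per_Cq_derive h).
by rewrite -[X in phi X - _]add0r (per_Cq_per h) subrr.
Qed.

Lemma icircD f g : continuous f -> continuous g -> icirc (fun t => f t + g t) = icirc f + icirc g.
Proof.
move=> cf cg; rewrite /icirc RintegralD//; [exact: measurable_circle|exact: continuous_icirc..].
Qed.

Lemma icircZ c f : continuous f -> icirc (fun t => c * f t) = c * icirc f.
Proof.
move=> cf; rewrite /icirc RintegralZl//; [exact: measurable_circle|exact: continuous_icirc].
Qed.

Section Convolution.
Variables (K : R -> R) (eps : R).
Hypothesis cK : continuous K.

Definition convol phi (s : R) : R := icirc (fun t => K t * phi (s - eps * t)).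

Lemma continuous_affine_comp phi (s : R) : continuous phi -> continuous (fun t : R => phi (s - eps * t)).
Proof.
move=> cphi t; apply: (@continuous_comp _ _ _ (fun t : R => s - eps * t) phi); last exact: cphi.
by apply: cvgB; [exact: cvg_cst|apply: cvgM; [exact: cvg_cst|exact: cvg_id]].
Qed.

Lemma continuous_convol_integrand phi (s : R) : continuous phi -> continuous (fun t : R => K t * phi (s - eps * t)).
Proof. by move=> cphi t; apply: cvgM; [exact: cK|exact: continuous_affine_comp]. Qed.

Lemma is_derive_convol q phi (s : R) : per_Cq q.+1 phi ->
  is_derive s (1 : R) (convol phi) (convol (derive1 phi) s).
Proof.
move=> h; have cphi := per_Cq_cont h; have cd := per_Cq_cont (per_Cq_derive h).
have [M hM] := per_Cq_bounded (per_Cq_derive h).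
pose f (x y : R) := K y * phi (x - eps * y).
have Df (x y : R) : is_derive x (1 : R) (f ^~ y) (K y * derive1 phi (x - eps * y)).
  have D1 : is_derive x (1 : R) (fun x => x - eps * y) (1 - 0).
    by apply: is_deriveB.
  have D2 := @is_derive1_comp R phi (fun x => x - eps * y) x _ _ (is_derive_per _ h) D1.
  have D3 := is_deriveZ (K y) D2; apply: (is_derive_eq D3); rewrite /GRing.scale/=; ring.
have is_ : `]s - 1, s + 1[%classic s by rewrite /= in_itv/=; apply/andP; split; lra.
have intf x : `]s - 1, s + 1[%classic x -> leb.-integrable circle (EFin \o f x).
  by move=> _; apply: continuous_icirc; exact: continuous_convol_integrand.
have derf x y : `]s - 1, s + 1[%classic x -> circle y -> derivable (f ^~ y) x 1.
  by move=> _ _; have [] := Df x y.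
have M0 : 0 <= M by exact: le_trans (normr_ge0 _) (hM 0).
have G0 y : 0 <= M * `|K y| by rewrite mulr_ge0.
have iG : leb.-integrable circle (EFin \o (fun y => M * `|K y|)).
  apply: continuous_icirc => y; apply: cvgM; first exact: cvg_cst.
  by apply: cvg_norm; exact: cK.
have d1E x y : partial1of2 f x y = K y * derive1 phi (x - eps * y).
  by rewrite /partial1of2 derive1E; have [_ ->] := Df x y.
have Gub x y : `]s - 1, s + 1[%classic x -> circle y -> `|partial1of2 f x y| <= M * `|K y|.
  by move=> _ _; rewrite d1E normrM mulrC ler_wpM2r.
have dv := @derivable_under_integral R _ (measurableTypeR R) leb f circle (@measurable_circle R) s (s - 1) (s + 1) is_ intf derf _ G0 iG Gub.
have dd := @differentiation_under_integral R _ (measurableTypeR R) leb f circle (@measurable_circle R) s (s - 1) (s + 1) is_ intf derf _ G0 iG Gub.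
apply: DeriveDef; first exact: dv.
rewrite -derive1E [LHS]dd /convol /icirc; congr Rintegral; apply/funext => y; exact: d1E.
Qed.

Lemma per_Cq_convol q phi : per_Cq q.+1 phi -> per_Cq q (convol phi).
Proof.
elim: q phi => [|q IH] phi h.
  have p s : convol phi (s + 2 * pi) = convol phi s.
    by congr icirc; apply/funext => t; rewrite addrAC (per_Cq_per h).
  exact: (And3 p (derive_continuous (fun s => is_derive_convol s h)) I).
have p s : convol phi (s + 2 * pi) = convol phi s.
  by congr icirc; apply/funext => t; rewrite addrAC (per_Cq_per h).
have d s : derivable (convol phi) s 1 by have [] := is_derive_convol s h.
have h' : per_Cq q (derive1 (convol phi)).
  have -> : derive1 (convol phi) = convol (derive1 phi).
    by apply/funext => s; rewrite derive1E; have [_ ->] := is_derive_convol s h.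
  by apply: IH; exact: per_Cq_derive h.
exact: (And3 p (derive_continuous (fun s => is_derive_convol s h)) (conj d h')).
Qed.

End Convolution.

(** The periodic Green function: [psi s] is [(1 - exp(-2 pi))^-1] times the integral over one period
    of [exp(-t) phi(s - eps t)], and the equation is the fundamental theorem of calculus for that
    integrand. Differentiation under the integral costs one order of regularity, which the relation
    [psi' = eps (phi - psi)] restores. *)
Lemma first_order_ode q (eps : R) phi : eps ^+ 2 = 1 -> per_Cq q.+1 phi ->
  exists2 psi, per_Cq q.+1 psi & forall s, psi s + eps * derive1 psi s = phi s.
Proof.
move=> e2 h; pose K (t : R) := expR (- t).
have DK (t : R) : is_derive t (1 : R) K (- K t).
  have DN : is_derive t (1 : R) (fun t : R => - t) (- 1) by apply: is_deriveN.
  have D := @is_derive1_comp R expR (fun t => - t) t _ _ (is_derive_expR _) DN.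
  by apply: (is_derive_eq D); rewrite mulrN1.
have cK : continuous K := derive_continuous DK.
pose c := 1 - expR (- (2 * pi)) : R.
have c0 : c != 0.
  by rewrite gt_eqF// subr_gt0 expR_lt1 oppr_lt0 two_pi_gt0.
pose psi s := c^-1 * convol K eps phi s.
have hpsi : per_Cq q psi by apply: per_CqZ; exact: per_Cq_convol.
have Dpsi (s : R) : is_derive s (1 : R) psi (c^-1 * convol K eps (derive1 phi) s).
  have D := is_deriveZ c^-1 (is_derive_convol eps cK s h); exact: D.
have dpsi s : derive1 psi s = c^-1 * convol K eps (derive1 phi) s.
  by rewrite derive1E; have [_ ->] := Dpsi s.
have cphi := per_Cq_cont h; have cdphi := per_Cq_cont (per_Cq_derive h).
have ode s : psi s + eps * derive1 psi s = phi s.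
  pose H (t : R) := K t * phi (s - eps * t).
  pose H' (t : R) := -1 * (K t * phi (s - eps * t)) + (- eps) * (K t * derive1 phi (s - eps * t)).
  have DH (t : R) : is_derive t (1 : R) H (H' t).
    have D1 : is_derive t (1 : R) (fun t => s - eps * t) (0 - eps *: 1).
      by apply: is_deriveB.
    have D2 := @is_derive1_comp R phi (fun t => s - eps * t) t _ _ (is_derive_per _ h) D1.
    have D3 := is_deriveM (DK t) D2.
    apply: (is_derive_eq D3); rewrite /GRing.scale/= /H'; ring.
  have c1 := @continuous_convol_integrand K eps cK _ s cphi.
  have c2 := @continuous_convol_integrand K eps cK _ s cdphi.
  have cH' : continuous H'.
    by move=> t; apply: cvgD; (apply: cvgM; [exact: cvg_cst|]); [exact: c1|exact: c2].
  have := icirc_derive DH cH'.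
  have e1 : continuous (fun t => -1 * (K t * phi (s - eps * t))).
    by move=> t; apply: cvgM; [exact: cvg_cst|exact: c1].
  have e3 : continuous (fun t => - eps * (K t * derive1 phi (s - eps * t))).
    by move=> t; apply: cvgM; [exact: cvg_cst|exact: c2].
  rewrite /H' (icircD e1 e3) (icircZ _ c1) (icircZ _ c2) /H /K mulr0 oppr0 expR0 addr0 mul1r.
  have -> : phi (s - eps * (2 * pi)) = phi s.
    have : (eps - 1) * (eps + 1) = 0 by rewrite -subr_sqr e2 expr1n subrr.
    move=> /eqP; rewrite mulf_eq0 => /orP[/eqP/subr0_eq ->|/eqP/addr0_eq e].
      by rewrite mul1r -{2}(subrK (2 * pi) s) (per_Cq_per h).
    by rewrite -mulNr e mul1r (per_Cq_per h).
  rewrite dpsi /psi /convol -/K => e; apply: (mulfI c0).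
  rewrite mulrDr (mulrCA c eps) !(mulrA c c^-1) divff// !mul1r.
  rewrite /c mulrBl mul1r; lra.
exists psi; last exact: ode.
have d1 : derive1 psi = (fun s => eps * (phi s + -1 * psi s)).
  apply/funext => s; rewrite -(ode s) mulrDr mulrDr mulrA -expr2 e2; lra.
have dd s : derivable psi s 1 by have [] := Dpsi s.
have hd : per_Cq q (derive1 psi).
  by rewrite d1; apply: per_CqZ; apply: per_CqD; [exact: per_CqW|exact: per_CqZ].
exact: (And3 (per_Cq_per hpsi) (per_Cq_cont hpsi) (conj dd hd)).
Qed.

End CircleODE.

(** Linear identities in the Hilbert space are checked by pairing both sides with an arbitrary
    element, which leaves an identity for [ring]. *)
Ltac linear_identity := apply: dot_inj => ?; rewrite !(dotBl, dotDl, dotNl, dotZl, dot0l); ring.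

Section WeakDerivatives.
Context {R : realType}.
Implicit Types (f g psi : R * R -> R) (phi chi : R -> R) (x y u v w : L2class R).

Definition tst chi phi : R * R -> R := fun z => chi z.1 * phi z.2.

Lemma is_Cq_tst q chi phi : per_Cq q chi -> per_Cq q phi -> is_Cq q (tst chi phi).
Proof. by move=> h1 h2; apply: is_CqM; [exact: per_Cq_fst|exact: per_Cq_snd]. Qed.

Lemma L2_tst q chi phi : per_Cq q chi -> per_Cq q phi -> is_L2 (tst chi phi).
Proof. by move=> h1 h2; exact: is_Cq_L2 (is_Cq_tst h1 h2). Qed.

Lemma ds_tst q chi phi : per_Cq q.+1 phi -> ds (tst chi phi) = tst chi (derive1 phi).
Proof.
move=> h; apply/funext => -[a b]; rewrite /ds /tst/= !derive1E.
have D := is_deriveZ (chi a) (is_derive_per b h); have [_ e] := D.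
by rewrite [LHS]e derive1E.
Qed.

Lemma dtheta_tst q chi phi : per_Cq q.+1 chi -> dtheta (tst chi phi) = tst (derive1 chi) phi.
Proof.
move=> h; apply/funext => -[a b]; rewrite /dtheta /tst/= !derive1E.
have D := is_deriveZ (phi b) (is_derive_per a h); have [_ e] := D.
have -> : (fun t => chi t * phi b) = (phi b \*: chi) by apply/funext => t; rewrite mulrC.
by rewrite [LHS]e derive1E /GRing.scale/= mulrC.
Qed.

Lemma is_Cq_section2 q f (a : R) : is_Cq q f -> per_Cq q (fun t => f (a, t)).
Proof.
have cf (g : R * R -> R) : continuous g -> continuous (fun t => g (a, t)).
  move=> cg t; apply: (@continuous_comp _ _ _ (fun t : R => (a, t)) g); last exact: cg.
  exact: (cvg_pair (cvg_cst a) cvg_id).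
elim: q f => [|q IH] f; first by move=> [pf c _]; exact: (And3 (fun t => (pf a t).2) (cf _ c) I).
move=> [pf c [d1 d2 h1 h2]].
exact: (And3 (fun s => (pf a s).2) (cf _ c) (conj (fun s => d2 (a, s)) (IH _ h2))).
Qed.

Lemma is_Cq_swap q f : is_Cq q f -> is_Cq q (fun z => f (z.2, z.1)).
Proof.
have cf (g : R * R -> R) : continuous g -> continuous (fun z : R * R => g (z.2, z.1)).
  move=> cg z; apply: (@continuous_comp _ _ _ (fun z : R * R => (z.2, z.1)) g); last exact: cg.
  exact: (cvg_pair cvg_snd cvg_fst).
have pe (g : R * R -> R) : periodic2 g -> periodic2 (fun z : R * R => g (z.2, z.1)).
  by move=> pg a b /=; split; [exact: (pg b a).2|exact: (pg b a).1].
elim: q f => [|q IH] f; first by move=> [pf c _]; exact: (And3 (pe _ pf) (cf _ c) I).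
move=> [pf c [d1 d2 h1 h2]].
exact: (And3 (pe _ pf) (cf _ c) (And4 (fun z => d2 (z.2, z.1)) (fun z => d1 (z.2, z.1)) (IH _ h2) (IH _ h1))).
Qed.

Lemma integral2_ds f : is_Cq 1 f -> integral2 (ds f) = 0.
Proof.
move=> h; have h' := is_Cq_ds h.
rewrite area_fubini1; [|exact: is_Cq_meas h'|].
  rewrite /Rintegral integral0_eq// => a _; congr EFin.
  exact: icirc_per_derive (is_Cq_section2 a h).
by apply: eq_intc (L2_mul (is_Cq_L2 h') (L2_cst 1)) => z; rewrite mulr1.
Qed.

Lemma separationL w :
  (forall chi phi, per_Cq 2 chi -> per_Cq 2 phi -> dot w (cls (tst chi phi)) = 0) -> w = 0.
Proof.
move=> h; rewrite -[w]repr2K -cls0; apply: cls_eq; [exact: repr2_L2|exact: L2_0|].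
apply: separation; first exact: repr2_L2.
move=> chi phi h1 h2; rewrite -[RHS](h chi phi h1 h2) dotC dot_clsl; last exact: L2_tst h1 h2.
by rewrite ipC.
Qed.

(** [W1 x y] says that [y] is the weak theta-derivative of [x], and [W2] the same for s. As
    relations they carry the existence of the derivative, which the total maps [D1] and [D2] below
    do not. *)
Definition W1 x y := forall psi, is_Cq 1 psi -> dot x (cls (dtheta psi)) = - dot y (cls psi).
Definition W2 x y := forall psi, is_Cq 1 psi -> dot x (cls (ds psi)) = - dot y (cls psi).
(** The closure of the graph of the classical s-derivative, that is, the strong derivative;
    [W2_closed] and [W2closed_W2] identify it with the weak one. *)
Definition W2closed x y := forall e, 0 < e -> exists psi,
  [/\ is_Cq 1 psi, nm (x - cls psi) < e & nm (y - cls (ds psi)) < e].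

Lemma W2_cls psi : is_Cq 1 psi -> W2 (cls psi) (cls (ds psi)).
Proof.
move=> h psi' h'; have [l l'] := (is_Cq_L2 h, is_Cq_L2 h').
have [d d'] := (is_Cq_L2 (is_Cq_ds h), is_Cq_L2 (is_Cq_ds h')).
rewrite !dot_cls//; have := integral2_ds (is_CqM h h').
rewrite (dsM h h') integral2D; [|exact: L2_mul..].
rewrite -/(ip _ _) -/(ip _ _); lra.
Qed.

Lemma le0_small (A a b : R) : 0 <= a -> 0 <= b ->
  (forall e, 0 < e -> A <= e * a + e * b) -> A <= 0.
Proof.
move=> a0 b0 h; rewrite leNgt; apply/negP => p; pose M := a + b + 1.
have M0 : 0 < M by rewrite ltr_wpDl// addr_ge0.
have h1 := h _ (divr_gt0 p M0); have : A = A / M * M by rewrite divfK// gt_eqF.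
have : 0 < A / M by rewrite divr_gt0.
by rewrite {3}/M !mulrDr mulr1; lra.
Qed.

Lemma W2closed_W2 x y : W2closed x y -> W2 x y.
Proof.
move=> h psi hpsi; apply/eqP; rewrite -subr_eq0 opprK -normr_le0.
apply: (le0_small (nm_ge0 (cls (ds psi))) (nm_ge0 (cls psi))) => e e0.
have [f [hf h1 h2]] := h e e0; have E := W2_cls hf hpsi.
have -> : dot x (cls (ds psi)) + dot y (cls psi) = dot (x - cls f) (cls (ds psi)) + dot (y - cls (ds f)) (cls psi).
  by rewrite !dotBl E; lra.
apply: le_trans (ler_normD _ _) _; apply: lerD; apply: le_trans (dot_le _ _) _.
  by rewrite ler_wpM2r ?nm_ge0// ltW.
by rewrite ler_wpM2r ?nm_ge0// ltW.
Qed.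

(** Periodicity makes [psi] orthogonal to [d_s psi], so the square of the norm on the right is the
    sum of the two squares. *)
Lemma nm_resolvent_classical psi (eps : R) : eps ^+ 2 = 1 -> is_Cq 1 psi ->
  nm (cls psi) <= nm (cls psi + eps *: cls (ds psi)) /\
  nm (cls (ds psi)) <= nm (cls psi + eps *: cls (ds psi)).
Proof.
move=> e2 h; have e := W2_cls h h.
have k : nm (cls psi + eps *: cls (ds psi)) ^+ 2 = nm (cls psi) ^+ 2 + nm (cls (ds psi)) ^+ 2.
  rewrite !sqr_nm !dotDl !dotDr !dotZl !dotZr mulrA -expr2 e2 mul1r.
  move: e; rewrite (dotC (cls (ds psi)) (cls psi)) => e; have -> : dot (cls psi) (cls (ds psi)) = 0 by lra.
  by rewrite mulr0; lra.
by split; rewrite -(@ler_pXn2r _ 2)// ?nnegrE ?nm_ge0// k; [rewrite lerDl|rewrite lerDr]; exact: sqr_ge0.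
Qed.

(** The range of [1 + eps d_s] on classical functions is dense: what is orthogonal to it is
    orthogonal to every product, because [first_order_ode] writes the factor in s as [p + eps p'].
    By [nm_resolvent_classical], the preimages of an approximating sequence converge together with
    their derivatives. *)
Lemma resolvent2 (eps : R) f : eps ^+ 2 = 1 -> is_L2 f ->
  exists u v, W2closed u v /\ u + eps *: v = cls f.
Proof.
move=> e2 hf.
pose S s := exists2 psi, is_Cq 1 psi & s = cls psi + eps *: cls (ds psi).
have S0 : S 0.
  exists (fun=> 0); first exact: is_Cq_cst.
  have -> : ds (fun=> 0 : R) = fun=> 0 :> R.
    by apply/funext => z; exact: (derive1_cst (0 : R) z.2).
  by rewrite cls0 scaler0 addr0.
have SD c s t : S s -> S t -> S (c *: s + t).
  move=> [p hp ->] [r hr ->]; exists (fun z => c * p z + r z); first exact: is_CqD (is_CqZ c hp) hr.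
  have -> : ds (fun z => c * p z + r z) = (fun z => c * ds p z + ds r z).
    rewrite (dsD (is_CqZ c hp) hr); apply/funext => z; congr (_ + _).
    rewrite (dsM (is_Cq_cst 1 c) hp); have -> : ds (fun=> c) = fun=> 0 :> R.
      by apply/funext => t'; exact: (derive1_cst c t'.2).
    by rewrite mul0r add0r.
  have [Lp Lr] := (is_Cq_L2 hp, is_Cq_L2 hr); have [Ldp Ldr] := (is_Cq_L2 (is_Cq_ds hp), is_Cq_L2 (is_Cq_ds hr)).
  rewrite !clsD ?clsZ//; [|exact: L2Z..].
  linear_identity.
have Sw w : (forall s, S s -> dot w s = 0) -> w = 0.
  move=> h; apply: separationL => chi phi h1 h2.
  have [p hp ode] := first_order_ode e2 h2.
  rewrite -[RHS](h (cls (tst chi phi)))//.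
  exists (tst chi p); first exact: is_CqW (is_Cq_tst h1 hp).
  have l1 := L2_tst (per_CqW h1) (per_Cq_derive hp); have l2 := L2_tst h1 hp.
  rewrite (ds_tst chi hp) -(clsZ eps l1) -(clsD l2 (L2Z eps l1)).
  by congr cls; apply/funext => z; rewrite /tst -ode; ring.
have q0 n : (0 : R) < (4^-1 ^+ 2) ^+ n by rewrite !exprn_gt0.
have /choice[p hp] : forall n, exists p, is_Cq 1 p /\ nm (cls f - (cls p + eps *: cls (ds p))) < (4^-1 ^+ 2) ^+ n.
  move=> n; have [_ [p hp ->] h] := dense_of_orthogonal (cls f) S0 SD Sw (q0 n).
  by exists p.
have dif n : is_Cq 1 (fun z => p n.+1 z - p n z) by apply: is_CqB; exact: (hp _).1.
have dsdif n : ds (fun z => p n.+1 z - p n z) = (fun z => ds (p n.+1) z - ds (p n) z).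
  apply/funext => z; rewrite /ds !derive1E.
  have := deriveB (@is_Cq_derivable2 R 0 _ (hp n.+1).1 z) (@is_Cq_derivable2 R 0 _ (hp n).1 z).
  exact.
have Lp n := is_Cq_L2 (hp n).1; have Ld n := is_Cq_L2 (is_Cq_ds (hp n).1).
have step n : nm (cls (fun z => p n.+1 z - p n z) + eps *: cls (ds (fun z => p n.+1 z - p n z))) <= 2 * (4^-1 ^+ 2) ^+ n.
  rewrite dsdif !clsB//.
  have -> : cls (p n.+1) - cls (p n) + eps *: (cls (ds (p n.+1)) - cls (ds (p n))) =
     (cls f - (cls (p n) + eps *: cls (ds (p n)))) - (cls f - (cls (p n.+1) + eps *: cls (ds (p n.+1)))).
    by linear_identity.
  apply: le_trans (nmB _ _) _; have h1 := (hp n).2; have h2 := (hp n.+1).2.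
  have : ((4^-1 ^+ 2) ^+ n.+1 : R) <= (4^-1 ^+ 2) ^+ n.
    by rewrite -!exprM; apply: ler_wiXn2l; [lra|lra|lia].
  lra.
have q01 : 0 < (4^-1 : R) < 1 by apply/andP; split; lra.
have s1 n : nm (cls (p n.+1) - cls (p n)) <= 2 * (4^-1 ^+ 2) ^+ n.
  by rewrite -clsB//; exact: le_trans (nm_resolvent_classical e2 (dif n)).1 (step n).
have s2 n : nm (cls (ds (p n.+1)) - cls (ds (p n))) <= 2 * (4^-1 ^+ 2) ^+ n.
  by rewrite -clsB// -dsdif; exact: le_trans (nm_resolvent_classical e2 (dif n)).2 (step n).
have [u [K hK]] := L2class_complete q01 s1; have [v [K' hK']] := L2class_complete q01 s2.
have small (C e : R) : 0 < e -> \forall n \near \oo, C * 4^-1 ^+ n < e.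
  move=> e0; have : (fun n : nat => C * 4^-1 ^+ n) @ \oo --> (C * 0 : R).
    by apply: cvgM; [exact: cvg_cst|apply: cvg_expr; rewrite ger0_norm; lra].
  by rewrite mulr0 => /cvgr_lt; apply.
exists u, v; split.
  move=> e e0; have [n _ hn] := filterI (small K e e0) (small K' e e0).
  have [n1 n2] := hn n (leqnn n).
  exists (p n); split; [exact: (hp n).1|rewrite nmBC; exact: le_lt_trans (hK n) n1|].
  by rewrite nmBC; exact: le_lt_trans (hK' n) n2.
apply/eqP; rewrite -subr_eq0; apply/eqP/nm_eq0/eqP; rewrite eq_le nm_ge0 andbT.
rewrite leNgt; apply/negP => pos; set A := nm _ in pos.
have eps1 : `|eps| = 1.
  by apply/eqP; rewrite -(@eqrXn2 _ 2)// real_normK ?num_real// e2 expr1n.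
have [n _ hn] := small (K + K' + 1) A pos.
have := hn n (leqnn n); apply/negP; rewrite -leNgt /A.
have -> : u + eps *: v - cls f = - (cls (p n) - u) - eps *: (cls (ds (p n)) - v) - (cls f - (cls (p n) + eps *: cls (ds (p n)))).
  by linear_identity.
apply: le_trans (nmB _ _) _; rewrite mulrDl; apply: lerD.
  apply: le_trans (nmB _ _) _; rewrite nmN nmZ eps1 mul1r mulrDl; exact: lerD.
apply: le_trans (ltW (hp n).2) _; rewrite mul1r -exprM; apply: ler_wiXn2l; [lra|lra|lia].
Qed.

(** Weak and strong derivatives agree, by resolvents: let [u + v = x + y] with [v] the strong
    derivative of [u]. Then [y - v = -(x - u)], and [x - u] is orthogonal to all [chi (p - p')],
    hence to all products on solving for [p]. *)
Lemma W2_prod x y :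
  (forall chi phi, per_Cq 2 chi -> per_Cq 2 phi ->
    dot x (cls (tst chi (derive1 phi))) = - dot y (cls (tst chi phi))) -> W2closed x y.
Proof.
move=> h; have [|u [v [huv e]]] := @resolvent2 1 (repr2 (x + y)) _ (repr2_L2 _); first by rewrite expr1n.
move: e; rewrite scale1r repr2K => e.
suff w0 : x - u = 0.
  have xu : x = u by apply/eqP; rewrite -subr_eq0 w0.
  have yv : y = v by apply: (addrI x); rewrite -e xu.
  by rewrite xu yv.
have yv : y - v = - (x - u).
  have -> : y = u + v - x by rewrite e addrAC subrr add0r.
  by linear_identity.
have hW := W2closed_W2 huv.
apply: separationL => chi phi h1 h2.
have [|p hp ode] := @first_order_ode R 1 (-1) phi _ h2; first by rewrite sqrrN expr1n.
have hp1 := per_CqW h1.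
have -> : tst chi phi = (fun z => tst chi p z - tst chi (derive1 p) z).
  by apply/funext => z; rewrite /tst -ode; ring.
rewrite clsB; [|exact: L2_tst h1 hp|exact: L2_tst hp1 (per_Cq_derive hp)].
rewrite dotBr [X in _ - X]dotBl (h _ _ h1 hp).
have := hW _ (is_CqW (is_Cq_tst h1 hp)); rewrite (ds_tst chi hp) => ->.
have : dot (y - v) (cls (tst chi p)) = - dot (x - u) (cls (tst chi p)) by rewrite yv dotNl.
rewrite !dotBl; lra.
Qed.

Lemma W2_closed x y : W2 x y -> W2closed x y.
Proof.
move=> h; apply: W2_prod => chi phi h1 h2.
by have := h _ (is_CqW (is_Cq_tst h1 h2)); rewrite (ds_tst chi h2).
Qed.

Lemma W2_parts x y x' y' : W2 x y -> W2 x' y' -> dot x y' = - dot y x'.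
Proof.
move=> /W2_closed h h'; apply/eqP; rewrite -subr_eq0 opprK -normr_le0.
apply: (le0_small (nm_ge0 y') (nm_ge0 x')) => e e0.
have [f [hf h1 h2]] := h e e0; have E := h' _ hf.
have -> : dot x y' + dot y x' = dot (x - cls f) y' + dot (y - cls (ds f)) x'.
  by rewrite !dotBl (dotC (cls f)) (dotC (cls (ds f))) E; lra.
apply: le_trans (ler_normD _ _) _; apply: lerD; apply: le_trans (dot_le _ _) _.
  by rewrite ler_wpM2r ?nm_ge0// ltW.
by rewrite ler_wpM2r ?nm_ge0// ltW.
Qed.

End WeakDerivatives.

Section Swap.
Context {R : realType}.
Implicit Types (f g psi : R * R -> R) (phi chi : R -> R) (x y u v w : L2class R).

(** Exchanging theta and s carries [W2] to [W1], so results on theta-derivatives are transported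
    instead of proved again. *)
Definition swapL x := cls (fun z => repr2 x (z.2, z.1)).

Lemma swap_cls f : is_L2 f -> swapL (cls f) = cls (fun z => f (z.2, z.1)).
Proof.
move=> hf; apply: cls_eq; [exact/L2_swap/repr2_L2|exact: L2_swap|].
exact: (ae_swap2 (cls_ae hf)).
Qed.

Lemma dot_swap x y : dot (swapL x) (swapL y) = dot x y.
Proof.
have [lx ly] := (repr2_L2 x, repr2_L2 y).
rewrite dot_cls; [|exact: L2_swap..]; rewrite dotE /ip.
exact: (integral2_swap (measurable_funM (L2_meas lx) (L2_meas ly)) (L2_mul lx ly)).
Qed.

Lemma W1_swap x y : W1 x y <-> W2 (swapL x) (swapL y).
Proof.
split=> h psi hpsi.
  have h' := is_Cq_swap hpsi; have := h _ h'.
  rewrite -dot_swap -[in X in _ = X -> _]dot_swap !swap_cls; [|exact: is_Cq_L2 h'|exact: is_Cq_L2 (is_Cq_dtheta h')].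
  by rewrite (_ : (fun z : R * R => psi (z.1, z.2)) = psi)//; apply/funext => -[].
have h' := is_Cq_swap hpsi; have := h _ h'.
have e (g : R * R -> R) : is_L2 g -> cls (fun z => g (z.2, z.1)) = swapL (cls g) by move=> /swap_cls.
have -> : ds (fun z => psi (z.2, z.1)) = (fun z => dtheta psi (z.2, z.1)) by [].
by rewrite !e ?dot_swap//; [exact: is_Cq_L2 hpsi|exact: is_Cq_L2 (is_Cq_dtheta hpsi)].
Qed.

Lemma W1_parts x y x' y' : W1 x y -> W1 x' y' -> dot x y' = - dot y x'.
Proof.
by move=> /W1_swap h /W1_swap h'; have := W2_parts h h'; rewrite !dot_swap.
Qed.

Lemma W1_prod x y :
  (forall chi phi, per_Cq 2 chi -> per_Cq 2 phi ->
    dot x (cls (tst (derive1 chi) phi)) = - dot y (cls (tst chi phi))) -> W1 x y.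
Proof.
move=> h; apply/W1_swap/W2closed_W2/W2_prod => chi phi h1 h2.
have := h phi chi h2 h1.
rewrite -dot_swap -[in X in _ = X -> _]dot_swap !swap_cls; last 2 first.
- exact: L2_tst h2 h1.
- exact: L2_tst (per_Cq_derive h2) (per_CqW h1).
rewrite (_ : (fun z => _) = tst chi (derive1 phi)); last by apply/funext => z; rewrite /tst mulrC.
by rewrite (_ : (fun z => _) = tst chi phi)//; apply/funext => z; rewrite /tst mulrC.
Qed.

Lemma W2_uniq x y y' : W2 x y -> W2 x y' -> y = y'.
Proof.
move=> h h'; apply/eqP; rewrite -subr_eq0; apply/eqP/separationL => chi phi h1 h2.
have hp := is_CqW (is_Cq_tst h1 h2); have := h _ hp; have := h' _ hp; rewrite dotBl; lra.
Qed.
Lemma W1_uniq x y y' : W1 x y -> W1 x y' -> y = y'.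
Proof.
move=> h h'; apply/eqP; rewrite -subr_eq0; apply/eqP/separationL => chi phi h1 h2.
have hp := is_CqW (is_Cq_tst h1 h2); have := h _ hp; have := h' _ hp; rewrite dotBl; lra.
Qed.

Lemma W1_lin c x y x' y' : W1 x y -> W1 x' y' -> W1 (c *: x + x') (c *: y + y').
Proof. by move=> h h' psi hp; rewrite !dotDl !dotZl h// h'//; lra. Qed.
Lemma W2_lin c x y x' y' : W2 x y -> W2 x' y' -> W2 (c *: x + x') (c *: y + y').
Proof. by move=> h h' psi hp; rewrite !dotDl !dotZl h// h'//; lra. Qed.
Lemma W1_0 : W1 (0 : L2class R) 0. Proof. by move=> psi _; rewrite !dot0l oppr0. Qed.
Lemma W2_0 : W2 (0 : L2class R) 0. Proof. by move=> psi _; rewrite !dot0l oppr0. Qed.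

Lemma W1_cls psi : is_Cq 1 psi -> W1 (cls psi) (cls (dtheta psi)).
Proof.
move=> h; apply/W1_swap; rewrite !swap_cls; last 2 first.
- exact: is_Cq_L2 (is_Cq_dtheta h).
- exact: is_Cq_L2 h.
exact: (W2_cls (is_Cq_swap h)).
Qed.

(** The mixed derivative in the other order exists as well: against a product of tests the
    derivatives in theta and in s act on different factors and commute there. *)
Lemma W_exchange x a b c : W1 x a -> W2 a b -> W2 x c -> W1 c b.
Proof.
move=> xa ab xc; apply: W1_prod => chi phi h1 h2.
have ht : is_Cq 1 (tst (derive1 chi) phi) by apply: is_Cq_tst; [exact: per_Cq_derive|exact: per_CqW].
have ht' : is_Cq 1 (tst chi (derive1 phi)) by apply: is_Cq_tst; [exact: per_CqW|exact: per_Cq_derive].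
have := xc _ ht; rewrite (ds_tst _ h2) => e1.
have := xa _ ht'; rewrite (dtheta_tst _ h1) => e2.
have := ab _ (is_CqW (is_Cq_tst h1 h2)); rewrite (ds_tst _ h2) => e3.
by lra.
Qed.
Lemma W_exchange' x a b c : W2 x a -> W1 a b -> W1 x c -> W2 c b.
Proof.
move=> xa ab xc; apply/W2closed_W2/W2_prod => chi phi h1 h2.
have ht : is_Cq 1 (tst (derive1 chi) phi) by apply: is_Cq_tst; [exact: per_Cq_derive|exact: per_CqW].
have ht' : is_Cq 1 (tst chi (derive1 phi)) by apply: is_Cq_tst; [exact: per_CqW|exact: per_Cq_derive].
have := xc _ ht'; rewrite (dtheta_tst _ h1) => e1.
have := xa _ ht; rewrite (ds_tst _ h2) => e2.
have := ab _ (is_CqW (is_Cq_tst h1 h2)); rewrite (dtheta_tst _ h1) => e3.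
by lra.
Qed.

Lemma W1_lim (x y : nat -> L2class R) x0 y0 : (forall n, W1 (x n) (y n)) ->
  (forall e, 0 < e -> exists n, nm (x n - x0) < e /\ nm (y n - y0) < e) -> W1 x0 y0.
Proof.
move=> hW h psi hp; apply/eqP; rewrite -subr_eq0 opprK -normr_le0.
apply: (le0_small (nm_ge0 (cls (dtheta psi))) (nm_ge0 (cls psi))) => e e0.
have [n [h1 h2]] := h e e0; have E := hW n _ hp.
have -> : dot x0 (cls (dtheta psi)) + dot y0 (cls psi) = - dot (x n - x0) (cls (dtheta psi)) - dot (y n - y0) (cls psi).
  by rewrite !dotBl E; lra.
apply: le_trans (ler_normB _ _) _; rewrite normrN; apply: lerD; apply: le_trans (dot_le _ _) _.
  by rewrite ler_wpM2r ?nm_ge0// ltW.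
by rewrite ler_wpM2r ?nm_ge0// ltW.
Qed.
Lemma W2_lim (x y : nat -> L2class R) x0 y0 : (forall n, W2 (x n) (y n)) ->
  (forall e, 0 < e -> exists n, nm (x n - x0) < e /\ nm (y n - y0) < e) -> W2 x0 y0.
Proof.
move=> hW h psi hp; apply/eqP; rewrite -subr_eq0 opprK -normr_le0.
apply: (le0_small (nm_ge0 (cls (ds psi))) (nm_ge0 (cls psi))) => e e0.
have [n [h1 h2]] := h e e0; have E := hW n _ hp.
have -> : dot x0 (cls (ds psi)) + dot y0 (cls psi) = - dot (x n - x0) (cls (ds psi)) - dot (y n - y0) (cls psi).
  by rewrite !dotBl E; lra.
apply: le_trans (ler_normB _ _) _; rewrite normrN; apply: lerD; apply: le_trans (dot_le _ _) _.
  by rewrite ler_wpM2r ?nm_ge0// ltW.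
by rewrite ler_wpM2r ?nm_ge0// ltW.
Qed.

Lemma weak_dthetaP f g : is_L2 f -> weak_dtheta f g <-> is_L2 g /\ W1 (cls f) (cls g).
Proof.
move=> hf; split=> -[hg h]; split=> // psi hp; have [l l'] := (is_Cq_L2 hp, is_Cq_L2 (is_Cq_dtheta hp)).
  by rewrite !dot_cls//; exact: h.
by have := h _ hp; rewrite !dot_cls.
Qed.
Lemma weak_dsP f g : is_L2 f -> weak_ds f g <-> is_L2 g /\ W2 (cls f) (cls g).
Proof.
move=> hf; split=> -[hg h]; split=> // psi hp; have [l l'] := (is_Cq_L2 hp, is_Cq_L2 (is_Cq_ds hp)).
  by rewrite !dot_cls//; exact: h.
by have := h _ hp; rewrite !dot_cls.
Qed.

Lemma wdtheta_L2 f : is_L2 (wdtheta f).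
Proof. by rewrite /wdtheta; case: xgetP => [g -> []//|_]; exact: L2_0. Qed.
Lemma wds_L2 f : is_L2 (wds f).
Proof. by rewrite /wds; case: xgetP => [g -> []//|_]; exact: L2_0. Qed.

Lemma D1_subproof : {D : L2class R -> L2class R | forall x, D x = cls (wdtheta (repr2 x))}.
Proof. by eexists. Qed.
Lemma D2_subproof : {D : L2class R -> L2class R | forall x, D x = cls (wds (repr2 x))}.
Proof. by eexists. Qed.
(** Total maps on classes, with value [0] where no weak derivative exists; they are meaningful only
    together with [W1 x (D1 x)] or [W2 x (D2 x)], which [Hr] records. *)
Definition D1 := sval D1_subproof.
Definition D2 := sval D2_subproof.
Lemma D1_def x : D1 x = cls (wdtheta (repr2 x)). Proof. exact: svalP D1_subproof x. Qed.
Lemma D2_def x : D2 x = cls (wds (repr2 x)). Proof. exact: svalP D2_subproof x. Qed.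

Lemma wdtheta_cls f : is_L2 f -> cls (wdtheta f) = D1 (cls f).
Proof.
move=> hf; rewrite D1_def; congr cls; rewrite /wdtheta; congr xget; apply/funext => g; apply/propext.
by rewrite /mkset !weak_dthetaP ?repr2K//; exact: repr2_L2.
Qed.
Lemma wds_cls f : is_L2 f -> cls (wds f) = D2 (cls f).
Proof.
move=> hf; rewrite D2_def; congr cls; rewrite /wds; congr xget; apply/funext => g; apply/propext.
by rewrite /mkset !weak_dsP ?repr2K//; exact: repr2_L2.
Qed.

Lemma D1E x y : W1 x y -> D1 x = y.
Proof.
move=> h; rewrite D1_def; apply: (W1_uniq (x := x)) (h).
have : weak_dtheta (repr2 x) (wdtheta (repr2 x)).
  apply: (@xgetPex _ (fun=> 0) [set v | weak_dtheta (repr2 x) v]).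
  exists (repr2 y); apply/(weak_dthetaP _ (repr2_L2 x)); rewrite !repr2K; split; [exact: repr2_L2|exact: h].
by move=> /(weak_dthetaP _ (repr2_L2 x))[_]; rewrite repr2K.
Qed.
Lemma D2E x y : W2 x y -> D2 x = y.
Proof.
move=> h; rewrite D2_def; apply: (W2_uniq (x := x)) (h).
have : weak_ds (repr2 x) (wds (repr2 x)).
  apply: (@xgetPex _ (fun=> 0) [set v | weak_ds (repr2 x) v]).
  exists (repr2 y); apply/(weak_dsP _ (repr2_L2 x)); rewrite !repr2K; split; [exact: repr2_L2|exact: h].
by move=> /(weak_dsP _ (repr2_L2 x))[_]; rewrite repr2K.
Qed.

Lemma weak_dtheta_cls f : is_L2 f -> weak_dtheta f (wdtheta f) <-> W1 (cls f) (D1 (cls f)).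
Proof.
move=> hf; rewrite (weak_dthetaP _ hf) wdtheta_cls//; split=> [[]//|h]; split=> //; exact: wdtheta_L2.
Qed.
Lemma weak_ds_cls f : is_L2 f -> weak_ds f (wds f) <-> W2 (cls f) (D2 (cls f)).
Proof.
move=> hf; rewrite (weak_dsP _ hf) wds_cls//; split=> [[]//|h]; split=> //; exact: wds_L2.
Qed.

End Swap.

(** * Sobolev classes and their norms *)

Section Sobolev.
Context {R : realType}.
Implicit Types (f g a b psi : R * R -> R) (phi chi : R -> R) (x y u v w : L2class R).

Fixpoint Hr (r : nat) x : Prop :=
  if r is r'.+1 then [/\ W1 x (D1 x), W2 x (D2 x), Hr r' (D1 x) & Hr r' (D2 x)] else True.

(** Sums the norms of the derivatives along all ordered words in [D1] and [D2] of length at most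
    [r]. This redundant norm has the recursion that the inductions use, and it is comparable to
    [Hq_norm]. *)
Fixpoint Nr (r : nat) x : R :=
  if r is r'.+1 then nm x + (Nr r' (D1 x) + Nr r' (D2 x)) else nm x.

Lemma is_HqP q f : is_Hq q f <-> is_L2 f /\ Hr q (cls f).
Proof.
elim: q f => [|q IH] f /=; first by split=> -[].
split=> -[hf].
  move=> [/(weak_dtheta_cls hf) h1 /(weak_ds_cls hf) h2 /IH[_ h3] /IH[_ h4]].
  by split=> //; rewrite -(wdtheta_cls hf) -(wds_cls hf) in h1 h2 *; exact: (And4 h1 h2 h3 h4).
move=> [h1 h2 h3 h4]; split=> //; split.
- exact/(weak_dtheta_cls hf).
- exact/(weak_ds_cls hf).
- by apply/IH; rewrite wdtheta_cls//; split=> //; exact: wdtheta_L2.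
- by apply/IH; rewrite wds_cls//; split=> //; exact: wds_L2.
Qed.

Lemma Hr_intro r x y y' : W1 x y -> W2 x y' -> Hr r y -> Hr r y' -> Hr r.+1 x.
Proof. by move=> h1 h2 h3 h4; rewrite /= (D1E h1) (D2E h2). Qed.

Lemma HrW r x : Hr r.+1 x -> Hr r x.
Proof. by elim: r x => [//|r IH] x [h1 h2 h3 h4]; exact: (And4 h1 h2 (IH _ h3) (IH _ h4)). Qed.

Lemma Hr_le r r' x : (r' <= r)%N -> Hr r x -> Hr r' x.
Proof. by move=> /subnK <-; elim: (r - r')%N => [//|k IH]; rewrite addSn => /HrW. Qed.

Lemma Hr_D1 r x : Hr r.+1 x -> Hr r (D1 x). Proof. by case. Qed.
Lemma Hr_D2 r x : Hr r.+1 x -> Hr r (D2 x). Proof. by case. Qed.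
Lemma Hr_W1 r x : Hr r.+1 x -> W1 x (D1 x). Proof. by case. Qed.
Lemma Hr_W2 r x : Hr r.+1 x -> W2 x (D2 x). Proof. by case. Qed.

Lemma D1_lin r c x y : Hr r.+1 x -> Hr r.+1 y -> D1 (c *: x + y) = c *: D1 x + D1 y.
Proof. by move=> /Hr_W1 h /Hr_W1 h'; apply: D1E; exact: W1_lin. Qed.
Lemma D2_lin r c x y : Hr r.+1 x -> Hr r.+1 y -> D2 (c *: x + y) = c *: D2 x + D2 y.
Proof. by move=> /Hr_W2 h /Hr_W2 h'; apply: D2E; exact: W2_lin. Qed.

Lemma Hr_lin r c x y : Hr r x -> Hr r y -> Hr r (c *: x + y).
Proof.
elim: r x y => [//|r IH] x y hx hy.
apply: (Hr_intro (W1_lin c (Hr_W1 hx) (Hr_W1 hy)) (W2_lin c (Hr_W2 hx) (Hr_W2 hy))); apply: IH.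
- exact: Hr_D1.
- exact: Hr_D1.
- exact: Hr_D2.
- exact: Hr_D2.
Qed.

Lemma Hr0 r : Hr r (0 : L2class R).
Proof. by elim: r => [//|r IH]; exact: (Hr_intro W1_0 W2_0). Qed.
Lemma HrZ r c x : Hr r x -> Hr r (c *: x).
Proof. by move=> h; rewrite -[_ *: _]addr0; apply: Hr_lin h _; exact: Hr0. Qed.
Lemma HrD r x y : Hr r x -> Hr r y -> Hr r (x + y).
Proof. by move=> h h'; rewrite -[x]scale1r; exact: Hr_lin. Qed.
Lemma HrN r x : Hr r x -> Hr r (- x). Proof. by rewrite -scaleN1r; exact: HrZ. Qed.
Lemma HrB r x y : Hr r x -> Hr r y -> Hr r (x - y).
Proof. by move=> h h'; apply: HrD h _; exact: HrN. Qed.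
Lemma Hr_sum r (I : Type) (s : seq I) (P : pred I) (F : I -> L2class R) :
  (forall i, P i -> Hr r (F i)) -> Hr r (\sum_(i <- s | P i) F i).
Proof. by move=> h; elim/big_ind: _ => //; [exact: Hr0|exact: HrD]. Qed.

Lemma D1Z r c x : Hr r.+1 x -> D1 (c *: x) = c *: D1 x.
Proof. by move=> h; have := D1_lin c h (Hr0 r.+1); rewrite addr0 (D1E W1_0) addr0. Qed.
Lemma D2Z r c x : Hr r.+1 x -> D2 (c *: x) = c *: D2 x.
Proof. by move=> h; have := D2_lin c h (Hr0 r.+1); rewrite addr0 (D2E W2_0) addr0. Qed.
Lemma D1D r x y : Hr r.+1 x -> Hr r.+1 y -> D1 (x + y) = D1 x + D1 y.
Proof. by move=> h h'; have := D1_lin 1 h h'; rewrite !scale1r. Qed.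
Lemma D2D r x y : Hr r.+1 x -> Hr r.+1 y -> D2 (x + y) = D2 x + D2 y.
Proof. by move=> h h'; have := D2_lin 1 h h'; rewrite !scale1r. Qed.
Lemma D1B r x y : Hr r.+1 x -> Hr r.+1 y -> D1 (x - y) = D1 x - D1 y.
Proof. by move=> h h'; rewrite (D1D h (HrN h')) -scaleN1r (D1Z _ h') scaleN1r. Qed.
Lemma D2B r x y : Hr r.+1 x -> Hr r.+1 y -> D2 (x - y) = D2 x - D2 y.
Proof. by move=> h h'; rewrite (D2D h (HrN h')) -scaleN1r (D2Z _ h') scaleN1r. Qed.

Lemma DC r x : Hr r.+2 x -> D1 (D2 x) = D2 (D1 x).
Proof.
move=> [h1 h2 [h3 h4 h5 h6] _]; apply: D1E; exact: W_exchange h1 h4 h2.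
Qed.

Lemma Nr_ge0 r x : 0 <= Nr r x.
Proof. by elim: r x => [|r IH] x /=; rewrite ?nm_ge0// !addr_ge0 ?nm_ge0. Qed.
Lemma NrS r x : Nr r x <= Nr r.+1 x.
Proof.
elim: r x => [|r IH] x /=; first by rewrite lerDl addr_ge0 ?nm_ge0.
by rewrite lerD2l; apply: lerD; exact: IH.
Qed.
Lemma Nr_le r r' x : (r <= r')%N -> Nr r x <= Nr r' x.
Proof.
move=> /subnK <-; elim: (r' - r)%N => [|k IH]; first by rewrite add0n.
by apply: le_trans IH _; rewrite addSn; exact: NrS.
Qed.
Lemma nm_le_Nr r x : nm x <= Nr r x. Proof. exact: (@Nr_le 0). Qed.
Lemma Nr_D1 r x : Nr r (D1 x) <= Nr r.+1 x.
Proof. by rewrite /= addrCA lerDl addr_ge0 ?nm_ge0 ?Nr_ge0. Qed.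
Lemma Nr_D2 r x : Nr r (D2 x) <= Nr r.+1 x.
Proof. by rewrite /= addrA lerDr addr_ge0 ?nm_ge0 ?Nr_ge0. Qed.
Lemma Nr_0 r : Nr r (0 : L2class R) = 0.
Proof. by elim: r => [|r IH] /=; rewrite ?(D1E W1_0) ?(D2E W2_0) ?IH ?nm0 ?addr0. Qed.

Lemma NrD r x y : Hr r x -> Hr r y -> Nr r (x + y) <= Nr r x + Nr r y.
Proof.
elim: r x y => [|r IH] x y hx hy /=; first exact: nmD.
rewrite (D1D hx hy) (D2D hx hy).
have := IH _ _ (Hr_D1 hx) (Hr_D1 hy); have := IH _ _ (Hr_D2 hx) (Hr_D2 hy); have := nmD x y; lra.
Qed.
Lemma NrZ r c x : Hr r x -> Nr r (c *: x) = `|c| * Nr r x.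
Proof.
elim: r x => [|r IH] x hx /=; first exact: nmZ.
by rewrite (D1Z _ hx) (D2Z _ hx) !IH ?nmZ ?mulrDr//; [exact: Hr_D2|exact: Hr_D1].
Qed.
Lemma NrN r x : Hr r x -> Nr r (- x) = Nr r x.
Proof. by move=> h; rewrite -scaleN1r NrZ// normrN1 mul1r. Qed.
Lemma NrB r x y : Hr r x -> Hr r y -> Nr r (x - y) <= Nr r x + Nr r y.
Proof. by move=> hx hy; rewrite -(NrN hy); apply: NrD => //; exact: HrN. Qed.
Lemma Nr_sum r (I : Type) (s : seq I) (P : pred I) (F : I -> L2class R) :
  (forall i, P i -> Hr r (F i)) -> Nr r (\sum_(i <- s | P i) F i) <= \sum_(i <- s | P i) Nr r (F i).
Proof.
move=> h; elim: s => [|i s IH]; first by rewrite !big_nil Nr_0.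
rewrite !big_cons; case: (boolP (P i)) => // Pi.
by apply: le_trans (NrD (h _ Pi) (Hr_sum _ h)) _; rewrite lerD2l.
Qed.

(** The limits of the derivatives are the derivatives of the limit, because the graphs of the weak
    derivatives are closed. *)
Lemma Hr_complete r (f : nat -> L2class R) (C q : R) : 0 < q < 1 -> (forall n, Hr r (f n)) ->
  (forall n, Nr r (f n.+1 - f n) <= C * (q ^+ 2) ^+ n) ->
  exists (g : L2class R) (K : R), Hr r g /\ forall n, Nr r (f n - g) <= K * q ^+ n.
Proof.
move=> q01; elim: r f C => [|r IH] f C hf h.
  by have [g [K hK]] := L2class_complete q01 h; exists g, K.
have h0 n : nm (f n.+1 - f n) <= C * (q ^+ 2) ^+ n by apply: le_trans (nm_le_Nr _ _) (h n).
have [g [K hK]] := L2class_complete q01 h0.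
have [g1 [K1 [H1 hK1]]] : exists (g : L2class R) (K : R), Hr r g /\ forall n, Nr r (D1 (f n) - g) <= K * q ^+ n.
  apply: (IH _ C) => n; first exact: Hr_D1.
  by rewrite -(D1B (hf n.+1) (hf n)); apply: le_trans (Nr_D1 _ _) (h n).
have [g2 [K2 [H2 hK2]]] : exists (g : L2class R) (K : R), Hr r g /\ forall n, Nr r (D2 (f n) - g) <= K * q ^+ n.
  apply: (IH _ C) => n; first exact: Hr_D2.
  by rewrite -(D2B (hf n.+1) (hf n)); apply: le_trans (Nr_D2 _ _) (h n).
have small (A e : R) : 0 < e -> \forall n \near \oo, A * q ^+ n < e.
  move=> e0; have : (fun n : nat => A * q ^+ n) @ \oo --> (A * 0 : R).
    by apply: cvgM; [exact: cvg_cst|apply: cvg_expr; rewrite ger0_norm; lra].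
  by rewrite mulr0 => /cvgr_lt; apply.
have w1 : W1 g g1.
  apply: (W1_lim (fun n => Hr_W1 (hf n))) => e e0.
  have [n _ hn] := filterI (small K e e0) (small K1 e e0); exists n.
  have [a b] := hn n (leqnn n); split; first exact: le_lt_trans (hK n) a.
  exact: le_lt_trans (le_trans (nm_le_Nr _ _) (hK1 n)) b.
have w2 : W2 g g2.
  apply: (W2_lim (fun n => Hr_W2 (hf n))) => e e0.
  have [n _ hn] := filterI (small K e e0) (small K2 e e0); exists n.
  have [a b] := hn n (leqnn n); split; first exact: le_lt_trans (hK n) a.
  exact: le_lt_trans (le_trans (nm_le_Nr _ _) (hK2 n)) b.
have hg : Hr r.+1 g := Hr_intro w1 w2 H1 H2.
exists g, (K + (K1 + K2)); split=> // n /=.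
rewrite (D1B (hf n) hg) (D2B (hf n) hg) (D1E w1) (D2E w2) !mulrDl.
by apply: lerD => //; exact: lerD.
Qed.

Lemma nm_iter_le_Nr r i j x : (i + j <= r)%N -> nm (iter j D2 (iter i D1 x)) <= Nr r x.
Proof.
elim: r i j x => [|r IH] i j x.
  by rewrite leqn0 addn_eq0 => /andP[/eqP-> /eqP->].
case: i => [|i] h.
  case: j h => [_|j h]; first exact: nm_le_Nr.
  rewrite iterSr; apply: le_trans (IH 0 j (D2 x) _) (Nr_D2 _ _); exact: h.
by rewrite [iter i.+1 _ _]iterSr; apply: le_trans (IH i j (D1 x) h) (Nr_D1 _ _).
Qed.

Lemma iter_D1_D2 r i x : Hr r x -> (i < r)%N -> iter i D1 (D2 x) = D2 (iter i D1 x).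
Proof.
elim: i r x => [//|i IH] [//|r] x h ir; rewrite !iterSr.
case: r h ir => [//|r] h ir; rewrite (DC h); apply: IH (Hr_D1 h) _; exact: ir.
Qed.

(** Commuting [D1] past [D2] sorts every word; three terms per order give [3 ^ r]. *)
Lemma Nr_le_iter r (M : R) x : Hr r x ->
  (forall i j, (i + j <= r)%N -> nm (iter j D2 (iter i D1 x)) <= M) -> Nr r x <= 3 ^+ r * M.
Proof.
elim: r x => [|r IH] x hx h; first by rewrite expr0 mul1r; exact: (h 0 0).
have h0 : nm x <= M := h 0 0 isT.
have M0 : 0 <= M := le_trans (nm_ge0 _) h0.
have h1 : Nr r (D1 x) <= 3 ^+ r * M.
  by apply: IH => [|i j ij]; [exact: Hr_D1|rewrite -iterSr; apply: h].
have h2 : Nr r (D2 x) <= 3 ^+ r * M.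
  apply: IH => [|i j ij]; first exact: Hr_D2.
  rewrite (iter_D1_D2 hx); last by lia.
  by rewrite -iterSr; apply: h; lia.
have e1 : (1 : R) <= 3 ^+ r by rewrite exprn_ege1//; lra.
by rewrite /= exprS; nra.
Qed.

Lemma cls_wd i j f : is_L2 f -> cls (wd i j f) = iter j D2 (iter i D1 (cls f)) /\ is_L2 (wd i j f).
Proof.
move=> hf; rewrite /wd.
have [e l] : cls (iter i wdtheta f) = iter i D1 (cls f) /\ is_L2 (iter i wdtheta f).
  elim: i => [//|i [e l]] /=; rewrite wdtheta_cls// e; split=> //; exact: wdtheta_L2.
elim: j => [//|j [e' l']] /=; rewrite wds_cls// e'; split=> //; exact: wds_L2.
Qed.

Lemma Hq_normE q f : is_L2 f -> Hq_norm q f =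
  Num.sqrt (\sum_(i < q.+1) \sum_(j < (q - i).+1) nm (iter j D2 (iter i D1 (cls f))) ^+ 2).
Proof.
move=> hf; congr Num.sqrt; apply: eq_bigr => i _; apply: eq_bigr => j _.
have [<- l] := cls_wd i j hf; rewrite sqr_nm dot_cls// /ip; congr integral2.
Qed.

(** Under the root there are at most [(q + 1)^2] derivatives, each of norm at most [Nr q]. *)
Lemma Hq_norm_le q f : is_L2 f -> Hq_norm q f <= (q.+1)%:R * Nr q (cls f).
Proof.
move=> hf; rewrite Hq_normE//; set N := Nr q _; have N0 : 0 <= N := Nr_ge0 _ _.
have k0 : 0 <= (q.+1)%:R * N by rewrite mulr_ge0.
rewrite -(ger0_norm k0) -sqrtr_sqr ler_sqrt ?sqr_ge0//.
apply: (@le_trans _ _ (\sum_(i < q.+1) \sum_(j < q.+1) N ^+ 2)); last first.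
  have gen (m : nat) : N ^+ 2 *+ m *+ m = (m%:R * N) ^+ 2.
    by rewrite -mulrnA -[LHS]mulr_natr natrM; ring.
  by rewrite !sumr_const !card_ord gen.
apply: ler_sum => i _.
rewrite [leRHS](_ : _ = \sum_(j < (q - i).+1) N ^+ 2 + (q.+1 - (q - i).+1)%:R * N ^+ 2).
  rewrite -[leLHS]addr0; apply: lerD; last by rewrite mulr_ge0// sqr_ge0.
  apply: ler_sum => j _; rewrite ler_pXn2r// ?nnegrE ?nm_ge0//; apply: nm_iter_le_Nr.
  by have := ltn_ord i; have := ltn_ord j; lia.
rewrite !sumr_const !card_ord -[X in _ = X + _]mulr_natl -[LHS]mulr_natl -mulrDl -natrD.
by congr (_%:R * _); lia.
Qed.

Lemma Nr_le_Hq_norm q f : is_L2 f -> Hr q (cls f) -> Nr q (cls f) <= 3 ^+ q * Hq_norm q f.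
Proof.
move=> hf h; apply: Nr_le_iter h _ => i j ij; rewrite Hq_normE//.
rewrite -[leLHS]ger0_norm ?nm_ge0// -sqrtr_sqr ler_sqrt; last first.
  by apply: sumr_ge0 => k _; apply: sumr_ge0 => l _; exact: sqr_ge0.
have hi : (i < q.+1)%N by lia.
rewrite (bigD1 (Ordinal hi))//= -[leLHS]addr0; apply: lerD; last first.
  by apply: sumr_ge0 => k _; apply: sumr_ge0 => l _; exact: sqr_ge0.
have hj : (j < (q - i).+1)%N by lia.
rewrite (bigD1 (Ordinal hj))//= -[leLHS]addr0; apply: lerD => //.
by apply: sumr_ge0 => k _; exact: sqr_ge0.
Qed.

End Sobolev.

(** * Averaging over theta *)

Section AverageAnalysis.
Context {R : realType}.
Implicit Types (f g : R * R -> R).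
Local Notation leb := (@lebesgue_measure R).

Let mcell : measurable (cell : set (measurableTypeR R * measurableTypeR R)%type).
Proof. exact: measurable_cell. Qed.

#[global] Instance ae_leb_filter : Filter (nbhs (almost_everywhere leb)).
Proof. exact: ae_filter_ringOfSetsType. Qed.

Lemma ae_sections (P : R * R -> Prop) : {ae area, forall z, P z} ->
  {ae leb, forall y, {ae leb, forall x, P (x, y)}}.
Proof.
move=> [N [mN N0 NP]].
have mI : measurable_fun setT (EFin \o \1_N : R * R -> \bar R).
  by apply/measurable_EFinP; exact: measurable_indic.
have I0 z : (0 <= (EFin \o \1_N : R * R -> \bar R) z)%E by rewrite /= lee_fin.
have := @fubini_tonelli2 _ _ (measurableTypeR R) (measurableTypeR R) R leb leb _ mI I0.
rewrite integral_indic// setIT -/area N0 => /esym e.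
have mG : measurable_fun setT (fubini_G leb (EFin \o \1_N : measurableTypeR R * measurableTypeR R -> \bar R)).
  exact: measurable_fun_fubini_tonelli_G.
have ae0 : ae_eq leb setT (fubini_G leb (EFin \o \1_N : measurableTypeR R * measurableTypeR R -> \bar R)) (cst 0%E).
  apply/(ae_eq_integral_abs _ measurableT mG); rewrite -[RHS]e; apply: eq_integral => y _.
  by rewrite gee0_abs//; apply: integral_ge0 => x _; exact: I0.
apply: filterS ae0 => y /(_ I); rewrite /fubini_G/= => h.
have mNy : measurable [set x | N (x, y)].
  have := measurable_ysection y mN; rewrite /ysection; congr measurable.
  by apply/seteqP; split => x /=; rewrite inE.
exists [set x | N (x, y)]; split => //; last by move=> x nP; exact: (NP (x, y)).
have := @integral_indic _ (measurableTypeR R) R leb _ measurableT _ mNy; rewrite setIT => <-.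
rewrite -[RHS]h; apply: eq_integral => x _.
by rewrite !indicE; congr ((nat_of_bool _)%:R)%:E; apply/idP/idP; rewrite !inE.
Qed.

Lemma ae_snd (Q : R -> Prop) : {ae leb, forall y, Q y} -> {ae area, forall z : R * R, Q z.2}.
Proof.
move=> [N [mN N0 NP]]; exists (setT `*` N); split.
- exact: measurableX.
- by rewrite /area [LHS]product_measure1E//; rewrite [X in (_ * X)%E]N0 mule0.
- by move=> z /= nz; split=> //; apply: NP.
Qed.

(** Jensen's inequality for the mean [m], read off from the non-negative integral of [(h - m)^2]. *)
Lemma Rintegral_sq_mean (h : R -> R) : measurable_fun setT h ->
  (\int[leb]_(t in circle) (h t ^+ 2)%:E < +oo)%E ->
  leb.-integrable circle (EFin \o h) /\
  2 * pi * ((2 * pi)^-1 * \int[leb]_(t in circle) h t) ^+ 2 <= \int[leb]_(t in circle) (h t ^+ 2).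
Proof.
move=> mh fin; have p0 := @two_pi_gt0 R.
have mc := @measurable_circle R.
have i2 : leb.-integrable circle (EFin \o (fun t => h t ^+ 2)).
  apply/integrableP; split; first by apply: measurable_funTS; apply/measurable_EFinP; exact: measurable_funX.
  by under eq_integral do rewrite /= ger0_norm ?sqr_ge0//.
have i1 (c : R) : leb.-integrable circle (EFin \o cst c).
  by apply: continuous_icirc => t; exact: cvg_cst.
have ih : leb.-integrable circle (EFin \o h).
  have i3 : leb.-integrable circle (EFin \o (fun t => 1 + h t ^+ 2)).
    by have h' := @integrableD _ (measurableTypeR R) R leb circle mc _ _ (i1 1) i2; exact: h'.
  apply: le_integrable i3 => //; first by apply: measurable_funTS; apply/measurable_EFinP.
  move=> t _ /=; rewrite lee_fin [leRHS]ger0_norm ?addr_ge0 ?sqr_ge0//.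
  rewrite -real_normK ?num_real//; have := normr_ge0 (h t); move: `|h t| => x x0.
  have := sqr_ge0 (x - 1); rewrite sqrrB1; nra.
split=> //; set m := _ * Rintegral _ _ _.
have hm : \int[leb]_(t in circle) h t = 2 * pi * m by rewrite /m mulrA divff ?mul1r// gt_eqF.
have ic : \int[leb]_(t in circle) (1 : R) = 2 * pi.
  rewrite -[LHS]/(icirc (fun=> 1)) (icirc_derive (F := id)) ?subr0// => t; exact: cvg_cst.
have : 0 <= \int[leb]_(t in circle) ((h t - m) ^+ 2).
  by apply: Rintegral_ge0 => t _; exact: sqr_ge0.
have -> : \int[leb]_(t in circle) ((h t - m) ^+ 2) =
   \int[leb]_(t in circle) (h t ^+ 2 + ((- 2 * m) * h t + m ^+ 2 * 1)).
  by congr Rintegral; apply/funext => t; ring.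
have i4 : leb.-integrable circle (EFin \o (fun t => - 2 * m * h t)).
  by have h' := @integrableZl _ (measurableTypeR R) R leb circle mc (- 2 * m) _ ih; exact: h'.
have i5 : leb.-integrable circle (EFin \o (fun t : R => m ^+ 2 * 1)) := i1 _.
have i6 : leb.-integrable circle (EFin \o (fun t => - 2 * m * h t + m ^+ 2 * 1)).
  by have h' := @integrableD _ (measurableTypeR R) R leb circle mc _ _ i4 i5; exact: h'.
rewrite RintegralD// RintegralD// !RintegralZl//; last exact: (i1 1).
rewrite hm ic; nra.
Qed.

Lemma measurable_Rpartial2 f : measurable_fun setT f ->
  measurable_fun setT (fun y => \int[leb]_(x in circle) f (x, y)).
Proof.
move=> mf; have mE : measurable_fun setT (EFin \o f) by exact/measurable_EFinP.
have m := @measurable_partial_integral _ _ (measurableTypeR R) (measurableTypeR R) R leb circle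
  (@measurable_circle R) _ (measurableT_comp mE measurable_swap2).
exact: (measurableT_comp (@fine_measurable R setT measurableT) m).
Qed.

Definition avg f : R * R -> R := fun z => (2 * pi)^-1 * \int[leb]_(t in circle) f (t, z.2).

Lemma avg_meas f : measurable_fun setT f -> measurable_fun setT (avg f).
Proof.
move=> mf; apply: measurable_funM => //.
exact: (measurableT_comp (measurable_Rpartial2 mf) measurable_snd).
Qed.

Lemma avg_per f : periodic2 f -> periodic2 (avg f).
Proof.
move=> pf x y; split=> //; congr (_ * _); congr Rintegral; apply/funext => t; exact: (pf t y).2.
Qed.

Lemma avg_sq_le f : is_L2 f ->
  (\int[area]_(z in cell) (avg f z ^+ 2)%:E <= \int[area]_(z in cell) (f z ^+ 2)%:E)%E.
Proof.
move=> hf; have mf := L2_meas hf; have ma := avg_meas mf.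
have p0 := @two_pi_gt0 R.
have msq (g : R * R -> R) : measurable_fun setT g -> measurable_fun setT (fun z => (g z ^+ 2)%:E).
  by move=> mg; apply/measurable_EFinP; exact: measurable_sq.
have mint (g : R * R -> R) : measurable_fun setT g ->
    measurable_fun circle (fun y => \int[leb]_(x in circle) (g (x, y) ^+ 2)%:E)%E.
  move=> mg; apply: measurable_funTS.
  exact: (@measurable_partial_integral _ _ (measurableTypeR R) (measurableTypeR R) R leb circle
    (@measurable_circle R) _ (measurableT_comp (msq _ mg) measurable_swap2)).
have sq0 (g : R * R -> R) z : (0 <= (g z ^+ 2)%:E)%E by rewrite lee_fin sqr_ge0.
rewrite (area_tonelli2 (msq _ mf) (sq0 f)) (area_tonelli2 (msq _ ma) (sq0 _)).
apply: ge0_le_integral => //.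
- exact: measurable_circle.
- by move=> y _; apply: integral_ge0 => x _; rewrite lee_fin sqr_ge0.
- exact: mint ma.
- exact: mint mf.
move=> y _.
(* A slice of infinite energy satisfies the inequality trivially; Jensen's inequality handles the
   others. *)
have [inf|] := leP +oo%E (\int[leb]_(x in circle) (f (x, y) ^+ 2)%:E)%E.
  by apply: le_trans inf; exact: leey.
move=> fin; have mfy : measurable_fun setT (fun x => f (x, y)) := measurable_section2 y mf.
have [i1 J] := Rintegral_sq_mean mfy fin.
have fn : (\int[leb]_(x in circle) (f (x, y) ^+ 2)%:E)%E \is a fin_num.
  by rewrite ge0_fin_numE//; apply: integral_ge0 => x _; rewrite lee_fin sqr_ge0.
rewrite -(fineK fn).
rewrite [leLHS](_ : _ = (\int[leb]_(x in circle) (cst (avg f (0%R, y) ^+ 2)%:E) x)%E)//.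
rewrite integral_cst; last exact: measurable_circle.
rewrite [X in (_ * X <= _)%E](_ : _ = (2 * pi)%:E); last first.
  by rewrite /circle [LHS]lebesgue_measure_itv/= lte_fin p0 sube0.
by rewrite -EFinM lee_fin mulrC.
Qed.

Lemma avg_L2 f : is_L2 f -> is_L2 (avg f).
Proof.
move=> hf; have ma := avg_meas (L2_meas hf).
split; [exact: avg_per (L2_per hf)|exact: ma|].
have abs0 (g : R * R -> R) : (\int[area]_(z in cell) `|(g z ^+ 2)%:E| = \int[area]_(z in cell) (g z ^+ 2)%:E)%E.
  by apply: eq_integral => z _; rewrite /= ger0_norm ?sqr_ge0.
apply/integrableP; split; first by apply: measurable_funTS; apply/measurable_EFinP; exact: measurable_sq.
rewrite abs0; apply: le_lt_trans (avg_sq_le hf) _.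
by have [_] := integrableP _ _ _ (L2_sq hf); rewrite /comp abs0.
Qed.

Lemma nrm_avg f : is_L2 f -> nrm (avg f) <= nrm f.
Proof.
move=> hf; have ha := avg_L2 hf.
rewrite /nrm ler_sqrt ?ip_ge0// /ip /integral2 /Rintegral.
have e (g : R * R -> R) : (\int[area]_(z in cell) (g z * g z)%:E = \int[area]_(z in cell) (g z ^+ 2)%:E)%E.
  by apply: eq_integral => z _; rewrite expr2.
rewrite !e; apply: fine_le; last exact: avg_sq_le.
  by apply: integrable_fin_num (L2_sq ha); exact: mcell.
by apply: integrable_fin_num (L2_sq hf); exact: mcell.
Qed.

Lemma avg_ae f g : is_L2 f -> is_L2 g -> aeeq f g ->
  {ae leb, forall y, \int[leb]_(t in circle) f (t, y) = \int[leb]_(t in circle) g (t, y)}.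
Proof.
move=> hf hg /ae_sections h0; apply: filterS h0 => y h.
rewrite /Rintegral; congr fine; apply: ae_eq_integral => //.
- exact: measurable_circle.
- by apply: measurable_funTS; apply/measurable_EFinP; exact: measurable_section2 (L2_meas hf).
- by apply: measurable_funTS; apply/measurable_EFinP; exact: measurable_section2 (L2_meas hg).
- by apply: filterS h => x /= -> _.
Qed.

(** Pairing an average with a product splits off the mean of the factor in theta. By [separation]
    this weak description determines the average, and the algebra of [Eav] is derived from it. *)
Lemma ip_avg_tst f (chi phi : R -> R) : is_L2 f -> per_Cq 0 chi -> per_Cq 0 phi ->
  ip (avg f) (tst chi phi) = (2 * pi)^-1 * icirc chi * ip f (fun z => phi z.2).
Proof.
move=> hf h1 h2; have ha := avg_L2 hf; have ht := L2_tst h1 h2.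
have p0 := @two_pi_gt0 R.
have hp : is_L2 (fun z : R * R => phi z.2) := is_Cq_L2 (per_Cq_snd h2).
rewrite /ip area_fubini2; [|exact: measurable_funM (L2_meas ha) (L2_meas ht)|exact: L2_mul].
rewrite area_fubini2; [|exact: measurable_funM (L2_meas hf) (L2_meas hp)|exact: L2_mul].
pose I y := \int[leb]_(x in circle) f (x, y).
have e1 y : \int[leb]_(x in circle) (avg f (x, y) * tst chi phi (x, y)) = (2 * pi)^-1 * icirc chi * (I y * phi y).
  have -> : \int[leb]_(x in circle) (avg f (x, y) * tst chi phi (x, y)) = icirc (fun x => ((2 * pi)^-1 * I y * phi y) * chi x).
    by congr Rintegral; apply/funext => x; rewrite /avg /tst /I/=; ring.
  by rewrite icircZ; [ring|exact: per_Cq_cont h1].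
rewrite [LHS](_ : _ = \int[leb]_(y in circle) ((2 * pi)^-1 * icirc chi * (I y * phi y))); last first.
  by congr Rintegral; apply/funext => y; exact: e1.
have mphi : measurable_fun setT phi.
  have := measurable_section1 0 (is_Cq_meas (per_Cq_snd h2)); exact.
have mIp : measurable_fun setT (fun y => I y * phi y).
  by apply: measurable_funM mphi; exact: measurable_Rpartial2 (L2_meas hf).
have mfp := measurable_funM (L2_meas hf) (L2_meas hp).
have mJ := measurable_Rpartial2 mfp.
have mE (g : R -> R) : measurable_fun setT g -> measurable_fun circle (EFin \o g).
  by move=> mg; apply: measurable_funTS; exact/measurable_EFinP.
have i1 : intc f by apply: eq_intc (L2_mul hf (L2_cst 1)) => z; rewrite mulr1.
have aeI : {ae leb, forall y, circle y -> \int[leb]_(x in circle) (f (x, y) * phi y) = I y * phi y}.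
  have := @ae_integrable_section _ _ (measurableTypeR R) (measurableTypeR R) R leb leb circle circle
    (@measurable_circle R) (@measurable_circle R) _ (integrable_cell_swap (L2_meas hf) i1).
  apply: filterS => y hy cy; rewrite RintegralZr//; [exact: measurable_circle|exact: hy].
have eI : \int[leb]_(y in circle) \int[leb]_(x in circle) (f (x, y) * phi y) = \int[leb]_(y in circle) (I y * phi y).
  rewrite [LHS]/Rintegral [RHS]/Rintegral; congr fine.
  apply: (@ae_eq_integral _ (measurableTypeR R) R leb circle _ _ (@measurable_circle R) (mE _ mJ) (mE _ mIp)).
  by apply: filterS aeI => y hy cy /=; rewrite hy.
rewrite eI RintegralZl//; first exact: measurable_circle.
have [M hM] := per_Cq_bounded h2.
have M0 : 0 <= M := le_trans (normr_ge0 _) (hM 0).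
have iI := @integrable_Rpartial _ _ (measurableTypeR R) (measurableTypeR R) R leb leb circle circle
  (@measurable_circle R) (@measurable_circle R) _ (measurableT_comp (L2_meas hf) measurable_swap2)
  (integrable_cell_swap (L2_meas hf) i1).
have iMI := @integrableZl _ (measurableTypeR R) R leb circle (@measurable_circle R) M _ iI.
apply: (@le_integrable _ (measurableTypeR R) R leb circle (@measurable_circle R) _ _ (mE _ mIp) _ iMI).
by move=> y _ /=; rewrite lee_fin !normrM mulrC (ger0_norm M0) ler_wpM2r.
Qed.

End AverageAnalysis.

(** * Multiplication by classical functions and the Leibniz rule *)

Section Multiplication.
Context {R : realType}.
Implicit Types (f g a b psi : R * R -> R) (phi chi : R -> R) (x y u v w : L2class R).

Lemma bmul_subproof : {m : (R * R -> R) -> L2class R -> L2class R | forall a x, m a x = cls (fun z => a z * repr2 x z)}.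
Proof. by eexists. Qed.
Definition bmul := sval bmul_subproof.
Lemma bmulE a x : bmul a x = cls (fun z => a z * repr2 x z). Proof. exact: svalP bmul_subproof a x. Qed.

Lemma L2_bmul q a f : is_Cq q a -> is_L2 f -> is_L2 (fun z => a z * f z).
Proof.
move=> ha hf; have [M hM] := is_Cq_bounded ha.
exact: L2_mulbdd (is_Cq_per ha) (is_Cq_meas ha) hM hf.
Qed.

Lemma bmul_cls q a f : is_Cq q a -> is_L2 f -> bmul a (cls f) = cls (fun z => a z * f z).
Proof.
move=> ha hf; rewrite bmulE; apply: cls_eq; [exact: L2_bmul ha (repr2_L2 _)|exact: L2_bmul ha hf|].
by apply: aeeqM; [exact: aeeq_refl|exact: cls_ae].
Qed.

Lemma bmul_lin q a c x y : is_Cq q a -> bmul a (c *: x + y) = c *: bmul a x + bmul a y.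
Proof.
move=> ha; have hx := repr2_L2 x; have hy := repr2_L2 y.
rewrite -[x in LHS]repr2K -[y in LHS]repr2K -clsZ// -clsD//; last exact: L2Z.
rewrite (bmul_cls ha); last exact/L2D/hy/L2Z.
rewrite !bmulE -clsZ; last exact: L2_bmul ha hx.
rewrite -clsD; [|exact/L2Z/(L2_bmul ha hx)|exact: L2_bmul ha hy].
by congr cls; apply/funext => z; ring.
Qed.
Lemma bmul0 q a : is_Cq q a -> bmul a 0 = 0.
Proof. by move=> ha; have := bmul_lin (-1) 0 0 ha; rewrite scaler0 addr0 scaleN1r addNr. Qed.
Lemma bmulZr q a c x : is_Cq q a -> bmul a (c *: x) = c *: bmul a x.
Proof. by move=> ha; have := bmul_lin c x 0 ha; rewrite !(bmul0 ha) !addr0. Qed.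
Lemma bmulDr q a x y : is_Cq q a -> bmul a (x + y) = bmul a x + bmul a y.
Proof. by move=> ha; have := bmul_lin 1 x y ha; rewrite !scale1r. Qed.
Lemma bmulNr q a x : is_Cq q a -> bmul a (- x) = - bmul a x.
Proof. by move=> ha; rewrite -scaleN1r (bmulZr _ _ ha) scaleN1r. Qed.
Lemma bmulBr q a x y : is_Cq q a -> bmul a (x - y) = bmul a x - bmul a y.
Proof. by move=> ha; rewrite (bmulDr _ _ ha) (bmulNr _ ha). Qed.
Lemma bmul_sumr q a (I : Type) (s : seq I) (P : pred I) (F : I -> L2class R) : is_Cq q a ->
  bmul a (\sum_(i <- s | P i) F i) = \sum_(i <- s | P i) bmul a (F i).
Proof. by move=> ha; apply: (big_morph (bmul a)) => [x y|]; [exact: bmulDr ha|exact: bmul0 ha]. Qed.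

Lemma bmulDl q a b x : is_Cq q a -> is_Cq q b -> bmul (fun z => a z + b z) x = bmul a x + bmul b x.
Proof.
move=> ha hb; rewrite !bmulE -clsD; [|exact: L2_bmul ha (repr2_L2 _)|exact: L2_bmul hb (repr2_L2 _)].
by congr cls; apply/funext => z; ring.
Qed.
Lemma bmulZl q a c x : is_Cq q a -> bmul (fun z => c * a z) x = c *: bmul a x.
Proof.
move=> ha; rewrite !bmulE -clsZ; last exact: L2_bmul ha (repr2_L2 _).
by congr cls; apply/funext => z; ring.
Qed.
Lemma bmulA q a b x : is_Cq q a -> is_Cq q b -> bmul a (bmul b x) = bmul (fun z => a z * b z) x.
Proof.
move=> ha hb; rewrite (bmulE b) (bmul_cls ha); last exact: L2_bmul hb (repr2_L2 _).
by rewrite bmulE; congr cls; apply/funext => z; ring.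
Qed.
Lemma bmulC q a b x : is_Cq q a -> is_Cq q b -> bmul a (bmul b x) = bmul b (bmul a x).
Proof.
by move=> ha hb; rewrite (bmulA _ ha hb) (bmulA _ hb ha); congr bmul; apply/funext => z; ring.
Qed.
Lemma bmul_cst c x : bmul (fun=> c) x = c *: x.
Proof. by rewrite bmulE clsZ ?repr2K//; exact: repr2_L2. Qed.

Lemma dot_bmul q a x y : is_Cq q a -> dot (bmul a x) y = dot x (bmul a y).
Proof.
move=> ha; rewrite !bmulE dot_clsl; last exact: L2_bmul ha (repr2_L2 _).
rewrite [RHS]dotC dot_clsl; last exact: L2_bmul ha (repr2_L2 _).
by congr integral2; apply/funext => z; ring.
Qed.
Lemma nm_bmul q a (M : R) x : is_Cq q a -> (forall z, `|a z| <= M) -> nm (bmul a x) <= M * nm x.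
Proof.
move=> ha hM; rewrite bmulE nm_cls; last exact: L2_bmul ha (repr2_L2 _).
rewrite -[x in leRHS]repr2K nm_cls; last exact: repr2_L2.
exact: nrm_mulbdd (is_Cq_per ha) (is_Cq_meas ha) hM (repr2_L2 _).
Qed.
Lemma nm_bmul_le q a b x : is_Cq q a -> is_Cq q b -> (forall z, `|a z| <= `|b z|) ->
  nm (bmul a x) <= nm (bmul b x).
Proof.
move=> ha hb h; rewrite !bmulE !nm_cls; [|exact: L2_bmul hb (repr2_L2 _)|exact: L2_bmul ha (repr2_L2 _)].
apply: le_nrm_ae; [exact: L2_bmul ha (repr2_L2 _)|exact: L2_bmul hb (repr2_L2 _)|].
by apply: aeW => z; rewrite !normrM ler_wpM2r.
Qed.

(** The multiplier is moved onto the test function: [a * psi] is again a test, and the classical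
    product rule applies there. *)
Lemma W2_bmul a x y : is_Cq 1 a -> W2 x y -> W2 (bmul a x) (bmul a y + bmul (ds a) x).
Proof.
move=> ha h psi hp; have hd := is_Cq_ds ha.
have Lp := is_Cq_L2 hp; have Ldp := is_Cq_L2 (is_Cq_ds hp).
rewrite dotDl (dot_bmul _ _ ha) (dot_bmul _ _ ha) (dot_bmul _ _ hd).
rewrite (bmul_cls ha Ldp) (bmul_cls ha Lp) (bmul_cls hd Lp).
have := h _ (is_CqM ha hp); rewrite (dsM ha hp) clsD; [|exact: L2_bmul hd Lp|exact: L2_bmul ha Ldp].
rewrite dotDr; lra.
Qed.
Lemma W1_bmul a x y : is_Cq 1 a -> W1 x y -> W1 (bmul a x) (bmul a y + bmul (dtheta a) x).
Proof.
move=> ha h psi hp; have hd := is_Cq_dtheta ha.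
have Lp := is_Cq_L2 hp; have Ldp := is_Cq_L2 (is_Cq_dtheta hp).
rewrite dotDl (dot_bmul _ _ ha) (dot_bmul _ _ ha) (dot_bmul _ _ hd).
rewrite (bmul_cls ha Ldp) (bmul_cls ha Lp) (bmul_cls hd Lp).
have := h _ (is_CqM ha hp); rewrite (dthetaM ha hp) clsD; [|exact: L2_bmul hd Lp|exact: L2_bmul ha Ldp].
rewrite dotDr; lra.
Qed.

(** A common bound for all words of derivatives of length at most [r]; in this form it passes to
    derivatives without computation. *)
Fixpoint Cbd (r : nat) (M : R) a : Prop :=
  (forall z, `|a z| <= M) /\ if r is r'.+1 then Cbd r' M (dtheta a) /\ Cbd r' M (ds a) else True.

Lemma Cbd_bd r M a : Cbd r M a -> forall z, `|a z| <= M. Proof. by case: r => [|r] []. Qed.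
Lemma Cbd_ge0 r M a : Cbd r M a -> 0 <= M.
Proof. by move=> /Cbd_bd h; exact: le_trans (normr_ge0 _) (h (0, 0)). Qed.
Lemma CbdW r M a : Cbd r.+1 M a -> Cbd r M a.
Proof.
elim: r a => [|r IH] a; first by case.
by move=> [h [h1 h2]]; exact: (conj h (conj (IH _ h1) (IH _ h2))).
Qed.
Lemma Cbd_le r r' M a : (r' <= r)%N -> Cbd r M a -> Cbd r' M a.
Proof. by move=> /subnK <-; elim: (r - r')%N => [//|k IH]; rewrite addSn => /CbdW. Qed.
Lemma Cbd_leM r M M' a : M <= M' -> Cbd r M a -> Cbd r M' a.
Proof.
move=> MM; elim: r a => [|r IH] a; first by move=> [h _]; exact: (conj (fun z => le_trans (h z) MM) I).
by move=> [h [h1 h2]]; exact: (conj (fun z => le_trans (h z) MM) (conj (IH _ h1) (IH _ h2))).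
Qed.
Lemma is_Cq_Cbd r a : is_Cq r a -> exists M, Cbd r M a.
Proof.
elim: r a => [|r IH] a h; first by have [M hM] := is_Cq_bounded h; exists M.
have [M hM] := is_Cq_bounded h; have [M1 h1] := IH _ (is_Cq_dtheta h); have [M2 h2] := IH _ (is_Cq_ds h).
have b : forall z, `|a z| <= M + (M1 + M2).
  by move=> z; rewrite (le_trans (hM z))// lerDl addr_ge0 ?(Cbd_ge0 h1) ?(Cbd_ge0 h2).
have M0 : 0 <= M := le_trans (normr_ge0 _) (hM (0, 0)).
exists (M + (M1 + M2)); split; [exact: b|split].
  by apply: Cbd_leM h1; have := Cbd_ge0 h2; lra.
by apply: Cbd_leM h2; have := Cbd_ge0 h1; lra.
Qed.

(** Besides [a x], one derivative produces [a (D x)] and [(D a) x] in each of the two directions;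
    the terms with [D a] cost two more copies of [Nr r x], whence a factor 3 per order. *)
Lemma HN_bmul r M a x : is_Cq r a -> Cbd r M a -> Hr r x ->
  Hr r (bmul a x) /\ Nr r (bmul a x) <= 3 ^+ r * M * Nr r x.
Proof.
elim: r a x => [|r IH] a x ha hM hx.
  by split=> //; rewrite expr0 mul1r; exact: nm_bmul ha (Cbd_bd hM).
have [hb [hb1 hb2]] := hM; have M0 := Cbd_ge0 hM.
have ha1 : is_Cq 1 a := is_Cq_le (isT : (1 <= r.+1)%N) ha.
have w1 := W1_bmul ha1 (Hr_W1 hx); have w2 := W2_bmul ha1 (Hr_W2 hx).
have [h1 n1] := IH _ _ (is_CqW ha) (CbdW hM) (Hr_D1 hx).
have [h2 n2] := IH _ _ (is_CqW ha) (CbdW hM) (Hr_D2 hx).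
have [h3 n3] := IH _ _ (is_Cq_dtheta ha) hb1 (HrW hx).
have [h4 n4] := IH _ _ (is_Cq_ds ha) hb2 (HrW hx).
have hH : Hr r.+1 (bmul a x) := Hr_intro w1 w2 (HrD h1 h3) (HrD h2 h4).
split=> //; rewrite /= (D1E w1) (D2E w2).
have a0 := nm_bmul x ha hb; have a1 := NrD h1 h3; have a2 := NrD h2 h4.
have m1 := NrS r x; rewrite /= in m1; rewrite exprS.
have e1 : (1 : R) <= 3 ^+ r by rewrite exprn_ege1//; lra.
have p0 := nm_ge0 x; have p1 := Nr_ge0 r (D1 x); have p2 := Nr_ge0 r (D2 x).
move: a0 n1 n2 n3 n4 a1 a2 m1 p0 p1 p2.
move: (nm (bmul a x)) (nm x) (Nr r x) (Nr r (D1 x)) (Nr r (D2 x)) (Nr r (bmul a (D1 x))) (Nr r (bmul a (D2 x))).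
move: (Nr r (bmul (dtheta a) x)) (Nr r (bmul (ds a) x)) (Nr r (_ + _)) (Nr r (_ + _)) => A B C D E F G H I J K a0 n1 n2 n3 n4 a1 a2 m1 p0 p1 p2.
set c := 3 ^+ r in e1 n1 n2 n3 n4 *.
have cM : M <= c * M by rewrite ler_peMl.
have cM0 : 0 <= c * M by rewrite mulr_ge0// (le_trans _ e1).
have b0 : M * F <= c * M * F by rewrite ler_wpM2r.
have b1 : c * M * G <= c * M * (F + (H + I)) by rewrite ler_wpM2l.
have -> : 3 * c * M * (F + (H + I)) = 3 * (c * M * (F + (H + I))) by ring.
move: b1; rewrite !mulrDr; lra.
Qed.

Lemma Hr_bmul r a x : is_Cq r a -> Hr r x -> Hr r (bmul a x).
Proof. by move=> ha hx; have [M hM] := is_Cq_Cbd ha; have [] := HN_bmul ha hM hx. Qed.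
Lemma Nr_bmul r M a x : is_Cq r a -> Cbd r M a -> Hr r x -> Nr r (bmul a x) <= 3 ^+ r * M * Nr r x.
Proof. by move=> ha hM hx; have [] := HN_bmul ha hM hx. Qed.
Lemma D2_bmul r a x : is_Cq 1 a -> Hr r.+1 x -> D2 (bmul a x) = bmul a (D2 x) + bmul (ds a) x.
Proof. by move=> ha /Hr_W2 h; apply: D2E; exact: W2_bmul. Qed.
Lemma D1_bmul r a x : is_Cq 1 a -> Hr r.+1 x -> D1 (bmul a x) = bmul a (D1 x) + bmul (dtheta a) x.
Proof. by move=> ha /Hr_W1 h; apply: D1E; exact: W1_bmul. Qed.

End Multiplication.

Section Average.
Context {R : realType}.
Implicit Types (f g a b psi : R * R -> R) (phi chi : R -> R) (x y u v w : L2class R).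

Definition mean chi : R := (2 * pi)^-1 * icirc chi.

Lemma Eav_subproof : {E : L2class R -> L2class R | forall x, E x = cls (avg (repr2 x))}.
Proof. by eexists. Qed.
Definition Eav := sval Eav_subproof.
Lemma Eav_def x : Eav x = cls (avg (repr2 x)). Proof. exact: svalP Eav_subproof x. Qed.

Lemma Eav_cls f : is_L2 f -> Eav (cls f) = cls (avg f).
Proof.
move=> hf; rewrite Eav_def; apply: cls_eq; [exact/avg_L2/repr2_L2|exact: avg_L2|].
have := ae_snd (avg_ae (repr2_L2 (cls f)) hf (cls_ae hf)).
by apply: filterS => z h; rewrite /avg h.
Qed.

Definition fsnd phi : R * R -> R := fun z => phi z.2.
Definition ffst phi : R * R -> R := fun z => phi z.1.

Lemma dot_Eav_tst x chi phi : per_Cq 0 chi -> per_Cq 0 phi ->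
  dot (Eav x) (cls (tst chi phi)) = mean chi * dot x (cls (fsnd phi)).
Proof.
move=> h1 h2; rewrite Eav_def dot_cls; [|exact/avg_L2/repr2_L2|exact: L2_tst h1 h2].
rewrite (ip_avg_tst (repr2_L2 x) h1 h2) [in RHS]dotC dot_clsl; last exact: is_Cq_L2 (per_Cq_snd h2).
by rewrite ipC.
Qed.

Lemma per_Cq_le q q' phi : (q' <= q)%N -> per_Cq q phi -> per_Cq q' phi.
Proof. by move=> /subnK <-; elim: (q - q')%N => [//|k IH]; rewrite addSn => /per_CqW. Qed.

Lemma Eav_lin c x y : Eav (c *: x + y) = c *: Eav x + Eav y.
Proof.
apply/eqP; rewrite -subr_eq0; apply/eqP/separationL => chi phi h1 h2.
have [p1 p2] := (per_Cq_le (isT : (0 <= 2)%N) h1, per_Cq_le (isT : (0 <= 2)%N) h2).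
by rewrite dotBl dotDl dotZl !dot_Eav_tst// dotDl dotZl; ring.
Qed.
Lemma Eav0 : Eav 0 = 0.
Proof. by have := Eav_lin (-1) 0 0; rewrite scaler0 addr0 scaleN1r addNr. Qed.
Lemma EavZ c x : Eav (c *: x) = c *: Eav x.
Proof. by have := Eav_lin c x 0; rewrite Eav0 !addr0. Qed.
Lemma EavD x y : Eav (x + y) = Eav x + Eav y.
Proof. by have := Eav_lin 1 x y; rewrite !scale1r. Qed.

Lemma EavB x y : Eav (x - y) = Eav x - Eav y.
Proof. by rewrite EavD -scaleN1r EavZ scaleN1r. Qed.

Lemma Eav_snd phi x : per_Cq 0 phi -> Eav (bmul (fsnd phi) x) = bmul (fsnd phi) (Eav x).
Proof.
move=> h; apply/eqP; rewrite -subr_eq0; apply/eqP/separationL => chi phi' h1 h2.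
have [p1 p2] := (per_Cq_le (isT : (0 <= 2)%N) h1, per_Cq_le (isT : (0 <= 2)%N) h2).
have hs := per_Cq_snd h.
rewrite dotBl (dot_bmul _ _ hs) (bmul_cls hs (L2_tst p1 p2)).
have -> : (fun z => fsnd phi z * tst chi phi' z) = tst chi (fun t => phi t * phi' t).
  by apply/funext => z; rewrite /tst /fsnd; ring.
rewrite !dot_Eav_tst//; last exact: per_CqM.
rewrite (dot_bmul _ _ hs) (bmul_cls hs (is_Cq_L2 (per_Cq_snd p2))); apply/eqP; rewrite subr_eq0.
by apply/eqP; congr (_ * dot _ (cls _)).
Qed.

Lemma Eav_fst_Eav chi x : per_Cq 0 chi -> Eav (bmul (ffst chi) (Eav x)) = mean chi *: Eav x.
Proof.
move=> h; apply/eqP; rewrite -subr_eq0; apply/eqP/separationL => chi' phi h1 h2.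
have [p1 p2] := (per_Cq_le (isT : (0 <= 2)%N) h1, per_Cq_le (isT : (0 <= 2)%N) h2).
have hs := per_Cq_fst h.
rewrite dotBl dotZl !dot_Eav_tst// (dot_bmul _ _ hs) (bmul_cls hs (is_Cq_L2 (per_Cq_snd p2))).
have -> : (fun z => ffst chi z * fsnd phi z) = tst chi phi by [].
by rewrite dot_Eav_tst//; ring.
Qed.

Lemma W1_Eav x : W1 (Eav x) 0.
Proof.
apply: W1_prod => chi phi h1 h2; have h1' := per_Cq_derive h1.
rewrite dot_Eav_tst; [|exact: per_Cq_le h1'|exact: per_Cq_le h2].
by rewrite /mean (icirc_per_derive (per_CqW h1)) mulr0 mul0r dot0l oppr0.
Qed.

Lemma W2_Eav x y : W2 x y -> W2 (Eav x) (Eav y).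
Proof.
move=> h; apply/W2closed_W2/W2_prod => chi phi h1 h2; have h2' := per_Cq_derive h2.
rewrite !dot_Eav_tst; [|exact: per_Cq_le h1|exact: per_Cq_le h2|exact: per_Cq_le h1|exact: per_Cq_le h2'].
have := h _ (per_Cq_snd (per_CqW h2)); rewrite ds_snd => e.
by rewrite [dot x _]e; ring.
Qed.

Lemma Hr_Eav r x : Hr r x -> Hr r (Eav x).
Proof.
elim: r x => [//|r IH] x hx.
exact: (Hr_intro (W1_Eav x) (W2_Eav (Hr_W2 hx)) (Hr0 _) (IH _ (Hr_D2 hx))).
Qed.

Lemma Eav_W1 x y : W1 x y -> Eav y = 0.
Proof.
move=> h; apply: separationL => chi phi h1 h2.
rewrite dot_Eav_tst; [|exact: per_Cq_le h1|exact: per_Cq_le h2].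
have := h _ (per_Cq_snd (per_CqW h2)); rewrite dtheta_snd cls0 dot0r => e.
have -> : dot y (cls (fsnd phi)) = 0 by rewrite /fsnd; lra.
exact: mulr0.
Qed.

Lemma nm_Eav x : nm (Eav x) <= nm x.
Proof.
rewrite Eav_def nm_cls; last exact/avg_L2/repr2_L2.
by rewrite -[x in leRHS]repr2K nm_cls; [exact/nrm_avg/repr2_L2|exact: repr2_L2].
Qed.

Lemma Eav_tst chi phi : per_Cq 0 chi -> per_Cq 0 phi ->
  Eav (cls (tst chi phi)) = mean chi *: cls (fsnd phi).
Proof.
move=> h1 h2; rewrite Eav_cls; last exact: L2_tst h1 h2.
rewrite -clsZ; last exact: is_Cq_L2 (per_Cq_snd h2).
congr cls; apply/funext => z; rewrite /avg /mean -mulrA; congr (_ * _).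
rewrite mulrC -icircZ; last exact: per_Cq_cont h1.
by congr Rintegral; apply/funext => t; rewrite mulrC.
Qed.

(** Both sides are continuous in [y], and the elements for which the identity holds form a subspace
    that contains the products of tests, hence is dense. *)
Lemma dot_Eav x y : dot (Eav x) y = dot x (Eav y).
Proof.
pose S s := forall x, dot (Eav x) s = dot x (Eav s).
have S0 : S 0 by move=> w; rewrite Eav0 !dot0r.
have SD c s t : S s -> S t -> S (c *: s + t).
  by move=> hs ht w; rewrite Eav_lin !dotDr !dotZr hs ht.
have Sw w : (forall s, S s -> dot w s = 0) -> w = 0.
  move=> h; apply: separationL => chi phi h1 h2; apply: h => v.
  have [p1 p2] := (per_Cq_le (isT : (0 <= 2)%N) h1, per_Cq_le (isT : (0 <= 2)%N) h2).
  by rewrite dot_Eav_tst// Eav_tst// dotZr.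
apply/eqP; rewrite -subr_eq0 -normr_le0.
apply: (le0_small (nm_ge0 x) (nm_ge0 x)) => e e0.
have [s hs hd] := dense_of_orthogonal y S0 SD Sw e0.
have -> : dot (Eav x) y - dot x (Eav y) = dot (Eav x) (y - s) - dot x (Eav (y - s)).
  by rewrite EavB !dotBr hs; ring.
apply: le_trans (ler_normB _ _) _; apply: lerD; apply: le_trans (dot_le _ _) _.
  by rewrite mulrC; apply: ler_pM; rewrite ?nm_ge0 ?nm_Eav// ltW.
by rewrite mulrC; apply: ler_pM; rewrite ?nm_ge0// (le_trans (nm_Eav _))// ltW.
Qed.

End Average.

(** * Fourier modes in theta *)

Section Frequencies.
Context {R : realType}.
Implicit Types (phi chi : R -> R) (x y u v w : L2class R) (k l m : nat).

Definition cosk k (t : R) : R := cos (k%:R * t).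
Definition sink k (t : R) : R := sin (k%:R * t).

Lemma cosk_per k (c t : R) : cos (k%:R * (t + 2 * pi) + c) = cos (k%:R * t + c).
Proof.
rewrite mulrDr addrAC; have := periodicn (@cosD2pi R) k (k%:R * t + c).
move=> <-; congr cos; congr (_ + _); rewrite !mulr_natl; by [].
Qed.
Lemma sink_per k (c t : R) : sin (k%:R * (t + 2 * pi) + c) = sin (k%:R * t + c).
Proof.
rewrite mulrDr addrAC; have := periodicn (@sinD2pi R) k (k%:R * t + c).
move=> <-; congr sin; congr (_ + _); rewrite !mulr_natl; by [].
Qed.

Lemma per_Cq_cosk q k : per_Cq q (cosk k).
Proof.
have h := @per_Cq_trig R q k%:R 1 0 0 (cosk_per k 0) (sink_per k 0).
have -> : cosk k = (fun s => 1 * cos (k%:R * s + 0) + 0 * sin (k%:R * s + 0)) => //.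
by apply/funext => s; rewrite mul1r mul0r !addr0.
Qed.
Lemma per_Cq_sink q k : per_Cq q (sink k).
Proof.
have h := @per_Cq_trig R q k%:R 0 1 0 (cosk_per k 0) (sink_per k 0).
have -> : sink k = (fun s => 0 * cos (k%:R * s + 0) + 1 * sin (k%:R * s + 0)) => //.
by apply/funext => s; rewrite mul1r mul0r add0r !addr0.
Qed.

Lemma is_derive_lin (c t : R) : is_derive t (1 : R) (fun t => c * t) c.
Proof. by apply: is_derive_eq; rewrite /GRing.scale/= mulr1. Qed.

Lemma derive_cosk k : derive1 (cosk k) = (fun t => (- k%:R) * sink k t).
Proof.
apply/funext => t; have D := @is_derive1_comp R cos (fun t => k%:R * t) t _ _ (is_derive_cos _) (is_derive_lin _ _).
by rewrite derive1E; have [_ ->] := D; rewrite /sink; ring.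
Qed.
Lemma derive_sink k : derive1 (sink k) = (fun t => k%:R * cosk k t).
Proof.
apply/funext => t; have D := @is_derive1_comp R sin (fun t => k%:R * t) t _ _ (is_derive_sin _) (is_derive_lin _ _).
by rewrite derive1E; have [_ ->] := D; rewrite /cosk; ring.
Qed.

Lemma mean_lin (c d : R) phi chi : per_Cq 0 phi -> per_Cq 0 chi ->
  mean (fun t => c * phi t + d * chi t) = c * mean phi + d * mean chi.
Proof.
move=> h1 h2; have [h1' h2'] := (per_CqZ c h1, per_CqZ d h2).
by rewrite /mean (icircD (per_Cq_cont h1') (per_Cq_cont h2')) (icircZ _ (per_Cq_cont h1)) (icircZ _ (per_Cq_cont h2)); ring.
Qed.

Lemma mean_derive phi : per_Cq 1 phi -> mean (derive1 phi) = 0.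
Proof. by move=> h; rewrite /mean icirc_per_derive// mulr0. Qed.

Lemma derive1M phi chi : per_Cq 1 phi -> per_Cq 1 chi ->
  derive1 (fun t => phi t * chi t) = (fun t => derive1 phi t * chi t + phi t * derive1 chi t).
Proof.
move=> h1 h2; apply/funext => t.
have := is_deriveM (is_derive_per t h1) (is_derive_per t h2) => D.
by rewrite derive1E; have [_ e] := D; rewrite [LHS]e /GRing.scale/=; ring.
Qed.

(** Orthogonality of eigenfunctions of the second derivative: the derivatives of [phi' chi] and of
    [phi chi'] have mean zero, and their difference is [(a - b) phi chi]. *)
Lemma mean_eigen (a b : R) phi chi : per_Cq 2 phi -> per_Cq 2 chi ->
  (forall t, derive1 (derive1 phi) t = a * phi t) -> (forall t, derive1 (derive1 chi) t = b * chi t) ->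
  a != b -> mean (fun t => phi t * chi t) = 0.
Proof.
move=> h1 h2 e1 e2 ab; have [p1 p2] := (per_CqW h1, per_CqW h2).
have [d1 d2] := (per_Cq_derive h1, per_Cq_derive h2).
have hw := mean_derive (per_CqM d1 p2); have hw' := mean_derive (per_CqM p1 d2).
have c1 := per_CqM (per_CqW p1) (per_CqW p2).
have c2 := per_CqM (per_CqW d1) (per_CqW d2).
move: hw hw'; rewrite (derive1M d1 p2) (derive1M p1 d2).
have -> : (fun t => derive1 (derive1 phi) t * chi t + derive1 phi t * derive1 chi t) =
          (fun t => a * (phi t * chi t) + 1 * (derive1 phi t * derive1 chi t)).
  by apply/funext => t; rewrite e1; ring.
have -> : (fun t => derive1 phi t * derive1 chi t + phi t * derive1 (derive1 chi) t) =
          (fun t => b * (phi t * chi t) + 1 * (derive1 phi t * derive1 chi t)).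
  by apply/funext => t; rewrite e2; ring.
rewrite !mean_lin// => q1 q2.
have : (a - b) * mean (fun t => phi t * chi t) = 0 by lra.
by move=> /eqP; rewrite mulf_eq0 subr_eq0 (negbTE ab) => /eqP.
Qed.

Lemma dd_cosk k t : derive1 (derive1 (cosk k)) t = - k%:R ^+ 2 * cosk k t.
Proof.
have := is_deriveZ (- k%:R) (is_derive_per t (per_Cq_sink 1 k)) => D.
by rewrite derive_cosk derive1E; have [_ e] := D; rewrite [LHS]e derive_sink /GRing.scale/=; ring.
Qed.
Lemma dd_sink k t : derive1 (derive1 (sink k)) t = - k%:R ^+ 2 * sink k t.
Proof.
have := is_deriveZ (k%:R) (is_derive_per t (per_Cq_cosk 1 k)) => D.
by rewrite derive_sink derive1E; have [_ e] := D; rewrite [LHS]e derive_cosk /GRing.scale/=; ring.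
Qed.

Lemma neq_sq k l : k != l -> - k%:R ^+ 2 != - l%:R ^+ 2 :> R.
Proof. by move=> kl; rewrite eqr_opp -!natrX eqr_nat eqn_exp2r. Qed.

Lemma mean_cc k l : k != l -> mean (fun t => cosk k t * cosk l t) = 0.
Proof. by move=> kl; apply: (mean_eigen (per_Cq_cosk 2 k) (per_Cq_cosk 2 l) (dd_cosk k) (dd_cosk l)); exact: neq_sq. Qed.
Lemma mean_ss k l : k != l -> mean (fun t => sink k t * sink l t) = 0.
Proof. by move=> kl; apply: (mean_eigen (per_Cq_sink 2 k) (per_Cq_sink 2 l) (dd_sink k) (dd_sink l)); exact: neq_sq. Qed.

Lemma mean_cst (c : R) : mean (fun=> c) = c.
Proof.
have cc : continuous (fun _ : R => c) by move=> t; exact: cvg_cst.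
have h := icirc_derive (fun t => is_derive_lin c t) cc.
by rewrite /mean h mulr0 subr0 mulrCA mulVf ?mulr1// gt_eqF// two_pi_gt0.
Qed.

(** The inverse of the mean of the square of [cosk k], which makes [Pk k] a projection. *)
Definition freq_wt k : R := if k == 0%N then 1 else 2.

(** The three means solve a linear system: the derivatives of [cos sin] and of [cos^2] have mean
    zero, and [cos^2 + sin^2 = 1]. *)
Lemma mean_cs_same k : (0 < k)%N ->
  [/\ mean (fun t => cosk k t * cosk k t) = 2^-1, mean (fun t => sink k t * sink k t) = 2^-1 &
      mean (fun t => cosk k t * sink k t) = 0].
Proof.
move=> k0; have kr : (k%:R : R) != 0 by rewrite pnatr_eq0 -lt0n.
have [c s] := (per_Cq_cosk 1 k, per_Cq_sink 1 k).
have [c0 s0] := (per_Cq_cosk 0 k, per_Cq_sink 0 k).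
have cc := per_CqM c0 c0; have ss := per_CqM s0 s0; have cs := per_CqM c0 s0.
have e1 := mean_derive (per_CqM c s); have e2 := mean_derive (per_CqM c c).
rewrite (derive1M c s) derive_cosk derive_sink in e1.
rewrite (derive1M c c) derive_cosk in e2.
have e3 : mean (fun t => 1 * (cosk k t * cosk k t) + 1 * (sink k t * sink k t)) = 1.
  rewrite -[RHS](mean_cst 1); congr mean; apply/funext => t; rewrite !mul1r -!expr2; exact: cos2Dsin2.
rewrite (mean_lin _ _ cc ss) in e3.
have e1' : mean (fun t => (- k%:R) * (sink k t * sink k t) + k%:R * (cosk k t * cosk k t)) = 0.
  by rewrite -[RHS]e1; congr mean; apply/funext => t; ring.
rewrite (mean_lin _ _ ss cc) in e1'.
have e2' : mean (fun t => (- 2 * k%:R) * (cosk k t * sink k t) + 0 * (cosk k t * sink k t)) = 0.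
  by rewrite -[RHS]e2; congr mean; apply/funext => t; ring.
rewrite (mean_lin _ _ cs cs) in e2'.
have e4 : mean (fun t => cosk k t * cosk k t) = mean (fun t => sink k t * sink k t).
  by apply: (mulfI kr); lra.
split; [lra|lra|].
have : k%:R * mean (fun t => cosk k t * sink k t) = 0 by lra.
by move=> /eqP; rewrite mulf_eq0 (negbTE kr) => /eqP.
Qed.

Lemma mean_cs k l : mean (fun t => cosk k t * sink l t) = 0.
Proof.
have [<-|kl] := eqVneq k l; last first.
  by apply: (mean_eigen (per_Cq_cosk 2 k) (per_Cq_sink 2 l) (dd_cosk k) (dd_sink l)); exact: neq_sq.
case: k => [|k]; last by have [] := mean_cs_same (ltn0Sn k).
rewrite -[RHS](mean_cst 0); congr mean; apply/funext => t.
by rewrite /sink mul0r sin0 mulr0.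
Qed.

Lemma fC q k : is_Cq q (ffst (cosk k)). Proof. exact/per_Cq_fst/per_Cq_cosk. Qed.
Lemma fS q k : is_Cq q (ffst (sink k)). Proof. exact/per_Cq_fst/per_Cq_sink. Qed.

Definition ccoef k x := Eav (bmul (ffst (cosk k)) x).
Definition scoef k x := Eav (bmul (ffst (sink k)) x).
(* The component of frequencies [k] and [-k] in theta *)
Definition Pk k x := freq_wt k *: (bmul (ffst (cosk k)) (ccoef k x) + bmul (ffst (sink k)) (scoef k x)).
(** The theta-derivative of [Pk k x]. It is a bounded operation on [x], so a class with finitely
    many frequencies has a theta-derivative whatever its regularity in s. *)
Definition Jk k x := (freq_wt k * k%:R) *: (bmul (ffst (cosk k)) (scoef k x) - bmul (ffst (sink k)) (ccoef k x)).

Lemma bmul_mix k l x y : Eav (bmul (ffst (cosk l)) (bmul (ffst (cosk k)) (Eav x) + bmul (ffst (sink k)) (Eav y)))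
   = mean (fun t => cosk l t * cosk k t) *: Eav x /\
  Eav (bmul (ffst (sink l)) (bmul (ffst (cosk k)) (Eav x) + bmul (ffst (sink k)) (Eav y)))
   = mean (fun t => sink l t * sink k t) *: Eav y.
Proof.
have pc := per_Cq_cosk 0; have ps := per_Cq_sink 0.
split.
- rewrite (bmulDr _ _ (fC 0 l)) EavD (bmulA _ (fC 0 l) (fC 0 k)) (bmulA _ (fC 0 l) (fS 0 k)).
  rewrite (Eav_fst_Eav x (per_CqM (pc l) (pc k))) (Eav_fst_Eav y (per_CqM (pc l) (ps k))).
  by rewrite mean_cs scale0r addr0.
- rewrite (bmulDr _ _ (fS 0 l)) EavD (bmulA _ (fS 0 l) (fC 0 k)) (bmulA _ (fS 0 l) (fS 0 k)).
  rewrite (Eav_fst_Eav x (per_CqM (ps l) (pc k))) (Eav_fst_Eav y (per_CqM (ps l) (ps k))).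
  have -> : mean (fun t => sink l t * cosk k t) = 0.
    by rewrite -[RHS](mean_cs k l); congr mean; apply/funext => t; rewrite mulrC.
  by rewrite scale0r add0r.
Qed.

Lemma coef_Pk_neq k l x : k != l -> ccoef l (Pk k x) = 0 /\ scoef l (Pk k x) = 0.
Proof.
move=> kl; rewrite /ccoef /scoef /Pk (bmulZr _ _ (fC 0 l)) (bmulZr _ _ (fS 0 l)) !EavZ.
have [-> ->] := bmul_mix k l (bmul (ffst (cosk k)) x) (bmul (ffst (sink k)) x).
by rewrite mean_cc 1?eq_sym// mean_ss 1?eq_sym// !scale0r !scaler0.
Qed.

Lemma bmul_sink0 x : bmul (ffst (sink 0)) x = 0.
Proof.
rewrite (_ : ffst (sink 0) = fun=> 0) ?bmul_cst ?scale0r//.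
by apply/funext => z; rewrite /ffst /sink mul0r sin0.
Qed.

Lemma coef_Pk k x : ccoef k (Pk k x) = ccoef k x /\ scoef k (Pk k x) = scoef k x.
Proof.
rewrite /ccoef /scoef /Pk (bmulZr _ _ (fC 0 k)) (bmulZr _ _ (fS 0 k)) !EavZ.
have [-> ->] := bmul_mix k k (bmul (ffst (cosk k)) x) (bmul (ffst (sink k)) x).
rewrite !scalerA /freq_wt; case: k => [|k] /=.
  rewrite bmul_sink0 Eav0 !scaler0; split=> //.
  have -> : (fun t : R => cosk 0 t * cosk 0 t) = fun=> 1.
    by apply/funext => t; rewrite /cosk mul0r cos0 mulr1.
  by rewrite mean_cst mulr1 scale1r.
have [-> -> _] := mean_cs_same (ltn0Sn k).
by rewrite divff ?scale1r.
Qed.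

Lemma Pk_Pk k x : Pk k (Pk k x) = Pk k x.
Proof. by rewrite {1}/Pk; have [-> ->] := coef_Pk k x. Qed.
Lemma Pk_Pk_neq k l x : k != l -> Pk l (Pk k x) = 0.
Proof.
move=> kl; rewrite {1}/Pk; have [-> ->] := coef_Pk_neq x kl.
by rewrite (bmul0 (fC 0 l)) (bmul0 (fS 0 l)) addr0 scaler0.
Qed.

Lemma Pk_lin k c x y : Pk k (c *: x + y) = c *: Pk k x + Pk k y.
Proof.
rewrite /Pk /ccoef /scoef (bmul_lin _ _ _ (fC 0 k)) (bmul_lin _ _ _ (fS 0 k)) !Eav_lin.
rewrite (bmul_lin _ _ _ (fC 0 k)) (bmul_lin _ _ _ (fS 0 k)); linear_identity.
Qed.
Lemma Pk0 k : Pk k 0 = 0.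
Proof. by have := Pk_lin k (-1) 0 0; rewrite scaler0 addr0 scaleN1r addNr. Qed.
Lemma PkZ k c x : Pk k (c *: x) = c *: Pk k x.
Proof. by have := Pk_lin k c x 0; rewrite Pk0 !addr0. Qed.
Lemma PkD k x y : Pk k (x + y) = Pk k x + Pk k y.
Proof. by have := Pk_lin k 1 x y; rewrite !scale1r. Qed.
Lemma Pk_sum k (I : Type) (s : seq I) (P : pred I) (F : I -> L2class R) :
  Pk k (\sum_(i <- s | P i) F i) = \sum_(i <- s | P i) Pk k (F i).
Proof. by apply: (big_morph (Pk k)) => [x y|]; [exact: PkD|exact: Pk0]. Qed.

Lemma dot_Pk k x y : dot (Pk k x) y = dot x (Pk k y).
Proof.
rewrite /Pk !(dotZl, dotZr, dotDl, dotDr); congr (_ * (_ + _)).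
  by rewrite (dot_bmul _ _ (fC 0 k)) dot_Eav (dot_bmul _ _ (fC 0 k)).
by rewrite (dot_bmul _ _ (fS 0 k)) dot_Eav (dot_bmul _ _ (fS 0 k)).
Qed.

Lemma Pk_bmul k phi x : per_Cq 0 phi -> Pk k (bmul (fsnd phi) x) = bmul (fsnd phi) (Pk k x).
Proof.
move=> h; have hs : is_Cq 0 (fsnd phi) := per_Cq_snd h.
rewrite /Pk /ccoef /scoef (bmulZr _ _ hs) (bmulDr _ _ hs).
rewrite (bmulC _ (fC 0 k) hs) (bmulC _ (fS 0 k) hs) !(Eav_snd _ h).
by rewrite (bmulC _ (fC 0 k) hs) (bmulC _ (fS 0 k) hs).
Qed.

Lemma W2_ffst a x y : per_Cq 1 a -> W2 x y -> W2 (bmul (ffst a) x) (bmul (ffst a) y).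
Proof.
move=> ha h; have := W2_bmul (per_Cq_fst ha) h.
by rewrite ds_fst bmul_cst scale0r addr0.
Qed.
Lemma W1_ffst_Eav a x : per_Cq 1 a -> W1 (bmul (ffst a) (Eav x)) (bmul (ffst (derive1 a)) (Eav x)).
Proof.
move=> ha; have := W1_bmul (per_Cq_fst ha) (W1_Eav x).
by rewrite (bmul0 (per_Cq_fst ha)) add0r.
Qed.

Lemma W2_Pk k x y : W2 x y -> W2 (Pk k x) (Pk k y).
Proof.
move=> h; have [c s] := (per_Cq_cosk 1 k, per_Cq_sink 1 k).
have hc := W2_ffst c (W2_Eav (W2_ffst c h)); have hs := W2_ffst s (W2_Eav (W2_ffst s h)).
have := W2_lin (freq_wt k) (W2_lin 1 hc hs) (@W2_0 R).
by rewrite !scale1r !addr0.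
Qed.

Lemma W1_Pk_Jk k x : W1 (Pk k x) (Jk k x).
Proof.
have [c s] := (per_Cq_cosk 1 k, per_Cq_sink 1 k).
have hc := W1_ffst_Eav (bmul (ffst (cosk k)) x) c; have hs := W1_ffst_Eav (bmul (ffst (sink k)) x) s.
have := W1_lin (freq_wt k) (W1_lin 1 hc hs) (@W1_0 R).
rewrite !scale1r !addr0 derive_cosk derive_sink.
have -> : ffst (fun t => (- k%:R) * sink k t) = (fun z : R * R => (- k%:R) * ffst (sink k) z) by [].
have -> : ffst (fun t => k%:R * cosk k t) = (fun z : R * R => k%:R * ffst (cosk k) z) by [].
rewrite (bmulZl _ _ (fS 0 k)) (bmulZl _ _ (fC 0 k)).
suff -> : freq_wt k *: (- k%:R *: bmul (ffst (sink k)) (Eav (bmul (ffst (cosk k)) x)) +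
   k%:R *: bmul (ffst (cosk k)) (Eav (bmul (ffst (sink k)) x))) = Jk k x by [].
by rewrite /Jk /ccoef /scoef; linear_identity.
Qed.

Lemma W1_Jk k x : W1 (Jk k x) (- k%:R ^+ 2 *: Pk k x).
Proof.
have [c s] := (per_Cq_cosk 1 k, per_Cq_sink 1 k).
have hc := W1_ffst_Eav (bmul (ffst (sink k)) x) c; have hs := W1_ffst_Eav (bmul (ffst (cosk k)) x) s.
have := W1_lin (freq_wt k * k%:R) (W1_lin (-1) hs hc) (@W1_0 R).
rewrite !scaleN1r !addr0 derive_cosk derive_sink.
have -> : ffst (fun t => (- k%:R) * sink k t) = (fun z : R * R => (- k%:R) * ffst (sink k) z) by [].
have -> : ffst (fun t => k%:R * cosk k t) = (fun z : R * R => k%:R * ffst (cosk k) z) by [].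
rewrite (bmulZl _ _ (fS 0 k)) (bmulZl _ _ (fC 0 k)) addrC.
suff -> : (freq_wt k * k%:R) *: (- (k%:R *: bmul (ffst (cosk k)) (Eav (bmul (ffst (cosk k)) x))) +
   - k%:R *: bmul (ffst (sink k)) (Eav (bmul (ffst (sink k)) x))) = - k%:R ^+ 2 *: Pk k x.
  by rewrite /Jk /ccoef /scoef.
by rewrite /Pk /ccoef /scoef; linear_identity.
Qed.

(** Averages of theta-derivatives vanish; by the product rule for [cos(k theta) x] and
    [sin(k theta) x], the coefficients of [y] are then those of [x], exchanged and multiplied by [k]
    up to sign. *)
Lemma Pk_W1 k x y : W1 x y -> Pk k y = Jk k x.
Proof.
move=> h; have [c s] := (per_Cq_cosk 1 k, per_Cq_sink 1 k).
have hc := Eav_W1 (W1_bmul (per_Cq_fst c) h); have hs := Eav_W1 (W1_bmul (per_Cq_fst s) h).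
move: hc hs; rewrite !dtheta_fst derive_cosk derive_sink.
have -> : (fun z : R * R => (- k%:R) * sink k z.1) = (fun z : R * R => (- k%:R) * ffst (sink k) z) by [].
have -> : (fun z : R * R => k%:R * cosk k z.1) = (fun z : R * R => k%:R * ffst (cosk k) z) by [].
rewrite (bmulZl _ _ (fS 0 k)) (bmulZl _ _ (fC 0 k)) !EavD !EavZ => /eqP hc /eqP hs.
rewrite addr_eq0 -scaleNr opprK in hc; rewrite addr_eq0 -scaleNr in hs.
rewrite /Pk /Jk /ccoef /scoef.
rewrite [X in bmul _ X + _](eqP hc) [X in _ + bmul _ X](eqP hs).
rewrite (bmulZr _ _ (fC 0 k)) (bmulZr _ _ (fS 0 k)); linear_identity.
Qed.

Lemma W1_Pk k x y : W1 x y -> W1 (Pk k x) (Pk k y).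
Proof. by move=> h; rewrite (Pk_W1 k h); exact: W1_Pk_Jk. Qed.

Lemma Hr_Pk r k x : Hr r x -> Hr r (Pk k x).
Proof.
by move=> h; apply: HrZ; apply: HrD; [apply: (Hr_bmul (fC r k))|apply: (Hr_bmul (fS r k))]; apply: Hr_Eav;
  [exact: (Hr_bmul (fC r k))|exact: (Hr_bmul (fS r k))].
Qed.
Lemma Hr_Jk r k x : Hr r x -> Hr r (Jk k x).
Proof.
by move=> h; apply: HrZ; apply: HrB; [apply: (Hr_bmul (fC r k))|apply: (Hr_bmul (fS r k))]; apply: Hr_Eav;
  [exact: (Hr_bmul (fS r k))|exact: (Hr_bmul (fC r k))].
Qed.

End Frequencies.

Section Multipliers.
Context {R : realType}.
Implicit Types (phi chi : R -> R) (x y u v w : L2class R) (k l m : nat) (mu nu : nat -> R).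

(** The Fourier multiplier [mu] on the frequencies allowed at order [m], the numbers [2n - m] with
    [0 <= n <= m]: those of modulus [k <= m] with the parity of [m]. *)
Definition Pms m mu x := \sum_(k < m.+1 | odd k == odd m) mu k *: Pk k x.

Lemma Pk_Pms l m mu x : Pk l (Pms m mu x) = if (l <= m)%N && (odd l == odd m) then mu l *: Pk l x else 0.
Proof.
rewrite /Pms Pk_sum; case: ifP => [/andP[lm ol]|h].
  have lm' : (l < m.+1)%N by [].
  rewrite (bigD1 (Ordinal lm'))//= PkZ Pk_Pk big1 ?addr0// => k /andP[_ kl].
  by rewrite PkZ Pk_Pk_neq ?scaler0//; apply: contra kl => /eqP e; apply/eqP/val_inj.
apply: big1 => k ok; rewrite PkZ Pk_Pk_neq ?scaler0//; apply/eqP => e.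
by move: h; rewrite -e ok andbT -ltnS ltn_ord.
Qed.

Lemma Pms_Pms m mu nu x : Pms m mu (Pms m nu x) = Pms m (fun k => mu k * nu k) x.
Proof.
rewrite {1}/Pms; apply: eq_bigr => k ok; rewrite Pk_Pms ok andbT -ltnS ltn_ord scalerA //.
Qed.

Lemma eq_Pms m mu nu x : (forall k, (k <= m)%N -> odd k == odd m -> mu k = nu k) -> Pms m mu x = Pms m nu x.
Proof. by move=> h; apply: eq_bigr => k ok; rewrite h// -ltnS. Qed.

Lemma Pms_lin m mu c x y : Pms m mu (c *: x + y) = c *: Pms m mu x + Pms m mu y.
Proof.
rewrite /Pms scaler_sumr -big_split/=; apply: eq_bigr => k _.
by rewrite Pk_lin scalerDr !scalerA [c * _]mulrC.
Qed.
Lemma Pms0 m mu : Pms m mu (0 : L2class R) = 0.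
Proof. by apply: big1 => k _; rewrite Pk0 scaler0. Qed.
Lemma PmsB m mu x y : Pms m mu (x - y) = Pms m mu x - Pms m mu y.
Proof. by rewrite addrC -scaleN1r Pms_lin scaleN1r addrC. Qed.

Lemma dot_Pms m mu x y : dot (Pms m mu x) y = dot x (Pms m mu y).
Proof. by rewrite /Pms dot_suml dot_sumr; apply: eq_bigr => k _; rewrite dotZl dotZr dot_Pk. Qed.

Lemma sqr_nm_Pms m mu x : nm (Pms m mu x) ^+ 2 = \sum_(k < m.+1 | odd k == odd m) mu k ^+ 2 * nm (Pk k x) ^+ 2.
Proof.
rewrite sqr_nm dot_Pms Pms_Pms /Pms dot_sumr; apply: eq_bigr => k _.
by rewrite dotZr -[in LHS]Pk_Pk -dot_Pk sqr_nm expr2.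
Qed.

Lemma nm_Pms_id m x : nm (Pms m (fun=> 1) x) <= nm x.
Proof.
set y := Pms _ _ _; have h : nm y ^+ 2 <= nm x * nm y.
  rewrite sqr_nm {1}/y dot_Pms Pms_Pms (@eq_Pms m _ (fun=> 1)) ?mulr1//; exact: dot_lev.
have [y0|y0] := eqVneq (nm y) 0; first by rewrite y0 nm_ge0.
have yp : 0 < nm y by rewrite lt_neqAle eq_sym y0 nm_ge0.
by rewrite -(ler_pM2r yp) -expr2.
Qed.

Lemma nm_Pms m mu (M : R) x : 0 <= M -> (forall k, (k <= m)%N -> odd k == odd m -> `|mu k| <= M) ->
  nm (Pms m mu x) <= M * nm x.
Proof.
move=> M0 h; rewrite -(@ler_pXn2r _ 2)// ?nnegrE ?mulr_ge0 ?nm_ge0//.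
rewrite sqr_nm_Pms exprMn.
apply: (@le_trans _ _ (M ^+ 2 * nm (Pms m (fun=> 1) x) ^+ 2)).
  rewrite sqr_nm_Pms mulr_sumr; apply: ler_sum => k ok.
  rewrite expr1n mul1r ler_wpM2r ?sqr_ge0// -real_normK ?num_real// ler_pXn2r// ?nnegrE//.
  by apply: h => //; rewrite -ltnS.
by rewrite ler_wpM2l ?sqr_ge0// ler_pXn2r// ?nnegrE ?nm_ge0// nm_Pms_id.
Qed.

Lemma W1_sum (I : Type) (s : seq I) (P : pred I) (F G : I -> L2class R) :
  (forall i, P i -> W1 (F i) (G i)) -> W1 (\sum_(i <- s | P i) F i) (\sum_(i <- s | P i) G i).
Proof.
move=> h; elim/big_ind2: _ => //; first exact: W1_0.
by move=> a b c d h1 h2; have := W1_lin 1 h1 h2; rewrite !scale1r.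
Qed.
Lemma W2_sum (I : Type) (s : seq I) (P : pred I) (F G : I -> L2class R) :
  (forall i, P i -> W2 (F i) (G i)) -> W2 (\sum_(i <- s | P i) F i) (\sum_(i <- s | P i) G i).
Proof.
move=> h; elim/big_ind2: _ => //; first exact: W2_0.
by move=> a b c d h1 h2; have := W2_lin 1 h1 h2; rewrite !scale1r.
Qed.
Lemma W1Z c x y : W1 x y -> W1 (c *: x) (c *: y).
Proof. by move=> h; have := W1_lin c h (@W1_0 R); rewrite !addr0. Qed.
Lemma W2Z c x y : W2 x y -> W2 (c *: x) (c *: y).
Proof. by move=> h; have := W2_lin c h (@W2_0 R); rewrite !addr0. Qed.

Lemma W1_Pms m mu x y : W1 x y -> W1 (Pms m mu x) (Pms m mu y).
Proof. by move=> h; apply: W1_sum => k _; apply: W1Z; exact: W1_Pk. Qed.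
Lemma W2_Pms m mu x y : W2 x y -> W2 (Pms m mu x) (Pms m mu y).
Proof. by move=> h; apply: W2_sum => k _; apply: W2Z; exact: W2_Pk. Qed.
Lemma Hr_Pms r m mu x : Hr r x -> Hr r (Pms m mu x).
Proof. by move=> h; apply: Hr_sum => k _; apply: HrZ; exact: Hr_Pk. Qed.

Lemma Nr_Pms r m mu (M : R) x : 0 <= M -> (forall k, (k <= m)%N -> odd k == odd m -> `|mu k| <= M) ->
  Hr r x -> Nr r (Pms m mu x) <= M * Nr r x.
Proof.
move=> M0 h; elim: r x => [|r IH] x hx; first exact: nm_Pms.
rewrite /= (D1E (W1_Pms m mu (Hr_W1 hx))) (D2E (W2_Pms m mu (Hr_W2 hx))) !mulrDr.
by apply: lerD; [exact: nm_Pms|apply: lerD; apply: IH; [exact: Hr_D1|exact: Hr_D2]].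
Qed.

(** The form taken by [has_modes] at order [m] on classes; [has_modesP] is the equivalence. *)
Definition modes m x := Pms m (fun=> 1) x = x.

Lemma modes_Pms m mu x : modes m (Pms m mu x).
Proof. by rewrite /modes Pms_Pms; apply: eq_Pms => k _ _; rewrite mul1r. Qed.
Lemma modes_lin m c x y : modes m x -> modes m y -> modes m (c *: x + y).
Proof. by rewrite /modes Pms_lin => -> ->. Qed.
Lemma modes0 m : modes m (0 : L2class R). Proof. exact: Pms0. Qed.
Lemma modesZ m c x : modes m x -> modes m (c *: x).
Proof. by move=> h; rewrite -[_ *: _]addr0; apply: modes_lin h _; exact: modes0. Qed.
Lemma modesD m x y : modes m x -> modes m y -> modes m (x + y).
Proof. by move=> h h'; rewrite -[x]scale1r; exact: modes_lin. Qed.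
Lemma modesB m x y : modes m x -> modes m y -> modes m (x - y).
Proof. by move=> h h'; apply: modesD h _; rewrite -scaleN1r; exact: modesZ. Qed.
Lemma modes_sum m (I : Type) (s : seq I) (P : pred I) (F : I -> L2class R) :
  (forall i, P i -> modes m (F i)) -> modes m (\sum_(i <- s | P i) F i).
Proof. by move=> h; elim/big_ind: _ => //; [exact: modes0|exact: modesD]. Qed.
Lemma modes_W1 m x y : W1 x y -> modes m x -> modes m y.
Proof. by move=> h mx; apply: (W1_uniq (x := x)) (h); rewrite -{1}mx; exact: W1_Pms. Qed.
Lemma modes_W2 m x y : W2 x y -> modes m x -> modes m y.
Proof. by move=> h mx; apply: (W2_uniq (x := x)) (h); rewrite -{1}mx; exact: W2_Pms. Qed.
Lemma modes_bmul m phi x : per_Cq 0 phi -> modes m x -> modes m (bmul (fsnd phi) x).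
Proof.
move=> h mx; rewrite /modes -[in RHS]mx /Pms (bmul_sumr _ _ _ (per_Cq_snd h : is_Cq 0 (fsnd phi))).
by apply: eq_bigr => k _; rewrite (bmulZr _ _ (per_Cq_snd h : is_Cq 0 (fsnd phi))) Pk_bmul.
Qed.

Lemma modes_lim m (f : nat -> L2class R) g : (forall n, modes m (f n)) ->
  (forall e, 0 < e -> exists n, nm (f n - g) < e) -> modes m g.
Proof.
move=> h hg; apply/eqP; rewrite -subr_eq0; apply/eqP/nm_eq0/eqP; rewrite eq_le nm_ge0 andbT.
apply: (@le0_small _ _ 1 1) => // e e0; have [n hn] := hg e e0.
have -> : Pms m (fun=> 1) g - g = (f n - g) - Pms m (fun=> 1) (f n - g).
  by rewrite PmsB h; linear_identity.
apply: le_trans (nmB _ _) _; rewrite mulr1; apply: lerD; first exact: ltW.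
exact: le_trans (nm_Pms_id _ _) (ltW hn).
Qed.

Lemma Pk_modes0 m l x : modes m x -> ~~ ((l <= m)%N && (odd l == odd m)) -> Pk l x = 0.
Proof. by move=> mx h; rewrite -mx Pk_Pms (negbTE h). Qed.

Lemma modes_W1J m x : modes m x -> W1 x (\sum_(k < m.+1 | odd k == odd m) Jk k x).
Proof.
move=> mx; rewrite -[in X in W1 X _]mx; apply: W1_sum => k _; rewrite scale1r; exact: W1_Pk_Jk.
Qed.
Lemma modes_D1 m x : modes m x -> W1 x (D1 x).
Proof. by move=> /modes_W1J h; rewrite (D1E h). Qed.
Lemma modes_Hr_D1 r m x : modes m x -> Hr r x -> Hr r (D1 x).
Proof. by move=> mx hx; rewrite (D1E (modes_W1J mx)); apply: Hr_sum => k _; exact: Hr_Jk. Qed.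
Lemma modes_HrS r m x y : modes m x -> W2 x y -> Hr r x -> Hr r y -> Hr r.+1 x.
Proof. by move=> mx h hx hy; apply: (Hr_intro (modes_D1 mx) h) hy; exact: modes_Hr_D1 mx hx. Qed.
Lemma modes_modes_D1 m x : modes m x -> modes m (D1 x).
Proof. by move=> mx; exact: modes_W1 (modes_D1 mx) mx. Qed.
Lemma modes_D1D1 m x : modes m x -> D1 (D1 x) = Pms m (fun k => - k%:R ^+ 2) x.
Proof.
move=> mx; rewrite (D1E (modes_W1J mx)); apply: D1E; apply: W1_sum => k _; exact: W1_Jk.
Qed.
(** [|D1 x|^2] equals [-<x, D1 D1 x>], a sum of non-negative contributions of the frequencies [k],
    each weighted by [k^2 <= m^2]. *)
Lemma nm_modes_D1 m x : modes m x -> nm (D1 x) <= m%:R * nm x.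
Proof.
move=> mx; rewrite -(@ler_pXn2r _ 2)// ?nnegrE ?mulr_ge0 ?nm_ge0//.
have h := W1_parts (modes_D1 mx) (modes_D1 (modes_modes_D1 mx)).
have -> : nm (D1 x) ^+ 2 = - dot x (D1 (D1 x)) by rewrite sqr_nm h opprK.
rewrite (modes_D1D1 mx) /Pms dot_sumr -sumrN.
apply: (@le_trans _ _ (\sum_(k < m.+1 | odd k == odd m) m%:R ^+ 2 * dot x (Pk k x))).
  apply: ler_sum => k ok; rewrite dotZr -mulNr opprK ler_wpM2r//.
    by rewrite -Pk_Pk -dot_Pk dot_ge0.
  by rewrite -!natrX ler_nat leq_exp2r// -ltnS.
rewrite -mulr_sumr exprMn ler_wpM2l ?sqr_ge0//.
have -> : \sum_(k < m.+1 | odd k == odd m) dot x (Pk k x) = dot x (Pms m (fun=> 1) x).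
  by rewrite /Pms dot_sumr; apply: eq_bigr => k _; rewrite scale1r.
by rewrite mx sqr_nm.
Qed.
Lemma Nr_modes_D1 r m x : modes m x -> Hr r x -> Nr r (D1 x) <= m%:R * Nr r x.
Proof.
elim: r x => [|r IH] x mx hx; first exact: nm_modes_D1.
have m1 := modes_modes_D1 mx; have m2 := modes_W2 (Hr_W2 hx) mx.
have h1 := modes_Hr_D1 mx hx.
have e : D2 (D1 x) = D1 (D2 x).
  by apply: D2E; apply: (W_exchange' (Hr_W2 hx) (modes_D1 m2) (modes_D1 mx)).
rewrite /= e !mulrDr; apply: lerD; first exact: nm_modes_D1.
apply: lerD; apply: IH => //; [exact: Hr_D1|exact: Hr_D2].
Qed.

End Multipliers.

(** * Finite Fourier expansions of functions and of classes *)

Section FunctionModes.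
Context {R : realType}.
Implicit Types (f g u : R * R -> R) (F G : R * R -> R[i]) (k l m n : nat).
Local Notation leb := (@lebesgue_measure R).

Definition kap m n : int := n%:Z *+ 2 - m%:Z.

Lemma Pk_cls k u : is_L2 u -> Pk k (cls u) = cls (fun z => freq_wt k *
  (cosk k z.1 * avg (fun z => cosk k z.1 * u z) z + sink k z.1 * avg (fun z => sink k z.1 * u z) z)).
Proof.
move=> hu; have hc := L2_bmul (fC 0 k) hu; have hs := L2_bmul (fS 0 k) hu.
have ac := avg_L2 hc; have as_ := avg_L2 hs.
have lc := L2_bmul (fC 0 k) ac; have ls := L2_bmul (fS 0 k) as_.
rewrite (clsZ _ (L2D lc ls)) (clsD lc ls) /Pk /ccoef /scoef.
by rewrite (bmul_cls (fC 0 k) hu) (bmul_cls (fS 0 k) hu) (Eav_cls hc) (Eav_cls hs)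
  (bmul_cls (fC 0 k) ac) (bmul_cls (fS 0 k) as_).
Qed.

Lemma Pms_cls m u : is_L2 u -> Pms m (fun=> 1) (cls u) = cls (fun z => \sum_(k < m.+1 | odd k == odd m)
  freq_wt k * (cosk k z.1 * avg (fun z => cosk k z.1 * u z) z + sink k z.1 * avg (fun z => sink k z.1 * u z) z)).
Proof.
move=> hu; rewrite cls_sum.
  by apply: eq_bigr => k _; rewrite scale1r Pk_cls.
move=> k _; have hc := L2_bmul (fC 0 k) hu; have hs := L2_bmul (fS 0 k) hu.
by apply: L2Z; apply: L2D; [exact: L2_bmul (fC 0 k) (avg_L2 hc)|exact: L2_bmul (fS 0 k) (avg_L2 hs)].
Qed.

Lemma avg_ae_slice u (p : R -> R) (s : R) : is_L2 u -> continuous p ->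
  {ae leb, forall x, u (x, s) = p x} -> \int[leb]_(t in circle) u (t, s) = icirc p.
Proof.
move=> hu cp h; rewrite /icirc /Rintegral; congr fine; apply: ae_eq_integral => //.
- exact: measurable_circle.
- by apply: measurable_funTS; apply/measurable_EFinP; exact: measurable_section2 (L2_meas hu).
- by apply: measurable_funTS; apply/measurable_EFinP; exact: continuous_measurable_fun.
- by apply: filterS h => x /= -> _.
Qed.

Lemma freq_wt_cc k : freq_wt k * mean (fun t => cosk k t * cosk k t) = 1 :> R.
Proof.
rewrite /freq_wt; case: k => [|k] /=.
  have -> : (fun t : R => cosk 0 t * cosk 0 t) = fun=> 1.
    by apply/funext => t; rewrite /cosk mul0r cos0 mulr1.
  by rewrite mean_cst mulr1.
by have [-> _ _] := @mean_cs_same R _ (ltn0Sn k); rewrite divff.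
Qed.
Lemma freq_wt_ss k (t : R) : freq_wt k * mean (fun t => sink k t * sink k t) * sink k t = sink k t.
Proof.
rewrite /freq_wt; case: k => [|k] /=; first by rewrite /sink mul0r sin0 mulr0.
by have [_ -> _] := @mean_cs_same R _ (ltn0Sn k); rewrite divff ?mul1r.
Qed.

(** [p] equals its own Fourier sum over the frequencies allowed at order [m]; this linear condition
    has to be checked on single cosines and sines only. *)
Definition own_sum m (p : R -> R) : Prop := per_Cq 0 p /\ forall t,
  \sum_(k < m.+1 | odd k == odd m)
    freq_wt k * (cosk k t * mean (fun t => cosk k t * p t) + sink k t * mean (fun t => sink k t * p t)) = p t.

Lemma own_sum_lin m (c d : R) p r : own_sum m p -> own_sum m r -> own_sum m (fun t => c * p t + d * r t).
Proof.
move=> [hp ep] [hr er]; split; first exact: per_CqD (per_CqZ c hp) (per_CqZ d hr).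
move=> t; rewrite -(ep t) -(er t) !mulr_sumr -big_split/=; apply: eq_bigr => k _.
have l (g : R -> R) : per_Cq 0 g -> mean (fun t => g t * (c * p t + d * r t)) =
    c * mean (fun t => g t * p t) + d * mean (fun t => g t * r t).
  move=> hg; rewrite -(mean_lin _ _ (per_CqM hg hp) (per_CqM hg hr)); congr mean.
  by apply/funext => t'; ring.
by rewrite (l _ (per_Cq_cosk 0 k)) (l _ (per_Cq_sink 0 k)); ring.
Qed.

Lemma own_sum_sum m (I : Type) (s : seq I) (p : I -> R -> R) : (forall i, own_sum m (p i)) ->
  own_sum m (fun t => \sum_(i <- s) p i t).
Proof.
move=> h; elim: s => [|i s IH].
  under eq_fun do rewrite big_nil; split; first exact: per_Cq_cst.
  move=> t; apply: big1 => k _.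
  have e (g : R -> R) : mean (fun t => g t * 0) = 0.
    by rewrite -[RHS](mean_cst 0); congr mean; apply/funext => t'; rewrite mulr0.
  by rewrite !e !mulr0 addr0 mulr0.
under eq_fun do rewrite big_cons -[p i _]mul1r -[\sum_(_ <- _) _]mul1r.
exact: own_sum_lin.
Qed.

Lemma own_sum_cos m k : (k <= m)%N -> odd k == odd m -> own_sum m (cosk k).
Proof.
move=> km ok; split; first exact: per_Cq_cosk.
have km' : (k < m.+1)%N by [].
move=> t; rewrite (bigD1 (Ordinal km'))//= big1 ?addr0 => [|l /andP[_ lk]].
  have -> : mean (fun t => sink k t * cosk k t) = 0 :> R.
    by rewrite -[RHS](mean_cs k k); congr mean; apply/funext => t'; rewrite mulrC.
  by rewrite mulr0 addr0 mulrCA freq_wt_cc mulr1.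
have lk' : val l != k by apply: contra lk => /eqP e; apply/eqP/val_inj.
rewrite mean_cc//; have -> : mean (fun t => sink l t * cosk k t) = 0 :> R.
  by rewrite -[RHS](mean_cs k l); congr mean; apply/funext => t'; rewrite mulrC.
by rewrite !mulr0 addr0 mulr0.
Qed.

Lemma own_sum_sin m k : (k <= m)%N -> odd k == odd m -> own_sum m (sink k).
Proof.
move=> km ok; split; first exact: per_Cq_sink.
have km' : (k < m.+1)%N by [].
move=> t; rewrite (bigD1 (Ordinal km'))//= big1 ?addr0 => [|l /andP[_ lk]].
  by rewrite mean_cs mulr0 add0r -[RHS]freq_wt_ss; ring.
have lk' : val l != k by apply: contra lk => /eqP e; apply/eqP/val_inj.
by rewrite mean_ss// mean_cs !mulr0 addr0 mulr0.
Qed.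

(** No measurability of [alpha] or [beta] is available. The expansion is therefore read on almost
    every slice of fixed s, where they are constants and the coefficients are recovered by
    integration in theta. *)
Lemma real_modes m u (I : finType) (kk : I -> nat) (alpha beta : I -> R -> R) : is_L2 u ->
  (forall i, (kk i <= m)%N /\ odd (kk i) == odd m) ->
  {ae area, forall z, u z = \sum_i (alpha i z.2 * cosk (kk i) z.1 + beta i z.2 * sink (kk i) z.1)} ->
  modes m (cls u).
Proof.
move=> hu hk hae; rewrite /modes Pms_cls//.
have LL (k : nat) : is_L2 (fun z => freq_wt k * (cosk k z.1 * avg (fun z => cosk k z.1 * u z) z +
    sink k z.1 * avg (fun z => sink k z.1 * u z) z)).
  have hc := L2_bmul (fC 0 k) hu; have hs := L2_bmul (fS 0 k) hu.
  by apply: L2Z; apply: L2D; [exact: L2_bmul (fC 0 k) (avg_L2 hc)|exact: L2_bmul (fS 0 k) (avg_L2 hs)].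
apply: cls_eq => //; first by apply: L2_sum => k _; exact: LL.
pose p (s t : R) := \sum_i (alpha i s * cosk (kk i) t + beta i s * sink (kk i) t).
have own s : own_sum m (p s).
  apply: own_sum_sum => i; have [k1 k2] := hk i.
  by apply: own_sum_lin; [exact: own_sum_cos|exact: own_sum_sin].
have key : {ae leb, forall s, forall g : R -> R, per_Cq 0 g ->
   (2 * pi)^-1 * \int[leb]_(t in circle) (g t * u (t, s)) = mean (fun t => g t * p s t)}.
  have h := ae_sections hae; apply: filterS h => s hs g hg.
  rewrite /mean; congr (_ * _).
  have lg : is_L2 (fun z => g z.1 * u z) := L2_bmul (per_Cq_fst hg) hu.
  apply: (avg_ae_slice (u := fun z => g z.1 * u z) lg).
    exact: per_Cq_cont (per_CqM hg (own s).1).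
  by apply: filterS hs => x /= ->.
have key2 := ae_snd key.
apply: filterS2 hae key2 => z /= -> hz; rewrite -[RHS](own z.2).2.
by apply: eq_bigr => k _; rewrite /avg /= (hz _ (per_Cq_cosk 0 k)) (hz _ (per_Cq_sink 0 k)).
Qed.

End FunctionModes.

Section ComplexModes.
Context {R : realType}.
Implicit Types (f g u : R * R -> R) (F G : R * R -> R[i]) (k l m n : nat).
Local Notation leb := (@lebesgue_measure R).

Definition cplx (a : R) : R[i] := (a%:C)%C.

(* [G] is the theta-derivative of the trigonometric polynomial [F]. *)
Definition hm2 m F G : Prop := exists c : nat -> R -> R[i],
  {ae area, forall z : R * R,
    F z = \sum_(n < m.+1) c n z.2 * expi (kap m n) z.1 /\
    G z = \sum_(n < m.+1) 'i%C * ((kap m n)%:~R : R[i]) * (c n z.2 * expi (kap m n) z.1)}.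
Definition hm m F : Prop := exists c : nat -> R -> R[i],
  {ae area, forall z : R * R, F z = \sum_(n < m.+1) c n z.2 * expi (kap m n) z.1}.

Lemma expiD (a b : int) (t : R) : expi (a + b) t = expi a t * expi b t.
Proof.
by rewrite /expi mulrzDr mulrDl cosD sinD; simpc; rewrite [in X in (_ +i* X)%C]addrC.
Qed.

Lemma hm0 m : hm m (fun=> 0).
Proof. by exists (fun _ _ => 0); apply: aeW => z; rewrite big1// => n _; rewrite mul0r. Qed.
Lemma hmD m F G : hm m F -> hm m G -> hm m (fun z => F z + G z).
Proof.
move=> [c hc] [d hd]; exists (fun n s => c n s + d n s).
by apply: filterS2 hc hd => z -> ->; rewrite -big_split/=; apply: eq_bigr => n _; rewrite mulrDl.
Qed.
Lemma hm_sum m (I : Type) (s : seq I) (P : pred I) (F : I -> R * R -> R[i]) : (forall i, P i -> hm m (F i)) ->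
  hm m (fun z => \sum_(i <- s | P i) F i z).
Proof.
move=> h; elim: s => [|i s IH]; first by under eq_fun do rewrite big_nil; exact: hm0.
case: (boolP (P i)) => Pi; last by under eq_fun do rewrite big_cons (negbTE Pi).
by under eq_fun do rewrite big_cons Pi; apply: hmD => //; exact: h.
Qed.
Lemma hm_single m n (c : R -> R[i]) : (n <= m)%N -> hm m (fun z => c z.2 * expi (kap m n) z.1).
Proof.
move=> nm; exists (fun n' s => if n' == n then c s else 0); apply: aeW => z.
have nm' : (n < m.+1)%N by [].
rewrite (bigD1 (Ordinal nm'))//= eqxx big1 ?addr0// => i ni.
by rewrite ifN ?mul0r//; apply: contra ni => /eqP e; apply/eqP/val_inj.
Qed.
Lemma hm_ae m F G : {ae area, forall z, G z = F z} -> hm m F -> hm m G.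
Proof. by move=> e [c hc]; exists c; apply: filterS2 e hc => z -> ->. Qed.

Lemma hm2_hm m F G : hm2 m F G -> hm m F.
Proof. by move=> [c hc]; exists c; apply: filterS hc => z []. Qed.
Lemma hm20 m : hm2 m (fun=> 0) (fun=> 0).
Proof.
exists (fun _ _ => 0); apply: aeW => z.
by rewrite !big1// => n _; rewrite !mul0r ?mulr0.
Qed.
Lemma hm2D m F G F' G' : hm2 m F G -> hm2 m F' G' -> hm2 m (fun z => F z + F' z) (fun z => G z + G' z).
Proof.
move=> [c hc] [d hd]; exists (fun n s => c n s + d n s).
apply: filterS2 hc hd => z [-> ->] [-> ->]; rewrite -!big_split/=.
by split; apply: eq_bigr => n _; rewrite mulrDl ?mulrDr.
Qed.
Lemma hm2_sum m (I : Type) (s : seq I) (P : pred I) (F G : I -> R * R -> R[i]) :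
  (forall i, P i -> hm2 m (F i) (G i)) ->
  hm2 m (fun z => \sum_(i <- s | P i) F i z) (fun z => \sum_(i <- s | P i) G i z).
Proof.
move=> h; elim: s => [|i s IH].
  by under eq_fun do rewrite big_nil; under [X in hm2 _ _ X]eq_fun do rewrite big_nil; exact: hm20.
case: (boolP (P i)) => Pi; last first.
  by under eq_fun do rewrite big_cons (negbTE Pi); under [X in hm2 _ _ X]eq_fun do rewrite big_cons (negbTE Pi).
under eq_fun do rewrite big_cons Pi; under [X in hm2 _ _ X]eq_fun do rewrite big_cons Pi.
by apply: hm2D => //; exact: h.
Qed.
Lemma hm2_single m n (c : R -> R[i]) : (n <= m)%N ->
  hm2 m (fun z => c z.2 * expi (kap m n) z.1)
        (fun z => 'i%C * ((kap m n)%:~R : R[i]) * (c z.2 * expi (kap m n) z.1)).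
Proof.
move=> nm; exists (fun n' s => if n' == n then c s else 0); apply: aeW => z.
have nm' : (n < m.+1)%N by [].
have dif (i : 'I_m.+1) : i != Ordinal nm' -> (val i == n) = false.
  by move=> ni; apply/negbTE; apply: contra ni => /eqP e; apply/eqP/val_inj.
split; rewrite (bigD1 (Ordinal nm'))//= eqxx big1 ?addr0// => i ni.
  by rewrite (dif _ ni) mul0r.
by rewrite (dif _ ni) mul0r mulr0.
Qed.
Lemma hm2_ae m F G F' G' : {ae area, forall z, F' z = F z} -> {ae area, forall z, G' z = G z} ->
  hm2 m F G -> hm2 m F' G'.
Proof. by move=> e e' [c hc]; exists c; apply: filterS3 e e' hc => z -> -> []. Qed.

Lemma kapD k l n n' : kap k n + kap l n' = kap (k + l) (n + n').
Proof. by rewrite /kap; lia. Qed.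

Lemma hmM k l F G : hm k F -> hm l G -> hm (k + l) (fun z => F z * G z).
Proof.
move=> [c hc] [d hd].
apply: (@hm_ae _ (fun z => \sum_(n < k.+1) \sum_(n' < l.+1) (c n z.2 * d n' z.2) * expi (kap (k + l) (n + n')) z.1)).
  apply: filterS2 hc hd => z -> ->; rewrite mulr_suml; apply: eq_bigr => n _.
  by rewrite mulr_sumr; apply: eq_bigr => n' _; rewrite -kapD expiD; ring.
apply: hm_sum => n _; apply: hm_sum => n' _.
by apply: (@hm_single _ _ (fun s => c n s * d n' s)); apply: leq_add; rewrite -ltnS.
Qed.

(* The extreme frequencies cancel. *)
Lemma hm_bracket k l m F G F' G' : (k + l = m + 2)%N -> hm2 k F F' -> hm2 l G G' ->
  hm m (fun z => (k%:R * l%:R) * (F z * G z) + F' z * G' z).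
Proof.
move=> klm [c hc] [d hd].
apply: (@hm_ae _ (fun z => \sum_(n < k.+1) \sum_(n' < l.+1)
   ((k%:R * l%:R - (kap k n)%:~R * (kap l n')%:~R) * (c n z.2 * d n' z.2)) * expi (kap (k + l) (n + n')) z.1)).
  apply: filterS2 hc hd => z [-> ->] [-> ->]; rewrite !mulr_suml mulr_sumr -big_split/=.
  apply: eq_bigr => n _; rewrite !mulr_sumr -big_split/=; apply: eq_bigr => n' _.
  rewrite -kapD expiD.
  have i2 : 'i%C * 'i%C = -1 :> R[i] by rewrite -expr2 sqr_i.
  transitivity (k%:R * l%:R * (c n z.2 * expi (kap k n) z.1 * (d n' z.2 * expi (kap l n') z.1)) +
    ('i%C * 'i%C) * ((kap k n)%:~R * (kap l n')%:~R * (c n z.2 * d n' z.2) * (expi (kap k n) z.1 * expi (kap l n') z.1)) : R[i]); first by ring.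
  by rewrite i2; ring.
apply: hm_sum => n _; apply: hm_sum => n' _.
have [e0|ne0] := eqVneq (k%:R * l%:R - (kap k n)%:~R * (kap l n')%:~R : R[i]) 0.
  by apply: hm_ae (hm0 m); apply: aeW => z; rewrite e0 !mul0r.
have n1 := ltn_ord n; have n2 := ltn_ord n'.
have nn0 : (0 < n + n')%N.
  rewrite lt0n; apply: contra ne0; rewrite addn_eq0 => /andP[/eqP -> /eqP ->].
  by rewrite /kap !mul0rn !sub0r !intrN mulrNN subrr.
have nnm : (n + n' <= m.+1)%N.
  rewrite leqNgt; apply: contra ne0 => h.
  have -> : (n : nat) = k by lia.
  have -> : (n' : nat) = l by lia.
  have e (j : nat) : kap j j = j%:Z by rewrite /kap; lia.
  by rewrite !e subrr.
(* Since [k + l = m + 2], the index [n + n'] at order [k + l] and its predecessor at order [m]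
   denote the same frequency. *)
have -> : (fun z => ((k%:R * l%:R - (kap k n)%:~R * (kap l n')%:~R) * (c n z.2 * d n' z.2)) * expi (kap (k + l) (n + n')) z.1) =
  (fun z : R * R => ((k%:R * l%:R - (kap k n)%:~R * (kap l n')%:~R) * (c n z.2 * d n' z.2)) * expi (kap m (n + n').-1) z.1).
  by apply/funext => z; congr (_ * expi _ _); rewrite /kap klm; lia.
apply: (@hm_single _ _ (fun s => (k%:R * l%:R - (kap k n)%:~R * (kap l n')%:~R) * (c n s * d n' s))).
by lia.
Qed.

Lemma cos_int (k : int) (t : R) : cos (k%:~R * t) = cosk `|k|%N t.
Proof.
by case: k => n; rewrite /cosk//= NegzE mulrNz mulNr cosN.
Qed.
Lemma sin_int (k : int) (t : R) : sin (k%:~R * t) = (sgz k)%:~R * sink `|k|%N t.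
Proof.
case: k => [[|n]|n]; rewrite /sink.
- by rewrite !mul0r sin0.
- by rewrite mul1r.
- by rewrite NegzE mulrNz mulNr sinN /= mulN1r.
Qed.

Lemma hm_modes m u : is_L2 u -> hm m (fun z => cplx (u z)) -> modes m (cls u).
Proof.
move=> hu [c hc].
have H := @real_modes R m u 'I_m.+1 (fun n : 'I_m.+1 => `|kap m n|%N) (fun (n : 'I_m.+1) s => complex.Re (c n s))
   (fun (n : 'I_m.+1) s => - (sgz (kap m n))%:~R * complex.Im (c n s)) hu.
apply: H.
  by move=> i; have := ltn_ord i; rewrite /kap; lia.
apply: filterS hc => z /(congr1 (@complex.Re R)) /= ->.
rewrite raddf_sum; apply: eq_bigr => n _ /=.
rewrite /expi; case: (c n z.2) => a b /=; rewrite cos_int sin_int; ring.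
Qed.

Lemma hm2_pair m k (A B : R -> R) : (k <= m)%N -> odd k == odd m ->
  hm2 m (fun z => cplx (freq_wt k * (cosk k z.1 * A z.2 + sink k z.1 * B z.2)))
        (fun z => cplx (freq_wt k * k%:R * (cosk k z.1 * B z.2 - sink k z.1 * A z.2))).
Proof.
(* The frequencies [k] and [-k] have the indices [(m + k) / 2] and [(m - k) / 2], exact by parity.
   For [k = 0] the two coincide and each carries half of the coefficient. *)
move=> km ok; pose n1 := ((m + k)./2)%N; pose n2 := ((m - k)./2)%N.
have e1 : kap m n1 = k%:Z by rewrite /kap /n1; lia.
have e2 : kap m n2 = - k%:Z by rewrite /kap /n2; lia.
have l1 : (n1 <= m)%N by rewrite /n1; lia.
have l2 : (n2 <= m)%N by rewrite /n2; lia.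
pose c1 s : R[i] := (freq_wt k / 2 * A s -i* (freq_wt k / 2 * B s))%C.
pose c2 s : R[i] := (freq_wt k / 2 * A s +i* (freq_wt k / 2 * B s))%C.
have := hm2D (hm2_single c1 l1) (hm2_single c2 l2); apply: hm2_ae; apply: aeW => z; rewrite e1 e2.
  rewrite /c1 /c2 /expi mulrNz mulNr cosN sinN /cplx /cosk /sink; simpc.
  by apply/eqP; rewrite eq_complex/=; apply/andP; split; apply/eqP; field.
rewrite /c1 /c2 /expi !mulrNz mulNr cosN sinN /cplx /cosk /sink.
have -> : (k%:Z%:~R : R[i]) = (k%:R)%:C%C by rewrite -pmulrn -(rmorph_nat (real_complex R)).
rewrite -rmorphN /=; simpc.
by apply/eqP; rewrite eq_complex/=; apply/andP; split; apply/eqP; field.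
Qed.

(** The function and its weak derivative are expanded with the same coefficients, averages against
    cosines and sines, so that [hm_bracket] can be applied to both at once. *)
Lemma modes_hm2 m u : is_L2 u -> modes m (cls u) ->
  hm2 m (fun z => cplx (u z)) (fun z => cplx (wdtheta u z)).
Proof.
move=> hu mu.
pose A k s : R := (2 * pi)^-1 * \int[leb]_(t in circle) (cosk k t * u (t, s)).
pose B k s : R := (2 * pi)^-1 * \int[leb]_(t in circle) (sink k t * u (t, s)).
have LC k := L2_bmul (fC 0 k) hu; have LS k := L2_bmul (fS 0 k) hu.
have LA k : is_L2 (fun z : R * R => A k z.2) := avg_L2 (LC k).
have LB k : is_L2 (fun z : R * R => B k z.2) := avg_L2 (LS k).
pose U z := \sum_(k < m.+1 | odd k == odd m) freq_wt k * (cosk k z.1 * A k z.2 + sink k z.1 * B k z.2).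
pose U' z := \sum_(k < m.+1 | odd k == odd m) freq_wt k * k%:R * (cosk k z.1 * B k z.2 - sink k z.1 * A k z.2).
have LU : is_L2 U.
  apply: L2_sum => k _; apply: L2Z; apply: L2D; [exact: L2_bmul (fC 0 k) (LA k)|exact: L2_bmul (fS 0 k) (LB k)].
have LU' : is_L2 U'.
  apply: L2_sum => k _; apply: L2Z; apply: L2B; [exact: L2_bmul (fC 0 k) (LB k)|exact: L2_bmul (fS 0 k) (LA k)].
have uU : aeeq u U by apply: cls_inj => //; rewrite -[LHS]mu Pms_cls.
have uU' : aeeq (wdtheta u) U'.
  apply: cls_inj; [exact: wdtheta_L2|exact: LU'|].
  rewrite (wdtheta_cls hu) (D1E (modes_W1J mu)) /U' cls_sum; last first.
    by move=> k _; apply: L2Z; apply: L2B; [exact: L2_bmul (fC 0 k) (LB k)|exact: L2_bmul (fS 0 k) (LA k)].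
  apply: eq_bigr => k _; rewrite clsZ; last first.
    by apply: L2B; [exact: L2_bmul (fC 0 k) (LB k)|exact: L2_bmul (fS 0 k) (LA k)].
  rewrite clsB; [|exact: L2_bmul (fC 0 k) (LB k)|exact: L2_bmul (fS 0 k) (LA k)].
  rewrite /Jk /ccoef /scoef (bmul_cls (fC 0 k) hu) (bmul_cls (fS 0 k) hu) (Eav_cls (LC k)) (Eav_cls (LS k)).
  by rewrite (bmul_cls (fC 0 k) (LB k)) (bmul_cls (fS 0 k) (LA k)).
have := @hm2_sum m _ (index_enum 'I_m.+1) (fun k : 'I_m.+1 => odd k == odd m) _ _
  (fun (k : 'I_m.+1) ok => @hm2_pair m k (A k) (B k) (ltn_ord k : (k <= m)%N) ok).
apply: hm2_ae.
  by apply: filterS uU => z ->; rewrite /cplx /U rmorph_sum.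
by apply: filterS uU' => z ->; rewrite /cplx /U' rmorph_sum.
Qed.

Lemma has_modesP m u : is_L2 u -> hm m (fun z => cplx (u z)) <-> modes m (cls u).
Proof. by move=> hu; split; [exact: hm_modes|move=> /(modes_hm2 hu)/hm2_hm]. Qed.

(** On almost every slice the function is a combination of [cos(m theta)] and [sin(m theta)], so all
    other projections vanish by orthogonality. *)
Lemma extremal_Pk m u : is_L2 u ->
  (exists c0 c1 : R -> R[i], {ae area, forall z : R * R, ((u z)%:C)%C =
      c0 z.2 * expi (- m%:Z) z.1 + c1 z.2 * expi m%:Z z.1}) -> Pk m (cls u) = cls u.
Proof.
move=> hu [c0 [c1 hc]].
have mx : modes m (cls u).
  apply: hm_modes => //; have h0 : kap m 0 = - m%:Z by rewrite /kap; lia.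
  have h1 : kap m m = m%:Z by rewrite /kap; lia.
  have := hmD (hm_single c0 (leq0n m)) (hm_single c1 (leqnn m)).
  by rewrite h0 h1; apply: hm_ae.
pose al s := complex.Re (c0 s) + complex.Re (c1 s); pose be s := complex.Im (c0 s) - complex.Im (c1 s).
have hr : {ae area, forall z, u z = al z.2 * cosk m z.1 + be z.2 * sink m z.1}.
  apply: filterS hc => z /(congr1 (@complex.Re R)) /= ->.
  rewrite /expi /al /be mulrNz mulNr cosN sinN /cosk /sink.
  case: (c0 z.2) => a b; case: (c1 z.2) => a' b' /=; rewrite /= -pmulrn; ring.
have Pk0' k : k != m -> Pk k (cls u) = 0.
  move=> km; rewrite Pk_cls// -cls0; apply: cls_eq; [|exact: L2_0|].
    have hc' := L2_bmul (fC 0 k) hu; have hs := L2_bmul (fS 0 k) hu.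
    by apply: L2Z; apply: L2D; [exact: L2_bmul (fC 0 k) (avg_L2 hc')|exact: L2_bmul (fS 0 k) (avg_L2 hs)].
  pose p (s t : R) := al s * cosk m t + be s * sink m t.
  have hp s : per_Cq 0 (p s).
    by apply: per_CqD; apply: per_CqZ; [exact: per_Cq_cosk|exact: per_Cq_sink].
  have key : {ae leb, forall s, forall g : R -> R, per_Cq 0 g ->
     (2 * pi)^-1 * \int[leb]_(t in circle) (g t * u (t, s)) = mean (fun t => g t * p s t)}.
    have h := ae_sections hr; apply: filterS h => s hs g hg.
    rewrite /mean; congr (_ * _).
    have lg : is_L2 (fun z => g z.1 * u z) := L2_bmul (per_Cq_fst hg) hu.
    apply: (avg_ae_slice (u := fun z => g z.1 * u z) lg).
      exact: per_Cq_cont (per_CqM hg (hp s)).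
    by apply: filterS hs => x /= ->.
  have lin s (g : R -> R) : per_Cq 0 g -> mean (fun t => g t * p s t) =
      al s * mean (fun t => g t * cosk m t) + be s * mean (fun t => g t * sink m t).
    move=> hg; rewrite -(mean_lin _ _ (per_CqM hg (per_Cq_cosk 0 m)) (per_CqM hg (per_Cq_sink 0 m))).
    by congr mean; apply/funext => t; rewrite /p; ring.
  apply: filterS (ae_snd key) => z hz; rewrite /avg /= (hz _ (per_Cq_cosk 0 k)) (hz _ (per_Cq_sink 0 k)).
  rewrite (lin _ _ (per_Cq_cosk 0 k)) (lin _ _ (per_Cq_sink 0 k)) mean_cc// mean_ss// mean_cs.
  have -> : mean (fun t => sink k t * cosk m t) = 0 :> R.
    by rewrite -[RHS](mean_cs m k); congr mean; apply/funext => t'; rewrite mulrC.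
  by rewrite !mulr0 !addr0 !mulr0 !addr0 mulr0.
rewrite -[RHS]mx /Pms (bigD1 (ord_max : 'I_m.+1))//= big1 ?addr0 ?scale1r// => k /andP[_ km].
rewrite Pk0' ?scaler0//; apply: contra km => /eqP e; apply/eqP/val_inj; exact: e.
Qed.

Lemma ae_snd_inv (Q : R -> Prop) : {ae area, forall z : R * R, Q z.2} -> {ae leb, forall y, Q y}.
Proof.
move=> /ae_sections; apply: filterS => y h.
apply: contrapT => nQ; have [N [mN N0 NP]] := h.
have : leb circle = 0%E.
  apply: (@subset_measure0 _ (measurableTypeR R) R leb _ N) => //; first exact: measurable_circle.
  by move=> t _; apply: NP.
rewrite /circle lebesgue_measure_itv/= lte_fin two_pi_gt0 sube0 => -[] e.
by have := @two_pi_gt0 R; rewrite e ltxx.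
Qed.

Lemma fourier_cos u m (z : R * R) :
  complex.Re (fourier_theta u m%:Z z.2) = avg (fun z => ffst (cosk m) z * u z) z.
Proof. by congr (_ * _); congr Rintegral; apply/funext => x; rewrite mulrC -pmulrn. Qed.
Lemma fourier_sin u m (z : R * R) :
  complex.Im (fourier_theta u m%:Z z.2) = - avg (fun z => ffst (sink m) z * u z) z.
Proof. by congr (- (_ * _)); congr Rintegral; apply/funext => x; rewrite mulrC -pmulrn. Qed.
Lemma fourier_cosN u m (z : R * R) :
  complex.Re (fourier_theta u (- m%:Z) z.2) = avg (fun z => ffst (cosk m) z * u z) z.
Proof.
by congr (_ * _); congr Rintegral; apply/funext => x; rewrite mulrC mulrNz mulNr cosN -pmulrn.
Qed.
Lemma fourier_sinN u m (z : R * R) :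
  complex.Im (fourier_theta u (- m%:Z) z.2) = - avg (fun z => (-1 * ffst (sink m) z) * u z) z.
Proof.
congr (- (_ * _)); congr Rintegral; apply/funext => x.
have e : sin ((- m%:Z)%:~R * x) = - sink m x by rewrite mulrNz mulNr sinN -pmulrn.
by rewrite e mulN1r mulrC.
Qed.

(** For real functions the coefficients of the frequencies [m] and [-m] have, up to sign, the
    averages against [cos] and [sin] as real and imaginary parts; these averages are recovered from
    [Pk m] by [coef_Pk]. *)
Lemma initial_dataP m u v : is_L2 u -> is_L2 v ->
  {ae leb, forall s,
    fourier_theta u (- m%:Z) s = fourier_theta v (- m%:Z) s /\
    fourier_theta u m%:Z s = fourier_theta v m%:Z s} <-> Pk m (cls u) = Pk m (cls v).
Proof.
move=> hu hv.
have LC w := @L2_bmul R 0 _ w (fC 0 m); have LS w := @L2_bmul R 0 _ w (fS 0 m).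
split=> h.
  rewrite /Pk /ccoef /scoef.
  suff [-> ->] : Eav (bmul (ffst (cosk m)) (cls u)) = Eav (bmul (ffst (cosk m)) (cls v)) /\
     Eav (bmul (ffst (sink m)) (cls u)) = Eav (bmul (ffst (sink m)) (cls v)) by [].
  rewrite !(bmul_cls (fC 0 m))// !(bmul_cls (fS 0 m))// !Eav_cls; [|exact: LS|exact: LS|exact: LC|exact: LC].
  split; (apply: cls_eq; [apply: avg_L2|apply: avg_L2|apply: filterS (ae_snd h) => z [_]]);
    [exact: LC|exact: LC| |exact: LS|exact: LS|].
  - by move=> /(congr1 (@complex.Re R)); rewrite !fourier_cos.
  - by move=> /(congr1 (@complex.Im R)); rewrite !fourier_sin => /oppr_inj.
have cu := (coef_Pk m (cls u)); have cv := coef_Pk m (cls v).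
have : ccoef m (cls u) = ccoef m (cls v) /\ scoef m (cls u) = scoef m (cls v).
  by rewrite -cu.1 -cv.1 -cu.2 -cv.2 h.
rewrite /ccoef /scoef !(bmul_cls (fC 0 m))// !(bmul_cls (fS 0 m))// !Eav_cls; [|exact: LS|exact: LS|exact: LC|exact: LC].
move=> [/cls_inj e1 /cls_inj e2].
have {}e1 := e1 (avg_L2 (LC _ hu)) (avg_L2 (LC _ hv)); have {}e2 := e2 (avg_L2 (LS _ hu)) (avg_L2 (LS _ hv)).
have hn := is_CqZ (-1) (@fS R 0 m).
have e3 : aeeq (avg (fun z => (-1 * ffst (sink m) z) * u z)) (avg (fun z => (-1 * ffst (sink m) z) * v z)).
  have [LN LN'] := (L2_bmul hn hu, L2_bmul hn hv).
  apply: cls_inj; [exact: avg_L2|exact: avg_L2|].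
  rewrite -!Eav_cls// -!(bmul_cls hn)// !(bmulZl _ _ (fS 0 m)) !EavZ; congr (_ *: _).
  by rewrite !(bmul_cls (fS 0 m))// !Eav_cls; [apply: cls_eq e2; exact/avg_L2/LS|exact: LS|exact: LS].
apply: ae_snd_inv; apply: filterS3 e1 e2 e3 => z h1 h2 h3.
split; apply/eqP; rewrite eq_complex; apply/andP; split; apply/eqP.
- by rewrite (fourier_cosN u m z) (fourier_cosN v m z).
- by rewrite (fourier_sinN u m z) (fourier_sinN v m z) h3.
- by rewrite (fourier_cos u m z) (fourier_cos v m z).
- by rewrite (fourier_sin u m z) (fourier_sin v m z) h2.
Qed.

End ComplexModes.

(** * Elliptic regularity *)

Section ConstantCoefficients.
Context {R : realType}.
Implicit Types (x y : L2class R) (k l m n d : nat) (z w : R[i]).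
Local Notation V := (L2class R).
Local Notation VV := (V * V)%type.
Implicit Types (X Y : VV).

Lemma modes_D1D2 m x : modes m x -> Hr 1 x -> D1 (D2 x) = D2 (D1 x) /\ W2 (D1 x) (D2 (D1 x)).
Proof.
move=> mx hx; have m2 := modes_W2 (Hr_W2 hx) mx.
have w := W_exchange' (Hr_W2 hx) (modes_D1 m2) (modes_D1 mx).
by rewrite (D2E w).
Qed.

Lemma dot_cross m x y : modes m y -> Hr 1 x -> Hr 1 y -> dot (D2 x) (D1 y) = dot (D1 x) (D2 y).
Proof.
move=> my hx hy; have [c w] := modes_D1D2 my hy; have my2 := modes_W2 (Hr_W2 hy) my.
have := W2_parts (Hr_W2 hx) w; have := W1_parts (Hr_W1 hx) (modes_D1 my2); rewrite c; lra.
Qed.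

Definition dd1 X : VV := (D1 X.1, D1 X.2).
Definition dd2 X : VV := (D2 X.1, D2 X.2).
(* [V * V] is the complexification of [V], and [cs] its multiplication by scalars. *)
Definition cs z X : VV := (complex.Re z *: X.1 - complex.Im z *: X.2, complex.Re z *: X.2 + complex.Im z *: X.1).
Definition q2 X : R := dot X.1 X.1 + dot X.2 X.2.
Definition n2 X : R := Num.sqrt (q2 X).
Definition HH r X : Prop := Hr r X.1 /\ Hr r X.2.
Definition mm m X : Prop := modes m X.1 /\ modes m X.2.
(** The first-order factor [d_s - z d_theta] that a root [z] of the symbol contributes to a
    homogeneous operator. *)
Definition Az z X : VV := dd2 X - cs z (dd1 X).

Lemma q2_ge0 X : 0 <= q2 X. Proof. by rewrite addr_ge0 ?dot_ge0. Qed.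
Lemma sqr_n2 X : n2 X ^+ 2 = q2 X. Proof. by rewrite sqr_sqrtr ?q2_ge0. Qed.
Lemma n2_ge0 X : 0 <= n2 X. Proof. exact: sqrtr_ge0. Qed.

(** The mixed term is a multiple of [<D2 X1, D1 X2> - <D1 X1, D2 X2>], which vanishes on integrating
    by parts twice. For [Im z != 0] the factor therefore controls both first derivatives. *)
Lemma Az_ident m z X : mm m X -> HH 1 X ->
  q2 (Az z X) = q2 (dd2 X - complex.Re z *: dd1 X) + complex.Im z ^+ 2 * q2 (dd1 X).
Proof.
move=> [m1 m2] [h1 h2]; rewrite /q2 /Az /cs /dd1 /dd2 /=.
rewrite !(dotBl, dotBr, dotDl, dotDr, dotZl, dotZr, dotNl, dotNr).
have c := dot_cross m2 h1 h2.
rewrite (dotC (D1 X.1) (D2 X.1)) (dotC (D1 X.2) (D2 X.2)) (dotC (D2 X.2) (D1 X.1)) (dotC (D1 X.2) (D2 X.1)).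
rewrite (dotC (D1 X.2) (D1 X.1)) c; ring.
Qed.

Lemma q2_add_le X Y : q2 (X + Y) <= 2 * q2 X + 2 * q2 Y.
Proof.
have e := q2_ge0 (X - Y); move: e.
rewrite /q2 /= !(dotBl, dotBr, dotDl, dotDr, dotNl, dotNr) (dotC Y.1 X.1) (dotC Y.2 X.2).
move: (dot X.1 X.1) (dot X.2 X.2) (dot Y.1 Y.1) (dot Y.2 Y.2) (dot X.1 Y.1) (dot X.2 Y.2) => a b c d e f; lra.
Qed.

Lemma Az_bound m z X (del B : R) : 0 < del -> del <= `|complex.Im z| -> `|complex.Re z| <= B -> mm m X -> HH 1 X ->
  n2 (dd1 X) + n2 (dd2 X) <= (1 / del + 2 * (1 + B / del)) * n2 (Az z X).
Proof.
move=> d0 hd hB mX hX; have e := Az_ident z mX hX.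
set t := n2 (Az z X); have t0 : 0 <= t := n2_ge0 _.
have B0 : 0 <= B := le_trans (normr_ge0 _) hB.
have Bd0 : 0 <= B / del by rewrite divr_ge0// ltW.
set a := complex.Re z in e hB; set b := complex.Im z in e hd.
have q0 := q2_ge0 (dd1 X); have q1 := q2_ge0 (dd2 X - a *: dd1 X).
have et : q2 (Az z X) = t ^+ 2 by rewrite sqr_n2.
have hb : del ^+ 2 <= b ^+ 2 by rewrite -[leRHS]real_normK ?num_real// ler_pXn2r ?nnegrE// ltW.
have h1 : n2 (dd1 X) <= t / del.
  have td0 : 0 <= t / del by rewrite divr_ge0// ltW.
  rewrite -(@ler_pXn2r _ 2)// ?nnegrE ?n2_ge0// sqr_n2 expr_div_n ler_pdivlMr ?exprn_gt0//.
  have : q2 (dd1 X) * del ^+ 2 <= q2 (dd1 X) * b ^+ 2 by rewrite ler_wpM2l.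
  move: e; rewrite et; lra.
have h2 : n2 (dd2 X) <= 2 * (1 + B / del) * t.
  have T0 : 0 <= 2 * (1 + B / del) * t by rewrite !mulr_ge0// addr_ge0.
  rewrite -(@ler_pXn2r _ 2)// ?nnegrE ?n2_ge0// sqr_n2.
  have s1 : q2 (dd2 X) <= 2 * q2 (dd2 X - a *: dd1 X) + 2 * (a ^+ 2 * q2 (dd1 X)).
    have := q2_add_le (dd2 X - a *: dd1 X) (a *: dd1 X); rewrite subrK.
    have -> // : q2 (a *: dd1 X) = a ^+ 2 * q2 (dd1 X).
    by rewrite /q2 /= !dotZl !dotZr; ring.
  have s2 : q2 (dd2 X - a *: dd1 X) <= t ^+ 2.
    by rewrite -et e lerDl mulr_ge0// sqr_ge0.
  have s3 : a ^+ 2 * q2 (dd1 X) <= (B / del * t) ^+ 2.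
    have Bt0 : 0 <= B / del * t by rewrite mulr_ge0.
    rewrite -sqr_n2 -[leLHS]exprMn -[leLHS]real_normK ?num_real// ler_pXn2r ?nnegrE//.
    rewrite normrM (ger0_norm (n2_ge0 _)) -mulrA [del^-1 * t]mulrC; apply: ler_pM => //; exact: n2_ge0.
  have p : 0 <= B / del * t ^+ 2 by rewrite mulr_ge0// sqr_ge0.
  have := sqr_ge0 t; have := sqr_ge0 (B / del * t).
  have -> : (2 * (1 + B / del) * t) ^+ 2 = 4 * t ^+ 2 + 8 * (B / del * t ^+ 2) + 4 * (B / del * t) ^+ 2 by ring.
  by move: s1 s2 s3 p; lra.
by rewrite mulrDl; apply: lerD => //; rewrite mul1r mulrC.
Qed.

Lemma cs_lin z (c : R) X Y : cs z (c *: X + Y) = c *: cs z X + cs z Y.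
Proof. by congr pair; rewrite /cs /=; linear_identity. Qed.

Lemma HH_cs r z X : HH r X -> HH r (cs z X).
Proof. by move=> [h1 h2]; split=> /=; [apply: HrB|apply: HrD]; exact: HrZ. Qed.
Lemma mm_cs m z X : mm m X -> mm m (cs z X).
Proof. by move=> [h1 h2]; split=> /=; [apply: modesB|apply: modesD]; exact: modesZ. Qed.
Lemma HH_dd1 r X : HH r.+1 X -> HH r (dd1 X). Proof. by move=> [h1 h2]; split; exact: Hr_D1. Qed.
Lemma HH_dd2 r X : HH r.+1 X -> HH r (dd2 X). Proof. by move=> [h1 h2]; split; exact: Hr_D2. Qed.
Lemma HH_le r r' X : (r' <= r)%N -> HH r X -> HH r' X.
Proof. by move=> rr [h1 h2]; split; exact: Hr_le rr _. Qed.
Lemma mm_dd1 m X : mm m X -> mm m (dd1 X). Proof. by move=> [h1 h2]; split; exact: modes_modes_D1. Qed.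
Lemma mm_dd2 r m X : HH r.+1 X -> mm m X -> mm m (dd2 X).
Proof. by move=> [h1 h2] [m1 m2]; split; [exact: modes_W2 (Hr_W2 h1) m1|exact: modes_W2 (Hr_W2 h2) m2]. Qed.
Lemma HHB r X Y : HH r X -> HH r Y -> HH r (X - Y).
Proof. by move=> [h1 h2] [h3 h4]; split; exact: HrB. Qed.
Lemma mmB m X Y : mm m X -> mm m Y -> mm m (X - Y).
Proof. by move=> [h1 h2] [h3 h4]; split; exact: modesB. Qed.
Lemma HH_Az r z X : HH r.+1 X -> HH r (Az z X).
Proof. by move=> h; apply: HHB; [exact: HH_dd2|apply: HH_cs; exact: HH_dd1]. Qed.
Lemma mm_Az r m z X : HH r.+1 X -> mm m X -> mm m (Az z X).
Proof. by move=> h hm; apply: mmB; [exact: mm_dd2 h hm|apply: mm_cs; exact: mm_dd1]. Qed.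

Lemma dd1_lin r (c : R) X Y : HH r.+1 X -> HH r.+1 Y -> dd1 (c *: X + Y) = c *: dd1 X + dd1 Y.
Proof. by move=> [h1 h2] [h3 h4]; congr pair; rewrite /=; [rewrite (D1_lin c h1 h3)|rewrite (D1_lin c h2 h4)]. Qed.
Lemma dd2_lin r (c : R) X Y : HH r.+1 X -> HH r.+1 Y -> dd2 (c *: X + Y) = c *: dd2 X + dd2 Y.
Proof. by move=> [h1 h2] [h3 h4]; congr pair; rewrite /=; [rewrite (D2_lin c h1 h3)|rewrite (D2_lin c h2 h4)]. Qed.
Lemma cs_dd1 r z X : HH r.+1 X -> dd1 (cs z X) = cs z (dd1 X).
Proof.
move=> [h1 h2]; congr pair; rewrite /=.
  by rewrite (D1B (HrZ _ h1) (HrZ _ h2)) (D1Z _ h1) (D1Z _ h2).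
by rewrite (D1D (HrZ _ h2) (HrZ _ h1)) (D1Z _ h1) (D1Z _ h2).
Qed.
Lemma cs_dd2 r z X : HH r.+1 X -> dd2 (cs z X) = cs z (dd2 X).
Proof.
move=> [h1 h2]; congr pair; rewrite /=.
  by rewrite (D2B (HrZ _ h1) (HrZ _ h2)) (D2Z _ h1) (D2Z _ h2).
by rewrite (D2D (HrZ _ h2) (HrZ _ h1)) (D2Z _ h1) (D2Z _ h2).
Qed.
Lemma dd_comm m X : mm m X -> HH 1 X -> dd1 (dd2 X) = dd2 (dd1 X).
Proof.
by move=> [m1 m2] [h1 h2]; congr pair; rewrite /=; [case: (modes_D1D2 m1 h1)|case: (modes_D1D2 m2 h2)].
Qed.
Lemma HH_modes_dd1 r m X : mm m X -> HH r X -> HH r (dd1 X).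
Proof. by move=> [m1 m2] [h1 h2]; split; [exact: modes_Hr_D1 m1 h1|exact: modes_Hr_D1 m2 h2]. Qed.

Lemma Az_dd1 m z X : mm m X -> HH 1 X -> Az z (dd1 X) = dd1 (Az z X).
Proof.
move=> mX hX; rewrite /Az -(dd_comm mX hX).
have h1 := HH_modes_dd1 mX hX.
have m2 := mm_dd2 hX mX.
have W : dd1 (dd2 X - cs z (dd1 X)) = dd1 (dd2 X) - dd1 (cs z (dd1 X)).
  have [a1 a2] := m2; have [b1 b2] := mm_cs z (mm_dd1 mX).
  congr pair; rewrite /=; apply: D1E.
    by have := W1_lin (-1) (modes_D1 b1) (modes_D1 a1); rewrite !scaleN1r addrC [X in W1 _ X]addrC.
  by have := W1_lin (-1) (modes_D1 b2) (modes_D1 a2); rewrite !scaleN1r addrC [X in W1 _ X]addrC.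
by rewrite W (cs_dd1 z h1).
Qed.
Lemma Az_dd2 z X : HH 2 X -> Az z (dd2 X) = dd2 (Az z X).
Proof.
move=> hX; rewrite /Az.
have h1 := HH_dd1 hX; have h2 := HH_dd2 hX.
have -> : dd2 (dd2 X - cs z (dd1 X)) = dd2 (dd2 X) - cs z (dd2 (dd1 X)).
  have [a1 a2] := h2; have [b1 b2] := HH_cs z h1.
  by rewrite -(cs_dd2 z h1); congr pair; rewrite /=; [exact: D2B a1 b1|exact: D2B a2 b2].
by congr (_ - cs z _); congr pair; rewrite /=; [exact: DC hX.1|exact: DC hX.2].
Qed.

Fixpoint Aprod (zs : seq R[i]) X : VV := if zs is z :: zs' then Az z (Aprod zs' X) else X.

Lemma HH_Aprod r zs X : HH (size zs + r) X -> HH r (Aprod zs X).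
Proof.
elim: zs r => [//|z zs IH] r /= h; apply: HH_Az; apply: IH.
by rewrite addnS.
Qed.
Lemma mm_Aprod m zs X : HH (size zs) X -> mm m X -> mm m (Aprod zs X).
Proof.
elim: zs => [//|z zs IH] /= h mX.
have h1 : HH (size zs + 1) X by rewrite addn1.
apply: (mm_Az z (HH_Aprod h1)); apply: IH => //; exact: HH_le h.
Qed.
Lemma Aprod_dd1 m zs X : HH (size zs) X -> mm m X -> Aprod zs (dd1 X) = dd1 (Aprod zs X).
Proof.
elim: zs => [//|z zs IH] /= h mX.
have h1 : HH (size zs + 1) X by rewrite addn1.
have h0 : HH (size zs) X by exact: HH_le h.
by rewrite IH// (Az_dd1 z (mm_Aprod h0 mX) (HH_Aprod h1)).
Qed.
Lemma Aprod_dd2 zs X : HH (size zs).+1 X -> Aprod zs (dd2 X) = dd2 (Aprod zs X).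
Proof.
elim: zs => [//|z zs IH] /= h.
have h2 : HH (size zs + 2) X by rewrite addn2.
by rewrite IH ?(Az_dd2 z (HH_Aprod h2))//; exact: HH_le h.
Qed.

Fixpoint SS k X : R := if k is k'.+1 then SS k' (dd1 X) + SS k' (dd2 X) else n2 X.

(** The factors commute with both derivatives, so they are peeled off one at a time, each at the
    cost of the constant of [Az_bound]. *)
Lemma SS_Aprod m (del B : R) zs X : 0 < del -> 0 <= B ->
  (forall z, z \in zs -> del <= `|complex.Im z| /\ `|complex.Re z| <= B) ->
  mm m X -> HH (size zs) X ->
  SS (size zs) X <= (1 / del + 2 * (1 + B / del)) ^+ size zs * n2 (Aprod zs X).
Proof.
move=> d0 B0; set K := 1 / del + _.
have K0 : 0 <= K.
  have d1 : 0 <= 1 / del by rewrite divr_ge0// ltW.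
  have d2 : 0 <= B / del by rewrite divr_ge0// ltW.
  by rewrite /K; lra.
elim: zs X => [|z zs IH] X hz mX hX /=; first by rewrite expr0 mul1r.
have hz' : forall z, z \in zs -> del <= `|complex.Im z| /\ `|complex.Re z| <= B.
  by move=> w wz; apply: hz; rewrite inE wz orbT.
have [hz1 hz2] := hz z (mem_head _ _).
have a1 := IH (dd1 X) hz' (mm_dd1 mX) (HH_dd1 hX).
have a2 := IH (dd2 X) hz' (mm_dd2 hX mX) (HH_dd2 hX).
have h0 : HH (size zs) X by exact: HH_le hX.
have h1 : HH (size zs + 1) X by rewrite addn1.
rewrite (Aprod_dd1 h0 mX) in a1; rewrite (Aprod_dd2 hX) in a2.
have b := Az_bound d0 hz1 hz2 (mm_Aprod h0 mX) (HH_Aprod h1).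
apply: le_trans (lerD a1 a2) _; rewrite -mulrDr exprSr -mulrA.
by apply: ler_wpM2l b; exact: exprn_ge0.
Qed.

End ConstantCoefficients.

Import Normc.

Section PolynomialAction.
Context {R : realType}.
Implicit Types (x y : L2class R) (k l m n d : nat) (z w : R[i]).
Local Notation V := (L2class R).
Local Notation VV := (V * V)%type.
Implicit Types (X Y : VV) (p : {poly R[i]}).

Definition Tij i j X : VV := iter i dd2 (iter j dd1 X).

Lemma csD z w X : cs (z + w) X = cs z X + cs w X.
Proof. by case: z w => a b [c d]; congr pair; rewrite /cs /=; linear_identity. Qed.
Lemma csN z X : cs (- z) X = - cs z X.
Proof. by case: z => a b; congr pair; rewrite /cs /=; linear_identity. Qed.
Lemma csM z w X : cs (z * w) X = cs z (cs w X).
Proof. by case: z w => a b [c d]; congr pair; rewrite /cs /=; linear_identity. Qed.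
Lemma cs0 X : cs 0 X = 0.
Proof. by congr pair; rewrite /cs /=; linear_identity. Qed.
Lemma cs1 X : cs 1 X = X.
Proof. by case: X => u v; congr pair; rewrite /cs /=; linear_identity. Qed.
Lemma cs_sum z (I : Type) (s : seq I) (P : pred I) (F : I -> VV) :
  cs z (\sum_(i <- s | P i) F i) = \sum_(i <- s | P i) cs z (F i).
Proof.
apply: (big_morph (cs z)) => [X Y|].
  by have := cs_lin z 1 X Y; rewrite !scale1r.
by congr pair; rewrite /cs /=; linear_identity.
Qed.

Lemma dd1_sum r (I : Type) (s : seq I) (P : pred I) (F : I -> VV) :
  (forall i, P i -> HH r.+1 (F i)) -> dd1 (\sum_(i <- s | P i) F i) = \sum_(i <- s | P i) dd1 (F i).
Proof.
move=> h; suff [] : HH r.+1 (\sum_(i <- s | P i) F i) /\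
   dd1 (\sum_(i <- s | P i) F i) = \sum_(i <- s | P i) dd1 (F i) by [].
elim/big_rec2: _ => [|i Y X Pi [hX e]].
  by split; [split; exact: Hr0|congr pair; rewrite /= (D1E (@W1_0 R))].
have [h1 h2] := h _ Pi; have hi := h _ Pi.
split; first by split; [exact: HrD h1 hX.1|exact: HrD h2 hX.2].
by rewrite -e; have := dd1_lin 1 hi hX; rewrite !scale1r.
Qed.
Lemma dd2_sum r (I : Type) (s : seq I) (P : pred I) (F : I -> VV) :
  (forall i, P i -> HH r.+1 (F i)) -> dd2 (\sum_(i <- s | P i) F i) = \sum_(i <- s | P i) dd2 (F i).
Proof.
move=> h; suff [] : HH r.+1 (\sum_(i <- s | P i) F i) /\
   dd2 (\sum_(i <- s | P i) F i) = \sum_(i <- s | P i) dd2 (F i) by [].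
elim/big_rec2: _ => [|i Y X Pi [hX e]].
  by split; [split; exact: Hr0|congr pair; rewrite /= (D2E (@W2_0 R))].
have [h1 h2] := h _ Pi; have hi := h _ Pi.
split; first by split; [exact: HrD h1 hX.1|exact: HrD h2 hX.2].
by rewrite -e; have := dd2_lin 1 hi hX; rewrite !scale1r.
Qed.

Lemma HH_iter1 r j X : HH (j + r) X -> HH r (iter j dd1 X).
Proof. by elim: j r => [//|j IH] r h /=; apply: HH_dd1; apply: IH; rewrite addnS. Qed.
Lemma HH_iter2 r j X : HH (j + r) X -> HH r (iter j dd2 X).
Proof. by elim: j r => [//|j IH] r h /=; apply: HH_dd2; apply: IH; rewrite addnS. Qed.
Lemma HH_Tij r i j X : HH (i + j + r) X -> HH r (Tij i j X).
Proof. by move=> h; apply: HH_iter2; apply: HH_iter1; rewrite addnCA addnA. Qed.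
Lemma mm_iter1 m j X : mm m X -> mm m (iter j dd1 X).
Proof. by move=> h; elim: j => [//|j IH]; exact: mm_dd1. Qed.

Lemma dd1_Tij m i j X : mm m X -> HH (i + j) X -> dd1 (Tij i j X) = Tij i j.+1 X.
Proof.
elim: i => [//|i IH] mX h; rewrite /Tij [iter i.+1 _ _]iterS [in RHS]iterS.
have h1 : HH (i + j + 1) X by rewrite addn1.
have hT := HH_Tij h1; rewrite (@dd_comm _ m)//; last first.
  have h2 : HH (i + j) X by exact: HH_le h.
  elim: i {IH h h1 hT} h2 => [|i IH] h2; first exact: mm_iter1.
  rewrite iterS.
  have h3 : HH (i + j + 1) X by rewrite addn1.
  by apply: (mm_dd2 (HH_Tij h3)); apply: IH; exact: HH_le h2.
congr dd2; apply: IH => //; exact: HH_le h.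
Qed.

(** The homogeneous operator of order [k] with symbol [p], the sum of the [p_i d_s^i d_theta^(k-i)].
    Multiplying [p] by ['X - z] composes it with [Az z]. *)
Definition polyact p k X : VV := \sum_(i < k.+1) cs p`_i (Tij i (k - i) X).

Lemma Az_polyact m z p k X : (size p <= k.+1)%N -> mm m X -> HH k.+1 X ->
  Az z (polyact p k X) = polyact (('X - z%:P) * p) k.+1 X.
Proof.
move=> sp mX hX.
have hT (i : 'I_k.+1) : HH 1 (Tij i (k - i) X).
  by apply: HH_Tij; have -> : (i + (k - i) + 1 = k.+1)%N by have := ltn_ord i; lia.
have hcT (i : 'I_k.+1) : true -> HH 1 (cs p`_i (Tij i (k - i) X)) by move=> _; exact: HH_cs.
rewrite /Az /polyact (dd1_sum _ hcT) (dd2_sum _ hcT) cs_sum.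
have -> : \sum_(i < k.+1) dd2 (cs p`_i (Tij i (k - i) X)) =
   \sum_(i < k.+2) cs (if i == 0%N :> nat then 0 else p`_(i.-1)) (Tij i (k.+1 - i) X).
  rewrite [RHS]big_ord_recl /= cs0 add0r; apply: eq_bigr => i _.
  by rewrite (cs_dd2 _ (hT i)).
have -> : \sum_(i < k.+1) cs z (dd1 (cs p`_i (Tij i (k - i) X))) =
   \sum_(i < k.+2) cs (z * p`_i) (Tij i (k.+1 - i) X).
  rewrite [RHS]big_ord_recr /= nth_default// mulr0 cs0 addr0; apply: eq_bigr => i _.
  rewrite (cs_dd1 _ (hT i)) csM (@dd1_Tij m)//; last first.
    by apply: HH_le hX; have := ltn_ord i; lia.
  by rewrite subSn// -ltnS.
rewrite -sumrB; apply: eq_bigr => i _.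
by rewrite -csN -csD mulrBl coefB coefXM coefCM.
Qed.

Lemma Aprod_polyact m zs X : mm m X -> HH (size zs) X ->
  Aprod zs X = polyact (\prod_(z <- zs) ('X - z%:P)) (size zs) X.
Proof.
move=> mX; elim: zs => [|z zs IH] h.
  by rewrite big_nil /polyact big_ord1 /= coef1 cs1.
have h0 : HH (size zs) X by exact: HH_le h.
by rewrite /= (IH h0) (@Az_polyact m)// ?size_prod_XsubC// big_cons.
Qed.

Lemma normc_ge (z : R[i]) : `|complex.Re z| <= normc z /\ `|complex.Im z| <= normc z.
Proof.
case: z => a b /=; split; rewrite -sqrtr_sqr ler_sqrt ?addr_ge0 ?sqr_ge0//.
  by rewrite lerDl sqr_ge0.
by rewrite lerDr sqr_ge0.
Qed.
Lemma normc_ge0 (z : R[i]) : 0 <= normc z. Proof. by case: z => a b; exact: sqrtr_ge0. Qed.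
Lemma normcX (z : R[i]) n : normc (z ^+ n) = normc z ^+ n.
Proof. by elim: n => [|n IH]; rewrite ?expr0 ?normc1// !exprS normcM IH. Qed.
Lemma normc_sum (I : Type) (s : seq I) (P : pred I) (F : I -> R[i]) :
  normc (\sum_(i <- s | P i) F i) <= \sum_(i <- s | P i) normc (F i).
Proof.
elim/big_ind2: _ => // [|a b c e h1 h2]; first by rewrite normc0.
exact: le_trans (le_normcD _ _) (lerD h1 h2).
Qed.
Lemma normc_real (a : R) : normc (a%:C)%C = `|a|.
Proof. by rewrite /normc /= expr0n /= addr0 sqrtr_sqr. Qed.

(* Bounds on the roots of a real polynomial whose values on the real line stay
   away from 0: the imaginary parts cannot be small. *)
Section Roots.
Variables (d : nat) (gam : nat -> R) (C M : R).
Hypotheses (C0 : 0 < C) (gM : forall n, (n <= d)%N -> `|gam n| <= M) (g0 : C <= `|gam 0|).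
Hypothesis gC : forall a : R, C <= `|\sum_(n < d.+1) gam n * a ^+ (d - n)|.

Let p : {poly R[i]} := \poly_(i < d.+1) ((gam (d - i))%:C)%C.
Let B := 1 + d%:R * M / C.
Let del := C / (M * (2 * B) ^+ d).

Let gam0 : gam 0 != 0.
Proof. by apply/eqP => e; move: g0; rewrite e normr0 leNgt C0. Qed.
Let M0 : 0 < M. Proof. exact: lt_le_trans C0 (le_trans g0 (gM (leq0n d))). Qed.
Let B1 : 1 <= B. Proof. by rewrite /B lerDl divr_ge0 ?mulr_ge0// ltW. Qed.

Lemma size_sym : size p = d.+1.
Proof.
rewrite size_poly_eq//= subnn; apply: contra gam0 => /eqP e.
by apply/eqP; have := congr1 (@complex.Re R) e.
Qed.
Lemma lead_sym : lead_coef p = ((gam 0)%:C)%C.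
Proof. by rewrite /lead_coef size_sym /= coef_poly ltnSn subnn. Qed.

Lemma eval_sym z : p.[z] = \sum_(n < d.+1) ((gam n)%:C)%C * z ^+ (d - n).
Proof.
rewrite horner_poly (reindex_inj rev_ord_inj) /=; apply: eq_bigr => n _.
by rewrite subSS subKn// -ltnS.
Qed.
Lemma eval_sym_real (a : R) : C <= normc p.[(a%:C)%C].
Proof.
have -> : p.[(a%:C)%C] = ((\sum_(n < d.+1) gam n * a ^+ (d - n))%:C)%C.
  rewrite eval_sym rmorph_sum; apply: eq_bigr => n _; by rewrite rmorphM rmorphXn.
by rewrite normc_real; exact: gC.
Qed.

(** Cauchy's bound: for [|z| > 1] the leading term, at least [C |z|^d], is balanced by [d] terms of
    size at most [M |z|^(d-1)]. *)
Lemma root_bound z : root p z -> normc z <= B.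
Proof.
move=> /rootP; rewrite eval_sym big_ord_recl subn0 => /eqP; rewrite addr_eq0 => /eqP e.
have [le1|gt1] := leP (normc z) 1; first exact: le_trans le1 B1.
case: (posnP d) => [d0|dpos].
  move: e; rewrite d0 expr0 mulr1 big_ord0 oppr0 => /(congr1 (@complex.Re R)) /= h.
  by move: gam0; rewrite h eqxx.
have := congr1 (@normc R) e; rewrite normcN normcM normcX normc_real => h.
have h2 : `|gam 0| * normc z ^+ d <= d%:R * (M * normc z ^+ d.-1).
  rewrite h; apply: le_trans (normc_sum _ _ _) _.
  have -> : d%:R * (M * normc z ^+ d.-1) = \sum_(i < d) M * normc z ^+ d.-1.
    by rewrite sumr_const card_ord mulr_natl.
  apply: ler_sum => i _; rewrite normcM normcX normc_real.
  apply: ler_pM => //; [exact: exprn_ge0 (normc_ge0 _)|apply: gM; exact: ltn_ord|].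
  by apply: ler_weXn2l; [exact: ltW|rewrite lift0; have := ltn_ord i; lia].
have zp : 0 < normc z ^+ d.-1 by rewrite exprn_gt0// (lt_trans _ gt1).
have h3 : C * normc z <= d%:R * M.
  rewrite -(ler_pM2r zp) -!mulrA -exprS prednK//.
  by apply: le_trans h2; rewrite ler_wpM2r// exprn_ge0// normc_ge0.
have h4 : normc z <= d%:R * M / C by rewrite ler_pdivlMr// mulrC.
by apply: le_trans h4 _; rewrite /B lerDr.
Qed.

(** At the real point [Re z] the value of [p] is at least [C] in modulus, while the factor of [z] is
    [|Im z|] and every other factor is at most [2 B]. *)
Lemma root_imag zs : p = lead_coef p *: \prod_(z <- zs) ('X - z%:P) -> size zs = d ->
  forall z, z \in zs -> del <= `|complex.Im z| /\ `|complex.Re z| <= B.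
Proof.
move=> pE sz z zzs.
have zr w : w \in zs -> root p w by move=> wz; rewrite pE rootZ ?root_prod_XsubC// lead_coef_eq0 -size_poly_eq0 size_sym.
have zB w : w \in zs -> normc w <= B by move=> /zr /root_bound.
split; last exact: le_trans (normc_ge z).1 (zB _ zzs).
set a := complex.Re z.
have := eval_sym_real a; rewrite [in X in X -> _]pE hornerZ horner_prod normcM lead_sym normc_real.
rewrite (big_rem z)//= normcM hornerXsubC.
have -> : normc (a%:C%C - z) = `|complex.Im z|.
  rewrite /a; case: z {zzs a} => a b /=; rewrite subrr expr0n add0r sub0r sqrrN /= sqrtr_sqr//.
have h (ws : seq R[i]) : {subset ws <= zs} ->
    normc (\prod_(w <- ws) ('X - w%:P).[a%:C%C]) <= (2 * B) ^+ size ws.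
  elim: ws => [|w ws IH] hw; first by rewrite big_nil normc1.
  rewrite big_cons normcM /= exprS; apply: ler_pM; rewrite ?normc_ge0//.
    rewrite hornerXsubC; apply: le_trans (le_normcD _ _) _; rewrite normcN normc_real mulr_natl mulr2n.
    by apply: lerD; [exact: le_trans (normc_ge z).1 (zB _ zzs)|apply: zB; apply: hw; exact: mem_head].
  by apply: IH => v vw; apply: hw; rewrite inE vw orbT.
have hrem := h (rem z zs) (fun v => @mem_rem _ z zs v).
have B20 : 1 <= 2 * B by move: B1; lra.
have hs : (2 * B) ^+ size (rem z zs) <= (2 * B) ^+ d.
  by rewrite ler_weXn2l// size_rem// sz leq_pred.
move=> hC; rewrite /del ler_pdivrMr ?mulr_gt0 ?exprn_gt0 ?(lt_le_trans _ B20)//.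
apply: le_trans hC _; rewrite mulrCA ler_wpM2l//; apply: ler_pM; rewrite ?normr_ge0 ?normc_ge0//.
  exact: gM.
exact: le_trans hrem hs.
Qed.

End Roots.

Fixpoint Sd k x : R := if k is k'.+1 then Sd k' (D1 x) + Sd k' (D2 x) else nm x.

Lemma SS_real k x : SS k (x, 0) = Sd k x.
Proof.
elim: k x => [|k IH] x /=; first by rewrite /n2 /q2 /= dot0r addr0.
by rewrite /dd1 /dd2 /= (D1E (@W1_0 R)) (D2E (@W2_0 R)) !IH.
Qed.

Lemma Tij_real i j x : Tij i j (x, 0) = (iter i D2 (iter j D1 x), 0).
Proof.
have e1 : iter j dd1 (x, 0) = (iter j D1 x, 0).
  by elim: j => [//|j IH]; rewrite !iterS IH /dd1 /= (D1E (@W1_0 R)).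
rewrite /Tij e1; elim: i => [//|i IH]; rewrite !iterS IH /dd2 /= (D2E (@W2_0 R)) //.
Qed.

(** [K] is fixed before [gam], [m] and [x]: the roots of the symbol stay in a compact set off the
    real axis that depends only on [d], [C] and [M]. This uniformity allows the coefficients to be
    frozen at arbitrary points. *)
Lemma const_elliptic d (C M : R) : 0 < C -> exists K, 0 <= K /\ forall gam : nat -> R,
  (forall n, (n <= d)%N -> `|gam n| <= M) -> C <= `|gam 0| ->
  (forall a : R, C <= `|\sum_(n < d.+1) gam n * a ^+ (d - n)|) ->
  forall m x, modes m x -> Hr d x ->
  Sd d x <= K * nm (\sum_(n < d.+1) gam n *: iter (d - n) D2 (iter n D1 x)).
Proof.
move=> C0; pose B := 1 + d%:R * M / C; pose del := C / (M * (2 * B) ^+ d).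
exists (`|1 / del + 2 * (1 + B / del)| ^+ d / C); split.
  by rewrite divr_ge0 ?exprn_ge0// ltW.
move=> gam gM g0 gC m x mx hx.
have M0 : 0 < M by exact: lt_le_trans C0 (le_trans g0 (gM 0 (leq0n d))).
have B1 : 1 <= B by rewrite /B lerDl divr_ge0 ?mulr_ge0// ltW.
have B0 : 0 <= B by lra.
have del0 : 0 < del by rewrite divr_gt0// mulr_gt0// exprn_gt0//; lra.
pose p : {poly R[i]} := \poly_(i < d.+1) ((gam (d - i)%N)%:C)%C.
have sp : size p = d.+1 := size_sym d C0 g0.
have lp : lead_coef p = ((gam 0)%:C)%C := lead_sym d C0 g0.
have [zs pE] := closed_field_poly_normal p.
have lp0 : lead_coef p != 0 by rewrite lead_coef_eq0 -size_poly_eq0 sp.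
have sz : size zs = d.
  by have := sp; rewrite pE size_scale// size_prod_XsubC => -[].
have hz := root_imag C0 gM g0 gC pE sz.
have mX : mm m (x, 0) by split; [exact: mx|exact: modes0].
have hX : HH (size zs) (x, 0) by rewrite sz; split; [exact: hx|exact: Hr0].
have := SS_Aprod del0 B0 hz mX hX; rewrite SS_real (Aprod_polyact mX hX) sz => h.
set Y := polyact _ _ _ in h.
have eY : cs (lead_coef p) Y = (\sum_(n < d.+1) gam n *: iter (d - n) D2 (iter n D1 x), 0).
  rewrite /Y /polyact cs_sum.
  transitivity (\sum_(i < d.+1) (gam (d - i)%N *: iter i D2 (iter (d - i) D1 x), 0 : L2class R)).
    apply: eq_bigr => i _; rewrite -csM -coefZ -pE coef_poly ltn_ord Tij_real.
    by congr pair; rewrite /cs /=; linear_identity.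
  rewrite (reindex_inj rev_ord_inj) /=.
  have e (F : 'I_d.+1 -> L2class R) : \sum_i (F i, 0 : L2class R) = (\sum_i F i, 0).
    by elim/big_rec2: _ => // i y [u v] _ [-> ->]; congr pair; rewrite /= addr0.
  rewrite -(e (fun n : 'I_d.+1 => gam n *: iter (d - n) D2 (iter n D1 x))); apply: eq_bigr => i _.
  have hi : (i <= d)%N by rewrite -ltnS.
  by rewrite subSS (subKn hi).
have nY : nm (\sum_(n < d.+1) gam n *: iter (d - n) D2 (iter n D1 x)) = `|gam 0| * n2 Y.
  have n2r (y : L2class R) : nm y = n2 (y, 0) by rewrite /n2 /q2 /= dot0r addr0.
  rewrite n2r.
  rewrite -eY lp /n2 /q2 /cs /= !scale0r subr0 addr0 !dotZl !dotZr.
  by rewrite !mulrA -expr2 -mulrDr sqrtrM ?sqr_ge0// sqrtr_sqr.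
rewrite nY; apply: le_trans h _.
set k := 1 / del + _; have n0 := n2_ge0 Y.
apply: (@le_trans _ _ (`|k| ^+ d * n2 Y)).
  rewrite ler_wpM2r//; apply: le_trans (ler_norm _) _; rewrite normrX//.
rewrite -mulrA ler_wpM2l ?exprn_ge0// mulrA ler_peMl// mulrC ler_pdivlMr// mul1r //.
Qed.

End PolynomialAction.

(** * Localisation in s and freezing of coefficients *)

Section Localisation.
Context {R : realType}.
Implicit Types (phi : R -> R) (k m n d : nat).

(** Powers of the positive part are of class [C^(k-1)]: cut-offs of finite regularity suffice. *)
Definition posx k (u : R) : R := Num.max 0 u ^+ k.

Lemma posx_ge0 k u : 0 <= posx k u. Proof. by apply: exprn_ge0; rewrite le_max lexx. Qed.
Lemma posx_le0 k u : u <= 0 -> posx k.+1 u = 0.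
Proof. by move=> h; rewrite /posx max_l// expr0n. Qed.

Lemma continuous_posx k : continuous (posx k).
Proof.
move=> u; apply: (@continuous_comp _ _ _ (Num.max (0 : R)) (fun x : R => x ^+ k)); last exact: exprn_continuous.
by apply: (@continuous_max _ _ (cst 0) id); [exact: cst_continuous|exact: cvg_id].
Qed.

Lemma is_derive_posx k (u : R) : is_derive u (1 : R) (posx k.+2) (k.+2%:R * posx k.+1 u).
Proof.
have [u0|u0|->] := ltgtP u 0.
- have D := is_derive_cst (0 : R) u (1 : R).
  rewrite posx_le0 ?mulr0 ?ltW//; apply: near_eq_is_derive D.
  by near=> t; rewrite /cst posx_le0// ltW//; near: t; exact: lt_nbhsl.
- have D := is_deriveX k.+2 (is_derive_id u (1 : R)).
  apply: near_eq_is_derive (is_derive_eq D _).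
    by near=> t; rewrite /posx max_r ?exprfctE// ltW//; near: t; exact: lt_nbhsr.
  by rewrite /GRing.scale/= mulr1 /posx max_r// ltW.
- rewrite posx_le0 ?mulr0//.
  have C : (fun h : R => h^-1 *: (posx k.+2 (h *: (1 : R) + 0) - posx k.+2 0)) @ 0^' --> (0 : R).
    have e : (fun h : R => h^-1 *: (posx k.+2 (h *: (1 : R) + 0) - posx k.+2 0)) = posx k.+1.
      apply/funext => h; rewrite (posx_le0 _ (lexx 0)) subr0 addr0 /GRing.scale/= mulr1.
      have [h0|h0] := leP h 0; first by rewrite !posx_le0 ?mulr0.
      by rewrite /posx max_r ?ltW// [in LHS]exprS mulKf// gt_eqF.
    rewrite e; have c := @continuous_posx k.+1 0.
    have c' : posx k.+1 @ 0^' --> posx k.+1 0 by apply: cvg_trans c; apply: cvg_app; exact: cvg_within.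
    by rewrite posx_le0 in c'.
  apply: DeriveDef; first by apply/cvg_ex; exists 0.
  exact: cvg_lim C.
Unshelve. all: by end_near. Qed.

Lemma per_Cq_posx q k phi : (q < k)%N -> per_Cq q phi -> per_Cq q (fun s => posx k (phi s)).
Proof.
elim: q k phi => [|q IH] [//|k] phi qk h.
  split=> //; first by move=> s; rewrite (per_Cq_per h).
  move=> s; apply: (@continuous_comp _ _ _ phi (posx k.+1)); first exact: (per_Cq_cont h).
  exact: continuous_posx.
case: k qk => [//|k] qk.
have D s : is_derive s (1 : R) (fun s => posx k.+2 (phi s)) (k.+2%:R * posx k.+1 (phi s) * derive1 phi s).
  exact: (is_derive1_comp (is_derive_posx k (phi s)) (is_derive_per s h)).
have E : derive1 (fun s => posx k.+2 (phi s)) = (fun s => (k.+2%:R * posx k.+1 (phi s)) * derive1 phi s).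
  by apply/funext => s; rewrite derive1E; have [_ ->] := D s.
apply: And3; first by move=> s; rewrite (per_Cq_per h).
  by move=> s; apply/differentiable_continuous/derivable1_diffP; have [] := D s.
split; first by move=> s; have [] := D s.
rewrite E; apply: per_CqM; last exact: per_Cq_derive h.
by apply: per_CqZ; apply: IH => //; exact: per_CqW.
Qed.

Lemma cos_near (e : R) : 0 < e -> exists2 n, (0 < n)%N & forall h : R, `|h| <= 2 * pi / n%:R -> 1 - e < cos h.
Proof.
move=> e0.
have /cvgrPdist_lt /(_ _ e0) : cos @ (0 : R) --> cos (0 : R) := @continuous_cos R 0.
rewrite cos0 => /nbhs_ballP [del /= d0 hd].
have hn := archi_boundP (divr_ge0 (ltW (@two_pi_gt0 R)) (ltW d0)); set n := Num.bound _ in hn.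
exists n.+1 => // h hh.
have : ball (0 : R) del h.
  rewrite /ball /= sub0r normrN; apply: le_lt_trans hh _.
  have n0 : (0 : R) < n.+1%:R by rewrite ltr0n.
  have h1 : 2 * pi < n%:R * del by rewrite -ltr_pdivrMr.
  rewrite (ltr_pdivrMr _ _ n0) mulrC -natr1; move: h1 d0; lra.
move=> /hd /=; rewrite ger0_norm ?subr_ge0 ?cos_le1//; lra.
Qed.

(** The bumps are the powers [q + 1] of the positive part of [cos (s - t_j) - r], at [n] equally
    spaced nodes. Some node is within [2 pi / n] of [s], and there the cosine exceeds [(1 + r) / 2].
    The sum is bounded below and not normalised. *)
Lemma bumps q (r : R) : r < 1 -> exists (n : nat) (t : 'I_n -> R) (kp : 'I_n -> R -> R) (c0 : R),
  [/\ 0 < c0, forall j, per_Cq q (kp j), forall j s, kp j s != 0 -> r < cos (s - t j) &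
      forall s, c0 <= \sum_j kp j s].
Proof.
move=> r1; have e0 : 0 < (1 - r) / 2 by lra.
have [n n0 hn] := cos_near e0.
exists n, (fun j => 2 * pi / n%:R * j%:R), (fun j s => posx q.+1 (cos (s - 2 * pi / n%:R * j%:R) - r)), (((1 - r) / 2) ^+ q.+1).
split; first exact: exprn_gt0.
- move=> j; apply: per_Cq_posx => //; apply: per_CqD; [exact: per_Cq_cosshift|exact: per_Cq_cst].
- by move=> j s; apply: contraR; rewrite -leNgt => h; rewrite posx_le0// subr_le0.
move=> s; have [l hl] := fundamental_domain s.
set s' := s - _ in hl; have p0 := @two_pi_gt0 R; have nR : (0 : R) < n%:R by rewrite ltr0n.
(* The minimum with [n - 1] covers the endpoint [s' = 2 pi]. *)
pose j := minn (Num.truncn (s' / (2 * pi / n%:R))) n.-1.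
have jn : (j < n)%N by rewrite /j gtn_min orbC ltn_predL n0.
have hj : `|s' - 2 * pi / n%:R * j%:R| <= 2 * pi / n%:R.
  have w0 : 0 < 2 * pi / n%:R :> R by rewrite divr_gt0.
  have q0 : 0 <= s' / (2 * pi / n%:R) by apply: divr_ge0; [case/andP: hl|exact: ltW].
  have := Num.Theory.truncn_itv q0.
  rewrite ler_pdivlMr// ltr_pdivrMr// => /andP[h1 h2].
  rewrite /j /minn; case: ltnP => h3; first by move: h1 h2; rewrite -natr1 ler_norml => h1 h2; apply/andP; split; lra.
  have h4 : (n.-1%:R : R) * (2 * pi / n%:R) <= (Num.truncn (s' / (2 * pi / n%:R)))%:R * (2 * pi / n%:R).
    by rewrite ler_wpM2r ?ler_nat// ltW.
  have h5 : (n%:R : R) = n.-1%:R + 1 by rewrite natr1 prednK.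
  have h6 : n%:R * (2 * pi / n%:R) = 2 * pi :> R by rewrite mulrC divfK// gt_eqF.
  rewrite [in X in X * _ = _]h5 mulrDl mul1r in h6.
  by case/andP: hl => hl1 hl2; rewrite ler_norml; apply/andP; split; lra.
have := hn _ hj.
have -> : cos (s' - 2 * pi / n%:R * j%:R) = cos (s - 2 * pi / n%:R * j%:R).
  have -> : s' - 2 * pi / n%:R * j%:R = (s - 2 * pi / n%:R * j%:R) + (- l)%:~R * (2 * pi) by rewrite /s' mulrNz; ring.
  by rewrite (periodic_int (f := cos))// => y; rewrite mulr_natl cosD2pi.
move=> hc; rewrite (bigD1 (Ordinal jn))//= -[leLHS]addr0; apply: lerD; last by apply: sumr_ge0 => i _; exact: posx_ge0.
rewrite /posx ler_pXn2r; rewrite ?nnegrE ?le_max ?lexx//; last exact: ltW.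
by apply/orP; right; lra.
Qed.

(** Closeness on the circle is measured by the cosine, to match the supports of the bumps; the mean
    value theorem, after reducing [s - t] modulo [2 pi], is uniform over all [phi] with the same
    bound. *)
Lemma per_C1_cos_close (M eps : R) : 0 < eps -> 0 < M -> exists2 r : R, r < 1 &
  forall phi, per_Cq 1 phi -> (forall s, `|derive1 phi s| <= M) ->
    forall s t, r < cos (s - t) -> `|phi s - phi t| <= eps.
Proof.
move=> e0 M0; pose eta := Num.min pi (eps / M).
have p0 := pi_gt0 R.
have eta0 : 0 < eta by rewrite lt_min p0 divr_gt0.
have etap : eta <= pi by rewrite ge_min lexx.
exists (cos eta).
  have i0 : (0 : R) \in `[0, pi] by rewrite in_itv/= lexx ltW.
  have ie : eta \in `[0, pi] by rewrite in_itv/= etap ltW.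
  by have := ltr_cos i0 ie; rewrite cos0 => ->.
move=> phi hphi hM s t hst.
have [l hl] := fundamental_domain (s - t + pi).
set h := s - t - l%:~R * (2 * pi).
have hh : `|h| <= pi by rewrite ler_norml /h; move: hl => /andP[h1 h2]; apply/andP; split; lra.
have hc : cos `|h| = cos (s - t).
  rewrite cos_norm /h -mulNr -mulrNz (periodic_int (f := cos))// => y.
  by rewrite mulr_natl cosD2pi.
have heta : `|h| < eta.
  by move: hst; rewrite -hc ltr_cos// in_itv/= ?normr_ge0 ?hh// ltW.
have -> : phi s = phi (t + h).
  have -> : t + h = s + (- l)%:~R * (2 * pi) by rewrite /h mulrNz; ring.
  by rewrite (periodic_int (f := phi))//; exact: (per_Cq_per hphi).
have cont (a b : R) : {within `[a, b]%classic, continuous phi}.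
  by apply: continuous_subspaceT; exact: (per_Cq_cont hphi).
have main (a b : R) : a <= b -> `|phi b - phi a| <= M * (b - a).
  move=> ab; have [x _ ->] := MVT_segment ab (fun x _ => is_derive_per x hphi) (cont a b).
  by rewrite normrM (ger0_norm (_ : 0 <= b - a)) ?subr_ge0// ler_wpM2r// subr_ge0.
have fin : M * `|h| <= eps.
  rewrite mulrC -ler_pdivlMr//; apply: le_trans (ltW heta) _; by rewrite ge_min lexx orbT.
apply: le_trans fin.
have [h0|h0] := leP 0 h.
  by have := main t (t + h); rewrite lerDl addrAC subrr add0r (ger0_norm h0); exact.
have e : t - (t + h) = - h by ring.
by have := main (t + h) t; rewrite e distrC (ltr0_norm h0); apply; rewrite gerDl ltW.
Qed.

End Localisation.

Section Freezing.
Context {R : realType}.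
Implicit Types (x y : L2class R) (m n d : nat).
Local Notation V := (L2class R).

Fixpoint Dw (w : seq bool) x : V := if w is b :: w' then Dw w' (if b then D1 x else D2 x) else x.

Lemma Dw_lin w (c : R) x y : Hr (size w) x -> Hr (size w) y -> Dw w (c *: x + y) = c *: Dw w x + Dw w y.
Proof.
elim: w x y => [//|b w IH] x y hx hy /=.
case: b hx hy => hx hy; first by rewrite (D1_lin c hx hy) IH//; [exact: Hr_D1 hx|exact: Hr_D1 hy].
by rewrite (D2_lin c hx hy) IH//; [exact: Hr_D2 hx|exact: Hr_D2 hy].
Qed.
Lemma DwD w x y : Hr (size w) x -> Hr (size w) y -> Dw w (x + y) = Dw w x + Dw w y.
Proof. by move=> hx hy; have := Dw_lin 1 hx hy; rewrite !scale1r. Qed.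

Lemma nm_Dw_le w x : nm (Dw w x) <= Nr (size w) x.
Proof.
elim: w x => [//|b w IH] x /=; apply: le_trans (IH _) _.
by case: b; [exact: (Nr_D1 (size w))|exact: (Nr_D2 (size w))].
Qed.
Lemma nm_Dw_Sd w x : nm (Dw w x) <= Sd (size w) x.
Proof.
have S0 k y : 0 <= Sd k y by elim: k y => [|k IH] y; [exact: nm_ge0|rewrite addr_ge0].
elim: w x => [//|b w IH] x /=; apply: le_trans (IH _) _.
by case: b; rewrite ?lerDl ?lerDr.
Qed.
Lemma Sd_le_Dw d (B : R) x : (forall w, size w = d -> nm (Dw w x) <= B) -> Sd d x <= 2 ^+ d * B.
Proof.
elim: d x => [|d IH] x h; first by rewrite mul1r; exact: (h [::]).
rewrite /= exprS -mulrA mulr_natl mulr2n; apply: lerD; apply: IH => w sw.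
  by apply: (h (true :: w)); rewrite /= sw.
by apply: (h (false :: w)); rewrite /= sw.
Qed.
Lemma Dw_iter i j x : Dw (nseq i true ++ nseq j false) x = iter j D2 (iter i D1 x).
Proof.
elim: i x => [|i IH] x /=; last by rewrite IH -iterSr.
by elim: j x => [//|j IH] x /=; rewrite IH -iterSr.
Qed.

(** In the commutator at least one derivative falls on [a], so only derivatives of [x] of order
    below [size w] remain. This makes all cut-off errors of lower order. *)
Lemma Dw_bmul (r : nat) (M : R) a w x : (size w <= r)%N -> is_Cq r a -> Cbd r M a -> Hr (size w) x ->
  nm (Dw w (bmul a x) - bmul a (Dw w x)) <= (size w)%:R * (3 ^+ r * M) * Nr (size w).-1 x.
Proof.
move=> sw ca ba; have M0 := Cbd_ge0 ba.
elim: w x sw => [|b w IH] x sw hx /=; first by rewrite subrr nm0 !mul0r.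
case: r sw ca ba IH => [//|r] sw ca ba IH.
have sw' : (size w <= r.+1)%N by exact: ltnW sw.
have [c1 c2] : is_Cq r (dtheta a) /\ is_Cq r (ds a) by split; [exact: is_Cq_dtheta|exact: is_Cq_ds].
have [b1 b2] : Cbd r M (dtheta a) /\ Cbd r M (ds a) by case: ba => _ [].
have ca1 : is_Cq 1 a by exact: is_Cq_le ca.
have K0 : 0 <= 3 ^+ r.+1 * M by rewrite mulr_ge0// exprn_ge0.
(* For the empty word the commutator term carries the factor [0], so the exponent of [*+] switches
   the hypothesis on [y] off. *)
have key y a' : Hr (size w) y -> Nr (size w).-1 y *+ (size w != 0%N) <= Nr (size w) x ->
   is_Cq r a' -> Cbd r M a' ->
   nm (Dw w (bmul a y + bmul a' x) - bmul a (Dw w y)) <= (size w).+1%:R * (3 ^+ r.+1 * M) * Nr (size w) x.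
  move=> hy ny ca' ba'.
  have hx' : Hr (size w) x by exact: HrW.
  have ca0 : is_Cq (size w) a by exact: is_Cq_le ca.
  have ca'0 : is_Cq (size w) a' by exact: is_Cq_le ca'.
  rewrite (DwD (Hr_bmul ca0 hy) (Hr_bmul ca'0 hx')) addrAC; apply: le_trans (nmD _ _) _.
  rewrite -natr1 mulrDl mul1r mulrDl; apply: lerD.
    apply: le_trans (IH y sw' hy) _; rewrite -!mulrA.
    case: (size w) ny => [|k] ny; first by rewrite !mul0r.
    by rewrite mulr1n in ny; rewrite !ler_wpM2l// exprn_ge0.
  apply: le_trans (nm_Dw_le _ _) _.
  have nb := Nr_bmul ca'0 (Cbd_le (sw : (size w <= r)%N) ba') hx'; apply: (le_trans nb).
  by rewrite ler_wpM2r ?Nr_ge0// ler_wpM2r// ler_weXn2l// ?ler1n// ltnW.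
case: b hx sw => /= hx sw.
  rewrite (D1_bmul ca1 hx); apply: key => //; first exact: Hr_D1 hx.
  by case: (size w) => [|k]; [rewrite mulr0n nm_ge0|rewrite mulr1n; exact: (Nr_D1 k)].
rewrite (D2_bmul ca1 hx); apply: key => //; first exact: Hr_D2 hx.
by case: (size w) => [|k]; [rewrite mulr0n nm_ge0|rewrite mulr1n; exact: (Nr_D2 k)].
Qed.

Definition topop d (c : nat -> R -> R) x : V :=
  \sum_(n < d.+1) bmul (fsnd (c n)) (iter (d - n) D2 (iter n D1 x)).

Lemma bmul_suml (I : Type) (s : seq I) (F : I -> R * R -> R) x : (forall i, is_Cq 0 (F i)) ->
  \sum_(i <- s) bmul (F i) x = bmul (fun z => \sum_(i <- s) F i z) x.
Proof.
move=> h; elim: s => [|i s IH].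
  rewrite big_nil; have -> : (fun z : R * R => \sum_(i <- [::]) F i z) = fun=> 0 by apply/funext => z; rewrite big_nil.
  by rewrite bmul_cst scale0r.
rewrite big_cons IH -(bmulDl _ (h i) (is_Cq_sum s h)); congr (bmul _ x).
by apply/funext => z; rewrite big_cons.
Qed.

Section Patch.
Variables (d : nat) (M K0 eps : R) (c : nat -> R -> R).
Hypotheses (cC : forall n, (n <= d)%N -> per_Cq 1 (c n)) (cM : forall n, (n <= d)%N -> forall s, `|c n s| <= M).
Hypotheses (K00 : 0 <= K0) (eps0 : 0 <= eps) (Keps : K0 * d.+1%:R * eps <= 2^-1).

Lemma patch_bound m x (t : R) (kp : R -> R) (Mk : R) : modes m x -> Hr d x ->
  per_Cq d kp -> Cbd d Mk (fsnd kp) ->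
  (forall n, (n <= d)%N -> forall s, kp s != 0 -> `|c n s - c n t| <= eps) ->
  (forall y, modes m y -> Hr d y -> Sd d y <= K0 * nm (\sum_(n < d.+1) c n t *: iter (d - n) D2 (iter n D1 y))) ->
  Sd d (bmul (fsnd kp) x) <= 2 * K0 * (Mk * nm (topop d c x) +
     d.+1%:R * (eps + M) * (d%:R * (3 ^+ d * Mk)) * Nr d.-1 x).
Proof.
move=> mx hx ck bk ceps hK.
have ck2 := per_Cq_snd ck.
have ck0 : is_Cq 0 (fsnd kp) by exact: is_Cq_le ck2.
have Mk0 := Cbd_ge0 bk.
pose T n y := iter (d - n) D2 (iter n D1 y).
set E := d%:R * (3 ^+ d * Mk) * Nr d.-1 x.
have E0 : 0 <= E by rewrite mulr_ge0 ?Nr_ge0// mulr_ge0// mulr_ge0// exprn_ge0.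
have hT n : (n <= d)%N -> nm (T n (bmul (fsnd kp) x) - bmul (fsnd kp) (T n x)) <= E.
  move=> nd; rewrite /T -!Dw_iter.
  have sw : size (nseq n true ++ nseq (d - n) false) = d by rewrite size_cat !size_nseq subnKC.
  have hx' : Hr (size (nseq n true ++ nseq (d - n) false)) x by rewrite sw.
  have sw' : (size (nseq n true ++ nseq (d - n) false) <= d)%N by rewrite sw.
  by have := Dw_bmul sw' ck2 bk hx'; rewrite sw.
set S := Sd d (bmul (fsnd kp) x).
have hS n : (n <= d)%N -> nm (T n (bmul (fsnd kp) x)) <= S.
  move=> nd; rewrite /T -!Dw_iter.
  have sw : size (nseq n true ++ nseq (d - n) false) = d by rewrite size_cat !size_nseq subnKC.
  by have := nm_Dw_Sd (nseq n true ++ nseq (d - n) false) (bmul (fsnd kp) x); rewrite sw.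
have ck00 : per_Cq 0 kp by exact: per_Cq_le ck.
have h := hK _ (modes_bmul ck00 mx) (Hr_bmul ck2 hx).
rewrite -/S in h.
pose g n s := kp s * (c n s - c n t).
have cg n : (n <= d)%N -> is_Cq 0 (fsnd (g n)).
  move=> nd; apply: (@per_Cq_snd _ 0); apply: per_CqM => //.
  by apply: per_CqD; [exact: per_Cq_le (cC nd)|exact: per_Cq_cst].
have cc n : (n <= d)%N -> is_Cq 0 (fsnd (c n)).
  by move=> nd; apply: (@per_Cq_snd _ 0); exact: per_Cq_le (cC nd).
have id1 : \sum_(n < d.+1) c n t *: T n (bmul (fsnd kp) x) = bmul (fsnd kp) (topop d c x) -
   \sum_(n < d.+1) bmul (fsnd (g n)) (T n x) +
   \sum_(n < d.+1) c n t *: (T n (bmul (fsnd kp) x) - bmul (fsnd kp) (T n x)).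
  rewrite /topop (bmul_sumr _ _ _ ck0) -sumrB -big_split/=; apply: eq_bigr => n _.
  have nd : (n <= d)%N by rewrite -ltnS.
  rewrite (bmulA _ ck0 (cc n nd)) -/(T n x).
  have -> : bmul (fsnd (g n)) (T n x) = bmul (fun z => fsnd kp z * fsnd (c n) z) (T n x) - c n t *: bmul (fsnd kp) (T n x).
    rewrite -(bmulZl _ _ ck0) -scaleN1r -(bmulZl _ _ (is_CqZ (c n t) ck0)).
    rewrite -(bmulDl _ (is_CqM ck0 (cc n nd)) (is_CqZ (-1) (is_CqZ (c n t) ck0))).
    by congr (bmul _ _); apply/funext => z; rewrite /fsnd /g; ring.
  by rewrite subKr scalerBr addrC subrK.
have n1 : nm (bmul (fsnd kp) (topop d c x)) <= Mk * nm (topop d c x).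
  exact: nm_bmul ck0 (Cbd_bd bk).
have n2 : nm (\sum_(n < d.+1) bmul (fsnd (g n)) (T n x)) <= d.+1%:R * (eps * (S + E)).
  apply: le_trans (nm_sum _ _ _) _.
  have -> : d.+1%:R * (eps * (S + E)) = \sum_(n < d.+1) (eps * (S + E)).
    by rewrite sumr_const card_ord [LHS]mulr_natl.
  apply: ler_sum => n _; have nd : (n <= d)%N by rewrite -ltnS.
  apply: (@le_trans _ _ (nm (bmul (fun z => eps * fsnd kp z) (T n x)))).
    apply: (nm_bmul_le _ (cg n nd) (is_CqZ eps ck0)) => z.
    rewrite /fsnd /g !normrM (ger0_norm eps0) mulrC.
    have [->|k0] := eqVneq (kp z.2) 0; first by rewrite normr0 !mulr0.
    by rewrite ler_wpM2r//; exact: ceps.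
  rewrite (bmulZl _ _ ck0) nmZ (ger0_norm eps0) ler_wpM2l//.
  have -> : bmul (fsnd kp) (T n x) = T n (bmul (fsnd kp) x) - (T n (bmul (fsnd kp) x) - bmul (fsnd kp) (T n x)).
    by rewrite subKr.
  by apply: le_trans (nmB _ _) _; apply: lerD; [exact: hS|exact: hT].
have n3 : nm (\sum_(n < d.+1) c n t *: (T n (bmul (fsnd kp) x) - bmul (fsnd kp) (T n x))) <= d.+1%:R * (M * E).
  apply: le_trans (nm_sum _ _ _) _.
  have -> : d.+1%:R * (M * E) = \sum_(n < d.+1) (M * E).
    by rewrite sumr_const card_ord [LHS]mulr_natl.
  apply: ler_sum => n _; have nd : (n <= d)%N by rewrite -ltnS.
  by rewrite nmZ; apply: ler_pM => //; [exact: nm_ge0|exact: cM|exact: hT].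
have n4 : nm (\sum_(n < d.+1) c n t *: T n (bmul (fsnd kp) x)) <=
    Mk * nm (topop d c x) + d.+1%:R * (eps * (S + E)) + d.+1%:R * (M * E).
  rewrite id1; apply: le_trans (nmD _ _) _; apply: lerD n3.
  by apply: le_trans (nmB _ _) _; apply: lerD.
have S0 : 0 <= S by apply: le_trans (nm_ge0 _) (hS 0%N (leq0n d)).
have h2 := le_trans h (ler_wpM2l K00 n4).
have h3 : K0 * d.+1%:R * eps * S <= 2^-1 * S by rewrite ler_wpM2r.
have -> : 2 * K0 * (Mk * nm (topop d c x) + d.+1%:R * (eps + M) * (d%:R * (3 ^+ d * Mk)) * Nr d.-1 x)
   = 2 * (K0 * (Mk * nm (topop d c x) + d.+1%:R * (eps * (S + E)) + d.+1%:R * (M * E)))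
     - 2 * (K0 * d.+1%:R * eps * S) by rewrite /E; ring.
move: h2 h3; lra.
Qed.

End Patch.

(** The bumps add up to at least [k0], so a derivative [Dw w x] is controlled by its products with
    them, and each product differs from the derivative of the localised [x] by a commutator. *)
Lemma variable_elliptic d (C : R) (c : nat -> R -> R) : 0 < C ->
  (forall n, (n <= d)%N -> per_Cq 1 (c n)) -> (forall s, C <= `|c 0%N s|) ->
  (forall s a : R, C <= `|\sum_(n < d.+1) c n s * a ^+ (d - n)|) ->
  exists2 K : R, 0 <= K & forall m x, modes m x -> Hr d x ->
    Sd d x <= K * (nm (topop d c x) + Nr d.-1 x).
Proof.
move=> C0 cC c0 cC'.
have [M1 hM1] : exists M1 : R, 0 < M1 /\ forall n, (n <= d)%N -> forall s, `|c n s| <= M1 /\ `|derive1 (c n) s| <= M1.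
  have : exists M1 : R, 0 < M1 /\ forall n, (n < d.+1)%N -> forall s, `|c n s| <= M1 /\ `|derive1 (c n) s| <= M1.
    have : forall n, (n < d.+1)%N -> per_Cq 1 (c n) by move=> n; exact: cC.
    elim: (d.+1) => [|k IH] h; first by exists 1; split=> //.
    have [|M2 [M20 hM2]] := IH; first by move=> n nk; apply: h; exact: ltnW.
    have [M3 hM3] := per_Cq_bounded (h k (ltnSn k)); have [M4 hM4] := per_Cq_bounded (per_Cq_derive (h k (ltnSn k))).
    exists (Num.max M2 (Num.max M3 M4)); split; first by rewrite lt_max M20.
    move=> n; rewrite ltnS leq_eqVlt => /orP[/eqP ->|nk] s.
      by split; rewrite !le_max ?hM3 ?hM4 !orbT.
    by have [h1 h2] := hM2 n nk s; split; rewrite le_max ?h1 ?h2.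
  by [].
(* Order of the choices: the bound [M1] of the coefficients and their derivatives determines [K0],
   then [eps], then the arc size [r], and only then the bumps. *)
have [K0 [K00 hK0]] := @const_elliptic R d C M1 C0.
pose eps := 2^-1 / (K0 * d.+1%:R + 1) : R.
have Kd : 0 <= K0 * d.+1%:R by rewrite mulr_ge0.
have eps0 : 0 < eps by rewrite divr_gt0//; lra.
have Keps : K0 * d.+1%:R * eps <= 2^-1.
  by rewrite /eps mulrCA ler_piMr// ler_pdivrMr; lra.
have [r r1 hr] := per_C1_cos_close eps0 hM1.1.
have [n [t [kp [k0 [k00 ck hkr hk0]]]]] := @bumps R d r r1.
have [Mk hMk] : exists Mk, forall j, Cbd d Mk (fsnd (kp j)).
  have [Mj hj] := boolp.choice (fun j => is_Cq_Cbd (per_Cq_snd (ck j))).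
  exists (\sum_j Mj j) => j; apply: Cbd_leM (hj j).
  by rewrite (bigD1 j)//= lerDl sumr_ge0// => i _; exact: Cbd_ge0 (hj i).
set E := d%:R * (3 ^+ d * `|Mk|).
have E0 : 0 <= E by rewrite !mulr_ge0// exprn_ge0.
exists (2 ^+ d * (n%:R * (2 * K0 * (`|Mk| + d.+1%:R * (eps + M1) * E) + E) / k0)).
  by rewrite !(mulr_ge0, addr_ge0, exprn_ge0, invr_ge0)// ltW// hM1.1.
move=> m x mx hx; rewrite -[leRHS]mulrA; apply: Sd_le_Dw => w sw.
set N := nm (topop d c x) + Nr d.-1 x.
have N0 : 0 <= N by rewrite addr_ge0 ?nm_ge0 ?Nr_ge0.
have Mke (j : 'I_n) : Mk = `|Mk| by rewrite ger0_norm//; exact: Cbd_ge0 (hMk j).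
have hS j : Sd d (bmul (fsnd (kp j)) x) <= 2 * K0 * (`|Mk| + d.+1%:R * (eps + M1) * E) * N.
  have M1p := ltW hM1.1.
  have P := @patch_bound d M1 K0 eps c cC (fun n nd s => (hM1.2 n nd s).1) K00 (ltW eps0) Keps
    m x (t j) (kp j) Mk mx hx (ck j) (hMk j).
  apply: le_trans (P _ _) _.
  - by move=> k kd s ks; apply: (hr _ (cC k kd) (fun s => (hM1.2 k kd s).2)); exact: hkr ks.
  - move=> y my hy; apply: (hK0 (fun n => c n (t j)) _ _ _ m y my hy) => //.
    by move=> k kd; exact: (hM1.2 k kd (t j)).1.
  rewrite -[leRHS]mulrA; apply: ler_wpM2l; first by rewrite mulr_ge0.
  rewrite mulrDl; apply: lerD.
    by rewrite (Mke j) normr_id ler_wpM2l// /N lerDl Nr_ge0.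
  have Ke0 : 0 <= d.+1%:R * (eps + M1) * E by rewrite !mulr_ge0// addr_ge0// ltW.
  by rewrite (Mke j) -/E ler_wpM2l// /N lerDr nm_ge0.
have hW j : nm (bmul (fsnd (kp j)) (Dw w x)) <= (2 * K0 * (`|Mk| + d.+1%:R * (eps + M1) * E) + E) * N.
  have -> : bmul (fsnd (kp j)) (Dw w x) = Dw w (bmul (fsnd (kp j)) x) - (Dw w (bmul (fsnd (kp j)) x) - bmul (fsnd (kp j)) (Dw w x)).
    by rewrite subKr.
  apply: le_trans (nmB _ _) _; rewrite mulrDl; apply: lerD.
    by apply: le_trans (nm_Dw_Sd _ _) _; rewrite sw.
  have hx' : Hr (size w) x by rewrite sw.
  have sw' : (size w <= d)%N by rewrite sw.
  have := Dw_bmul sw' (per_Cq_snd (ck j)) (hMk j) hx'; rewrite sw (Mke j) => h.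
  apply: le_trans h _; rewrite -/E ler_wpM2l// /N lerDr nm_ge0 //.
have ckj j : is_Cq 0 (fsnd (kp j)) by exact: is_Cq_le (per_Cq_snd (ck j)).
have hsum : k0 * nm (Dw w x) <= \sum_j nm (bmul (fsnd (kp j)) (Dw w x)).
  apply: le_trans (nm_sum _ _ _); rewrite (bmul_suml _ _ ckj).
  have -> : k0 * nm (Dw w x) = nm (bmul (fun=> k0) (Dw w x)) by rewrite bmul_cst nmZ (ger0_norm (ltW k00)).
  apply: (nm_bmul_le _ (is_Cq_cst 0 k0) (is_Cq_sum (index_enum _) ckj)) => z.
  rewrite (ger0_norm (ltW k00)); apply: le_trans (hk0 z.2) (ler_norm _).
rewrite -(ler_pM2l k00); apply: le_trans hsum _.
set Q := 2 * K0 * _ + E; have -> : k0 * (n%:R * Q / k0 * N) = n%:R * (Q * N).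
  by have kn : k0 != 0 := lt0r_neq0 k00; field.
have -> : n%:R * (Q * N) = \sum_(j < n) Q * N by rewrite sumr_const card_ord [LHS]mulr_natl.
by apply: ler_sum => j _; exact: hW.
Qed.

End Freezing.

(** * Interpolation and a priori bounds *)

Section APriori.
Context {R : realType}.
Implicit Types (x y : L2class R) (k m n d r : nat).
Local Notation V := (L2class R).

Lemma NrS_Sd k x : Nr k.+1 x = Nr k x + Sd k.+1 x.
Proof.
elim: k x => [//|k IH] x.
have -> : Nr k.+2 x = nm x + (Nr k.+1 (D1 x) + Nr k.+1 (D2 x)) by [].
have -> : Nr k.+1 x = nm x + (Nr k (D1 x) + Nr k (D2 x)) by [].
have -> : Sd k.+2 x = Sd k.+1 (D1 x) + Sd k.+1 (D2 x) by [].
by rewrite !IH; ring.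
Qed.
Lemma Sd_le_Nr k x : Sd k x <= Nr k x.
Proof. by case: k x => [//|k] x; rewrite NrS_Sd lerDr Nr_ge0. Qed.

Lemma sqr_le_small (t a b eps : R) : 0 < eps -> 0 <= a -> 0 <= b -> t ^+ 2 <= a * b -> t <= eps * a + eps^-1 * b.
Proof.
move=> e0 a0 b0 h; have ie0 : 0 < eps^-1 by rewrite invr_gt0.
have s0 : 0 <= eps * a + eps^-1 * b by rewrite addr_ge0// mulr_ge0// ltW.
have [t0|t0] := leP t 0; first exact: le_trans t0 s0.
rewrite -(@ler_pXn2r _ 2)// ?nnegrE//; last exact: ltW.
apply: le_trans h _.
have -> : (eps * a + eps^-1 * b) ^+ 2 = (eps * a) ^+ 2 + (eps^-1 * b) ^+ 2 + 2 * (eps * eps^-1) * (a * b) by ring.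
rewrite mulfV ?gt_eqF// mulr1; have := sqr_ge0 (eps * a); have := sqr_ge0 (eps^-1 * b).
have := mulr_ge0 a0 b0; lra.
Qed.

(** Integration by parts gives [|D x|^2 <= |D D x| |x|] in each direction; higher orders apply this
    to derivatives of [x]. *)
Lemma Sd_interp (eps : R) k x : 0 < eps -> Hr k.+2 x -> Sd k.+1 x <= eps * Sd k.+2 x + 2 * eps^-1 * Sd k x.
Proof.
move=> e0; elim: k x => [|k IH] x hx; last first.
  have h1 := IH _ (Hr_D1 hx); have h2 := IH _ (Hr_D2 hx).
  by move: h1 h2; rewrite /= => h1 h2; move: (lerD h1 h2); lra.
have a1 : nm (D1 x) ^+ 2 <= nm (D1 (D1 x)) * nm x.
  have := W1_parts (Hr_W1 hx) (Hr_W1 (Hr_D1 hx)); rewrite sqr_nm => e.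
  have := dot_lev x (D1 (D1 x)); have := dot_lev (- x) (D1 (D1 x)); rewrite dotNl nmN.
  by rewrite e; lra.
have a2 : nm (D2 x) ^+ 2 <= nm (D2 (D2 x)) * nm x.
  have := W2_parts (Hr_W2 hx) (Hr_W2 (Hr_D2 hx)); rewrite sqr_nm => e.
  have := dot_lev x (D2 (D2 x)); have := dot_lev (- x) (D2 (D2 x)); rewrite dotNl nmN.
  by rewrite e; lra.
have b1 := sqr_le_small e0 (nm_ge0 _) (nm_ge0 _) a1.
have b2 := sqr_le_small e0 (nm_ge0 _) (nm_ge0 _) a2.
have p1 : 0 <= eps * nm (D2 (D1 x)) by rewrite mulr_ge0 ?nm_ge0// ltW.
have p2 : 0 <= eps * nm (D1 (D2 x)) by rewrite mulr_ge0 ?nm_ge0// ltW.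
by rewrite /=; move: b1 b2 p1 p2; lra.
Qed.

(** Ehrling's inequality: iterating [Sd_interp] trades the order [k] for a small multiple of the
    next one and a large multiple of the norm of [x]. *)
Lemma Nr_interp k (eps : R) : 0 < eps -> exists2 K : R, 0 <= K &
  forall x, Hr k.+1 x -> Nr k x <= eps * Nr k.+1 x + K * nm x.
Proof.
elim: k eps => [|k IH] eps e0.
  by exists 1 => // x hx; rewrite mul1r lerDr mulr_ge0 ?Nr_ge0// ltW.
have e2 : 0 < eps / 2 by apply: divr_gt0.
set C := 1 + 2 * (eps / 2)^-1.
have C0 : 0 < C by rewrite /C ltr_wpDr// mulr_ge0// invr_ge0 ltW.
have [|K K0 hK] := IH (2^-1 / C); first by rewrite divr_gt0.
exists (2 * (C * K)); first by rewrite !mulr_ge0// ltW.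
move=> x hx; have h1 := Sd_interp e2 hx; have h2 := hK x (HrW hx).
have h3 : Nr k.+1 x <= eps / 2 * Nr k.+2 x + C * Nr k x.
  rewrite [leLHS]NrS_Sd.
  have s1 : Sd k.+2 x <= Nr k.+2 x := Sd_le_Nr _ _.
  have s2 : Sd k x <= Nr k x := Sd_le_Nr _ _.
  have s3 : eps / 2 * Sd k.+2 x <= eps / 2 * Nr k.+2 x by rewrite ler_wpM2l// ltW.
  have s4 : 2 * (eps / 2)^-1 * Sd k x <= 2 * (eps / 2)^-1 * Nr k x by rewrite ler_wpM2l// mulr_ge0// invr_ge0 ltW.
  by rewrite /C mulrDl mul1r; move: h1 s3 s4; lra.
have h4 : C * Nr k x <= 2^-1 * Nr k.+1 x + C * K * nm x.
  apply: le_trans (ler_wpM2l (ltW C0) h2) _.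
  by rewrite mulrDr !mulrA [C * 2^-1]mulrC mulfK ?gt_eqF.
by move: h3 h4; rewrite -mulrA; lra.
Qed.

(* An operator of order [d] on the functions whose theta-frequencies are at most [m],
   with the mapping properties and commutators expected of a differential operator
   with C^q coefficients independent of theta. *)
Definition op_on (d q : nat) (C : R) m (L : V -> V) : Prop :=
  [/\ forall a x y, modes m x -> modes m y -> Hr d x -> Hr d y -> L (a *: x + y) = a *: L x + L y,
      forall r x, (r <= q)%N -> modes m x -> Hr (r + d) x ->
        [/\ Hr r (L x), modes m (L x) & Nr r (L x) <= C * Nr (r + d) x],
      forall x, modes m x -> Hr d.+1 x -> D1 (L x) = L (D1 x) &
      forall r x, (r < q)%N -> modes m x -> Hr (r.+1 + d) x -> Nr r (D2 (L x) - L (D2 x)) <= C * Nr (r + d) x].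

(** Top-order estimate and coercivity in [L^2], with the constants as separate parameters so that a
    bound in terms of them serves whole families of [m] and [L]. *)
Definition elliptic_on (d q : nat) (K C : R) m (L : V -> V) : Prop :=
  [/\ op_on d q C m L,
      forall x, modes m x -> Hr d x -> Nr d x <= K * (nm (L x) + Nr d.-1 x) &
      forall x, modes m x -> Hr d x -> nm x <= nm (L x)].

(** At [r = 0], interpolation and [|x| <= |L x|] absorb the lower-order term. In the step the
    estimate is applied to [D1 x] and [D2 x]: [D1] commutes with [L], and the commutator with [D2]
    has order [d], hence is bounded by the previous case. *)
Lemma elliptic_regularity (d q : nat) (K C : R) : (0 < d)%N -> 0 <= K -> 0 <= C -> exists2 B : R, 0 <= B &
  forall m L, elliptic_on d q K C m L ->
  forall r x, (r <= q)%N -> modes m x -> Hr (r + d) x -> Nr (r + d) x <= B * Nr r (L x).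
Proof.
case: d => [//|d _] K0 C0.
(* Chosen so that [K] times this number is at most one half. *)
have e0 : 0 < 2^-1 / (K + 1) by rewrite divr_gt0// ltr_wpDl.
have [K1 K10 hK1] := Nr_interp d e0.
suff H r : exists2 B : R, 0 <= B & forall m L, elliptic_on d.+1 q K C m L ->
    forall x, (r <= q)%N -> modes m x -> Hr (r + d.+1) x -> Nr (r + d.+1) x <= B * Nr r (L x).
  have /boolp.choice [B hB] : forall r, exists B : R, 0 <= B /\ forall m L, elliptic_on d.+1 q K C m L ->
    forall x, (r <= q)%N -> modes m x -> Hr (r + d.+1) x -> Nr (r + d.+1) x <= B * Nr r (L x).
    by move=> r; have [B B0 hB] := H r; exists B.
  exists (\sum_(r < q.+1) B r); first by apply: sumr_ge0 => r _; case: (hB r).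
  move=> m L hL r x rq mx hx; have [B0 hBr] := hB r; apply: le_trans (hBr m L hL x rq mx hx) _.
  have rq' : (r < q.+1)%N by [].
  rewrite ler_wpM2r ?Nr_ge0// (bigD1 (Ordinal rq'))//= lerDl.
  by apply: sumr_ge0 => i _; case: (hB i).
elim: r => [|r [B B0 IH]].
  exists (2 * (K + K * K1)); first by rewrite mulr_ge0// addr_ge0// mulr_ge0.
  move=> m L [_ h1 h2] x _ mx hx; rewrite add0n in hx *.
  have a1 := h1 x mx hx; have a2 := h2 x mx hx; have a3 := hK1 x hx.
  have a4 : K * Nr d x <= 2^-1 * Nr d.+1 x + K * K1 * nm (L x).
    apply: le_trans (ler_wpM2l K0 a3) _; rewrite mulrDr; apply: lerD.
      by rewrite mulrA ler_wpM2r ?Nr_ge0// mulrCA ler_piMr// ler_pdivrMr; lra.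
    by rewrite -mulrA !ler_wpM2l.
  by move: a1 a4; rewrite /= mulrDr; lra.
exists (B + B * (1 + 1 + C * B)); first by rewrite addr_ge0// mulr_ge0// !addr_ge0// mulr_ge0.
move=> m L hL x rq mx hx.
have rq' : (r <= q)%N by exact: ltnW.
have hx0 : Hr (r + d.+1) x by apply: Hr_le hx; rewrite leq_add2r.
have [[_ e0' e3 e4] _ _] := hL.
have mx1 := modes_modes_D1 mx; have mx2 : modes m (D2 x) by exact: modes_W2 (Hr_W2 hx) mx.
have i0 := IH m L hL x rq' mx hx0.
have i1 := IH m L hL _ rq' mx1 (Hr_D1 hx).
have i2 := IH m L hL _ rq' mx2 (Hr_D2 hx).
have hd : Hr d.+2 x by apply: Hr_le hx; rewrite addSn ltnS leq_addl.
rewrite -(e3 x mx hd) in i1.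
have [hLx _ _] := e0' r.+1 x rq mx hx.
have [hLD _ _] := e0' r _ rq' mx2 (Hr_D2 hx).
have c4 := e4 r x rq mx hx.
have l2 : Nr r (L (D2 x)) <= Nr r.+1 (L x) + C * (B * Nr r.+1 (L x)).
  have -> : L (D2 x) = D2 (L x) - (D2 (L x) - L (D2 x)) by rewrite subKr.
  apply: le_trans (NrB (Hr_D2 hLx) (HrB (Hr_D2 hLx) hLD)) _; apply: lerD; first exact: Nr_D2.
  apply: le_trans c4 _; rewrite ler_wpM2l//; apply: le_trans i0 _.
  by rewrite ler_wpM2l//; exact: NrS.
rewrite addSn [Nr (r + d.+1).+1 x]/=.
have n0 : nm x <= B * Nr r.+1 (L x).
  apply: le_trans (nm_le_Nr (r + d.+1) x) _; apply: le_trans i0 _.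
  by rewrite ler_wpM2l//; exact: NrS.
have n1 : B * Nr r (D1 (L x)) <= B * Nr r.+1 (L x) by rewrite ler_wpM2l//; exact: Nr_D1.
have n2 := ler_wpM2l B0 l2.
have -> : (B + B * (1 + 1 + C * B)) * Nr r.+1 (L x) = B * Nr r.+1 (L x) + (B * Nr r.+1 (L x) + B * (Nr r.+1 (L x) + C * (B * Nr r.+1 (L x)))) by ring.
by apply: lerD => //; apply: lerD; [exact: le_trans i1 n1|exact: le_trans i2 n2].
Qed.

End APriori.

(** * Differential operators with coefficients depending on s *)

Section DifferentialOperator.
Context {R : realType}.
Implicit Types (x y : L2class R) (k m n d r : nat) (c : nat -> nat -> R -> R).
Local Notation V := (L2class R).

Definition dop d c x : V := \sum_(k < d.+1) topop k (c k) x.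

Lemma Hr_iter1 r i x : Hr (i + r) x -> Hr r (iter i D1 x).
Proof. by elim: i r => [//|i IH] r h /=; apply: Hr_D1; apply: IH; rewrite addnS. Qed.
Lemma Hr_iter2 r i x : Hr (i + r) x -> Hr r (iter i D2 x).
Proof. by elim: i r => [//|i IH] r h /=; apply: Hr_D2; apply: IH; rewrite addnS. Qed.
Lemma Hr_iter r i j x : Hr (i + j + r) x -> Hr r (iter j D2 (iter i D1 x)).
Proof. by move=> h; apply: Hr_iter2; apply: Hr_iter1; rewrite addnA. Qed.
Lemma D1_iter2 j x : Hr j.+1 x -> D1 (iter j D2 x) = iter j D2 (D1 x).
Proof.
elim: j => [//|j IH] h; rewrite !iterS -IH; last exact: HrW.
by apply: (@DC R 0); apply: Hr_iter2; rewrite addn2.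
Qed.
Lemma Nr_iter r i j x : Nr r (iter j D2 (iter i D1 x)) <= Nr (i + j + r) x.
Proof.
elim: j r => [|j IH] r /=; last first.
  apply: le_trans (Nr_D2 _ _) _; apply: le_trans (IH _) _; by rewrite addnS addnS addSn.
rewrite addn0; elim: i r => [//|i IH] r /=; apply: le_trans (Nr_D1 _ _) _; apply: le_trans (IH _) _; by rewrite addnS.
Qed.
Lemma iter_D_lin r i j (a : R) x y : Hr (i + j + r) x -> Hr (i + j + r) y ->
  iter j D2 (iter i D1 (a *: x + y)) = a *: iter j D2 (iter i D1 x) + iter j D2 (iter i D1 y).
Proof.
elim: j r => [|j IH] r hx hy /=.
  rewrite addn0 in hx hy; elim: i r hx hy => [//|i IH] r hx hy /=.
  rewrite (IH r.+1) ?addnS//.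
  have h (z : V) : Hr (i.+1 + r) z -> Hr r.+1 (iter i D1 z) by have := @Hr_iter1 r.+1 i z; rewrite addnS.
  by rewrite (D1_lin a (h _ hx) (h _ hy)).
rewrite (IH r.+1); [|by rewrite addnS -addSn -addnS|by rewrite addnS -addSn -addnS].
have h (z : V) : Hr (i + j.+1 + r) z -> Hr r.+1 (iter j D2 (iter i D1 z)).
  by have := @Hr_iter r.+1 i j z; rewrite addnS -addSn -addnS.
by rewrite (D2_lin a (h _ hx) (h _ hy)).
Qed.
Lemma modes_iter m i j x : modes m x -> Hr j (iter i D1 x) -> modes m (iter j D2 (iter i D1 x)).
Proof.
move=> mx; have mi : modes m (iter i D1 x) by elim: i => [//|i IH]; exact: modes_modes_D1.
elim: j => [//|j IH] h.
have hj : Hr 1 (iter j D2 (iter i D1 x)) by apply: (@Hr_iter 1 0); rewrite add0n addn1.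
by apply: modes_W2 (Hr_W2 hj) _; apply: IH; exact: HrW.
Qed.

Let exp_nk n k r : (n < k.+1)%N -> (n + (k - n) + r = r + k)%N.
Proof. by rewrite ltnS => h; rewrite subnKC// addnC. Qed.

Section Coefs.
Variables (d r : nat) (c : nat -> nat -> R -> R) (M : R).
Hypotheses (cC : forall k n, (n <= k <= d)%N -> per_Cq r (c k n)) (cM : forall k n, (n <= k <= d)%N -> Cbd r M (fsnd (c k n))).

Let cS k n (h : (n <= k <= d)%N) : is_Cq r (fsnd (c k n)) := per_Cq_snd (cC h).

Lemma topop_lin k (a : R) x y : (k <= d)%N -> Hr (r + k) x -> Hr (r + k) y ->
  topop k (c k) (a *: x + y) = a *: topop k (c k) x + topop k (c k) y.
Proof.
move=> kd hx hy; rewrite /topop scaler_sumr -big_split/=; apply: eq_bigr => n _.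
have nk : (n <= k <= d)%N by rewrite kd -ltnS ltn_ord.
have e := exp_nk r (ltn_ord n).
rewrite (@iter_D_lin r) ?e//; exact: bmul_lin (cS nk).
Qed.
Lemma Hr_topop k x : (k <= d)%N -> Hr (r + k) x -> Hr r (topop k (c k) x).
Proof.
move=> kd hx; apply: Hr_sum => n _; have nk : (n <= k <= d)%N by rewrite kd -ltnS ltn_ord.
have e := exp_nk r (ltn_ord n).
by apply: (Hr_bmul (cS nk)); apply: Hr_iter; rewrite e.
Qed.
Lemma Nr_topop k x : (k <= d)%N -> Hr (r + k) x -> Nr r (topop k (c k) x) <= k.+1%:R * (3 ^+ r * M) * Nr (r + k) x.
Proof.
move=> kd hx; apply: le_trans (Nr_sum _ _) _ => [n _|].
  have nk : (n <= k <= d)%N by rewrite kd -ltnS ltn_ord.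
  have e := exp_nk r (ltn_ord n).
  by apply: (Hr_bmul (cS nk)); apply: Hr_iter; rewrite e.
have -> : k.+1%:R * (3 ^+ r * M) * Nr (r + k) x = \sum_(n < k.+1) (3 ^+ r * M * Nr (r + k) x).
  by rewrite sumr_const card_ord -[LHS]mulrA [LHS]mulr_natl.
apply: ler_sum => n _.
have nk : (n <= k <= d)%N by rewrite kd -ltnS ltn_ord.
have e := exp_nk r (ltn_ord n).
have hh : Hr r (iter (k - n) D2 (iter n D1 x)) by apply: Hr_iter; rewrite e.
have hN := Nr_bmul (cS nk) (cM nk) hh; apply: (le_trans hN).
rewrite ler_wpM2l ?mulr_ge0 ?exprn_ge0//; first exact: Cbd_ge0 (cM nk).
by have := Nr_iter r n (k - n) x; rewrite e.
Qed.
Lemma modes_topop m k x : (k <= d)%N -> modes m x -> Hr k x -> modes m (topop k (c k) x).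
Proof.
move=> kd mx hx; apply: modes_sum => n _.
have nk : (n <= k <= d)%N by rewrite kd -ltnS ltn_ord.
apply: modes_bmul; first by apply: per_Cq_le (cC nk).
apply: modes_iter => //; apply: (@Hr_iter _ n 0); rewrite addn0 subnKC//; by case/andP: nk.
Qed.

Lemma dop_lin (a : R) x y : Hr (r + d) x -> Hr (r + d) y -> dop d c (a *: x + y) = a *: dop d c x + dop d c y.
Proof.
move=> hx hy; rewrite /dop scaler_sumr -big_split/=; apply: eq_bigr => k _.
have kd : (k <= d)%N by rewrite -ltnS.
by apply: topop_lin => //; [apply: Hr_le hx|apply: Hr_le hy]; rewrite leq_add2l.
Qed.
Lemma Hr_dop x : Hr (r + d) x -> Hr r (dop d c x).
Proof.
move=> hx; apply: Hr_sum => k _; have kd : (k <= d)%N by rewrite -ltnS.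
by apply: Hr_topop => //; apply: Hr_le hx; rewrite leq_add2l.
Qed.
Lemma Nr_dop x : Hr (r + d) x -> Nr r (dop d c x) <= d.+1%:R * (d.+1%:R * (3 ^+ r * M)) * Nr (r + d) x.
Proof.
move=> hx; apply: le_trans (Nr_sum _ _) _ => [k _|].
  have kd : (k <= d)%N by rewrite -ltnS.
  by apply: Hr_topop => //; apply: Hr_le hx; rewrite leq_add2l.
have M0 : 0 <= M by have := Cbd_ge0 (cM (leqnn 0 : (0 <= 0 <= d)%N)).
have -> : d.+1%:R * (d.+1%:R * (3 ^+ r * M)) * Nr (r + d) x = \sum_(n < d.+1) (d.+1%:R * (3 ^+ r * M) * Nr (r + d) x).
  by rewrite sumr_const card_ord -[LHS]mulrA [LHS]mulr_natl.
apply: ler_sum => k _; have kd : (k <= d)%N by rewrite -ltnS.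
have hk : Hr (r + k) x by apply: Hr_le hx; rewrite leq_add2l.
apply: le_trans (Nr_topop kd hk) _; rewrite -!mulrA; apply: ler_pM => //.
  by rewrite !mulr_ge0 ?exprn_ge0 ?Nr_ge0.
  by rewrite ler_nat ltnS.
by rewrite !ler_wpM2l ?exprn_ge0//; apply: Nr_le; rewrite leq_add2l.
Qed.
Lemma modes_dop m x : modes m x -> Hr d x -> modes m (dop d c x).
Proof.
move=> mx hx; apply: modes_sum => k _; have kd : (k <= d)%N by rewrite -ltnS.
by apply: modes_topop => //; apply: Hr_le hx.
Qed.
End Coefs.

Lemma D2_topop k (c : nat -> R -> R) x : (forall n, (n <= k)%N -> per_Cq 1 (c n)) -> Hr k.+1 x ->
  D2 (topop k c x) = topop k c (D2 x) + topop k (fun n => derive1 (c n)) x.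
Proof.
move=> cC hx; rewrite /topop -big_split/=.
have h (n : 'I_k.+1) : Hr 1 (iter (k - n) D2 (iter n D1 x)).
  by apply: Hr_iter; rewrite (exp_nk 1 (ltn_ord n)).
have c1 (n : 'I_k.+1) : is_Cq 1 (fsnd (c n)) by apply: (@per_Cq_snd _ 1); apply: cC; rewrite -ltnS.
have -> : D2 (\sum_(n < k.+1) bmul (fsnd (c n)) (iter (k - n) D2 (iter n D1 x))) =
   \sum_(n < k.+1) D2 (bmul (fsnd (c n)) (iter (k - n) D2 (iter n D1 x))).
  apply: D2E; apply: W2_sum => n _; apply: (@Hr_W2 _ 0); exact: Hr_bmul (c1 n) (h n).
apply: eq_bigr => n _; rewrite (D2_bmul (c1 n) (h n)) -[D2 (iter _ _ _)]iterS iterSr.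
by have <- : iter n D1 (D2 x) = D2 (iter n D1 x) := iter_D1_D2 hx (ltn_ord n).
Qed.
Lemma D1_topop k (c : nat -> R -> R) x : (forall n, (n <= k)%N -> per_Cq 1 (c n)) -> Hr k.+1 x ->
  D1 (topop k c x) = topop k c (D1 x).
Proof.
move=> cC hx; rewrite /topop.
have h (n : 'I_k.+1) : Hr 1 (iter (k - n) D2 (iter n D1 x)).
  by apply: Hr_iter; rewrite (exp_nk 1 (ltn_ord n)).
have c1 (n : 'I_k.+1) : is_Cq 1 (fsnd (c n)) by apply: (@per_Cq_snd _ 1); apply: cC; rewrite -ltnS.
have -> : D1 (\sum_(n < k.+1) bmul (fsnd (c n)) (iter (k - n) D2 (iter n D1 x))) =
   \sum_(n < k.+1) D1 (bmul (fsnd (c n)) (iter (k - n) D2 (iter n D1 x))).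
  apply: D1E; apply: W1_sum => n _; apply: (@Hr_W1 _ 0); exact: Hr_bmul (c1 n) (h n).
apply: eq_bigr => n _; rewrite (D1_bmul (c1 n) (h n)) dtheta_snd bmul_cst scale0r addr0.
congr bmul; rewrite -iterSr.
have hy : Hr (k - n).+1 (iter n D1 x).
  have e : (n + (k - n).+1 = k.+1)%N by have := ltn_ord n; lia.
  by have := @Hr_iter1 (k - n).+1 n x; rewrite e; exact.
by rewrite (D1_iter2 hy).
Qed.

Lemma Cbd_derive r (M : R) (phi : R -> R) : Cbd r.+1 M (fsnd phi) -> Cbd r M (fsnd (derive1 phi)).
Proof. by move=> [_ []]. Qed.

(** The commutator with [D2] is the operator with differentiated coefficients, which are bounded to
    one order less; with [D1] there is none, because the coefficients do not depend on theta. *)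
Lemma op_on_dop m (d q : nat) c (M C : R) : (0 < q)%N ->
  (forall k n, (n <= k <= d)%N -> per_Cq q (c k n)) -> (forall k n, (n <= k <= d)%N -> Cbd q M (fsnd (c k n))) ->
  d.+1%:R * (d.+1%:R * (3 ^+ q * M)) <= C -> op_on d q C m (dop d c).
Proof.
case: q => [//|q] _ cC cM hC.
have M0 : 0 <= M by have := Cbd_ge0 (cM 0%N 0%N isT).
have cCr r : (r <= q.+1)%N -> forall k n, (n <= k <= d)%N -> per_Cq r (c k n).
  by move=> rq k n h; exact: per_Cq_le (cC k n h).
have cMr r : (r <= q.+1)%N -> forall k n, (n <= k <= d)%N -> Cbd r M (fsnd (c k n)).
  by move=> rq k n h; exact: Cbd_le (cM k n h).
have CC r x : (r <= q.+1)%N -> d.+1%:R * (d.+1%:R * (3 ^+ r * M)) * Nr (r + d) x <= C * Nr (r + d) x.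
  move=> rq; rewrite ler_wpM2r ?Nr_ge0//; apply: le_trans hC.
  by rewrite !ler_wpM2l// ler_wpM2r// ler_weXn2l// ler1n.
split.
- by move=> a x y _ _ hx hy; exact: (@dop_lin d 0 c (cCr 0%N isT)).
- move=> r x rq mx hx; split; first exact: (Hr_dop (cCr r rq)).
    have hx0 : Hr d x by apply: Hr_le hx; exact: leq_addl.
    exact: (modes_dop (cCr 0%N isT)).
  exact: le_trans (Nr_dop (cCr r rq) (cMr r rq) hx) (CC r x rq).
- move=> x mx hx; rewrite /dop.
  have -> : D1 (\sum_(k < d.+1) topop k (c k) x) = \sum_(k < d.+1) D1 (topop k (c k) x).
    apply: D1E; apply: W1_sum => k _; apply: (@Hr_W1 _ 0); apply: (@Hr_topop d 1 c (cCr 1%N isT)); first by rewrite -ltnS.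
    by apply: Hr_le hx; have := ltn_ord k; lia.
  apply: eq_bigr => k _; apply: D1_topop; last by apply: Hr_le hx; have := ltn_ord k; lia.
  by move=> n nk; apply: (cCr 1%N isT); rewrite nk -ltnS ltn_ord.
move=> r x rq mx hx.
have cdC : forall k n, (n <= k <= d)%N -> per_Cq r (derive1 (c k n)).
  by move=> k n h; apply: per_Cq_derive; apply: cCr => //; exact: ltnW.
have cdM : forall k n, (n <= k <= d)%N -> Cbd r M (fsnd (derive1 (c k n))).
  by move=> k n h; apply: Cbd_derive; apply: cMr.
have hx1 : Hr d.+1 x by apply: Hr_le hx; rewrite addSn ltnS leq_addl.
have -> : D2 (dop d c x) - dop d c (D2 x) = dop d (fun k n => derive1 (c k n)) x.
  rewrite /dop.
  have -> : D2 (\sum_(k < d.+1) topop k (c k) x) = \sum_(k < d.+1) D2 (topop k (c k) x).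
    apply: D2E; apply: W2_sum => k _; apply: (@Hr_W2 _ 0); apply: (@Hr_topop d 1 c (cCr 1%N isT)); first by rewrite -ltnS.
    by apply: Hr_le hx1; have := ltn_ord k; lia.
  rewrite -sumrB; apply: eq_bigr => k _.
  rewrite D2_topop; first by rewrite addrAC subrr add0r.
    by move=> n nk; apply: (cCr 1%N isT); rewrite nk -ltnS ltn_ord.
  by apply: Hr_le hx1; have := ltn_ord k; lia.
have hxr : Hr (r + d) x by exact: HrW.
exact: le_trans (Nr_dop cdC cdM hxr) (CC r x (ltnW rq)).
Qed.

Lemma op_onW m (d q : nat) (C C' : R) L : C <= C' -> op_on d q C m L -> op_on d q C' m L.
Proof.
move=> CC [h1 h2 h3 h4]; split=> //.
  move=> r x rq mx hx; have [a b e] := h2 r x rq mx hx; split=> //.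
  by apply: le_trans e _; rewrite ler_wpM2r ?Nr_ge0.
by move=> r x rq mx hx; apply: le_trans (h4 r x rq mx hx) _; rewrite ler_wpM2r ?Nr_ge0.
Qed.

Lemma op_on_id m (d q : nat) : op_on d q 1 m (fun x : V => x).
Proof.
split=> //.
  move=> r x rq mx hx; split=> //; first by apply: Hr_le hx; exact: leq_addr.
  by rewrite mul1r; apply: Nr_le; exact: leq_addr.
by move=> r x _ _ _; rewrite subrr Nr_0 mul1r Nr_ge0.
Qed.

Lemma op_on_comb m (d q : nat) (C C' a b : R) L L' : (0 < q)%N -> op_on d q C m L -> op_on d q C' m L' ->
  op_on d q (`|a| * C + `|b| * C') m (fun x => a *: L x + b *: L' x).
Proof.
move=> q0 [h1 h2 h3 h4] [k1 k2 k3 k4].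
have H1 x : modes m x -> Hr d.+1 x -> Hr 1 (L x) /\ Hr 1 (L' x).
  by move=> mx hx; have [a1 _ _] := h2 1%N x q0 mx hx; have [b1 _ _] := k2 1%N x q0 mx hx.
split.
- by move=> e x y mx my hx hy; rewrite h1// k1//; linear_identity.
- move=> r x rq mx hx; have [a1 a2 a3] := h2 r x rq mx hx; have [b1 b2 b3] := k2 r x rq mx hx.
  split; [apply: HrD; exact: HrZ|apply: modesD; exact: modesZ|].
  apply: le_trans (NrD (HrZ _ a1) (HrZ _ b1)) _; rewrite (NrZ a a1) (NrZ b b1).
  by rewrite mulrDl -!mulrA; apply: lerD; rewrite ler_wpM2l.
- move=> x mx hx; have [a1 b1] := H1 x mx hx.
  by rewrite (D1D (HrZ a a1) (HrZ b b1)) (D1Z a a1) (D1Z b b1) h3// k3.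
move=> r x rq mx hx.
have hx1 : Hr d.+1 x by apply: Hr_le hx; rewrite addSn ltnS leq_addl.
have [a1 b1] := H1 x mx hx1.
have mx2 : modes m (D2 x) by exact: modes_W2 (Hr_W2 hx) mx.
have [a2 _ _] := h2 r.+1 x rq mx hx; have [b2 _ _] := k2 r.+1 x rq mx hx.
have [a3 _ _] := h2 r _ (ltnW rq) mx2 (Hr_D2 hx); have [b3 _ _] := k2 r _ (ltnW rq) mx2 (Hr_D2 hx).
rewrite (D2D (HrZ a a1) (HrZ b b1)) (D2Z a a1) (D2Z b b1).
have -> : a *: D2 (L x) + b *: D2 (L' x) - (a *: L (D2 x) + b *: L' (D2 x)) =
   a *: (D2 (L x) - L (D2 x)) + b *: (D2 (L' x) - L' (D2 x)) by linear_identity.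
have ha := HrB (Hr_D2 a2) a3; have hb := HrB (Hr_D2 b2) b3.
apply: le_trans (NrD (HrZ a ha) (HrZ b hb)) _; rewrite (NrZ a ha) (NrZ b hb).
rewrite mulrDl -!mulrA; apply: lerD; rewrite ler_wpM2l//; [exact: h4|exact: k4].
Qed.

Lemma nm_dop_lower d c (M : R) x : (0 < d)%N -> (forall k n, (n <= k <= d)%N -> per_Cq 0 (c k n)) ->
  (forall k n, (n <= k <= d)%N -> Cbd 0 M (fsnd (c k n))) -> Hr d x ->
  nm (dop d c x - topop d (c d) x) <= d%:R * (d%:R * M) * Nr d.-1 x.
Proof.
case: d => [//|d] _ cC cM hx; rewrite /dop big_ord_recr /= addrK.
have := @Nr_dop d 0 c M _ _ x; rewrite expr0 mul1r; apply.
- by move=> k n /andP[nk kd]; apply: cC; rewrite nk ltnW.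
- by move=> k n /andP[nk kd]; apply: cM; rewrite nk ltnW.
exact: HrW.
Qed.

(** Passing from the leading part to the full operator costs only terms of order at most [d - 1],
    which go into the second summand on the right. *)
Lemma dop_elliptic d c (C M : R) : (0 < d)%N -> 0 < C ->
  (forall k n, (n <= k <= d)%N -> per_Cq 1 (c k n)) ->
  (forall k n, (n <= k <= d)%N -> Cbd 1 M (fsnd (c k n))) ->
  (forall s, C <= `|c d 0%N s|) ->
  (forall s a : R, C <= `|\sum_(n < d.+1) c d n s * a ^+ (d - n)|) ->
  exists2 K : R, 0 <= K & forall m x, modes m x -> Hr d x ->
    Nr d x <= K * (nm (x + dop d c x) + Nr d.-1 x).
Proof.
move=> d0 C0 cC cM c0 cC'.
have cd n : (n <= d)%N -> per_Cq 1 (c d n) by move=> nd; apply: cC; rewrite nd leqnn.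
have [K K0 hK] := variable_elliptic C0 cd c0 cC'.
have M0 : 0 <= M by have := Cbd_ge0 (cM 0%N 0%N isT).
have dM : 0 <= d%:R * (d%:R * M) by rewrite !mulr_ge0.
exists (1 + K * (2 + d%:R * (d%:R * M))).
  by rewrite addr_ge0// mulr_ge0// addr_ge0.
move=> m x mx hx; have h1 := hK m x mx hx.
have h2 : nm (dop d c x - topop d (c d) x) <= d%:R * (d%:R * M) * Nr d.-1 x.
  apply: (nm_dop_lower d0) hx => [k n h|k n h]; first exact: per_CqW (cC k n h).
  exact: CbdW (cM k n h).
have h3 : nm (topop d (c d) x) <= nm (x + dop d c x) + nm x + d%:R * (d%:R * M) * Nr d.-1 x.
  have -> : topop d (c d) x = (x + dop d c x) - x - (dop d c x - topop d (c d) x) by linear_identity.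
  apply: le_trans (nmB _ _) _; apply: lerD h2; exact: nmB.
have h4 := nm_le_Nr d.-1 x.
have -> : Nr d x = Nr d.-1 x + Sd d x by rewrite -[in LHS](prednK d0) NrS_Sd prednK.
set N := Nr d.-1 x in h1 h2 h3 h4 *; set T := nm (topop _ _ _) in h1 h3.
set L := nm (x + _) in h3 *.
have N0 : 0 <= N := Nr_ge0 _ _; have L0 : 0 <= L := nm_ge0 _.
have h5 : T + N <= (2 + d%:R * (d%:R * M)) * (L + N).
  have e1 : 0 <= d%:R * (d%:R * M) * L by rewrite mulr_ge0.
  by rewrite mulrDl !mulrDr; move: h3 h4 e1 L0 N0; lra.
rewrite mulrDl mul1r -mulrA; apply: lerD; first by rewrite lerDr.
apply: le_trans h1 _; exact: ler_wpM2l.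
Qed.

End DifferentialOperator.

(** * Existence by the method of continuity *)

Section ContinuityMethod.
Context {R : realType}.
Implicit Types (x y g : L2class R) (k m n d r : nat).
Local Notation V := (L2class R).

Definition onto_on (d q : nat) m (L : V -> V) : Prop :=
  forall g, modes m g -> Hr q g -> exists x, [/\ modes m x, Hr (q + d) x & L x = g].

Lemma op_on_sub m d q C L x y : op_on d q C m L -> modes m x -> modes m y -> Hr d x -> Hr d y -> L (x - y) = L x - L y.
Proof. by move=> [h _ _ _] mx my hx hy; have := h (-1) y x my mx hy hx; rewrite !scaleN1r addrC => ->; rewrite addrC. Qed.

Lemma expr_half_small (K e : R) : 0 < e -> exists n, K * (2^-1) ^+ n < e.
Proof.
move=> e0; have [K0|K0] := leP K 0.
  by exists 0; rewrite expr0 mulr1; apply: le_lt_trans e0.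
have hn := archi_boundP (divr_ge0 (ltW K0) (ltW e0)); set n := Num.bound _ in hn.
exists n; rewrite exprVn ltr_pdivrMr ?exprn_gt0//.
rewrite ltr_pdivrMr// in hn; apply: lt_le_trans hn _; rewrite mulrC ler_pM2l//.
rewrite -natrX ler_nat; exact: ltnW (ltn_expl n (ltnSn 1)).
Qed.

(** The equation at [t'] is rewritten as [L_t x = g - (t' - t) (L1 - L0) x] and iterated. The a
    priori bound makes each step contract by [1/4], the square of the rate [1/2] that completeness
    then yields. *)
Lemma continuity_step m d q (B C : R) (L0 L1 : V -> V) (t t' : R) :
  (forall t, 0 <= t <= 1 -> op_on d q C m (fun x => (1 - t) *: L0 x + t *: L1 x)) ->
  (forall t, 0 <= t <= 1 -> forall x, modes m x -> Hr (q + d) x ->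
     Nr (q + d) x <= B * Nr q ((1 - t) *: L0 x + t *: L1 x)) ->
  0 <= t <= 1 -> 0 <= t' <= 1 -> 0 <= B -> 0 <= C -> `|t' - t| * (B * (C + C)) <= 4^-1 ->
  onto_on d q m (fun x => (1 - t) *: L0 x + t *: L1 x) -> onto_on d q m (fun x => (1 - t') *: L0 x + t' *: L1 x).
Proof.
move=> hop hB t01 t01' B0 C0 small onto g mg hg.
have op0 : op_on d q C m L0.
  have -> : L0 = fun x => (1 - 0) *: L0 x + 0 *: L1 x by apply/funext => x; rewrite subr0 scale1r scale0r addr0.
  by apply: hop; rewrite lexx ler01.
have op1 : op_on d q C m L1.
  have -> : L1 = fun x => (1 - 1) *: L0 x + 1 *: L1 x by apply/funext => x; rewrite subrr scale1r scale0r add0r.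
  by apply: hop; rewrite lexx ler01.
set Lt := (fun x => (1 - t) *: L0 x + t *: L1 x) in onto *.
have opt : op_on d q C m Lt := hop t t01.
pose N x := L1 x - L0 x; pose s := t' - t.
have hd x : Hr (q + d) x -> Hr d x by apply: Hr_le; exact: leq_addl.
have opN x : modes m x -> Hr (q + d) x -> [/\ Hr q (N x), modes m (N x) & Nr q (N x) <= (C + C) * Nr (q + d) x].
  move=> mx hx; case: op0 => _ /(_ q x (leqnn q) mx hx) [a1 a2 a3] _ _.
  case: op1 => _ /(_ q x (leqnn q) mx hx) [b1 b2 b3] _ _.
  split; [exact: HrB|exact: modesB|apply: le_trans (NrB b1 a1) _; rewrite mulrDl; exact: lerD].
have Nsub x y : modes m x -> modes m y -> Hr (q + d) x -> Hr (q + d) y -> N (x - y) = N x - N y.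
  move=> mx my hx hy; rewrite /N (op_on_sub op0 mx my (hd _ hx) (hd _ hy)) (op_on_sub op1 mx my (hd _ hx) (hd _ hy)).
  by rewrite opprD addrACA -opprD.
(* A solution is selected for every [y], with the value [0] outside the domain, so that the
   iteration is that of a plain map. *)
have step y : exists z, modes m y -> Hr (q + d) y -> [/\ modes m z, Hr (q + d) z & Lt z = g - s *: N y].
  have [[my hy]|nh] := pselect (modes m y /\ Hr (q + d) y); last by exists 0 => my hy; case: nh.
  have [n1 n2 _] := opN y my hy.
  by have [z zP] := onto (g - s *: N y) (modesB mg (modesZ _ n2)) (HrB hg (HrZ _ n1)); exists z.
have [S hS] := boolp.choice step.
pose f n := iter n S 0.
have hf n : modes m (f n) /\ Hr (q + d) (f n).
  elim: n => [|n [a b]]; first by split; [exact: modes0|exact: Hr0].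
  by have [] := hS (f n) a b.
have ef n : Lt (f n.+1) = g - s *: N (f n) by have [a b] := hf n; have [] := hS _ a b.
set K1 := Nr (q + d) (f 1 - f 0).
have hdiff n : Nr (q + d) (f n.+1 - f n) <= K1 * ((2^-1) ^+ 2) ^+ n.
  elim: n => [|n IH]; first by rewrite expr0 mulr1.
  have [a0 b0] := hf n; have [a1 b1] := hf n.+1; have [a2 b2] := hf n.+2.
  apply: le_trans (hB t t01 _ (modesB a2 a1) (HrB b2 b1)) _.
  rewrite -/(Lt _) (op_on_sub opt a2 a1 (hd _ b2) (hd _ b1)) !ef.
  have -> : g - s *: N (f n.+1) - (g - s *: N (f n)) = (- s) *: N (f n.+1 - f n).
    by rewrite Nsub//; linear_identity.
  have [c1 _ c3] := opN _ (modesB a1 a0) (HrB b1 b0).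
  rewrite (NrZ _ c1) normrN.
  apply: (@le_trans _ _ (`|s| * (B * (C + C)) * Nr (q + d) (f n.+1 - f n))).
    by rewrite mulrCA -!mulrA ler_wpM2l// ler_wpM2l// mulrDl -mulrDl.
  have -> : K1 * ((2^-1 ^+ 2) ^+ n.+1) = 2^-1 ^+ 2 * (K1 * (2^-1 ^+ 2) ^+ n) by rewrite exprS mulrCA.
  apply: ler_pM => //; [by rewrite !mulr_ge0 ?addr_ge0|exact: Nr_ge0|].
  by have -> : (2^-1) ^+ 2 = 4^-1 :> R by rewrite exprVn; congr (_^-1); ring.
have q01 : 0 < (2^-1 : R) < 1 by rewrite invr_gt0 ltr0n /= invf_lt1 ?ltr1n.
have [x [K [hx hxK]]] := Hr_complete q01 (fun n => (hf n).2) hdiff.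
have mx : modes m x.
  apply: (modes_lim (fun n => (hf n).1)) => e e0; have [n hn] := expr_half_small K e0.
  by exists n; apply: le_lt_trans hn; apply: le_trans (nm_le_Nr (q + d) _) (hxK n).
exists x; split=> //.
set W := (1 - t') *: L0 x + t' *: L1 x.
have K0 : 0 <= K by have := hxK 0%N; rewrite expr0 mulr1; apply: le_trans; exact: Nr_ge0.
have hxK' n : Nr (q + d) (x - f n) <= K * 2^-1 ^+ n.
  by rewrite -(NrN (HrB hx (hf n).2)) opprB.
have bound n : nm (W - g) <= (C + `|s| * (C + C)) * K * 2^-1 ^+ n.
  have [a0 b0] := hf n; have [a1 b1] := hf n.+1.
  have -> : W - g = Lt (x - f n.+1) + s *: N (x - f n).
    rewrite (op_on_sub opt mx a1 (hd _ hx) (hd _ b1)) ef Nsub// /W /Lt /N /s.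
    by linear_identity.
  apply: le_trans (nmD _ _) _; rewrite nmZ.
  have h1 : nm (Lt (x - f n.+1)) <= C * (K * 2^-1 ^+ n).
    have [_ /(_ q _ (leqnn q) (modesB mx a1) (HrB hx b1)) [_ _ h] _ _] := opt.
    apply: le_trans (nm_le_Nr q _) _; apply: le_trans h _; rewrite ler_wpM2l//.
    apply: le_trans (hxK' n.+1) _; rewrite ler_wpM2l// exprS ler_piMl ?exprn_ge0 ?invr_ge0//.
    by rewrite invf_le1 ?ler1n.
  have h2 : nm (N (x - f n)) <= (C + C) * (K * 2^-1 ^+ n).
    have [_ _ h] := opN _ (modesB mx a0) (HrB hx b0).
    apply: le_trans (nm_le_Nr q _) _; apply: le_trans h _; rewrite ler_wpM2l ?addr_ge0//.
  rewrite -mulrA mulrDl -mulrA; apply: lerD h1 _; exact: ler_wpM2l h2.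
have W0 : nm (W - g) = 0.
  apply/eqP; rewrite eq_le nm_ge0 andbT leNgt; apply/negP => W0.
  have [n hn] := expr_half_small ((C + `|s| * (C + C)) * K) W0.
  by have := lt_le_trans hn (bound n); rewrite ltxx.
by apply/eqP; rewrite -subr_eq0; apply/eqP/nm_eq0.
Qed.

(** The admissible step length depends only on [B] and [C], which are the same for all [t], so
    finitely many steps lead from [0] to [1]. *)
Lemma continuity_method m d q (K C : R) (L0 L1 : V -> V) : (0 < d)%N -> 0 <= K -> 0 <= C ->
  (forall t, 0 <= t <= 1 -> elliptic_on d q K C m (fun x => (1 - t) *: L0 x + t *: L1 x)) ->
  onto_on d q m L0 -> onto_on d q m L1.
Proof.
move=> d0 K0 C0 hell onto0; have [B B0 hB] := @elliptic_regularity R d q K C d0 K0 C0.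
have hop t : 0 <= t <= 1 -> op_on d q C m (fun x => (1 - t) *: L0 x + t *: L1 x) by move=> /hell [].
have hB' t : 0 <= t <= 1 -> forall x, modes m x -> Hr (q + d) x ->
     Nr (q + d) x <= B * Nr q ((1 - t) *: L0 x + t *: L1 x).
  by move=> t01 x mx hx; exact: hB m _ (hell t t01) q x (leqnn q) mx hx.
have [n n0 hn] : exists2 n, (0 < n)%N & n%:R^-1 * (B * (C + C)) <= 4^-1.
  exists (Num.bound (4 * (B * (C + C)))).+1 => //.
  have h0 : 0 <= 4 * (B * (C + C)) by rewrite !mulr_ge0 ?addr_ge0.
  have := archi_boundP h0; set k := Num.bound _ => hk.
  have k0 : (0 : R) < k.+1%:R by rewrite ltr0n.
  rewrite [leLHS]mulrC ler_pdivrMr// -(natr1 k); move: hk; move: (B * (C + C)) => Q; lra.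
have nR : (0 : R) < n%:R by rewrite ltr0n.
have t01 k : (k <= n)%N -> 0 <= (k%:R / n%:R : R) <= 1.
  by move=> kn; rewrite divr_ge0//= ler_pdivrMr// mul1r ler_nat.
have H k : (k <= n)%N -> onto_on d q m (fun x => (1 - k%:R / n%:R) *: L0 x + (k%:R / n%:R) *: L1 x).
  elim: k => [|k IH] kn.
    rewrite mul0r subr0; have -> // : (fun x => 1 *: L0 x + 0 *: L1 x) = L0.
    by apply/funext => x; rewrite scale1r scale0r addr0.
  apply: (continuity_step hop hB' (t01 k (ltnW kn)) (t01 k.+1 kn) B0 C0 _ (IH (ltnW kn))).
  by rewrite -mulrBl -natr1 addrAC subrr add0r mul1r ger0_norm// invr_ge0.
have := H n (leqnn n); rewrite mulfV ?gt_eqF// subrr.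
have -> // : (fun x => 0 *: L0 x + 1 *: L1 x) = L1.
by apply/funext => x; rewrite scale1r scale0r add0r.
Qed.

End ContinuityMethod.

(** * The model operator [(1 - d_s^2)^D] *)

Section BaseOperator.
Context {R : realType}.
Implicit Types (x y g : L2class R) (k m n d r D : nat).
Local Notation V := (L2class R).

(** The inner operator is needed up to regularity [q + d], because the outer one uses up [d]
    derivatives. *)
Lemma op_on_comp m d d' q (C C' : R) (L L' : V -> V) : (0 < q)%N -> 0 <= C -> 0 <= C' ->
  op_on d q C m L -> op_on d' (q + d) C' m L' -> op_on (d + d') q (C * C' + C * C') m (L \o L').
Proof.
move=> q0 C0 C0' [l1 l2 l3 l4] [k1 k2 k3 k4].
have eA r : (r + (d + d') = r + d + d')%N by rewrite addnA.
have CC : 0 <= C * C' by rewrite mulr_ge0.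
split=> [a x y mx my hx hy|r x rq mx hx|x mx hx|r x rq mx hx] /=.
- have dq : (d <= q + d)%N by exact: leq_addl.
  have [a1 a2 _] := k2 d x dq mx hx; have [b1 b2 _] := k2 d y dq my hy.
  by rewrite k1 ?l1//; [apply: Hr_le hx|apply: Hr_le hy]; exact: leq_addl.
- rewrite eA in hx *; have rq' : (r + d <= q + d)%N by rewrite leq_add2r.
  have [a1 a2 a3] := k2 _ x rq' mx hx; have [b1 b2 b3] := l2 r _ rq a2 a1.
  split=> //; apply: le_trans b3 _; apply: le_trans (ler_wpM2l C0 a3) _.
  by rewrite mulrA ler_wpM2r ?Nr_ge0// lerDl.
- have dq : (d.+1 <= q + d)%N by rewrite -addn1 addnC leq_add2r.
  have [a1 a2 _] := k2 d.+1 x dq mx hx.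
  by rewrite l3// k3//; apply: Hr_le hx; rewrite ltnS leq_addl.
have hx' : Hr (r.+1 + d + d') x by rewrite -addnA.
have rq1 : (r.+1 + d <= q + d)%N by rewrite leq_add2r.
have rq2 : (r + d < q + d)%N by rewrite ltn_add2r.
have [a1 a2 _] := k2 _ x rq1 mx hx'.
have mx2 : modes m (D2 x) by exact: modes_W2 (Hr_W2 hx) mx.
have hDx : Hr (r + d + d') (D2 x) by apply: Hr_D2; exact: hx'.
have hx0 : Hr (r + d + d') x by apply: HrW; exact: hx'.
have [b1 b2 _] := k2 _ _ (ltnW rq2) mx2 hDx.
have [_ _ b3] := k2 _ _ (ltnW rq2) mx hx0.
have m2 : modes m (D2 (L' x)) by exact: modes_W2 (Hr_W2 a1) a2.
have c1 := l4 r _ rq a2 a1.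
have c2 := k4 (r + d)%N x rq2 mx hx'.
have a1' : Hr (r + d) (D2 (L' x)) := Hr_D2 a1.
have hd (z : V) : Hr (r + d) z -> Hr d z by apply: Hr_le; exact: leq_addl.
have mB := modesB m2 b2; have hB := HrB a1' b1.
have [d1 _ d3] := l2 r _ (ltnW rq) mB hB.
have [e1 _ _] := l2 r.+1 _ rq a2 a1.
have [f1 _ _] := l2 r _ (ltnW rq) m2 a1'.
have -> : D2 (L (L' x)) - L (L' (D2 x)) = (D2 (L (L' x)) - L (D2 (L' x))) + L (D2 (L' x) - L' (D2 x)).
  have -> : L (D2 (L' x) - L' (D2 x)) = L (D2 (L' x)) - L (L' (D2 x)).
    have := l1 (-1) _ _ b2 m2 (hd _ b1) (hd _ a1').
    by rewrite !scaleN1r addrC => ->; rewrite addrC.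
  by rewrite addrA subrK.
apply: le_trans (NrD (HrB (Hr_D2 e1) f1) d1) _; rewrite eA mulrDl; apply: lerD.
  apply: le_trans c1 _; rewrite -mulrA; exact: ler_wpM2l.
apply: le_trans d3 _; rewrite -mulrA; exact: ler_wpM2l.
Qed.

Lemma op_on_D2D2 m q : op_on 2 q 1 m (fun x : V => D2 (D2 x)).
Proof.
split.
- by move=> a x y _ _ hx hy; rewrite (D2_lin a hx hy) (D2_lin a (Hr_D2 hx) (Hr_D2 hy)).
- move=> r x rq mx; rewrite addn2 mul1r => hx; split; first exact: Hr_D2 (Hr_D2 hx).
    have m1 := modes_W2 (Hr_W2 hx) mx; exact: modes_W2 (Hr_W2 (Hr_D2 hx)) m1.
  apply: le_trans (Nr_D2 _ _) (Nr_D2 _ _).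
- move=> x mx hx; rewrite (DC (Hr_D2 hx)) (DC hx) //.
by move=> r x _ _ _; rewrite subrr Nr_0 mul1r Nr_ge0.
Qed.

Definition oneD22 x : V := x - D2 (D2 x).
Lemma op_on_oneD22 m q : (0 < q)%N -> op_on 2 q (1 + 1) m oneD22.
Proof.
move=> q0; have := op_on_comb 1 (-1) q0 (op_on_id m 2 q) (op_on_D2D2 m q).
rewrite normrN normr1 !mul1r; have -> // : (fun x : V => 1 *: x + -1 *: D2 (D2 x)) = oneD22.
by apply/funext => x; rewrite scale1r scaleN1r.
Qed.

Lemma op_on_iter m D q : (0 < q)%N -> exists2 C : R, 0 <= C & op_on (2 * D) q C m (iter D oneD22).
Proof.
move=> q0; elim: D => [|D [C C0 IH]]; first by exists 1; [exact: ler01|exact: op_on_id].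
have q1 : (0 < q + 2 * D)%N by rewrite addn_gt0 q0.
have h := op_on_comp q0 C0 (addr_ge0 ler01 ler01) IH (@op_on_oneD22 m _ q1).
exists (C * (1 + 1) + C * (1 + 1)); first by rewrite addr_ge0// mulr_ge0// addr_ge0.
have -> : (2 * D.+1 = 2 * D + 2)%N by rewrite mulnS addnC.
have -> // : iter D.+1 oneD22 = iter D oneD22 \o oneD22.
by apply/funext => x; rewrite iterSr.
Qed.

(** Projecting the solution of [resolvent2] onto the allowed frequencies keeps the equation. In the
    form [D2 u = eps (g - u)] it gains regularity order by order, theta-derivatives being bounded
    there. *)
Lemma resolvent_modes (eps : R) m r g : eps ^+ 2 = 1 -> modes m g -> Hr r g ->
  exists u, [/\ modes m u, Hr r.+1 u & u + eps *: D2 u = g].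
Proof.
move=> e2 mg hg; have [u [v [/W2closed_W2 huv e]]] := resolvent2 e2 (repr2_L2 g).
rewrite repr2K in e.
pose u' := Pms m (fun=> 1) u; pose v' := Pms m (fun=> 1) v.
have mu : modes m u' := modes_Pms _ _ _.
have h : W2 u' v' := W2_Pms m (fun=> 1) huv.
have e' : u' + eps *: v' = g.
  by rewrite -[RHS]mg -e addrC [u + _]addrC Pms_lin.
have ev : v' = eps *: (g - u').
  by rewrite -e' [u' + _]addrC addrK scalerA -expr2 e2 scale1r.
have H k : (k <= r.+1)%N -> Hr k u'.
  elim: k => [//|k IH] kr; have hk := IH (ltnW kr).
  apply: (modes_HrS mu h hk); rewrite ev; apply: HrZ; apply: HrB hk; exact: (Hr_le (kr : (k <= r)%N) hg).
exists u'; split=> //; first exact: H.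
by rewrite (D2E h).
Qed.

(** [1 - d_s^2] factors as [(1 - d_s) (1 + d_s)], and each factor is onto with a gain of one
    derivative. *)
Lemma onto_oneD22 m r g : modes m g -> Hr r g -> exists x, [/\ modes m x, Hr r.+2 x & oneD22 x = g].
Proof.
move=> mg hg.
have e1 : (-1 : R) ^+ 2 = 1 by rewrite sqrrN expr1n.
have [y [my hy ey]] := resolvent_modes e1 mg hg.
have e2 : (1 : R) ^+ 2 = 1 by rewrite expr1n.
have [x [mx hx ex]] := resolvent_modes e2 my hy.
exists x; split=> //; rewrite scale1r in ex; rewrite scaleN1r in ey.
rewrite /oneD22 -ey -ex (D2D (HrW hx) (Hr_D2 hx)); linear_identity.
Qed.

Lemma onto_iter m q D : onto_on (2 * D) q m (iter D oneD22).
Proof.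
move=> g mg hg; elim: D => [|D [x [mx hx ex]]]; first by exists g; rewrite addn0.
have [y [my hy ey]] := onto_oneD22 mx hx.
by exists y; rewrite iterSr ey; split=> //; rewrite mulnS addnCA addnC addn2.
Qed.

Lemma dot_oneD22_ge x : Hr 2 x -> nm x ^+ 2 <= dot x (oneD22 x).
Proof.
move=> hx; rewrite /oneD22 dotBr sqr_nm.
have := W2_parts (Hr_W2 hx) (Hr_W2 (Hr_D2 hx)); have := dot_ge0 (D2 x); lra.
Qed.
Lemma nm_oneD22 x : Hr 2 x -> nm x <= nm (oneD22 x).
Proof.
move=> hx; have h := dot_oneD22_ge hx; have := dot_lev x (oneD22 x) => h2.
have [->|x0] := eqVneq (nm x) 0; first exact: nm_ge0.
have xp : 0 < nm x by rewrite lt_neqAle eq_sym x0 nm_ge0.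
by rewrite -(ler_pM2l xp) -expr2 (le_trans h).
Qed.
Lemma dot_oneD22 x y : Hr 2 x -> Hr 2 y -> dot x (oneD22 y) = dot (oneD22 x) y.
Proof.
move=> hx hy; rewrite /oneD22 dotBr dotBl.
have := W2_parts (Hr_W2 hx) (Hr_W2 (Hr_D2 hy)); have := W2_parts (Hr_W2 (Hr_D2 hx)) (Hr_W2 hy).
by move=> -> ->; lra.
Qed.
Lemma Hr_oneD22 r x : Hr r.+2 x -> Hr r (oneD22 x).
Proof. by move=> h; apply: HrB; [exact: HrW (HrW h)|exact: Hr_D2 (Hr_D2 h)]. Qed.
Lemma Hr_iter_oneD22 r D x : Hr (r + 2 * D) x -> Hr r (iter D oneD22 x).
Proof.
elim: D x => [|D IH] x; first by rewrite muln0 addn0.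
by rewrite iterSr => h; apply: IH; apply: Hr_oneD22; rewrite mulnS addnCA addnC addn2 in h.
Qed.

(** With [A = 1 - d_s^2], symmetry removes two factors at a time,
    [<x, A^(D+2) x> = <A x, A^D (A x)>], and [|A x| >= |x|]. *)
Lemma dot_iter_ge D x : Hr (2 * D) x -> nm x ^+ 2 <= dot x (iter D oneD22 x).
Proof.
have [n] := ubnP D; elim: n D x => [//|n IH] [|[|D]] x Dn hx.
- by rewrite sqr_nm.
- exact: dot_oneD22_ge.
rewrite iterS iterSr.
have hx2 : Hr 2 x by apply: Hr_le hx; rewrite mulnS leq_addr.
have h1 : Hr (2 * D) (oneD22 x).
  by apply: Hr_oneD22; apply: Hr_le hx; rewrite !mulnS addnA addnC addn2 -addn2 leq_add2l.
have h2 : Hr 2 (iter D oneD22 (oneD22 x)).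
  apply: Hr_iter_oneD22; apply: Hr_oneD22; apply: Hr_le hx; rewrite !mulnS; lia.
rewrite dot_oneD22//; apply: le_trans (IH D _ _ h1); last by lia.
by rewrite ler_pXn2r ?nnegrE ?nm_ge0//; exact: nm_oneD22.
Qed.

Lemma iter_oneD22B D x y : Hr (2 * D) x -> Hr (2 * D) y -> iter D oneD22 (x - y) = iter D oneD22 x - iter D oneD22 y.
Proof.
elim: D x y => [//|D IH] x y hx hy; rewrite !iterSr.
have e : (2 * D.+1 = (2 * D).+2)%N by rewrite mulnS add2n.
rewrite e in hx hy.
have -> : oneD22 (x - y) = oneD22 x - oneD22 y.
  by rewrite /oneD22 (D2B hx hy) (D2B (Hr_D2 hx) (Hr_D2 hy)); linear_identity.
by apply: IH; exact: Hr_oneD22.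
Qed.

(** Isolates the top-order part; its sign [(-1)^D] is the one that ellipticity gives to the
    coefficient of [d_s^(2D)] in [P], which keeps the path between the two operators from
    degenerating. *)
Lemma iter_oneD22_top D : exists2 C : R, 0 <= C & forall x, Hr (2 * D) x ->
  nm (iter D oneD22 x - (-1) ^+ D *: iter (2 * D) D2 x) <= C * Nr (2 * D).-1 x.
Proof.
case: D => [|D]; first by exists 0 => // x _; rewrite expr0 scale1r subrr nm0 mul0r.
elim: D => [|D [C C0 IH]].
  exists 1 => // x hx; rewrite expr1 mul1r /= /oneD22 scaleN1r opprK subrK.
  exact: (nm_le_Nr 1).
exists (C + C + 1); first by rewrite !addr_ge0.
move=> x hx.
have e : (2 * D.+2 = (2 * D.+1).+2)%N by rewrite mulnS add2n.
have e' : (2 * D.+1 = (2 * D.+1).-1.+1)%N by [].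
rewrite e in hx *; set d := (2 * D.+1)%N in hx IH e' *.
have hx0 : Hr d x := HrW (HrW hx).
have hD : Hr d (D2 (D2 x)) := Hr_D2 (Hr_D2 hx).
rewrite iterSr {1}/oneD22 (iter_oneD22B hx0 hD).
have -> : iter d.+2 D2 x = iter d D2 (D2 (D2 x)) by rewrite !iterSr.
set z := D2 (D2 x) in hD *.
have -> : iter D.+1 oneD22 x - iter D.+1 oneD22 z - (-1) ^+ D.+2 *: iter d D2 z =
   (iter D.+1 oneD22 x - (-1) ^+ D.+1 *: iter d D2 x) + (-1) ^+ D.+1 *: iter d D2 x
    - (iter D.+1 oneD22 z - (-1) ^+ D.+1 *: iter d D2 z).
  by rewrite [(-1) ^+ D.+2]exprS; linear_identity.
apply: le_trans (nmB _ _) _.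
have h1 := IH x hx0; have h2 := IH z hD.
have h3 : nm ((-1) ^+ D.+1 *: iter d D2 x) <= Nr d.+1 x.
  rewrite nmZ normrX normrN1 expr1n mul1r; apply: le_trans (NrS d x).
  exact: (@nm_iter_le_Nr R d 0 d).
have h4 : C * Nr d.-1 x <= C * Nr d.+1 x by rewrite ler_wpM2l//; apply: Nr_le; rewrite e'; lia.
have h5 : C * Nr d.-1 z <= C * Nr d.+1 x.
  rewrite ler_wpM2l// [in leRHS]e'; apply: le_trans (Nr_D2 _ _) (Nr_D2 _ _).
change d.+2.-1 with d.+1.
apply: le_trans (lerD (le_trans (nmD _ _) (lerD h1 h3)) h2) _.
rewrite !mulrDl mul1r; move: h4 h5; move: (C * Nr d.-1 x) (C * Nr d.-1 z) (C * Nr d.+1 x) => a b e1; lra.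
Qed.

End BaseOperator.

(** * Surjectivity of [1 + P] on finitely many frequencies *)

Section Existence.
Context {R : realType}.
Implicit Types (x y g : L2class R) (k m n d r D : nat).
Local Notation V := (L2class R).

(** A theta-derivative in the word costs a factor [m] and lowers the order by one; only the pure
    s-derivative is of top order. *)
Lemma nm_Dw_modes m w x : modes m x -> Hr (size w) x ->
  nm (Dw w x) <= nm (iter (size w) D2 x) + m%:R * Nr (size w).-1 x.
Proof.
elim: w x => [|b w IH] x mx hx; first by rewrite lerDl mulr_ge0 ?nm_ge0.
case: b hx => hx.
  apply: le_trans (nm_Dw_le w (D1 x)) _; apply: le_trans (Nr_modes_D1 mx (HrW hx)) _.
  by rewrite /= lerDr nm_ge0.
case: w IH hx => [|b w] IH hx; first by rewrite /= lerDl mulr_ge0 ?nm_ge0.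
have m2 : modes m (D2 x) by exact: modes_W2 (Hr_W2 hx) mx.
apply: le_trans (IH _ m2 (Hr_D2 hx)) _; rewrite -iterSr.
by apply: lerD => //; rewrite ler_wpM2l//; exact: (Nr_D2 (size w)).
Qed.

Lemma nm_topop_rest d (c : nat -> R -> R) (M : R) m x : (0 < d)%N -> 0 <= M ->
  (forall n, (n <= d)%N -> per_Cq 0 (c n)) -> (forall n s, (n <= d)%N -> `|c n s| <= M) ->
  modes m x -> Hr d x ->
  nm (topop d c x - bmul (fsnd (c 0%N)) (iter d D2 x)) <= d%:R * (M * (m%:R * Nr d.-1 x)).
Proof.
move=> d0 M0 cC cM mx hx; rewrite /topop big_ord_recl subn0 /= addrAC subrr add0r.
apply: le_trans (nm_sum _ _ _) _.
have -> : d%:R * (M * (m%:R * Nr d.-1 x)) = \sum_(n < d) (M * (m%:R * Nr d.-1 x)).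
  by rewrite sumr_const card_ord [LHS]mulr_natl.
apply: ler_sum => n _; have nd : (n.+1 <= d)%N by exact: ltn_ord.
change (bump 0 n) with n.+1; change (0 + n)%N with (n : nat).
have cn : is_Cq 0 (fsnd (c n.+1)) := per_Cq_snd (cC _ nd).
apply: le_trans (nm_bmul _ cn (fun z => cM n.+1 z.2 nd)) _; rewrite ler_wpM2l//.
have hx' : Hr d.-1 x by apply: Hr_le hx; exact: leq_pred.
apply: le_trans (Nr_modes_D1 mx hx').
have -> : D1 (iter n D1 x) = iter n D1 (D1 x) by rewrite -iterS iterSr.
by apply: nm_iter_le_Nr; lia.
Qed.

(** Along the segment the coefficient of the top s-derivative is [(1 - t) (-1)^D + t c], of modulus
    at least [min 1 C] because both summands have the sign [(-1)^D]; positivity gives [|x| <= |L x|]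
    for every [t]. The constants grow with [m], which is harmless for surjectivity. *)
Lemma onto_dop m q D c (C M : R) : (0 < q)%N -> (0 < D)%N -> 0 < C ->
  (forall k n, (n <= k <= 2 * D)%N -> per_Cq q (c k n)) ->
  (forall k n, (n <= k <= 2 * D)%N -> Cbd q M (fsnd (c k n))) ->
  (forall s, C <= (-1) ^+ D * c (2 * D)%N 0%N s) ->
  (forall x, Hr (2 * D) x -> 0 <= dot x (dop (2 * D) c x)) ->
  onto_on (2 * D) q m (fun x => x + dop (2 * D) c x).
Proof.
move=> q0 D0 C0 cC cM cpos psd.
set d := (2 * D)%N in cC cM cpos psd *.
have d0 : (0 < d)%N by rewrite /d; lia.
have M0 : 0 <= M by have := Cbd_ge0 (cM 0%N 0%N isT).
have cC0 k n : (n <= k <= d)%N -> per_Cq 0 (c k n) by move=> h; exact: per_Cq_le (cC k n h).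
have cM0 k n : (n <= k <= d)%N -> Cbd 0 M (fsnd (c k n)) by move=> h; exact: Cbd_le (cM k n h).
have [CB CB0 opB] := @op_on_iter R m D q q0.
have [C1 C10 hC1] := @iter_oneD22_top R D.
have opP := @op_on_dop R m d q c M _ q0 cC cM (lexx _).
set CP := _ * _ in opP; have CP0 : 0 <= CP by rewrite /CP !mulr_ge0// exprn_ge0.
have opL : op_on d q (1 + CP) m (fun x : V => x + dop d c x).
  have := op_on_comb 1 1 q0 (op_on_id m d q) opP; rewrite normr1 !mul1r.
  have -> // : (fun x : V => 1 *: x + 1 *: dop d c x) = fun x => x + dop d c x.
  by apply/funext => x; rewrite !scale1r.
pose c1 := Num.min 1 C; have c10 : 0 < c1 by rewrite lt_min ltr01.
pose K1 := 1 + C1 + 1 + d%:R * (d%:R * M) + d%:R * (M * m%:R).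
have K10 : 0 <= K1 by rewrite !addr_ge0// !mulr_ge0.
pose K := 1 + 2 ^+ d * (c1^-1 * K1 + m%:R).
have K0 : 0 <= K by rewrite addr_ge0// mulr_ge0 ?exprn_ge0// addr_ge0// mulr_ge0// invr_ge0 ltW.
apply: (@continuity_method R m d q K (CB + (1 + CP)) (iter D (@oneD22 R)) _ d0 K0).
- by rewrite !addr_ge0.
- move=> t /andP[t0 t1]; have t1' : 0 <= 1 - t by rewrite subr_ge0.
  split.
  + apply: op_onW (op_on_comb (1 - t) t q0 opB opL).
    rewrite !ger0_norm//.
    have p1 : (1 - t) * CB <= 1 * CB by rewrite ler_wpM2r//; lra.
    have p2 : t * (1 + CP) <= 1 * (1 + CP) by rewrite ler_wpM2r// addr_ge0.
    by rewrite !mul1r in p1 p2; exact: lerD.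
  + move=> x mx hx; set Lx := (1 - t) *: _ + _.
    pose y0 := iter d D2 x; pose N := Nr d.-1 x.
    have N0 : 0 <= N := Nr_ge0 _ _.
    pose gg s := (1 - t) * (-1) ^+ D + t * c d 0%N s.
    have h0d : (0 <= d <= d)%N by rewrite leqnn.
    have cc0 : is_Cq 0 (fsnd (c d 0%N)) := per_Cq_snd (cC0 _ _ h0d).
    have cg : is_Cq 0 (fsnd gg).
      by apply: (@per_Cq_snd _ 0); apply: per_CqD; [exact: per_Cq_cst|apply: per_CqZ; exact: cC0].
    have g1 s : c1 <= `|gg s|.
      have -> : `|gg s| = `|(-1) ^+ D * gg s| by rewrite normrM normrX normrN1 expr1n mul1r.
      apply: le_trans (ler_norm _).
      have -> : (-1) ^+ D * gg s = (1 - t) + t * ((-1) ^+ D * c d 0%N s).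
        by rewrite /gg mulrDr mulrCA -expr2 sqrr_sign mulr1; ring.
      have hm1 : c1 <= 1 by rewrite ge_min lexx.
      have hm2 : c1 <= (-1) ^+ D * c d 0%N s by apply: le_trans (cpos s); rewrite ge_min lexx orbT.
      have a1 : t * c1 <= t * ((-1) ^+ D * c d 0%N s) by rewrite ler_wpM2l.
      have a2 : (1 - t) * c1 <= (1 - t) * 1 by rewrite ler_wpM2l.
      by move: a1 a2; rewrite mulrBl mul1r mulr1; lra.
    have n1 : c1 * nm y0 <= nm (bmul (fsnd gg) y0).
      have -> : c1 * nm y0 = nm (bmul (fun=> c1) y0) by rewrite bmul_cst nmZ (ger0_norm (ltW c10)).
      apply: (nm_bmul_le _ (is_Cq_cst 0 c1) cg) => z; rewrite (ger0_norm (ltW c10)); exact: g1.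
    have eq1 : bmul (fsnd gg) y0 = Lx - (1 - t) *: (iter D (@oneD22 R) x - (-1) ^+ D *: y0)
        - t *: (x + (dop d c x - topop d (c d) x) + (topop d (c d) x - bmul (fsnd (c d 0%N)) y0)).
      have -> : bmul (fsnd gg) y0 = ((1 - t) * (-1) ^+ D) *: y0 + t *: bmul (fsnd (c d 0%N)) y0.
        rewrite -(bmulZl _ _ cc0) -(bmul_cst ((1 - t) * (-1) ^+ D)).
        by rewrite -(bmulDl _ (is_Cq_cst 0 _) (is_CqZ t cc0)).
      by rewrite /Lx; linear_identity.
    have e1 := hC1 x hx.
    have e2 := nm_dop_lower d0 cC0 cM0 hx.
    have e3 : nm (topop d (c d) x - bmul (fsnd (c d 0%N)) y0) <= d%:R * (M * (m%:R * N)).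
      apply: (nm_topop_rest d0 M0) mx hx => [n nd|n s nd]; first by apply: cC0; rewrite nd leqnn.
      have nd' : (n <= d <= d)%N by rewrite nd leqnn.
      exact: (Cbd_bd (cM0 d n nd') (0, s)).
    have e4 : nm x <= N := nm_le_Nr _ _.
    have n2 : nm (bmul (fsnd gg) y0) <= nm Lx + C1 * N + (N + d%:R * (d%:R * M) * N + d%:R * (M * (m%:R * N))).
      rewrite eq1; apply: le_trans (nmB _ _) _; apply: lerD.
        apply: le_trans (nmB _ _) _; apply: lerD => //; rewrite nmZ (ger0_norm t1').
        apply: le_trans _ e1; rewrite ler_piMl ?nm_ge0//; lra.
      rewrite nmZ (ger0_norm t0); apply: (@le_trans _ _ (1 * nm (x + (dop d c x - topop d (c d) x) + (topop d (c d) x - bmul (fsnd (c d 0%N)) y0)))).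
        by rewrite ler_wpM2r ?nm_ge0.
      rewrite mul1r; apply: le_trans (nmD _ _) _; apply: lerD e3; apply: le_trans (nmD _ _) _; exact: lerD.
    have L0 : 0 <= nm Lx := nm_ge0 _.
    have n3 : nm (bmul (fsnd gg) y0) <= K1 * (nm Lx + N).
      apply: le_trans n2 _; rewrite /K1.
      have p1 : 0 <= C1 * nm Lx by rewrite mulr_ge0.
      have p2 : 0 <= d%:R * (d%:R * M) * nm Lx by rewrite !mulr_ge0.
      have p3 : 0 <= d%:R * (M * m%:R) * nm Lx by rewrite !mulr_ge0.
      have p4 : d%:R * (M * (m%:R * N)) = d%:R * (M * m%:R) * N by rewrite !mulrA.
      rewrite p4 !mulrDl !mulrDr !mul1r; move: p1 p2 p3.
      move: (C1 * nm Lx) (d%:R * (d%:R * M) * nm Lx) (d%:R * (M * m%:R) * nm Lx) => a1 a2 a3; lra.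
    have n4 : nm y0 <= c1^-1 * K1 * (nm Lx + N).
      by rewrite -mulrA -ler_pdivrMl ?invr_gt0// invrK; exact: le_trans n1 n3.
    have n5 : Sd d x <= 2 ^+ d * (nm y0 + m%:R * N).
      apply: Sd_le_Dw => w sw; have hw : Hr (size w) x by rewrite sw.
      by have := nm_Dw_modes mx hw; rewrite sw.
    have -> : Nr d x = N + Sd d x by rewrite /N -[in LHS](prednK d0) NrS_Sd prednK.
    rewrite /K mulrDl mul1r; apply: lerD; first by rewrite lerDr.
    apply: le_trans n5 _; rewrite -mulrA ler_wpM2l ?exprn_ge0// mulrDl; apply: lerD n4 _.
    by rewrite ler_wpM2l// lerDr.
  + move=> x mx hx.
    set Lx := (1 - t) *: _ + _.
    have h1 : nm x ^+ 2 <= dot x Lx.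
      rewrite /Lx dotDr !dotZr dotDr.
      have a1 := ler_wpM2l t1' (dot_iter_ge hx).
      have a2 := ler_wpM2l t0 (psd x hx); rewrite mulr0 in a2.
      by move: a1 a2; rewrite mulrDr sqr_nm mulrBl; lra.
    have h2 := dot_lev x Lx.
    have [->|x0] := eqVneq (nm x) 0; first exact: nm_ge0.
    have xp : 0 < nm x by rewrite lt_neqAle eq_sym x0 nm_ge0.
    by rewrite -(ler_pM2l xp) -expr2 (le_trans h1).
exact: onto_iter.
Qed.

End Existence.

(** * The recursion in powers of rho *)

Section Weights.
Context {R : realType}.
Implicit Types (k l n p : nat).

Definition node n j : R := 2 * pi / n%:R * j%:R.

(** Multiplication by [2 sin h], with half a step [h = p pi / n], makes the sums telescope over
    whole periods; [sin h] is nonzero for [0 < p < n]. *)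
Lemma node_sums n p : (0 < p < n)%N ->
  \sum_(j < n) cos (p%:R * node n j) = 0 :> R /\ \sum_(j < n) sin (p%:R * node n j) = 0 :> R.
Proof.
move=> /andP[p0 pn]; have n0 : (0 : R) < n%:R by rewrite ltr0n; exact: leq_trans pn.
pose h : R := p%:R * pi / n%:R.
have h0 : 0 < h by rewrite divr_gt0// mulr_gt0 ?ltr0n// pi_gt0.
have hpi : h < pi by rewrite ltr_pdivrMr// mulrC ltr_pM2l ?pi_gt0// ltr_nat.
have sh : sin h != 0 by rewrite gt_eqF// sin_gt0_pi// h0.
have e1 j : p%:R * node n j.+1 - h = p%:R * node n j + h.
  rewrite /node /h -natr1; have nn : n%:R != 0 :> R by rewrite gt_eqF.
  by field.
have eN : p%:R * node n n - h = p%:R * (2 * pi) - h.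
  by rewrite /node divfK ?gt_eqF.
have per (T : R -> R) (hT : forall y, T (y + 2 * pi) = T y) : T (p%:R * (2 * pi) - h) = T (- h).
  by rewrite addrC; have := periodic_int hT p%:Z (- h).
have e0 : p%:R * node n 0 - h = - h by rewrite /node !mulr0 sub0r.
have tel (T : R -> R) (hT : forall y, T (y + 2 * pi) = T y) :
    \sum_(j < n) (T (p%:R * node n j + h) - T (p%:R * node n j - h)) = 0.
  rewrite -(big_mkord xpredT (fun j => T (p%:R * node n j + h) - T (p%:R * node n j - h))).
  under eq_bigr => j _ do rewrite -e1.
  by rewrite telescope_sumr// eN e0 per// subrr.
have sper y : sin (y + 2 * pi) = sin y :> R by rewrite mulr_natl sinD2pi.
have cper y : cos (y + 2 * pi) = cos y :> R by rewrite mulr_natl cosD2pi.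
have s2 : 2 * sin h != 0 by rewrite mulf_neq0// pnatr_eq0.
have s2' : - 2 * sin h != 0 by rewrite mulf_neq0// oppr_eq0 pnatr_eq0.
split.
  apply: (mulfI s2); rewrite mulr0 -[RHS](tel sin sper) mulr_sumr.
  by apply: eq_bigr => j _; rewrite sinD sinB; ring.
apply: (mulfI s2'); rewrite mulr0 -[RHS](tel cos cper) mulr_sumr.
by apply: eq_bigr => j _; rewrite cosD cosB; ring.
Qed.

Lemma node_sum_cos n k l : (k + l < n)%N -> \sum_(j < n) cos (k%:R * node n j - l%:R * node n j) = n%:R * (k == l)%:R :> R.
Proof.
move=> kl; have [lt|lt|<-] := ltngtP k l.
- rewrite mulr0; have [|h _] := @node_sums n (l - k); first by lia.
  rewrite -[RHS]h; apply: eq_bigr => j _.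
  by rewrite -cosN opprB -mulrBl -natrB// ltnW.
- rewrite mulr0; have [|h _] := @node_sums n (k - l); first by lia.
  rewrite -[RHS]h; apply: eq_bigr => j _.
  by rewrite -mulrBl -natrB// ltnW.
rewrite mulr1 (eq_bigr (fun=> 1)); last by move=> j _; rewrite subrr cos0.
by rewrite sumr_const card_ord.
Qed.
Lemma node_sum_sin n k l : (k + l < n)%N -> \sum_(j < n) sin (k%:R * node n j - l%:R * node n j) = 0 :> R.
Proof.
move=> kl; have [lt|lt|<-] := ltngtP k l.
- have [|_ h] := @node_sums n (l - k); first by lia.
  transitivity (- \sum_(j < n) sin ((l - k)%:R * node n j) : R); last by rewrite h oppr0.
  rewrite -sumrN; apply: eq_bigr => j _.
  by rewrite natrB ?(ltnW lt)// mulrBl -sinN opprB.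
- have [|_ h] := @node_sums n (k - l); first by lia.
  rewrite -[RHS]h; apply: eq_bigr => j _.
  by rewrite -mulrBl -natrB// ltnW.
by rewrite big1// => j _; rewrite subrr sin0.
Qed.

(** Weights for the derivative at [0]: if [g] is a trigonometric polynomial of degree at most [k],
    then [g'(0)] is the sum of the [wnode k j] times the values of [g] at the nodes. Up to
    normalisation they are values of the derivative of the Dirichlet kernel. *)
Definition wnode k j : R := 2 / (k.*2.+1)%:R * \sum_(l < k.+1) l%:R * sin (l%:R * node k.*2.+1 j).

Lemma wnode_cos k l : (l <= k)%N -> \sum_(j < k.*2.+1) wnode k j * cos (l%:R * node k.*2.+1 j) = 0.
Proof.
move=> lk; set n := k.*2.+1.
transitivity (\sum_(i < k.+1) 2 / n%:R * i%:R * \sum_(j < n) sin (i%:R * node n j) * cos (l%:R * node n j)).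
  under eq_bigr => j _ do rewrite /wnode mulr_sumr mulr_suml.
  rewrite exchange_big/=; apply: eq_bigr => i _; rewrite mulr_sumr; apply: eq_bigr => j _; ring.
apply: big1 => i _; have ik : (i <= k)%N by rewrite -ltnS.
have [i0|i0] := posnP i; first by rewrite i0 mulr0 mul0r.
suff -> : \sum_(j < n) sin (i%:R * node n j) * cos (l%:R * node n j) = 0 by rewrite mulr0.
have kl : (i + l < n)%N by rewrite /n; lia.
have h1 := node_sum_sin kl; have [|_ h2] := @node_sums n (i + l); first by rewrite kl addn_gt0 i0.
have e2 : 2 != 0 :> R by rewrite pnatr_eq0.
apply: (mulfI e2); rewrite mulr0.
transitivity (\sum_(j < n) sin (i%:R * node n j - l%:R * node n j) + \sum_(j < n) sin ((i + l)%:R * node n j) : R).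
  2: by rewrite h1 h2 addr0.
rewrite -big_split mulr_sumr; apply: eq_bigr => j _ /=.
have e : (i + l)%:R * node n j = i%:R * node n j + l%:R * node n j by rewrite (natrD _ i l) mulrDl.
by rewrite e sinB sinD; ring.
Qed.
Lemma wnode_sin k l : (l <= k)%N -> \sum_(j < k.*2.+1) wnode k j * sin (l%:R * node k.*2.+1 j) = l%:R.
Proof.
move=> lk; set n := k.*2.+1.
have [->|l0] := posnP l; first by rewrite big1// => j _; rewrite mul0r sin0 mulr0.
transitivity (\sum_(i < k.+1) 2 / n%:R * i%:R * \sum_(j < n) sin (i%:R * node n j) * sin (l%:R * node n j)).
  under eq_bigr => j _ do rewrite /wnode mulr_sumr mulr_suml.
  rewrite exchange_big/=; apply: eq_bigr => i _; rewrite mulr_sumr; apply: eq_bigr => j _; ring.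
transitivity (\sum_(i < k.+1) (i%:R * (i == l :> nat)%:R : R)).
  apply: eq_bigr => i _; have ik : (i <= k)%N by rewrite -ltnS.
  have kl : (i + l < n)%N by rewrite /n; lia.
  have h1 := node_sum_cos kl; have [|h2 _] := @node_sums n (i + l); first by rewrite kl addn_gt0 l0 orbT.
  have e2 : 2 * \sum_(j < n) sin (i%:R * node n j) * sin (l%:R * node n j) = n%:R * (i == l :> nat)%:R.
    transitivity (\sum_(j < n) cos (i%:R * node n j - l%:R * node n j) - \sum_(j < n) cos ((i + l)%:R * node n j) : R).
      2: by rewrite h1 h2 subr0.
    rewrite -sumrB mulr_sumr; apply: eq_bigr => j _ /=.
    have e : (i + l)%:R * node n j = i%:R * node n j + l%:R * node n j by rewrite (natrD _ i l) mulrDl.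
    by rewrite e cosB cosD; ring.
  have n0 : n%:R != 0 :> R by rewrite pnatr_eq0.
  have -> : 2 / n%:R * i%:R * \sum_(j < n) sin (i%:R * node n j) * sin (l%:R * node n j) =
    n%:R^-1 * i%:R * (2 * \sum_(j < n) sin (i%:R * node n j) * sin (l%:R * node n j)) by ring.
  by rewrite e2; field.
have lk' : (l < k.+1)%N by [].
rewrite (bigD1 (Ordinal lk'))//= eqxx mulr1 big1 ?addr0// => i il.
by rewrite (_ : (i == l :> nat) = false) ?mulr0//; apply/negP => /eqP e; case/negP: il; apply/eqP/val_inj.
Qed.
Lemma wnode_bound k : \sum_(j < k.*2.+1) `|wnode k j| <= 2 * k.+1%:R ^+ 2.
Proof.
have h j : `|wnode k j| <= 2 / k.*2.+1%:R * k.+1%:R ^+ 2.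
  rewrite /wnode normrM (ger0_norm (_ : 0 <= 2 / _))// ler_wpM2l//.
  apply: le_trans (ler_norm_sum _ _ _) _.
  have -> : k.+1%:R ^+ 2 = \sum_(l < k.+1) k.+1%:R :> R by rewrite sumr_const card_ord -[RHS]mulr_natl expr2.
  apply: ler_sum => l _; rewrite normrM -[leRHS]mulr1 ger0_norm//; apply: ler_pM => //.
    by rewrite ler_nat ltnW.
  by rewrite ler_norml sin_geN1 sin_le1.
apply: (@le_trans _ _ (\sum_(j < k.*2.+1) (2 / k.*2.+1%:R * k.+1%:R ^+ 2))).
  by apply: ler_sum => j _; exact: h.
rewrite sumr_const card_ord -[leLHS]mulr_natl.
have n0 : k.*2.+1%:R != 0 :> R by rewrite pnatr_eq0.
by have -> : k.*2.+1%:R * (2 / k.*2.+1%:R * k.+1%:R ^+ 2) = 2 * k.+1%:R ^+ 2 :> R by field.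
Qed.

Lemma wnode_expi k (j : int) : (`|j| <= k)%N ->
  \sum_(i < k.*2.+1) cplx (wnode k i) * expi j (node k.*2.+1 i) = 'i%C * (j%:~R : R[i]).
Proof.
move=> jk.
have -> : 'i%C * (j%:~R : R[i]) = (0 +i* j%:~R)%C.
  by rewrite -(rmorph_int (real_complex R)) /real_complex_def; simpc.
have -> : \sum_(i < k.*2.+1) cplx (wnode k i) * expi j (node k.*2.+1 i) =
  ((\sum_(i < k.*2.+1) wnode k i * cos (j%:~R * node k.*2.+1 i)) +i*
   (\sum_(i < k.*2.+1) wnode k i * sin (j%:~R * node k.*2.+1 i)))%C.
  elim/big_rec3: _ => [//|i a b c _ ->].
  by rewrite /cplx /expi; apply/eqP; rewrite eq_complex /= !mul0r subr0 addr0 !eqxx.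
have h1 : \sum_(i < k.*2.+1) wnode k i * cos (j%:~R * node k.*2.+1 i) = 0.
  by rewrite -[RHS](wnode_cos jk); apply: eq_bigr => i _; rewrite cos_int.
have h2 : \sum_(i < k.*2.+1) wnode k i * sin (j%:~R * node k.*2.+1 i) = j%:~R.
  transitivity ((sgz j)%:~R * \sum_(i < k.*2.+1) wnode k i * sin (`|j|%N%:R * node k.*2.+1 i)).
    by rewrite mulr_sumr; apply: eq_bigr => i _; rewrite sin_int /sink; ring.
  by rewrite (wnode_sin jk) {3}[j]intEsg rmorphM.
by rewrite h1 h2.
Qed.
End Weights.

Section Classical.
Context {R : realType}.
Implicit Types (f g a : R * R -> R) (k l n m q : nat).
Local Notation leb := (@lebesgue_measure R).

(** A continuous difference that is nonzero at a point is nonzero on a square of positive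
    measure. *)
Lemma continuous_ae_eq f g : continuous f -> continuous g -> aeeq f g -> forall z, f z = g z.
Proof.
move=> cf cg [N [mN N0 hN]] [x y]; apply/eqP; apply: contraT => fg.
have ch : continuous (fun z => f z - g z) by move=> z; apply: cvgB; [exact: cf|exact: cg].
have : \forall z \near (x, y), f z - g z != 0.
  have h0 : f (x, y) - g (x, y) != 0 by rewrite subr_eq0.
  have := ch (x, y) => /(_ [set t | t != 0]); apply.
  by apply: open_nbhs_nbhs; split=> //; exact: open_neq.
move=> /near_prod_ball [e e0 he].
pose I (x : R) := `]x - e, x + e[%classic.
have sub : I x `*` I y `<=` N.
  move=> [x' y'] [/= hx hy]; apply: hN => /= h.
  have : f (x', y') - g (x', y') != 0; last by rewrite h subrr eqxx.
  apply: he.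
    by move: hx; rewrite /I /= in_itv/= => /andP[h1 h2]; rewrite ltr_norml; apply/andP; split; lra.
  by move: hy; rewrite /I /= in_itv/= => /andP[h1 h2]; rewrite ltr_norml; apply/andP; split; lra.
have mI z : measurable (I z) by exact: measurable_itv.
have hle := @le_measure _ _ _ (@area R) _ _ (mem_set (measurableX (mI x) (mI y))) (mem_set mN) sub.
have {hle} : (area (I x `*` I y) <= 0)%E by apply: (le_trans hle); rewrite le_eqVlt; apply/orP; left; apply/eqP; exact: N0.
rewrite /area [X in (X <= _)%E]product_measure1E//.
have lI z : leb (I z) = (2 * e)%:E.
  rewrite /I lebesgue_measure_itv/= lte_fin ifT; last by lra.
  by rewrite -EFinB; congr EFin; ring.
have E : (leb (I x) * leb (I y))%E = (2 * e * (2 * e))%:E by rewrite !lI.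
move=> hle; have : ((2 * e * (2 * e))%:E <= 0)%E by rewrite -E; exact: hle.
rewrite lee_fin; have h1 : 0 < 2 * e * (2 * e) by rewrite !mulr_gt0.
by move=> h2; have := lt_le_trans h1 h2; rewrite ltxx.
all: exact: mI.
Qed.

Definition rot (t : R) f : R * R -> R := fun z => f (z.1 + t, z.2).

Lemma dtheta_rot f (t : R) : dtheta (rot t f) = rot t (dtheta f).
Proof.
apply/funext => z; rewrite /dtheta /rot /= /derive1.
by under eq_fun do rewrite -addrA.
Qed.
Lemma ds_rot f (t : R) : ds (rot t f) = rot t (ds f).
Proof. by []. Qed.

Lemma is_Cq_rot q f (t : R) : is_Cq q f -> is_Cq q (rot t f).
Proof.
have P g : periodic2 g -> periodic2 (rot t g).
  by move=> pg x y; rewrite /rot /=; have [_ ->] := pg (x + t) y; rewrite addrAC; have [-> _] := pg (x + t) y.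
have C g : continuous g -> continuous (rot t g).
  move=> cg [x y]; apply: (@continuous_comp _ _ _ (fun z : R * R => (z.1 + t, z.2)) g); last exact: cg.
  have -> : (fun z : R * R => (z.1 + t, z.2)) = (fun z => z + ((t, 0) : R * R)).
    by apply/funext => -[u v]; congr pair; rewrite /= addr0.
  by apply: (@cvgD R (R * R)%type); [exact: cvg_id|exact: cvg_cst].
elim: q f => [|q IH] f h.
  by split=> //; [exact: P (is_Cq_per h)|exact: C (is_Cq_cont h)].
split; [exact: P (is_Cq_per h)|exact: C (is_Cq_cont h)|split].
- move=> z; have := @is_Cq_derivable1 R q f h (z.1 + t, z.2); rewrite /derivable /rot /=.
  by under [X in _ -> cvg (X @ _)]eq_fun do rewrite -addrA.
- move=> z; exact: (@is_Cq_derivable2 R q f h (z.1 + t, z.2)).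
- by rewrite dtheta_rot; apply: IH; exact: is_Cq_dtheta.
by rewrite ds_rot; apply: IH; exact: is_Cq_ds.
Qed.

Lemma Hr_is_Cq q f : is_Cq q f -> Hr q (cls f).
Proof.
elim: q f => [//|q IH] f h.
have h1 : is_Cq 1 f by exact: is_Cq_le h.
have w1 := W1_cls h1; have w2 := W2_cls h1.
exact: (Hr_intro w1 w2 (IH _ (is_Cq_dtheta h)) (IH _ (is_Cq_ds h))).
Qed.

(** Symmetry of second derivatives follows from that of the weak ones: both sides are continuous and
    represent the same class. *)
Lemma dtheta_ds f : is_Cq 2 f -> dtheta (ds f) = ds (dtheta f).
Proof.
move=> h; apply/funext; apply: continuous_ae_eq.
- exact: is_Cq_cont (is_Cq_dtheta (is_Cq_ds h)).
- exact: is_Cq_cont (is_Cq_ds (is_Cq_dtheta h)).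
apply: cls_inj; [exact: is_Cq_L2 (is_Cq_dtheta (is_Cq_ds h))|exact: is_Cq_L2 (is_Cq_ds (is_Cq_dtheta h))|].
have e1 g : is_Cq 1 g -> cls (dtheta g) = D1 (cls g) by move=> hg; rewrite (D1E (W1_cls hg)).
have e2 g : is_Cq 1 g -> cls (ds g) = D2 (cls g) by move=> hg; rewrite (D2E (W2_cls hg)).
have h1 : is_Cq 1 f := is_CqW h.
have a1 := e1 (ds f) (@is_Cq_ds R 1 f h); have a2 := e2 f h1.
have b1 := e2 (dtheta f) (@is_Cq_dtheta R 1 f h); have b2 := e1 f h1.
have dc : D1 (D2 (cls f)) = D2 (D1 (cls f)) := @DC R 0 _ (Hr_is_Cq h).
exact: etrans a1 (etrans (congr1 (@D1 R) a2) (etrans dc (esym (etrans b1 (congr1 (@D2 R) b2))))).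
Qed.

Lemma is_Cq_iter_dtheta q i f : is_Cq (i + q) f -> is_Cq q (iter i dtheta f).
Proof. by elim: i q => [//|i IH] q h /=; apply: is_Cq_dtheta; apply: IH; rewrite addnS. Qed.
Lemma is_Cq_iter_ds q i f : is_Cq (i + q) f -> is_Cq q (iter i ds f).
Proof. by elim: i q => [//|i IH] q h /=; apply: is_Cq_ds; apply: IH; rewrite addnS. Qed.
Lemma is_Cq_pd q i j f : is_Cq (i + j + q) f -> is_Cq q (pd i j f).
Proof. by move=> h; apply: is_Cq_iter_ds; apply: is_Cq_iter_dtheta; rewrite addnA. Qed.
Lemma iter_dtheta_ds i f : is_Cq i.+1 f -> iter i dtheta (ds f) = ds (iter i dtheta f).
Proof.
elim: i => [//|i IH] h; rewrite [LHS]iterS (IH (is_CqW h)) [in RHS]iterS; apply: dtheta_ds.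
by apply: is_Cq_iter_dtheta; rewrite addn2.
Qed.

Lemma Cbd_pd q f (M : R) : is_Cq q f -> (forall i j z, (i + j <= q)%N -> `|pd i j f z| <= M) -> Cbd q M f.
Proof.
elim: q f => [|q IH] f h hM /=; first by split=> // z; exact: (hM 0%N 0%N z).
split; first by move=> z; exact: (hM 0%N 0%N z).
split; apply: IH; [exact: is_Cq_dtheta|move=> i j z ij|exact: is_Cq_ds|move=> i j z ij].
  have -> : pd i j (dtheta f) = pd i.+1 j f by rewrite /pd iterSr.
  exact: hM.
have -> : pd i j (ds f) = pd i j.+1 f.
  by rewrite /pd iter_dtheta_ds -?iterSr//; apply: is_Cq_le h; lia.
by apply: hM; rewrite addnS.
Qed.

Lemma pd_le_norm q f i j z : is_Cq q f -> (i + j <= q)%N -> `|pd i j f z| <= Cq_norm q f.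
Proof.
move=> h ij.
have hb i' j' : (i' + j' <= q)%N -> has_sup (range (fun z => `|pd i' j' f z|)).
  move=> ij'; have hp : is_Cq 0 (pd i' j' f) by apply: is_Cq_pd; rewrite addn0; exact: is_Cq_le h.
  have [M hM] := is_Cq_bounded hp.
  by split; [exists `|pd i' j' f (0, 0)|; exists (0, 0)|exists M => _ [w _ <-]].
have hs i' j' : (i' + j' <= q)%N -> 0 <= sup (range (fun z => `|pd i' j' f z|)).
  move=> ij'; apply: le_trans (normr_ge0 (pd i' j' f (0, 0))) _.
  by apply: sup_upper_bound; [exact: hb|exists (0, 0)].
have iq : (i < q.+1)%N by lia.
have jq : (j < (q - i).+1)%N by lia.
rewrite /Cq_norm (bigD1 (Ordinal iq))//= (bigD1 (Ordinal jq))//=.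
apply: (@le_trans _ _ (sup (range (fun z => `|pd i j f z|)))).
  by apply: sup_upper_bound; [exact: hb|exists z].
rewrite -addrA lerDl addr_ge0// sumr_ge0// => i' _; last first.
  by apply: sumr_ge0 => j' _; apply: hs; have := ltn_ord i'; have := ltn_ord j'; lia.
by apply: hs; have := ltn_ord i'; lia.
Qed.

Lemma Cbd_Cq_norm q f : is_Cq q f -> Cbd q (Cq_norm q f) f.
Proof. by move=> h; apply: Cbd_pd => // i j z ij; exact: pd_le_norm. Qed.

Lemma Cbd_rot q (M t : R) f : Cbd q M f -> Cbd q M (rot t f).
Proof.
elim: q f => [|q IH] f [h1 h2]; first by split=> // z; exact: h1.
split; first by move=> z; exact: h1.
by case: h2 => a1 a2; rewrite dtheta_rot ds_rot; split; exact: IH.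
Qed.

Lemma CbdD q (M M' : R) f g : is_Cq q f -> is_Cq q g -> Cbd q M f -> Cbd q M' g ->
  Cbd q (M + M') (fun z => f z + g z).
Proof.
elim: q f g => [|q IH] f g cf cg [h1 h2] [k1 k2].
  by split=> // z; apply: le_trans (ler_normD _ _) _; exact: lerD.
split; first by move=> z; apply: le_trans (ler_normD _ _) _; exact: lerD.
case: h2 k2 => a1 a2 [b1 b2]; rewrite (dthetaD cf cg) (dsD cf cg).
by split; apply: IH => //; (exact: is_Cq_dtheta || exact: is_Cq_ds).
Qed.
Lemma dthetaZ q (c : R) f : is_Cq q.+1 f -> dtheta (fun z => c * f z) = (fun z => c * dtheta f z).
Proof.
move=> h; apply/funext => z; rewrite /dtheta !derive1E.
by have := deriveZ c (@is_Cq_derivable1 R q f h z); rewrite /GRing.scale.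
Qed.
Lemma dsZ q (c : R) f : is_Cq q.+1 f -> ds (fun z => c * f z) = (fun z => c * ds f z).
Proof.
move=> h; apply/funext => z; rewrite /ds !derive1E.
by have := deriveZ c (@is_Cq_derivable2 R q f h z); rewrite /GRing.scale.
Qed.
Lemma CbdZ q (c M : R) f : is_Cq q f -> Cbd q M f -> Cbd q (`|c| * M) (fun z => c * f z).
Proof.
elim: q f => [|q IH] f cf [h1 h2]; first by split=> // z; rewrite normrM ler_wpM2l.
split; first by move=> z; rewrite normrM ler_wpM2l.
by case: h2 => a1 a2; rewrite (dthetaZ c cf) (dsZ c cf); split; apply: IH => //; (exact: is_Cq_dtheta || exact: is_Cq_ds).
Qed.
Lemma Cbd_cst0 q (M : R) : 0 <= M -> Cbd q M (fun=> 0 : R).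
Proof.
move=> M0; elim: q => [|q IH]; first by split=> // z; rewrite normr0.
split; first by move=> z; rewrite normr0.
have -> : dtheta (fun=> 0 : R) = (fun=> 0) by apply/funext => z; rewrite /dtheta derive1_cst.
by have -> : ds (fun=> 0 : R) = (fun=> 0) by apply/funext => z; rewrite /ds derive1_cst.
Qed.

Lemma Cbd_sum q (I : Type) (s : seq I) (F : I -> R * R -> R) (M : I -> R) :
  (forall i, is_Cq q (F i)) -> (forall i, Cbd q (M i) (F i)) ->
  Cbd q (\sum_(i <- s) M i) (fun z => \sum_(i <- s) F i z).
Proof.
move=> cF bF; elim: s => [|i s IH].
  rewrite big_nil; have -> : (fun z => \sum_(i <- [::]) F i z) = fun=> 0 by apply/funext => z; rewrite big_nil.
  exact: Cbd_cst0.
rewrite big_cons; have -> : (fun z => \sum_(i <- i :: s) F i z) = fun z => F i z + \sum_(i <- s) F i z.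
  by apply/funext => z; rewrite big_cons.
by apply: CbdD => //; exact: is_Cq_sum.
Qed.

Lemma expi_add (j : int) (s t : R) : expi j (s + t) = expi j s * expi j t.
Proof. by rewrite /expi mulrDr cosD sinD; simpc; rewrite [in X in (_ +i* X)%C]addrC. Qed.

Lemma dtheta_modes k a : is_Cq 1 a -> modes k (cls a) ->
  dtheta a = (fun z => \sum_(i < k.*2.+1) wnode k i * rot (node k.*2.+1 i) a z).
Proof.
move=> h ma; have La := is_Cq_L2 h.
apply/funext; apply: continuous_ae_eq.
- exact: is_Cq_cont (is_Cq_dtheta h).
- apply: (@is_Cq_cont R 0); apply: is_Cq_sum => i; apply: is_CqZ; apply: is_Cq_rot; exact: is_CqW h.
have [c hc] := modes_hm2 La ma.
have e1 : aeeq (wdtheta a) (dtheta a).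
  apply: cls_inj; [exact: wdtheta_L2|exact: is_Cq_L2 (is_Cq_dtheta h)|].
  by rewrite (wdtheta_cls La) (D1E (W1_cls h)).
have hs N : {ae area, forall z : R * R, forall i, (i < N)%N -> cplx (rot (node k.*2.+1 i) a z) =
    \sum_(n < k.+1) c n z.2 * expi (kap k n) (z.1 + node k.*2.+1 i)}.
  elim: N => [|N IH]; first by apply: aeW => z i; rewrite ltn0.
  have hN := ae_shift2 (node k.*2.+1 N) 0 hc.
  apply: filterS2 IH hN => z h1 [h2 _] i; rewrite ltnS leq_eqVlt => /orP[/eqP ->|]; last exact: h1.
  by move: h2; rewrite /shift2 /rot /= addr0.
apply: filterS3 hc e1 (hs k.*2.+1) => z [hz1 hz2] <- hz3.
have inj : injective (@cplx R) by move=> u v [].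
apply: inj; rewrite hz2 /cplx rmorph_sum.
transitivity (\sum_(i < k.*2.+1) cplx (wnode k i) * \sum_(n < k.+1) c n z.2 * expi (kap k n) (z.1 + node k.*2.+1 i)).
  2: by apply: eq_bigr => i _; rewrite -hz3// rmorphM.
under [RHS]eq_bigr => i _ do rewrite mulr_sumr.
rewrite exchange_big; apply: eq_bigr => n _ /=.
have kn : (`|kap k n| <= k)%N by rewrite /kap; have := ltn_ord n; lia.
rewrite -(wnode_expi kn) mulr_suml; apply: eq_bigr => i _.
by rewrite expi_add; ring.
Qed.

(** The translates of [a] obey the same bounds as [a], so the theta-derivative of a trigonometric
    polynomial stays in [C^q] at the price of the sum of the weights, whereas in general it would
    lose one order. *)
Lemma bernstein q k (M : R) a : (0 < q)%N -> is_Cq q a -> Cbd q M a -> modes k (cls a) ->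
  is_Cq q (dtheta a) /\ Cbd q (2 * k.+1%:R ^+ 2 * M) (dtheta a).
Proof.
move=> q0 ca ba ma; have ca1 : is_Cq 1 a by exact: is_Cq_le ca.
rewrite (dtheta_modes ca1 ma).
have cr i : is_Cq q (fun z => wnode k i * rot (node k.*2.+1 i) a z) by apply: is_CqZ; exact: is_Cq_rot.
split; first exact: is_Cq_sum.
have := @Cbd_sum q _ (index_enum 'I_k.*2.+1) _ (fun i => `|wnode k i| * M) cr
  (fun i => CbdZ (wnode k i) (is_Cq_rot _ ca) (Cbd_rot _ ba)).
apply: Cbd_leM; rewrite -mulr_suml ler_wpM2r//; first exact: Cbd_ge0 ba.
exact: wnode_bound.
Qed.

End Classical.

(** * The equation for sequences of classes *)

Section Translation.
Context {R : realType}.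
Implicit Types (x y : L2class R) (u v : R * R -> R) (k l m n d D q : nat) (P : nat -> nat -> R -> R) (X Y : nat -> L2class R).
Local Notation V := (L2class R).

Lemma is_Cq1_per q (p : R -> R) : is_Cq1 q p -> per_Cq q p.
Proof.
elim: q p => [|q IH] p [pp dp cp]; first by split=> //; exact: (cp 0%N).
apply: And3 => //; first exact: (cp 0%N).
split; first exact: (dp 0%N).
apply: IH; split.
- move=> s; rewrite /derive1; have -> : (fun h => h^-1 *: (p (h + (s + 2 * pi)) - p (s + 2 * pi))) =
    (fun h => h^-1 *: (p (h + s) - p s)) by apply/funext => h; rewrite addrA !pp.
  by [].
- by move=> k kq s; have := dp k.+1 kq s; rewrite derive1Sn.
by move=> k kq; have := cp k.+1 kq; rewrite derive1Sn.
Qed.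

Definition coefP q d P := forall k n, (n <= k <= d)%N -> per_Cq q (P k n).

Lemma ord_pair d (k : 'I_d.+1) (n : 'I_k.+1) : (n <= k <= d)%N.
Proof. by apply/andP; split; rewrite -ltnS. Qed.

Lemma cls_apply_P D P u : coefP 0 (2 * D) P -> is_L2 u ->
  is_L2 (apply_P D P u) /\ cls (apply_P D P u) = dop (2 * D) P (cls u).
Proof.
move=> cP hu.
have h1 k n : (n <= k <= 2 * D)%N -> is_L2 (fun z => P k n z.2 * wd n (k - n) u z).
  by move=> h; apply: (L2_bmul (per_Cq_snd (cP k n h))); exact: (cls_wd n (k - n) hu).2.
have h2 (k : 'I_(2 * D).+1) : is_L2 (fun z => \sum_(n < k.+1) P k n z.2 * wd n (k - n) u z).
  by apply: L2_sum => n _; apply: h1; exact: ord_pair.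
split; first by apply: L2_sum => k _; exact: h2.
rewrite /apply_P cls_sum; last by move=> k _; exact: h2.
apply: eq_bigr => k _; rewrite cls_sum; last by move=> n _; apply: h1; exact: ord_pair.
apply: eq_bigr => n _; have nk := ord_pair n.
by have [e l] := cls_wd n (k - n) hu; rewrite -e (bmul_cls (per_Cq_snd (cP k n nk)) l).
Qed.

Definition Lop D P x : V := x + dop (2 * D) P x.

Lemma cls_one_plus_P D P (phi : rho_series R) m : coefP 0 (2 * D) P -> is_L2 (phi m) ->
  is_L2 (one_plus_P D P phi m) /\ cls (one_plus_P D P phi m) = Lop D P (cls (phi m)).
Proof.
move=> cP hu; have [l e] := cls_apply_P cP hu.
by split; [exact: L2D|rewrite /one_plus_P clsD// e].
Qed.

Lemma cls_laplace_perp (psi : rho_series R) m : is_L2 (psi m.+2) ->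
  is_L2 (laplace_perp psi m) /\
  cls (laplace_perp psi m) = m.+2%:R ^+ 2 *: cls (psi m.+2) + D1 (D1 (cls (psi m.+2))).
Proof.
move=> hu; have [e l] := cls_wd 2 0 hu.
split; first by apply: L2D => //; exact: L2Z.
by rewrite /laplace_perp /div_rho2 clsD ?clsZ// ?e//; exact: L2Z.
Qed.

(* The coefficient of order [m] of [L^(a) phi]; the terms with [a^(2)] are grouped
   so that each summand only contains the frequencies allowed at order [m]. *)
Definition Lv (b : nat -> rho_series R) X m : V :=
  (\sum_(k < m.+1) (bmul (b 1%N k) (X (m - k)%N) + bmul (b 3%N k) (D1 (X (m - k)%N)) +
     bmul (b 4%N k) (D2 (X (m - k)%N)) + bmul (b 5%N k) (D1 (D1 (X (m - k)%N))) +
     bmul (b 6%N k) (D2 (D1 (X (m - k)%N))) + bmul (b 7%N k) (D2 (D2 (X (m - k)%N))))) +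
  \sum_(k < m.+2) ((k.+1 * (m.+1 - k))%N%:R *: bmul (b 2%N k.+1) (X (m.+1 - k)%N) +
     bmul (dtheta (b 2%N k.+1)) (D1 (X (m.+1 - k)%N))).

Definition coefA q (b : nat -> rho_series R) : Prop :=
  forall j, (1 <= j <= 7)%N -> forall k, is_Cq q (b j k) /\ modes k (cls (b j k)).

Lemma dtheta_modes0 (a : R * R -> R) : is_Cq 1 a -> modes 0 (cls a) -> dtheta a = fun=> 0.
Proof.
move=> h ma; rewrite (dtheta_modes h ma); apply/funext => z; rewrite big_ord1 /wnode big_ord1.
by rewrite !mul0r mulr0 mul0r.
Qed.

Lemma is_Cq_dtheta_modes q k (a : R * R -> R) : (0 < q)%N -> is_Cq q a -> modes k (cls a) -> is_Cq q (dtheta a).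
Proof. by move=> q0 ca ma; have [M hM] := is_Cq_Cbd ca; have [] := bernstein q0 ca hM ma. Qed.

Lemma cls_series_mul q (g h : rho_series R) m : (forall k, is_Cq q (g k)) -> (forall k, is_L2 (h k)) ->
  is_L2 (series_mul g h m) /\ cls (series_mul g h m) = \sum_(k < m.+1) bmul (g k) (cls (h (m - k)%N)).
Proof.
move=> cg lh; have hk (k : 'I_m.+1) : is_L2 (fun z => g k z * h (m - k)%N z) by exact: (L2_bmul (cg k)).
split; first by apply: L2_sum => k _; exact: hk.
rewrite /series_mul cls_sum; last by move=> k _; exact: hk.
by apply: eq_bigr => k _; rewrite (bmul_cls (cg k) (lh _)).
Qed.

Lemma cls_apply_L q (b : nat -> rho_series R) (phi : rho_series R) m : (0 < q)%N -> coefA q b ->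
  (forall k, is_L2 (phi k)) ->
  is_L2 (apply_L b phi m) /\ cls (apply_L b phi m) = Lv b (fun k => cls (phi k)) m.
Proof.
move=> q0 cb lphi.
have cq j k : (1 <= j <= 7)%N -> is_Cq q (b j k) by move=> /cb /(_ k) [].
have lw i j k : is_L2 (wd i j (phi k)) := (cls_wd i j (lphi k)).2.
have ew i j k : cls (wd i j (phi k)) = iter j D2 (iter i D1 (cls (phi k))) := (cls_wd i j (lphi k)).1.
have [l1 e1] := cls_series_mul m (fun k => cq 1%N k isT) lphi.
have c2 k : is_Cq q (drho (b 2%N) k) by apply: is_CqZ; exact: cq.
have ld k : is_L2 (drho phi k) by apply: L2Z.
have [l2 e2] := cls_series_mul m c2 ld.
have c3 k : is_Cq q (dtheta (b 2%N k)).
  by have [c2' m2] := cb 2%N isT k; exact: is_Cq_dtheta_modes q0 c2' m2.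
have [l3 e3] := cls_series_mul m.+2 c3 (fun k => lw 1%N 0%N k).
have [l4 e4] := cls_series_mul m (fun k => cq 3%N k isT) (fun k => lw 1%N 0%N k).
have [l5 e5] := cls_series_mul m (fun k => cq 4%N k isT) (fun k => lw 0%N 1%N k).
have [l6 e6] := cls_series_mul m (fun k => cq 5%N k isT) (fun k => lw 2%N 0%N k).
have [l7 e7] := cls_series_mul m (fun k => cq 6%N k isT) (fun k => lw 1%N 1%N k).
have [l8 e8] := cls_series_mul m (fun k => cq 7%N k isT) (fun k => lw 0%N 2%N k).
have a2 := L2D l1 l2; have a3 := L2D a2 l3; have a4 := L2D a3 l4; have a5 := L2D a4 l5.
have a6 := L2D a5 l6; have a7 := L2D a6 l7; have a8 := L2D a7 l8.
split; first exact: a8.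
rewrite /apply_L (clsD a7 l8) (clsD a6 l7) (clsD a5 l6) (clsD a4 l5) (clsD a3 l4) (clsD a2 l3) (clsD l1 l2).
have s4 : \sum_(k < m.+1) bmul (b 3%N k) (cls (wd 1 0 (phi (m - k)%N))) = \sum_(k < m.+1) bmul (b 3%N k) (D1 (cls (phi (m - k)%N))).
  by apply: eq_bigr => k _; exact: congr1 (ew 1%N 0%N (m - k)%N).
have s5 : \sum_(k < m.+1) bmul (b 4%N k) (cls (wd 0 1 (phi (m - k)%N))) = \sum_(k < m.+1) bmul (b 4%N k) (D2 (cls (phi (m - k)%N))).
  by apply: eq_bigr => k _; exact: congr1 (ew 0%N 1%N (m - k)%N).
have s6 : \sum_(k < m.+1) bmul (b 5%N k) (cls (wd 2 0 (phi (m - k)%N))) = \sum_(k < m.+1) bmul (b 5%N k) (D1 (D1 (cls (phi (m - k)%N)))).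
  by apply: eq_bigr => k _; exact: congr1 (ew 2%N 0%N (m - k)%N).
have s7 : \sum_(k < m.+1) bmul (b 6%N k) (cls (wd 1 1 (phi (m - k)%N))) = \sum_(k < m.+1) bmul (b 6%N k) (D2 (D1 (cls (phi (m - k)%N)))).
  by apply: eq_bigr => k _; exact: congr1 (ew 1%N 1%N (m - k)%N).
have s8 : \sum_(k < m.+1) bmul (b 7%N k) (cls (wd 0 2 (phi (m - k)%N))) = \sum_(k < m.+1) bmul (b 7%N k) (D2 (D2 (cls (phi (m - k)%N)))).
  by apply: eq_bigr => k _; exact: congr1 (ew 0%N 2%N (m - k)%N).
(* The coefficient of order [0] does not depend on theta, so the first term vanishes and the sum is
   shifted by one. *)
have s3 : \sum_(k < m.+3) bmul (dtheta (b 2%N k)) (cls (wd 1 0 (phi (m.+2 - k)%N))) =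
   \sum_(k < m.+2) bmul (dtheta (b 2%N k.+1)) (D1 (cls (phi (m.+1 - k)%N))).
  rewrite big_ord_recl.
  have [c0 m0] := cb 2%N isT 0%N; have c01 : is_Cq 1 (b 2%N 0%N) by exact: is_Cq_le c0.
  have -> : bmul (dtheta (b 2%N (@ord0 m.+2))) (cls (wd 1 0 (phi (m.+2 - (@ord0 m.+2))%N))) = 0.
    by rewrite (dtheta_modes0 c01 m0) bmul_cst scale0r.
  rewrite add0r; apply: eq_bigr => k _.
  by congr (bmul _ _); exact: (ew 1%N 0%N (m.+1 - k)%N).
(* The added term [k = m + 1] has the factor [0]; it aligns the radial sum with the angular one. *)
have s2 : \sum_(k < m.+1) bmul (drho (b 2%N) k) (cls (drho phi (m - k)%N)) =
   \sum_(k < m.+2) (k.+1 * (m.+1 - k))%N%:R *: bmul (b 2%N k.+1) (cls (phi (m.+1 - k)%N)).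
  rewrite [RHS]big_ord_recr /= subnn muln0 scale0r addr0; apply: eq_bigr => k _.
  have km : (k <= m)%N by rewrite -ltnS.
  rewrite /drho (bmulZl _ _ (cq 2%N k.+1 isT)) (clsZ _ (lphi _)) (bmulZr _ _ (cq 2%N k.+1 isT)).
  by rewrite scalerA -natrM subSn.
have E := f_equal2 +%R (f_equal2 +%R (f_equal2 +%R (f_equal2 +%R (f_equal2 +%R (f_equal2 +%R (f_equal2 +%R e1 (etrans e2 s2)) (etrans e3 s3)) (etrans e4 s4)) (etrans e5 s5)) (etrans e6 s6)) (etrans e7 s7)) (etrans e8 s8).
apply: (etrans E); rewrite /Lv !big_split /=.
by linear_identity.
Qed.

(** Orders and frequencies add up under products. In the second sum the orders add up to [m + 2],
    and [hm_bracket] brings the frequencies back to those of order [m]. *)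
Lemma Lv_modes q b X m : (0 < q)%N -> coefA q b -> (forall j, (j <= m.+1)%N -> modes j (X j) /\ Hr 2 (X j)) ->
  modes m (Lv b X m).
Proof.
move=> q0 cb hX.
have prod k l (a : R * R -> R) y : is_Cq q a -> modes k (cls a) -> modes l y -> modes (k + l) (bmul a y).
  move=> ca ma my; rewrite bmulE; have ly := repr2_L2 y.
  have La := is_Cq_L2 ca.
  apply: (hm_modes (L2_bmul ca ly)); apply: (@hm_ae _ _ (fun z => cplx (a z) * cplx (repr2 y z))).
    by apply: aeW => z; rewrite /cplx rmorphM.
  by apply: hmM; apply/has_modesP => //; rewrite repr2K.
apply: modesD; apply: modes_sum => k _.
  have km : (k <= m)%N by rewrite -ltnS.
  have [mX hXk] : modes (m - k) (X (m - k)%N) /\ Hr 2 (X (m - k)%N) by apply: hX; exact: leq_trans (leq_subr _ _) (leqnSn _).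
  have m1 := modes_modes_D1 mX; have m2 := modes_W2 (Hr_W2 hXk) mX.
  have m11 := modes_modes_D1 m1; have m22 := modes_W2 (Hr_W2 (Hr_D2 hXk)) m2.
  have m12 := modes_W2 (Hr_W2 (Hr_D1 hXk)) m1.
  have P j y : (1 <= j <= 7)%N -> modes (m - k) y -> modes m (bmul (b j k) y).
    by move=> /cb /(_ k) [ca ma] my; have := prod _ _ _ _ ca ma my; rewrite subnKC.
  by do 5 (apply: modesD; last exact: P); exact: P.
have km : (k <= m.+1)%N by rewrite -ltnS.
have [mX hXk] := hX (m.+1 - k)%N (leq_subr _ _).
set l := (m.+1 - k)%N in mX hXk *; set x := X l in mX hXk *; set K := k.+1.
have [ca ma] := cb 2%N isT K; set a := b 2%N K in ca ma *.
have La := is_Cq_L2 ca; have lx := repr2_L2 x.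
have ca1 : is_Cq 1 a by exact: is_Cq_le ca.
have cd : is_Cq q (dtheta a) := is_Cq_dtheta_modes q0 ca ma.
have lw := wdtheta_L2 (repr2 x).
have -> : (K * l)%:R *: bmul a x + bmul (dtheta a) (D1 x) =
   cls (fun z => (K%:R * l%:R) * (a z * repr2 x z) + dtheta a z * wdtheta (repr2 x) z).
  have h1 := L2_bmul ca lx; have h2 := L2_bmul cd lw.
  rewrite (clsD (L2Z (K%:R * l%:R) h1) h2) (clsZ _ h1) -(bmul_cls ca lx) -(bmul_cls cd lw) repr2K.
  by rewrite (wdtheta_cls lx) repr2K natrM.
apply: (hm_modes (L2D (L2Z _ (L2_bmul ca lx)) (L2_bmul cd lw))).
have Kl : (K + l = m + 2)%N by rewrite /K /l; lia.
have ha := modes_hm2 La ma.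
have hx : hm2 l (fun z => cplx (repr2 x z)) (fun z => cplx (wdtheta (repr2 x) z)).
  by apply: modes_hm2 => //; rewrite repr2K.
apply: hm_ae (hm_bracket Kl ha hx).
have e1 : aeeq (wdtheta a) (dtheta a).
  apply: cls_inj; [exact: wdtheta_L2|exact: is_Cq_L2 cd|].
  by rewrite (wdtheta_cls La) (D1E (W1_cls ca1)).
by apply: filterS e1 => z ->; rewrite /cplx rmorphD !rmorphM !rmorph_nat.
Qed.

(** Bilinearity, arranged so that the first term is the recursion of [b'] on the difference of the
    unknowns and the second can be treated as a source. *)
Lemma LvB q b b' X X' m : (0 < q)%N -> coefA q b -> coefA q b' -> (forall j, Hr 2 (X j)) -> (forall j, Hr 2 (X' j)) ->
  Lv b' X' m - Lv b X m = Lv b' (fun j => X' j - X j) m + Lv (fun j => series_sub (b' j) (b j)) X m.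
Proof.
move=> q0 cb cb' hX hX'.
have cC j k : (1 <= j <= 7)%N -> is_Cq q (b j k) by move=> /cb /(_ k) [].
have cC' j k : (1 <= j <= 7)%N -> is_Cq q (b' j k) by move=> /cb' /(_ k) [].
have bs j k y : (1 <= j <= 7)%N -> bmul (series_sub (b' j) (b j) k) y = bmul (b' j k) y - bmul (b j k) y.
  move=> hj; rewrite -scaleN1r -(bmulZl _ _ (cC j k hj)) -(bmulDl _ (cC' j k hj) (is_CqZ (-1) (cC j k hj))).
  by congr (bmul _ _); apply/funext => z; rewrite /series_sub mulN1r.
have cd k : is_Cq q (dtheta (b 2%N k)).
  by have [ca ma] := cb 2%N isT k; exact: is_Cq_dtheta_modes q0 ca ma.
have cd' k : is_Cq q (dtheta (b' 2%N k)).
  by have [ca ma] := cb' 2%N isT k; exact: is_Cq_dtheta_modes q0 ca ma.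
have bd k y : bmul (dtheta (series_sub (b' 2%N) (b 2%N) k)) y = bmul (dtheta (b' 2%N k)) y - bmul (dtheta (b 2%N k)) y.
  have c1 : is_Cq 1 (b 2%N k) by exact: is_Cq_le (cC 2%N k isT).
  have c1' : is_Cq 1 (b' 2%N k) by exact: is_Cq_le (cC' 2%N k isT).
  have -> : dtheta (series_sub (b' 2%N) (b 2%N) k) = fun z => dtheta (b' 2%N k) z + (-1) * dtheta (b 2%N k) z.
    have -> : series_sub (b' 2%N) (b 2%N) k = fun z => b' 2%N k z + (-1) * b 2%N k z.
      by apply/funext => z; rewrite /series_sub mulN1r.
    by rewrite (dthetaD c1' (is_CqZ (-1) c1)) (dthetaZ (-1) c1).
  by rewrite (bmulDl _ (cd' k) (is_CqZ (-1) (cd k))) (bmulZl _ _ (cd k)) scaleN1r.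
rewrite /Lv opprD addrACA -!sumrB [RHS]addrACA -!big_split /=.
congr (_ + _); apply: eq_bigr => k _.
  set x := X (m - k)%N; set x' := X' (m - k)%N.
  have [h h'] : Hr 2 x /\ Hr 2 x' by exact: conj (hX _) (hX' _).
  rewrite !bs// (D1B h' h) (D2B h' h) (D1B (Hr_D1 h') (Hr_D1 h)) (D2B (Hr_D1 h') (Hr_D1 h)) (D2B (Hr_D2 h') (Hr_D2 h)).
  have bB j y y' : (1 <= j <= 7)%N -> bmul (b' j k) (y - y') = bmul (b' j k) y - bmul (b' j k) y'.
    by move=> hj; exact: bmulBr (cC' j k hj).
  by rewrite !bB//; linear_identity.
set x := X _; set x' := X' _.
have [h h'] : Hr 2 x /\ Hr 2 x' by exact: conj (hX _) (hX' _).
rewrite bs// bd (D1B h' h) (bmulBr _ _ (cC' 2%N k.+1 isT)) (bmulBr _ _ (cd' k.+1)).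
by linear_identity.
Qed.

End Translation.

Section LvBound.
Context {R : realType}.
Implicit Types (x y : L2class R) (k l m n d q : nat) (X Y : nat -> L2class R).
Local Notation V := (L2class R).

(** Geometric growth of the coefficients; [(Sigma, C^q)]-analytic ones have the rate
    [r = 1/Sigma]. *)
Definition coefB q (M r : R) (b : nat -> rho_series R) : Prop :=
  forall j, (1 <= j <= 7)%N -> forall k, Cbd q (M * r ^+ k) (b j k).

Lemma Hr_Lv q b X m : (0 < q)%N -> coefA q b -> (forall j, Hr (q + 2) (X j)) -> Hr q (Lv b X m).
Proof.
move=> q0 cb hX.
have P j k y : (1 <= j <= 7)%N -> Hr q y -> Hr q (bmul (b j k) y).
  by move=> /cb /(_ k) [ca _] hy; exact: Hr_bmul ca hy.
have e : (q + 2 = q.+2)%N by rewrite addn2.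
apply: HrD; apply: Hr_sum => k _.
  have h := hX (m - k)%N; rewrite e in h.
  have h1 := Hr_D1 h; have h2 := Hr_D2 h.
  by do 5 (apply: HrD; last by apply: P => //; [
     exact: Hr_D2 (Hr_D2 h) || exact: Hr_D2 (Hr_D1 h) || exact: Hr_D1 (Hr_D1 h) || exact: HrW h2 || exact: HrW h1]); apply: P => //; exact: HrW (HrW h).
have h := hX (m.+1 - k)%N; rewrite e in h.
apply: HrD; first by apply: HrZ; apply: P => //; exact: HrW (HrW h).
have [ca ma] := cb 2%N isT k.+1.
by apply: (Hr_bmul (is_Cq_dtheta_modes q0 ca ma)); exact: HrW (Hr_D1 h).
Qed.

Lemma pow2_ge k : (k.+1 <= 2 ^ k)%N.
Proof. exact: ltn_expl. Qed.

(** The rate [4 r + 1] absorbs what depends on the order [k] of the coefficient: the factor [k] of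
    its radial derivative and [2 (k + 1)^2] of its theta-derivative, since [(k + 1)^2 <= 4^k]. The
    summand 1 makes the rate at least 1, so that exponents may be raised. The factor [m + 1] comes
    from the radial derivative of the unknown. *)
Lemma Lv_bound q (M r : R) b X m : (0 < q)%N -> 0 <= r -> 0 <= M -> coefA q b -> coefB q M r b ->
  (forall j, Hr (q + 2) (X j)) ->
  Nr q (Lv b X m) <= m.+1%:R * (9 * 3 ^+ q * M) * \sum_(k < m.+2) (4 * r + 1) ^+ k.+1 * Nr (q + 2) (X (m.+1 - k)%N).
Proof.
move=> q0 r0 M0 cb bb hX.
set s := 4 * r + 1; pose N j := Nr (q + 2) (X j).
have s1 : 1 <= s by rewrite /s; lra.
have rs : r <= s by rewrite /s; lra.
have s0 : 0 <= s by lra.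
have N0 j : 0 <= N j := Nr_ge0 _ _.
have Mr k : 0 <= M * r ^+ k by rewrite mulr_ge0// exprn_ge0.
have t0 : 0 <= (3 : R) ^+ q by rewrite exprn_ge0.
have e : (q + 2 = q.+2)%N by rewrite addn2.
have cbb j k y : (1 <= j <= 7)%N -> Hr q y -> Nr q (bmul (b j k) y) <= 3 ^+ q * (M * r ^+ k) * Nr q y.
  by move=> hj hy; have [ca _] := cb j hj k; exact: Nr_bmul ca (bb j hj k) hy.
have rk k : r ^+ k <= s ^+ k.+2.
  apply: (@le_trans _ _ (s ^+ k)); first exact: lerXn2r.
  by apply: ler_weXn2l => //; exact: leq_trans (leqnSn _) (leqnSn _).
have bern k : 2 * k.+1%:R ^+ 2 * (M * r ^+ k) <= 2 * M * s ^+ k.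
  have h : k.+1%:R ^+ 2 * r ^+ k <= s ^+ k.
    apply: (@le_trans _ _ ((4 * r) ^+ k)); last first.
      by apply: lerXn2r; rewrite ?nnegrE//; rewrite /s; lra.
    rewrite exprMn ler_wpM2r ?exprn_ge0//.
    have -> : (4 : R) ^+ k = (2 ^+ k) ^+ 2 by rewrite -exprM mulnC exprM; congr (_ ^+ _); ring.
    by apply: lerXn2r; rewrite ?nnegrE ?exprn_ge0// -natrX ler_nat pow2_ge.
  have -> : 2 * k.+1%:R ^+ 2 * (M * r ^+ k) = 2 * M * (k.+1%:R ^+ 2 * r ^+ k) by ring.
  by rewrite ler_wpM2l// mulr_ge0.
have lin k : k%:R * (M * r ^+ k) <= M * s ^+ k.
  have h : k%:R * r ^+ k <= s ^+ k.
    apply: (@le_trans _ _ ((4 * r) ^+ k)); last first.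
      by apply: lerXn2r; rewrite ?nnegrE//; rewrite /s; lra.
    rewrite exprMn ler_wpM2r ?exprn_ge0// -natrX ler_nat.
    exact: ltnW (ltn_expl k (isT : (1 < 4)%N)).
  by rewrite mulrCA ler_wpM2l.
have dbd k y : Hr q y -> Nr q (bmul (dtheta (b 2%N k)) y) <= 3 ^+ q * (2 * M * s ^+ k) * Nr q y.
  move=> hy; have [ca ma] := cb 2%N isT k.
  have [cd bd] := bernstein q0 ca (bb 2%N isT k) ma.
  by exact: Nr_bmul cd (Cbd_leM (bern k) bd) hy.
rewrite /Lv; set S1 := \sum_(k < m.+1) _; set S2 := \sum_(k < m.+2) _.
pose G k := s ^+ k.+1 * N (m.+1 - k)%N.
have G0 k : 0 <= G k by rewrite mulr_ge0// exprn_ge0.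
set W := \sum_(k < m.+2) G k.
have W0 : 0 <= W by apply: sumr_ge0.
have hP j k y : (1 <= j <= 7)%N -> Hr q y -> Hr q (bmul (b j k) y).
  by move=> /cb /(_ k) [ca _] hy; exact: Hr_bmul ca hy.
have NE x : Nr (q + 2) x = Nr q.+2 x by rewrite e.
set c := 3 ^+ q * M; have c0 : 0 <= c by rewrite mulr_ge0.
have hterm (k : 'I_m.+1) : let x := X (m - k)%N in
   let y := bmul (b 1%N k) x + bmul (b 3%N k) (D1 x) + bmul (b 4%N k) (D2 x) + bmul (b 5%N k) (D1 (D1 x)) +
     bmul (b 6%N k) (D2 (D1 x)) + bmul (b 7%N k) (D2 (D2 x)) in
   Hr q y /\ Nr q y <= 6 * c * G k.+1.
  move=> x y; have h : Hr q.+2 x by rewrite -e; exact: hX.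
  have h1 := Hr_D1 h; have h2 := Hr_D2 h.
  have n0 : Nr q x <= N (m - k)%N by rewrite /N NE; apply: Nr_le; exact: leq_trans (leqnSn _) (leqnSn _).
  have n1 : Nr q (D1 x) <= N (m - k)%N by rewrite /N NE; apply: le_trans (NrS _ _) _; exact: Nr_D1.
  have n2 : Nr q (D2 x) <= N (m - k)%N by rewrite /N NE; apply: le_trans (NrS _ _) _; exact: Nr_D2.
  have n11 : Nr q (D1 (D1 x)) <= N (m - k)%N by rewrite /N NE; apply: le_trans (Nr_D1 _ _) _; exact: Nr_D1.
  have n12 : Nr q (D2 (D1 x)) <= N (m - k)%N by rewrite /N NE; apply: le_trans (Nr_D2 _ _) _; exact: Nr_D1.
  have n22 : Nr q (D2 (D2 x)) <= N (m - k)%N by rewrite /N NE; apply: le_trans (Nr_D2 _ _) _; exact: Nr_D2.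
  have T j z : (1 <= j <= 7)%N -> Hr q z -> Nr q z <= N (m - k)%N ->
      Hr q (bmul (b j k) z) /\ Nr q (bmul (b j k) z) <= c * G k.+1.
    move=> hj hz nz; split; first exact: hP.
    apply: le_trans (cbb j k z hj hz) _; rewrite /G /c subSS.
    have -> : 3 ^+ q * M * (s ^+ k.+2 * N (m - k)%N) = 3 ^+ q * (M * s ^+ k.+2) * N (m - k)%N by ring.
    apply: ler_pM => //; [exact: mulr_ge0|exact: Nr_ge0|].
    by rewrite ler_wpM2l// ler_wpM2l.
  have [a1 b1] := T 1%N x isT (HrW (HrW h)) n0.
  have [a3 b3] := T 3%N _ isT (HrW h1) n1.
  have [a4 b4] := T 4%N _ isT (HrW h2) n2.
  have [a5 b5] := T 5%N _ isT (Hr_D1 h1) n11.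
  have [a6 b6] := T 6%N _ isT (Hr_D2 h1) n12.
  have [a7 b7] := T 7%N _ isT (Hr_D2 h2) n22.
  have s2 := HrD a1 a3; have s3 := HrD s2 a4; have s4 := HrD s3 a5; have s5 := HrD s4 a6; have s6 := HrD s5 a7.
  split; first exact: s6.
  have t2 := le_trans (NrD a1 a3) (lerD b1 b3).
  have t3 := le_trans (NrD s2 a4) (lerD t2 b4).
  have t4 := le_trans (NrD s3 a5) (lerD t3 b5).
  have t5 := le_trans (NrD s4 a6) (lerD t4 b6).
  have t6 := le_trans (NrD s5 a7) (lerD t5 b7).
  by apply: le_trans t6 _; rewrite -mulrA; move: (c * G k.+1) => u; lra.
have hterm2 (k : 'I_m.+2) : let x := X (m.+1 - k)%N in
   let y := (k.+1 * (m.+1 - k))%N%:R *: bmul (b 2%N k.+1) x + bmul (dtheta (b 2%N k.+1)) (D1 x) in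
   Hr q y /\ Nr q y <= (m.+1%:R + 2) * c * G k.
  move=> x y; have h : Hr q.+2 x by rewrite -e; exact: hX.
  have n0 : Nr q x <= N (m.+1 - k)%N by rewrite /N NE; apply: Nr_le; exact: leq_trans (leqnSn _) (leqnSn _).
  have n1 : Nr q (D1 x) <= N (m.+1 - k)%N by rewrite /N NE; apply: le_trans (NrS _ _) _; exact: Nr_D1.
  have hx0 : Hr q x := HrW (HrW h); have hx1 : Hr q (D1 x) := HrW (Hr_D1 h).
  have [ca ma] := cb 2%N isT k.+1.
  have a1 := hP 2%N k.+1 x isT hx0; have a2 := Hr_bmul (is_Cq_dtheta_modes q0 ca ma) hx1.
  have a1' := HrZ (k.+1 * (m.+1 - k))%N%:R a1.
  split; first exact: HrD.
  apply: le_trans (NrD a1' a2) _.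
  have -> : (m.+1%:R + 2) * c * G k = m.+1%:R * (c * G k) + 2 * (c * G k) by ring.
  apply: lerD.
    rewrite (NrZ _ a1) ger0_norm// natrM.
    have u1 := cbb 2%N k.+1 x isT hx0.
    have u2 : (m.+1 - k)%N%:R <= m.+1%:R :> R by rewrite ler_nat leq_subr.
    apply: (@le_trans _ _ (k.+1%:R * (m.+1 - k)%N%:R * (3 ^+ q * (M * r ^+ k.+1) * N (m.+1 - k)%N))).
      apply: ler_wpM2l; first by rewrite mulr_ge0.
      by apply: le_trans u1 _; rewrite ler_wpM2l// mulr_ge0.
    have -> : k.+1%:R * (m.+1 - k)%N%:R * (3 ^+ q * (M * r ^+ k.+1) * N (m.+1 - k)%N) =
      (m.+1 - k)%N%:R * (3 ^+ q * (k.+1%:R * (M * r ^+ k.+1)) * N (m.+1 - k)%N) by ring.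
    apply: ler_pM => //; first by rewrite !mulr_ge0 ?exprn_ge0.
    by rewrite /c /G [leRHS]mulrA ler_wpM2r// -mulrA ler_wpM2l.
  apply: le_trans (dbd k.+1 _ hx1) _.
  have -> : 2 * (c * G k) = 3 ^+ q * (2 * M * s ^+ k.+1) * N (m.+1 - k)%N by rewrite /c /G; ring.
  by rewrite ler_wpM2l// !mulr_ge0// exprn_ge0.
have b1 : Nr q S1 <= 6 * c * W.
  apply: le_trans (Nr_sum _ _) _ => [k _|]; first exact: (hterm k).1.
  apply: (@le_trans _ _ (\sum_(k < m.+1) 6 * c * G k.+1)).
    by apply: ler_sum => k _; exact: (hterm k).2.
  rewrite -mulr_sumr; apply: ler_wpM2l; first by rewrite mulr_ge0.
  by rewrite /W [leRHS]big_ord_recl -[leLHS]add0r lerD.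
have b2 : Nr q S2 <= (m.+1%:R + 2) * c * W.
  apply: le_trans (Nr_sum _ _) _ => [k _|]; first exact: (hterm2 k).1.
  apply: (@le_trans _ _ (\sum_(k < m.+2) (m.+1%:R + 2) * c * G k)).
    by apply: ler_sum => k _; exact: (hterm2 k).2.
  by rewrite -mulr_sumr.
have hS1 : Hr q S1 by apply: Hr_sum => k _; exact: (hterm k).1.
have hS2 : Hr q S2 by apply: Hr_sum => k _; exact: (hterm2 k).1.
apply: le_trans (NrD hS1 hS2) _; apply: le_trans (lerD b1 b2) _.
have -> : m.+1%:R * (9 * 3 ^+ q * M) * W = m.+1%:R * (9 * (c * W)) by rewrite /c; ring.
have cW : 0 <= c * W by rewrite mulr_ge0.
have m1 : 8 * (c * W) <= m.+1%:R * (8 * (c * W)) by rewrite ler_peMl ?ler1n// mulr_ge0.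
have -> : 6 * c * W + (m.+1%:R + 2) * c * W = 8 * (c * W) + m.+1%:R * (c * W) by ring.
have -> : m.+1%:R * (9 * (c * W)) = m.+1%:R * (8 * (c * W)) + m.+1%:R * (c * W) by ring.
by rewrite lerD2r.
Qed.

End LvBound.

(** * One order of the recursion *)

Section Step.
Context {R : realType}.
Implicit Types (x y g : L2class R) (k l m n d : nat) (X Y I F : nat -> L2class R).
Local Notation V := (L2class R).

Lemma Pk_dop l d c x : coefP 0 d c -> Hr d x -> Pk l (dop d c x) = dop d c (Pk l x).
Proof.
move=> cc hx; rewrite /dop Pk_sum; apply: eq_bigr => k _; rewrite /topop Pk_sum; apply: eq_bigr => n _.
have nk := ord_pair n; rewrite (Pk_bmul _ _ (cc k n nk)); congr (bmul _ _).
have hk : Hr k x by apply: Hr_le hx; rewrite -ltnS.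
have {hk hx} : Hr (n + (k - n)) x by rewrite subnKC//; case/andP: nk.
elim: (k - n)%N => [|j IH] hx.
  rewrite addn0 in hx; elim: {nk} (n : nat) hx => [//|i IH] hx /=.
  have h1 : Hr 1 (iter i D1 x) by apply: Hr_iter1; rewrite addn1.
  have IH' : Pk l (iter i D1 x) = iter i D1 (Pk l x) := IH (HrW hx).
  by rewrite -IH' (D1E (W1_Pk l (Hr_W1 h1))).
rewrite addnS in hx.
have h1 : Hr 1 (iter j D2 (iter n D1 x)) by apply: Hr_iter; rewrite addn1.
by rewrite !iterS -(IH (HrW hx)) (D2E (W2_Pk l (Hr_W2 h1))).
Qed.

Lemma Pms_SS m mu x : Pms m.+2 mu x = Pms m mu x + mu m.+2 *: Pk m.+2 x.
Proof.
rewrite /Pms [LHS]big_mkcond [LHS]big_ord_recr [X in X + _ = _]big_ord_recr /= !negbK eqxx.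
have -> : (~~ odd m == odd m) = false by case: (odd m).
by rewrite addr0 [in RHS]big_mkcond.
Qed.
Lemma Pms_Pk m mu l x : Pms m mu (Pk l x) = if (l <= m)%N && (odd l == odd m) then mu l *: Pk l x else 0.
Proof.
rewrite /Pms; case: ifP => [/andP[lm ol]|h].
  have lm' : (l < m.+1)%N by [].
  rewrite (bigD1 (Ordinal lm'))//= Pk_Pk big1 ?addr0// => k /andP[_ kl].
  rewrite Pk_Pk_neq ?scaler0//; apply: contra kl => /eqP e; by apply/eqP/val_inj.
apply: big1 => k ok; rewrite Pk_Pk_neq ?scaler0//; apply: contraFneq h => ->.
by rewrite ok -ltnS ltn_ord.
Qed.
Lemma modes_SS m x : modes m x -> modes m.+2 x.
Proof.
move=> mx; rewrite /modes Pms_SS mx (Pk_modes0 mx) ?scaler0 ?addr0//.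
by rewrite negb_and -ltnNge leqnSn.
Qed.
Lemma modes_Pk m x : Pk m x = x -> modes m x.
Proof. by move=> e; rewrite /modes -e Pms_Pk leqnn eqxx scale1r. Qed.
Lemma modes_top m x : modes m.+2 x -> modes m (x - Pk m.+2 x).
Proof. by move=> mx; rewrite -[X in X - _]mx Pms_SS scale1r addrK; exact: modes_Pms. Qed.
(** Orders 0 and 1 contain only the extreme frequencies, so the initial data determine them
    completely. *)
Lemma modes_01 m x y : (m <= 1)%N -> modes m x -> Pk m x = Pk m y -> Pk m y = y -> x = y.
Proof.
move=> m1 mx e ey; rewrite -mx -ey -e; case: m m1 {mx e ey} => [|[|//]] _.
  by rewrite /Pms big_mkcond big_ord1 /= scale1r.
by rewrite /Pms big_mkcond big_ord_recl big_ord1 /= scale1r add0r.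
Qed.

Variables (D q : nat) (P : nat -> nat -> R -> R).
Hypotheses (q0 : (0 < q)%N) (D0 : (0 < D)%N) (cP : coefP q (2 * D) P).
Let d := (2 * D)%N.
Let Q := (q + d)%N.
Let LL := @Lop R D P.

Let cP0 : coefP 0 d P. Proof. by move=> k n h; exact: per_Cq_le (cP h). Qed.
Lemma LopB x y : Hr d x -> Hr d y -> LL (x - y) = LL x - LL y.
Proof.
move=> hx hy; rewrite /LL /Lop; have := dop_lin cP0 (-1) hy hx; rewrite !scaleN1r addrC => ->; linear_identity.
Qed.
Lemma Pk_Lop l x : Hr d x -> Pk l (LL x) = LL (Pk l x).
Proof. by move=> hx; rewrite /LL /Lop PkD (Pk_dop l cP0 hx). Qed.
Lemma modes_Lop m x : modes m x -> Hr d x -> modes m (LL x).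
Proof. by move=> mx hx; apply: modesD => //; exact: (modes_dop cP0). Qed.

Definition lam m k : R := m.+2%:R ^+ 2 - k%:R ^+ 2.
(** From order [m + 2] to order [m], [Delta_perp] acts as the multiplier [lam m], which vanishes at
    the frequency [m + 2] only; [Tm m] inverts it on the others. *)
Definition Tm m g : V := Pms m (fun k => (lam m k)^-1) g.

Lemma lam_ge m k : (k <= m)%N -> m.+1%:R <= lam m k.
Proof.
move=> km; rewrite /lam; have h : k%:R <= m%:R :> R by rewrite ler_nat.
have h2 : (k%:R : R) ^+ 2 <= m%:R ^+ 2 by rewrite lerXn2r ?nnegrE.
have -> : (m.+2%:R : R) = m%:R + 2 by rewrite -addn2 natrD.
have -> : (m.+1%:R : R) = m%:R + 1 by rewrite -addn1 natrD.
have m0 : 0 <= (m%:R : R) by [].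
have -> : (m%:R + 2 : R) ^+ 2 = m%:R ^+ 2 + 4 * m%:R + 4 by ring.
by lra.
Qed.
Lemma lam_neq0 m k : (k <= m)%N -> lam m k != 0.
Proof. by move=> km; rewrite gt_eqF// (lt_le_trans _ (lam_ge km))// ltr0n. Qed.

Lemma Tm_bound m g : Hr q g -> Nr q (Tm m g) <= m.+1%:R^-1 * Nr q g.
Proof.
move=> hg; apply: Nr_Pms => // k km _.
have m0 : (0 : R) < m.+1%:R by rewrite ltr0n.
have l0 := lt_le_trans m0 (lam_ge km).
rewrite ger0_norm ?invr_ge0 ?(ltW l0)// lef_pV2 ?posrE//; exact: lam_ge.
Qed.

Lemma Pms_lam_Lop m x i : Hr d x -> Hr d i -> Pk m.+2 i = i ->
  Pms m.+2 (lam m) (LL x) = Pms m (lam m) (LL (x - i)).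
Proof.
move=> hx hi ei; rewrite Pms_SS /lam subrr scale0r addr0 (LopB hx hi) PmsB.
have -> : LL i = Pk m.+2 (LL i) by rewrite (Pk_Lop _ hi) ei.
by rewrite Pms_Pk ltnNge leqnSn /= subr0.
Qed.

(* At each order the equation amounts to inverting [1 + P] after the multiplier
   of [Delta_perp], the top frequency being prescribed by the initial data. *)
Lemma step_solve m x i g : Hr Q x -> Hr Q i -> Pk m.+2 i = i -> modes m g ->
  modes m.+2 x -> Pk m.+2 x = Pk m.+2 i -> Pms m.+2 (lam m) (LL x) = g ->
  modes m (x - i) /\ LL (x - i) = Tm m g.
Proof.
move=> hx hi ei mg mx ex eg.
have dQ : (d <= Q)%N by exact: leq_addl.
have [hx' hi'] : Hr d x /\ Hr d i by split; [exact: Hr_le hx|exact: Hr_le hi].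
have mv : modes m (x - i) by have := modes_top mx; rewrite ex ei.
split=> //; rewrite (Pms_lam_Lop hx' hi' ei) in eg.
rewrite /Tm -eg Pms_Pms -[LHS](modes_Lop mv (HrB hx' hi')); apply: eq_Pms => k km _.
by rewrite mulVf// lam_neq0.
Qed.

Lemma solve_step m v i g : Hr Q v -> Hr Q i -> Pk m.+2 i = i -> modes m g ->
  modes m v -> LL v = Tm m g ->
  [/\ modes m.+2 (i + v), Pk m.+2 (i + v) = Pk m.+2 i & Pms m.+2 (lam m) (LL (i + v)) = g].
Proof.
move=> hv hi ei mg mv ev.
have dQ : (d <= Q)%N by exact: leq_addl.
have [hv' hi'] : Hr d v /\ Hr d i by split; [exact: Hr_le hv|exact: Hr_le hi].
split; first by apply: modesD; [exact: modes_Pk|exact: modes_SS].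
  by rewrite PkD (Pk_modes0 mv) ?addr0// negb_and -ltnNge leqnSn.
rewrite (Pms_lam_Lop (HrD hi' hv') hi' ei) addrAC subrr add0r ev /Tm Pms_Pms -[RHS]mg.
by apply: eq_Pms => k km _; rewrite mulfV// lam_neq0.
Qed.

End Step.

(** * Existence, energy estimate and comparison of solutions *)

Section Solutions.
Context {R : realType}.
Implicit Types (x y g : L2class R) (k l m n : nat) (X Y I F : nat -> L2class R) (b : nat -> rho_series R).
Local Notation V := (L2class R).
Variables (D q : nat) (P : nat -> nat -> R -> R) (B : R).
Hypotheses (q0 : (0 < q)%N) (D0 : (0 < D)%N) (cP : coefP q (2 * D) P) (B0 : 0 <= B).
Local Notation d := (2 * D)%N.
Local Notation Q := (q + 2 * D)%N.
Local Notation LL := (@Lop R D P).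
Hypothesis apri : forall m x, modes m x -> Hr Q x -> Nr Q x <= B * Nr q (LL x).
Hypothesis onto : forall m, onto_on d q m LL.

(** Near-axis solutions in terms of classes. The initial data enter through the projections [Pk m],
    and the orders 0 and 1 carry no equation of their own. *)
Definition vsol F I b X : Prop := forall m,
  [/\ Hr Q (X m), modes m (X m), Pk m (X m) = Pk m (I m) & Pms m.+2 (@lam R m) (LL (X m.+2)) = F m + Lv b X m].

Let Q2 : (q + 2 <= Q)%N. Proof. by rewrite leq_add2l; lia. Qed.
Let HrQ2 (x : V) : Hr Q x -> Hr (q + 2) x. Proof. exact: Hr_le. Qed.

Lemma Lv_ext b X Y m : (forall j, (j <= m.+1)%N -> X j = Y j) -> Lv b X m = Lv b Y m.
Proof.
move=> h; rewrite /Lv; congr (_ + _); apply: eq_bigr => k _; rewrite h//.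
  by apply: leq_trans (leq_subr _ _) (leqnSn _).
exact: leq_subr.
Qed.

(** The stage [XX n] has its final values up to order [n + 1], because the equation that fixes order
    [n + 2] involves only those; the solution is the diagonal. *)
Lemma vsol_exists F I b : coefA q b -> (forall m, Hr q (F m) /\ modes m (F m)) ->
  (forall m, Hr Q (I m) /\ Pk m (I m) = I m) -> exists X, vsol F I b X.
Proof.
move=> cb hF hI.
pose good Y := forall j, Hr Q (Y j) /\ modes j (Y j).
have Lg m Y : good Y -> Hr q (F m + Lv b Y m) /\ modes m (F m + Lv b Y m).
  move=> gY; have [f1 f2] := hF m; split.
    by apply: HrD f1 _; apply: Hr_Lv => // j; apply: HrQ2; case: (gY j).
  apply: modesD f2 _; apply: (Lv_modes q0 cb) => j _; have [g1 g2] := gY j; split=> //.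
  by apply: Hr_le g1; lia.
have step (mY : nat * (nat -> V)) : exists v, good mY.2 ->
    [/\ modes mY.1 v, Hr Q v & LL v = Tm mY.1 (F mY.1 + Lv b mY.2 mY.1)].
  case: mY => m Y /=; have [gY|nY] := pselect (good Y); last by exists 0 => gY; case: nY.
  have [l1 l2] := Lg m Y gY.
  have [v [v1 v2 v3]] := onto (modes_Pms m (fun k => (@lam R m k)^-1) (F m + Lv b Y m)) (Hr_Pms m (fun k => (@lam R m k)^-1) l1).
  by exists v.
have [S hS] := boolp.choice step.
pose XX := fix XX n : nat -> V := if n is n'.+1 then
   (fun j => if j == n'.+2 then I j + S (n', XX n') else XX n' j) else I.
have gXX n : good (XX n).
  elim: n => [|n IH] j /=.
    by have [i1 i2] := hI j; split=> //; exact: modes_Pk.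
  case: eqP => [->|_]; last exact: IH.
  have [s1 s2 _] := hS (n, XX n) IH; have [i1 i2] := hI n.+2.
  by split; [exact: HrD|apply: modesD; [exact: modes_Pk|exact: modes_SS]].
have stab n k j : (j <= n.+1)%N -> XX (n + k)%N j = XX n j.
  move=> jn; elim: k => [|k IH]; first by rewrite addn0.
  by rewrite addnS /=; case: eqP => // e; move: jn; rewrite e; lia.
pose X j := XX j j.
have XE n j : (j <= n.+1)%N -> XX n j = X j.
  rewrite leq_eqVlt => /orP[/eqP ->|].
    by rewrite /X -(stab n 1%N)// addn1.
  by rewrite ltnS => jn; rewrite /X -[in LHS](subnKC jn) stab.
exists X => m; have [x1 x2] := gXX m m; have [i1 i2] := hI m.
have eX n : X n.+2 = I n.+2 + S (n, XX n) by rewrite -(XE n.+1 n.+2)//= eqxx.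
split=> //.
  case: m {x1 x2 i1} i2 => [|[|m]] i2 //.
  have [s1 s2 s3] := hS (m, XX m) (gXX m); have [_ l2] := Lg m _ (gXX m); have [i1 _] := hI m.+2.
  by rewrite eX; have [_ e _] := solve_step cP s2 i1 i2 l2 s1 s3; exact: e.
have [s1 s2 s3] := hS (m, XX m) (gXX m); have [_ l2] := Lg m _ (gXX m); have [j1 j2] := hI m.+2.
have [_ _ e] := solve_step cP s2 j1 j2 l2 s1 s3.
by rewrite eX e; congr (_ + _); apply: Lv_ext => j jm; exact: XE.
Qed.

(** [s^(m+2)] is distributed as [s^(k+1)] on the coefficient and [s^(m+1-k)] on the unknown. What
    remains is a geometric sum of ratio [s (4 r + 1) <= 1/2], at most twice that ratio. *)
Lemma weighted_Lv b X (M r s S : R) m : coefA q b -> coefB q M r b -> 0 <= r -> 0 <= M -> 0 <= s ->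
  s * (4 * r + 1) <= 2^-1 -> (forall j, Hr Q (X j)) -> (forall j, (j <= m.+1)%N -> s ^+ j * Nr Q (X j) <= S) ->
  s ^+ m.+2 * (B / m.+1%:R * Nr q (Lv b X m)) <= B * (9 * 3 ^+ q * M) * (2 * (s * (4 * r + 1))) * S.
Proof.
move=> cb bb r0 M0 s0 hs hX hS.
have m0 : (0 : R) < m.+1%:R by rewrite ltr0n.
set C := 9 * 3 ^+ q * M; have C0 : 0 <= C by rewrite !mulr_ge0// exprn_ge0.
set a := 4 * r + 1 in hs *; have a0 : 0 <= a by rewrite /a addr_ge0// mulr_ge0.
have S0 : 0 <= S by apply: le_trans (hS 0%N isT); rewrite mulr_ge0 ?exprn_ge0 ?Nr_ge0.
have h := Lv_bound m q0 r0 M0 cb bb (fun j => HrQ2 (hX j)).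
rewrite -/a -/C in h.
have h2 : s ^+ m.+2 * (B / m.+1%:R * Nr q (Lv b X m)) <= s ^+ m.+2 * (B * (C * \sum_(k < m.+2) a ^+ k.+1 * Nr (q + 2) (X (m.+1 - k)%N))).
  apply: ler_wpM2l; first exact: exprn_ge0.
  rewrite -mulrA; apply: ler_wpM2l => //.
  by rewrite ler_pdivrMl// mulrA.
apply: le_trans h2 _.
have -> : s ^+ m.+2 * (B * (C * \sum_(k < m.+2) a ^+ k.+1 * Nr (q + 2) (X (m.+1 - k)%N))) =
   B * C * \sum_(k < m.+2) (s * a) ^+ k.+1 * (s ^+ (m.+1 - k) * Nr (q + 2) (X (m.+1 - k)%N)).
  rewrite mulrCA [s ^+ _ * (C * _)]mulrCA mulrA mulr_sumr; congr (_ * _); apply: eq_bigr => k _.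
  have -> : s ^+ m.+2 = s ^+ k.+1 * s ^+ (m.+1 - k).
    have km : (k <= m.+1)%N := ltn_ord k.
    by rewrite -exprD addSn (subnKC km).
  by rewrite exprMn; ring.
rewrite -[leRHS]mulrA ler_wpM2l ?mulr_ge0//.
have t0 : 0 <= s * a by rewrite mulr_ge0.
apply: (@le_trans _ _ (\sum_(k < m.+2) (s * a) ^+ k.+1 * S)).
  apply: ler_sum => k _; rewrite ler_wpM2l ?exprn_ge0//.
  apply: le_trans (hS (m.+1 - k)%N (leq_subr _ _)); rewrite ler_wpM2l ?exprn_ge0//; exact: Nr_le.
rewrite -mulr_suml ler_wpM2r//.
under eq_bigr => k _ do rewrite exprS.
rewrite -mulr_sumr [leRHS]mulrC ler_wpM2l//.
have t1 : 0 <= s * a < 1 by rewrite t0 (le_lt_trans hs)// invf_lt1 ?ltr1n.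
have g := sum_geometric_le m.+2 t1; rewrite big_mkord in g; apply: le_trans g _.
by rewrite -[leRHS]invrK lef_pV2 ?posrE ?invr_gt0//; lra.
Qed.

(** By induction on the order: for small [s] the contribution of [Lv] is at most half of the bound
    valid for the lower orders, and [2 (SI + SF)] is the fixed point of [S = SI + SF + S / 2]. *)
Lemma energy F I b X (M r s SI SF : R) : coefA q b -> coefB q M r b -> 0 <= r -> 0 <= M -> 0 <= s ->
  s * (4 * r + 1) <= 2^-1 -> B * (9 * 3 ^+ q * M) * (2 * (s * (4 * r + 1))) <= 2^-1 ->
  (forall m, Hr q (F m) /\ modes m (F m)) -> (forall m, Hr Q (I m) /\ Pk m (I m) = I m) ->
  vsol F I b X -> (forall m, s ^+ m * Nr Q (I m) <= SI) ->
  (forall m, s ^+ m.+2 * (B / m.+1%:R * Nr q (F m)) <= SF) ->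
  forall m, s ^+ m * Nr Q (X m) <= 2 * (SI + SF).
Proof.
move=> cb bb r0 M0 s0 hs hB hF hI hX hSI hSF.
have sn n : 0 <= s ^+ n by exact: exprn_ge0.
have SI0 : 0 <= SI by apply: le_trans (hSI 0%N); rewrite mulr_ge0 ?Nr_ge0.
have SF0 : 0 <= SF.
  by apply: le_trans (hSF 0%N); rewrite !mulr_ge0 ?Nr_ge0// exprn_ge0.
have XH j : Hr Q (X j) by case: (hX j).
move=> m; have [n] := ubnP m; elim: n m => [//|n IH] m mn.
have base : X m = I m -> s ^+ m * Nr Q (X m) <= 2 * (SI + SF).
  by move=> ->; apply: le_trans (hSI m) _; lra.
case: m mn base => [|[|m]] mn base.
- by apply: base; have [_ x2 x3 _] := hX 0%N; exact: modes_01 x2 x3 (hI 0%N).2.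
- by apply: base; have [_ x2 x3 _] := hX 1%N; exact: modes_01 x2 x3 (hI 1%N).2.
have [x1 x2 x3 _] := hX m.+2; have [_ _ _ x4] := hX m; have [i1 i2] := hI m.+2.
have [f1 f2] := hF m.
have hL : Hr q (Lv b X m) by apply: Hr_Lv => // j; exact: HrQ2.
have mL : modes m (Lv b X m).
  by apply: (Lv_modes q0 cb) => j _; have [y1 y2 _ _] := hX j; split=> //; apply: Hr_le y1; lia.
have [mv ev] := step_solve cP x1 i1 i2 (modesD f2 mL) x2 x3 x4.
have hv : Nr Q (X m.+2 - I m.+2) <= B / m.+1%:R * Nr q (F m) + B / m.+1%:R * Nr q (Lv b X m).
  apply: le_trans (apri mv (HrB x1 i1)) _; rewrite ev -mulrDr -mulrA ler_wpM2l//.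
  apply: le_trans (Tm_bound m (HrD f1 hL)) _; rewrite ler_wpM2l ?invr_ge0//; exact: NrD.
have hx : Nr Q (X m.+2) <= Nr Q (I m.+2) + (B / m.+1%:R * Nr q (F m) + B / m.+1%:R * Nr q (Lv b X m)).
  have -> : X m.+2 = I m.+2 + (X m.+2 - I m.+2) by rewrite addrC subrK.
  by apply: le_trans (NrD i1 (HrB x1 i1)) _; rewrite lerD2l.
have w := weighted_Lv cb bb r0 M0 s0 hs XH (S := 2 * (SI + SF)) (m := m) (fun j jm => IH j (leq_ltn_trans jm (mn : (m.+1 < n)%N))).
apply: le_trans (ler_wpM2l (sn _) hx) _; rewrite !mulrDr.
have h1 := hSI m.+2; have h2 := hSF m.
have h3 : B * (9 * 3 ^+ q * M) * (2 * (s * (4 * r + 1))) * (2 * (SI + SF)) <= 2^-1 * (2 * (SI + SF)).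
  by rewrite ler_wpM2r// mulr_ge0// addr_ge0.
apply: le_trans (lerD h1 (lerD h2 (le_trans w h3))) _; lra.
Qed.

Lemma coefA_sub b b' : coefA q b -> coefA q b' -> coefA q (fun j => series_sub (b' j) (b j)).
Proof.
move=> cb cb' j hj k; have [c1 m1] := cb j hj k; have [c2 m2] := cb' j hj k.
split; first exact: is_CqB.
rewrite /series_sub (clsB (is_Cq_L2 c2) (is_Cq_L2 c1)); exact: modesB.
Qed.

Lemma vsol_diff F I b b' X X' : coefA q b -> coefA q b' -> vsol F I b X -> vsol F I b' X' ->
  vsol (Lv (fun j => series_sub (b' j) (b j)) X) (fun=> 0) b' (fun j => X' j - X j).
Proof.
move=> cb cb' hX hX' m; have [x1 x2 x3 x4] := hX m; have [y1 y2 y3 y4] := hX' m.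
have [u1 _ _ _] := hX m.+2; have [v1 _ _ _] := hX' m.+2.
have dQ : (d <= Q)%N by exact: leq_addl.
have h2 : (2 <= Q)%N by lia.
split; [exact: HrB|exact: modesB| |].
  by rewrite -scaleN1r PkD PkZ x3 y3 Pk0 scaleN1r subrr.
have X2 j : Hr 2 (X j) by have [a _ _ _] := hX j; exact: Hr_le a.
have X2' j : Hr 2 (X' j) by have [a _ _ _] := hX' j; exact: Hr_le a.
rewrite (LopB cP (Hr_le dQ v1) (Hr_le dQ u1)) PmsB x4 y4 opprD addrACA subrr add0r.
by rewrite (LvB m q0 cb cb' X2 X2') addrC.
Qed.

(** The difference solves the recursion of [b'] with zero initial data and with [Lv] of the
    difference of the coefficients, applied to [X], as its source; the weighted size of this source
    is proportional to [eta]. *)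
Lemma diff_bound F I b b' X X' (M eta r s S : R) : coefA q b -> coefA q b' -> coefB q M r b' ->
  coefB q eta r (fun j => series_sub (b' j) (b j)) -> 0 <= r -> 0 <= M -> 0 <= eta -> 0 <= s ->
  s * (4 * r + 1) <= 2^-1 -> B * (9 * 3 ^+ q * M) * (2 * (s * (4 * r + 1))) <= 2^-1 ->
  vsol F I b X -> vsol F I b' X' -> (forall m, s ^+ m * Nr Q (X m) <= S) ->
  forall m, s ^+ m * Nr Q (X' m - X m) <= 2 * (B * (9 * 3 ^+ q * eta) * (2 * (s * (4 * r + 1))) * S).
Proof.
move=> cb cb' bb' be r0 M0 e0 s0 hs hB hX hX' hS m.
have cd := coefA_sub cb cb'.
have X0 j : Hr Q (X j) by have [a _ _ _] := hX j.
have hF k : Hr q (Lv (fun j => series_sub (b' j) (b j)) X k) /\ modes k (Lv (fun j => series_sub (b' j) (b j)) X k).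
  split; first by apply: Hr_Lv => // j; exact: HrQ2.
  by apply: (Lv_modes q0 cd) => j _; have [a1 a2 _ _] := hX j; split=> //; apply: Hr_le a1; lia.
have hI k : Hr Q (0 : V) /\ Pk k 0 = 0 :> V by split; [exact: Hr0|exact: Pk0].
rewrite -[X in 2 * X]add0r.
apply: (energy cb' bb' r0 M0 s0 hs hB hF hI (vsol_diff cb cb' hX hX')) => k.
  by rewrite Nr_0 mulr0.
by apply: weighted_Lv => // j _; exact: hS.
Qed.

(** The comparison for equal coefficients, with [eta = 0]. A weighted bound is asked of one of the
    two solutions, and no growth condition of the other. *)
Lemma vsol_uniq F I b X X' (M r s S : R) : coefA q b -> coefB q M r b -> 0 <= r -> 0 <= M -> 0 < s ->
  s * (4 * r + 1) <= 2^-1 -> B * (9 * 3 ^+ q * M) * (2 * (s * (4 * r + 1))) <= 2^-1 ->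
  vsol F I b X -> vsol F I b X' -> (forall m, s ^+ m * Nr Q (X m) <= S) -> forall m, X' m = X m.
Proof.
move=> cb bb r0 M0 s0 hs hB hX hX' hS m.
have be : coefB q 0 r (fun j => series_sub (b j) (b j)).
  move=> j hj k; rewrite mul0r; have -> : series_sub (b j) (b j) k = fun=> 0.
    by apply/funext => z; rewrite /series_sub subrr.
  exact: Cbd_cst0.
have := diff_bound cb cb bb be r0 M0 (lexx 0) (ltW s0) hs hB hX hX' hS m.
rewrite !(mulr0, mul0r) pmulr_rle0 ?exprn_gt0// => h.
apply/eqP; rewrite -subr_eq0; apply/eqP/nm_eq0/eqP; rewrite eq_le nm_ge0 andbT.
exact: le_trans (nm_le_Nr Q _) h.
Qed.

End Solutions.

(** * Estimates for the given operator [P] *)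

Section Operator.
Context {R : realType}.
Implicit Types (x y : L2class R) (k m n D q : nat) (P : nat -> nat -> R -> R).

Lemma dop_psd D P : coefP 0 (2 * D) P -> positive_semidefinite D P ->
  forall x, Hr (2 * D) x -> 0 <= dot x (dop (2 * D) P x).
Proof.
move=> cP psd x hx; have lx := repr2_L2 x; have [l e] := cls_apply_P cP lx.
rewrite -[X in dot X _]repr2K -[X in dop _ _ X]repr2K -e dot_cls//; apply: psd.
by apply/is_HqP; rewrite repr2K.
Qed.

(** Ellipticity is tested at [(1, 0)], which gives the coefficient of [d_s^(2D)] with its sign, and
    at [(a, 1)], which keeps the symbol in one variable away from [0]. *)
Lemma elliptic_coefs D P : strongly_elliptic D P -> exists2 C : R, 0 < C &
  [/\ forall s, C <= (-1) ^+ D * P (2 * D)%N 0%N s,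
      forall s, C <= `|P (2 * D)%N 0%N s| &
      forall s a : R, C <= `|\sum_(n < (2 * D).+1) P (2 * D)%N n s * a ^+ (2 * D - n)|].
Proof.
move=> [C C0 hC]; exists C => //.
have sgn (u : R) : (-1) ^+ D * u <= `|u|.
  by apply: le_trans (ler_norm _) _; rewrite normrM normrX normrN1 expr1n mul1r.
have h1 s : C <= (-1) ^+ D * P (2 * D)%N 0%N s.
  have := hC s 1 0; rewrite xpair_eqE oner_eq0 /= => /(_ isT).
  rewrite expr1n expr0n addr0 expr1n mulr1 big_ord_recl big1 => [|i _]; last by rewrite expr0n mulr0.
  by rewrite subn0 expr1n expr0 !mulr1 addr0.
split=> // s; first exact: le_trans (h1 s) (sgn _).
move=> a; have := hC s a 1; rewrite xpair_eqE oner_eq0 andbF => /(_ isT) h.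
have h2 : C <= C * (a ^+ 2 + 1 ^+ 2) ^+ D.
  rewrite ler_peMr ?(ltW C0)// exprn_ege1// expr1n lerDr; exact: sqr_ge0.
apply: le_trans h2 (le_trans h _); apply: le_trans (sgn _) _.
by rewrite (eq_bigr (fun n : 'I_(2 * D).+1 => P (2 * D)%N n s * a ^+ (2 * D - n))) // => n _; rewrite expr1n mulr1.
Qed.

Lemma coefP_bounded q d P : coefP q d P -> exists M : R, forall k n, (n <= k <= d)%N -> Cbd q M (fsnd (P k n)).
Proof.
move=> cP.
have /boolp.choice [M hM] : forall kn : nat * nat, exists M : R, (kn.2 <= kn.1 <= d)%N -> Cbd q M (fsnd (P kn.1 kn.2)).
  move=> [k n]; have [h|h] := boolP (n <= k <= d)%N; last by exists 0 => /= h'; case/negP: h.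
  by have [M hM] := is_Cq_Cbd (per_Cq_snd (cP k n h)); exists M.
exists (\sum_(k < d.+1) \sum_(n < d.+1) `|M (k : nat, n : nat)|) => k n nk.
apply: Cbd_leM (hM (k, n) nk).
have kd : (k < d.+1)%N by case/andP: nk.
have nd : (n < d.+1)%N by case/andP: nk => h1 h2; rewrite ltnS (leq_trans h1).
rewrite (bigD1 (Ordinal kd))//= (bigD1 (Ordinal nd))//= -addrA; apply: le_trans (ler_norm _) _.
by rewrite lerDl addr_ge0// sumr_ge0// => i _; rewrite sumr_ge0.
Qed.

(** [B] comes from estimates that do not see [m]; surjectivity is obtained for each [m] with
    constants of its own. *)
Lemma Lop_estimates D q P : (0 < q)%N -> (0 < D)%N -> coefP q (2 * D) P ->
  strongly_elliptic D P -> positive_semidefinite D P -> exists B : R,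
  [/\ 0 <= B,
      forall m x, modes m x -> Hr (q + 2 * D) x -> Nr (q + 2 * D) x <= B * Nr q (Lop D P x) &
      forall m, onto_on (2 * D) q m (Lop D P)].
Proof.
move=> q0 D0 cP ell psd.
have d0 : (0 < 2 * D)%N by lia.
have [C C0 [c1 c2 c3]] := elliptic_coefs ell.
have [M hM] := coefP_bounded cP.
have M0 : 0 <= M by have := Cbd_ge0 (hM 0%N 0%N isT).
have cP0 : coefP 0 (2 * D) P by move=> k n h; exact: per_Cq_le (cP k n h).
have psd' := dop_psd cP0 psd.
have cP1 : coefP 1 (2 * D) P by move=> k n h; exact: per_Cq_le (cP k n h).
have hM1 k n : (n <= k <= 2 * D)%N -> Cbd 1 M (fsnd (P k n)) by move=> h; exact: Cbd_le (hM k n h).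
have [K K0 hK] := dop_elliptic d0 C0 cP1 hM1 c2 c3.
set CP : R := (2 * D).+1%:R * ((2 * D).+1%:R * (3 ^+ q * M)).
have CP0 : 0 <= CP by rewrite /CP !mulr_ge0// exprn_ge0.
have [B B0 hB] := @elliptic_regularity R (2 * D) q K (1 + CP) d0 K0 (addr_ge0 ler01 CP0).
exists B; split=> //; last by move=> m; exact: onto_dop q0 D0 C0 cP hM c1 psd'.
move=> m x mx hx; apply: (hB m (Lop D P)) => //; split.
- have := op_on_comb 1 1 q0 (op_on_id m (2 * D) q) (@op_on_dop R m (2 * D) q P M CP q0 cP hM (lexx _)).
  rewrite normr1 !mul1r; have -> // : (fun x : L2class R => 1 *: x + 1 *: dop (2 * D) P x) = Lop D P.
  by apply/funext => y; rewrite !scale1r.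
- by move=> y my hy; exact: hK my hy.
move=> y my hy; have h := psd' y hy.
have h1 : nm y ^+ 2 <= nm y * nm (Lop D P y).
  by apply: le_trans (dot_lev _ _); rewrite /Lop dotDr sqr_nm lerDl.
have [->|y0] := eqVneq (nm y) 0; first exact: nm_ge0.
have yp : 0 < nm y by rewrite lt_neqAle eq_sym y0 nm_ge0.
by rewrite -(ler_pM2l yp) -expr2.
Qed.

End Operator.

(** * From sequences of classes to analytic series *)

Section Bridge.
Context {R : realType}.
Implicit Types (x y : L2class R) (k m n D q : nat) (P : nat -> nat -> R -> R) (f g phi : rho_series R) (b : nat -> rho_series R).

Lemma analytic_norm_leP (sigma S : R) (W : function_space R) f :
  (analytic_norm sigma W f <= S%:E)%E <-> forall m, sigma ^+ m * space_norm W (f m) <= S.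
Proof.
split=> [h m|h].
  by rewrite -lee_fin; apply: le_trans h; apply: ereal_sup_ubound; exists m.
by apply: ge_ereal_sup => _ [m _ <-]; rewrite lee_fin.
Qed.

Lemma analytic_norm_fin (sigma : R) (W : function_space R) f : 0 <= sigma ->
  (forall m, 0 <= space_norm W (f m)) -> (analytic_norm sigma W f < +oo)%E ->
  exists2 S : R, 0 <= S & analytic_norm sigma W f = S%:E.
Proof.
move=> s0 n0 fin.
have ge0 : (0 <= analytic_norm sigma W f)%E.
  have h : ((sigma ^+ 0 * space_norm W (f 0%N))%:E <= analytic_norm sigma W f)%E.
    by apply: ereal_sup_ubound; exists 0%N.
  by apply: le_trans h; rewrite lee_fin mulr_ge0// exprn_ge0.
case: (analytic_norm sigma W f) ge0 fin => [S| |] //= S0 _; by exists S.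
Qed.

Lemma Hq_norm_ge0 q (u : R * R -> R) : 0 <= Hq_norm q u.
Proof. exact: sqrtr_ge0. Qed.
Lemma Cq_norm_ge0 q (u : R * R -> R) : is_Cq q u -> 0 <= Cq_norm q u.
Proof. by move=> h; exact: Cbd_ge0 (Cbd_Cq_norm h). Qed.

Lemma coefficients_coefA Sigma q b : coefficients Sigma q b -> coefA q b.
Proof.
move=> h j hj k; have [c m _ _] := h j hj; split; first exact: c.
by apply: (hm_modes (is_Cq_L2 (c k))); exact: m k.
Qed.

Lemma coefB_le (Sigma S : R) q b : 0 < Sigma -> coefA q b ->
  (forall j, (1 <= j <= 7)%N -> (analytic_norm Sigma (Cq_space R q) (b j) <= S%:E)%E) -> coefB q S Sigma^-1 b.
Proof.
move=> s0 cb h j hj k; have [c _] := cb j hj k.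
apply: Cbd_leM (Cbd_Cq_norm c); have := (analytic_norm_leP _ _ _ _).1 (h j hj) k.
by rewrite /= exprVn ler_pdivlMr ?exprn_gt0// mulrC.
Qed.

Lemma coefB_add q (M M' r : R) a b : coefA q a -> coefA q b -> coefB q M r a ->
  coefB q M' r (fun j => series_sub (b j) (a j)) -> coefB q (M + M') r b.
Proof.
move=> ca cb ba bd j hj k; have [a1 _] := ca j hj k; have [b1 _] := cb j hj k.
rewrite mulrDl; have -> : b j k = fun z => a j k z + series_sub (b j) (a j) k z.
  by apply/funext => z; rewrite /series_sub addrC subrK.
by apply: CbdD (ba j hj k) (bd j hj k) => //; exact: is_CqB.
Qed.

Lemma Pms_add m (c : R) nu x : modes m x -> c *: x + Pms m nu x = Pms m (fun k => c + nu k) x.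
Proof.
move=> mx; rewrite -[X in c *: X]mx /Pms scaler_sumr -big_split /=; apply: eq_bigr => k _.
by rewrite scale1r scalerDl.
Qed.

(** On classes with finitely many frequencies [D1 D1] multiplies by [-k^2], so [laplace_perp]
    becomes the multiplier [lam m]; equality almost everywhere becomes equality of classes. *)
Lemma near_axisP D q P b f phiIC phi : (0 < q)%N -> coefP q (2 * D) P -> coefA q b ->
  (forall m, is_Hq (q + 2 * D) (phi m)) -> (forall m, is_L2 (f m)) -> (forall m, is_L2 (phiIC m)) ->
  near_axis_solution D P b f phiIC phi <->
  vsol D q P (fun m => cls (f m)) (fun m => cls (phiIC m)) b (fun m => cls (phi m)).
Proof.
move=> q0 cP cb hphi lf lI.
have cP0 : coefP 0 (2 * D) P by move=> k n h; exact: per_Cq_le (cP k n h).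
have lphi m : is_L2 (phi m) by have /is_HqP [] := hphi m.
have Hphi m : Hr (q + 2 * D) (cls (phi m)) by have /is_HqP [] := hphi m.
have dQ : (2 * D <= q + 2 * D)%N by exact: leq_addl.
have L1 m := cls_one_plus_P cP0 (lphi m).
have L2 m := cls_laplace_perp (L1 m.+2).1.
have L3 m := cls_apply_L m q0 cb lphi.
have LR m : is_L2 (fun z => f m z + apply_L b phi m z) := L2D (lf m) (L3 m).1.
have eqn m : modes m.+2 (cls (phi m.+2)) ->
   (aeeq (laplace_perp (one_plus_P D P phi) m) (fun z => f m z + apply_L b phi m z) <->
    Pms m.+2 (@lam R m) (Lop D P (cls (phi m.+2))) = cls (f m) + Lv b (fun m => cls (phi m)) m).
  move=> mm.
  have mL : modes m.+2 (Lop D P (cls (phi m.+2))) := modes_Lop cP mm (Hr_le dQ (Hphi m.+2)).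
  have e1 : cls (laplace_perp (one_plus_P D P phi) m) = Pms m.+2 (@lam R m) (Lop D P (cls (phi m.+2))).
    by have := (L2 m).2; rewrite (L1 m.+2).2 (modes_D1D1 mL) (Pms_add _ _ mL).
  have e2 : cls (fun z => f m z + apply_L b phi m z) = cls (f m) + Lv b (fun m => cls (phi m)) m.
    by rewrite (clsD (lf m) (L3 m).1) (L3 m).2.
  rewrite -e1 -e2; split=> h; first exact: cls_eq (L2 m).1 (LR m) h.
  exact: cls_inj (L2 m).1 (LR m) h.
split=> [[h1 h2 h3] m|h].
  have mm k : modes k (cls (phi k)) by apply: (hm_modes (lphi k)); exact: h1 k.
  split; [exact: Hphi|exact: mm| |exact: (eqn m (mm m.+2)).1 (h2 m)].
  exact: (initial_dataP m (lphi m) (lI m)).1 (h3 m).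
split=> m.
- have [_ mm _ _] := h m; exact: (has_modesP m (lphi m)).2 mm.
- have [_ mm _ _] := h m.+2; have [_ _ _ e] := h m; exact: (eqn m mm).2 e.
have [_ _ e _] := h m; exact: (initial_dataP m (lphi m) (lI m)).2 e.
Qed.

(** For fixed [rho] the series is dominated in [H^Q] by a geometric one, and its expansion in theta
    is inherited from [modes]. *)
Lemma analytic_of_bound Q (sigma S : R) phi : 0 < sigma -> (forall m, is_Hq Q (phi m)) ->
  (forall m, modes m (cls (phi m))) -> (forall m, sigma ^+ m * Nr Q (cls (phi m)) <= S) ->
  analytic sigma (Hq_space R Q) phi.
Proof.
move=> s0 hphi mphi hS.
have lphi m : is_L2 (phi m) by have /is_HqP [] := hphi m.
have Hphi m : Hr Q (cls (phi m)) by have /is_HqP [] := hphi m.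
split=> //.
- by move=> m; exact: (has_modesP m (lphi m)).2 (mphi m).
- move=> rho /andP[rho0 rhos].
  (* A ratio strictly between [rho / sigma] and 1, positive even for [rho = 0]; its square root is
     the rate used for completeness. *)
  pose t : R := (1 + rho / sigma) / 2.
  have rs : 0 <= rho / sigma < 1 by rewrite divr_ge0 ?(ltW s0)// ltr_pdivrMr// mul1r.
  have t01 : 0 < t < 1 by move: rs => /andP[r1 r2]; rewrite /t; apply/andP; split; lra.
  have tr : rho / sigma <= t by move: rs => /andP[r1 r2]; rewrite /t; lra.
  pose qq := Num.sqrt t.
  have q01 : 0 < qq < 1.
    case/andP: t01 => t0 t1; rewrite /qq sqrtr_gt0 t0 /= -sqrtr1 ltr_sqrt//.
  have q2 : qq ^+ 2 = t by rewrite sqr_sqrtr// ltW//; case/andP: t01.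
  pose X N := \sum_(m < N) rho ^+ m *: cls (phi m).
  have HX N : Hr Q (X N) by apply: Hr_sum => m _; exact: HrZ.
  have dX N : Nr Q (X N.+1 - X N) <= S * (qq ^+ 2) ^+ N.
    rewrite /X big_ord_recr /= addrAC subrr add0r (NrZ _ (Hphi N)) ger0_norm ?exprn_ge0//.
    have -> : rho ^+ N = (rho / sigma) ^+ N * sigma ^+ N by rewrite -exprMn divfK// gt_eqF.
    rewrite -mulrA [leRHS]mulrC q2; apply: ler_pM => //.
    + by rewrite exprn_ge0//; case/andP: rs.
    + by rewrite mulr_ge0 ?Nr_ge0// exprn_ge0// ltW.
    + by apply: lerXn2r; rewrite ?nnegrE//; [case/andP: rs|case/andP: t01 => /ltW].
  have [x [K [hx hK]]] := Hr_complete q01 HX dX.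
  exists (repr2 x); first by apply/is_HqP; rewrite repr2K; split=> //; exact: repr2_L2.
  have lsum N : is_L2 (fun z => \sum_(m < N) rho ^+ m * phi m z) by apply: L2_sum => m _; exact: L2Z.
  have cE N : cls (fun z => repr2 x z - \sum_(m < N) rho ^+ m * phi m z) = x - X N.
    rewrite (clsB (repr2_L2 x) (lsum N)) repr2K cls_sum; last by move=> m _; exact: L2Z.
    by congr (_ - _); apply: eq_bigr => m _; rewrite clsZ.
  have bnd N : Hq_norm Q (fun z => repr2 x z - \sum_(m < N) rho ^+ m * phi m z) <= Q.+1%:R * K * qq ^+ N.
    apply: le_trans (Hq_norm_le Q (L2B (repr2_L2 x) (lsum N))) _; rewrite cE -mulrA ler_wpM2l//.
    by rewrite -(NrN (HrB hx (HX N))) opprB.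
  apply/cvgrPdist_le => e e0.
  have c0 : (fun N => Q.+1%:R * K * qq ^+ N) @ \oo --> (0 : R).
    rewrite -[X in _ --> X](mulr0 (Q.+1%:R * K)); apply: cvgM; first exact: cvg_cst.
    by apply: cvg_expr; rewrite ger0_norm; case/andP: q01 => // /ltW.
  move/cvgrPdist_le : c0 => /(_ e e0) [N0 _ hN]; exists N0 => // N hNN.
  have := hN N hNN; rewrite /= !sub0r !normrN => h; rewrite ger0_norm ?Hq_norm_ge0//.
  exact: le_trans (bnd N) (le_trans (ler_norm _) h).
apply: (@le_lt_trans _ _ (Q.+1%:R * S)%:E); last exact: ltry.
apply/analytic_norm_leP => m /=.
apply: le_trans (ler_wpM2l _ (Hq_norm_le Q (lphi m))) _; first by rewrite exprn_ge0// ltW.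
by rewrite mulrCA ler_wpM2l.
Qed.

End Bridge.

Theorem theorem3p8 (R : realType) (sigma0 Sigma : R) (q D : nat)
  (a : nat -> rho_series R) (P : nat -> nat -> R -> R)
  (sigma0_gt0 : 0 < sigma0) (sigma0_lt : sigma0 < Sigma)
  (q_ge1 : (1 <= q)%N) (D_ge1 : (1 <= D)%N)
  (a_analytic : coefficients Sigma q a)
  (P_Cq : forall m n : nat, (n <= m <= 2 * D)%N -> is_Cq1 q (P m n))
  (P_elliptic : strongly_elliptic D P)
  (P_selfadjoint : selfadjoint D P)
  (P_psd : positive_semidefinite D P) :
  exists sigma C : R,
    [/\ 0 < sigma <= sigma0,
        0 < C,
        forall f phiIC : rho_series R,
          analytic sigma0 (Hq_space R q) f ->
          analytic sigma0 (Hq_space R (q + 2 * D)) phiIC ->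
          extremal_modes phiIC ->
          exists phi : rho_series R,
            [/\ analytic_solution sigma q D P a f phiIC phi,
                forall psi : rho_series R,
                  analytic_solution sigma q D P a f phiIC psi ->
                  forall m, aeeq (psi m) (phi m) &
                (analytic_norm sigma (Hq_space R (q + 2 * D)) phi <=
                 C%:E * analytic_norm sigma0 (Hq_space R q) f +
                 C%:E * analytic_norm sigma0 (Hq_space R (q + 2 * D)) phiIC)%E] &
        exists2 delta : R, 0 < delta &
          forall f phiIC : rho_series R,
            analytic sigma0 (Hq_space R q) f ->
            analytic sigma0 (Hq_space R (q + 2 * D)) phiIC ->
            extremal_modes phiIC ->
            forall b : nat -> rho_series R,
              coefficients Sigma q b -> coefficients_close Sigma q delta a b ->
              exists phi : rho_series R,
                [/\ analytic_solution sigma q D P b f phiIC phi,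
                    forall psi : rho_series R,
                      analytic_solution sigma q D P b f phiIC psi ->
                      forall m, aeeq (psi m) (phi m) &
                    forall eps : R, 0 < eps ->
                      exists2 eta : R, 0 < eta &
                        forall (b' : nat -> rho_series R) (phi' : rho_series R),
                          coefficients Sigma q b' ->
                          coefficients_close Sigma q delta a b' ->
                          coefficients_close Sigma q eta b b' ->
                          analytic_solution sigma q D P b' f phiIC phi' ->
                          (analytic_norm sigma (Hq_space R (q + 2 * D))
                             (series_sub phi' phi) < eps%:E)%E]].
Proof.
have Sig0 : 0 < Sigma by exact: lt_trans sigma0_lt.
have D0 : (0 < D)%N := D_ge1; have q0 : (0 < q)%N := q_ge1.
have cP : coefP q (2 * D) P by move=> k n h; apply: is_Cq1_per; exact: P_Cq.
have [B [B0 apri onto]] := Lop_estimates q0 D0 cP P_elliptic P_psd.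
set Q := (q + 2 * D)%N.
have ca := coefficients_coefA a_analytic.
have [M0 M00 ba] : exists2 M0 : R, 0 <= M0 & coefB q M0 Sigma^-1 a.
  have /boolp.choice [S hS] : forall j, exists S : R, (1 <= j <= 7)%N ->
      0 <= S /\ analytic_norm Sigma (Cq_space R q) (a j) = S%:E.
    move=> j; have [hj|hj] := boolP (1 <= j <= 7)%N; last by exists 0.
    have [c _ _ fin] := a_analytic j hj.
    by have [S S0 e] := @analytic_norm_fin R Sigma (Cq_space R q) (a j) (ltW Sig0) (fun m => Cq_norm_ge0 (c m)) fin; exists S.
  exists (\sum_(j < 8) `|S j|); first exact: sumr_ge0.
  apply: coefB_le => // j hj; have [S0 ->] := hS j hj.
  have j8 : (j < 8)%N by case/andP: hj.
  rewrite lee_fin (bigD1 (Ordinal j8))//=; apply: le_trans (ler_norm _) _.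
  by rewrite lerDl sumr_ge0.
set r := Sigma^-1 in ba *; have r0 : 0 <= r by rewrite invr_ge0 ltW.
(* The extra 1 leaves room for all coefficients at distance less than [delta = 1] from [a], which
   makes the radius below common to them. *)
pose M := M0 + 1; have M1 : 0 <= M by rewrite addr_ge0.
pose A := B * (9 * 3 ^+ q * M); have A0 : 0 <= A by rewrite !mulr_ge0// exprn_ge0.
pose w := 4 * r + 1; have w0 : 0 < w by rewrite /w ltr_wpDl// mulr_ge0.
(* Chosen so that [s w <= 1/2] and [2 A s w <= 1/2], the two smallness conditions of [energy];
   neither involves [f] or [phiIC]. *)
pose s := Num.min sigma0 ((2 * w * (1 + 2 * A))^-1).
have den0 : 0 < 2 * w * (1 + 2 * A) by rewrite !mulr_gt0// ltr_wpDr// mulr_ge0.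
have s0 : 0 < s by rewrite lt_min sigma0_gt0 invr_gt0.
have ss0 : s <= sigma0 by rewrite ge_min lexx.
have sw : s * w * (2 * (1 + 2 * A)) <= 1.
  have : s <= (2 * w * (1 + 2 * A))^-1 by rewrite ge_min lexx orbT.
  by rewrite -[X in s <= X]mul1r ler_pdivlMr// => h; apply: le_trans h; rewrite le_eqVlt; apply/orP; left; apply/eqP; ring.
have sw0 : 0 <= s * w by rewrite mulr_ge0 ?ltW.
have swA : 0 <= s * w * A by rewrite mulr_ge0.
have hs1 : s * (4 * r + 1) <= 2^-1.
  rewrite -/w; move: sw swA sw0; move: (s * w) => u.
  have -> : u * (2 * (1 + 2 * A)) = 2 * u + 4 * (u * A) by ring.
  lra.
have hs2 : B * (9 * 3 ^+ q * M) * (2 * (s * (4 * r + 1))) <= 2^-1.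
  rewrite -/w -/A; move: sw swA sw0; move: (s * w) => u.
  have -> : u * (2 * (1 + 2 * A)) = 2 * u + 4 * (u * A) by ring.
  have -> : A * (2 * u) = 2 * (u * A) by ring.
  lra.
have cB b : coefficients Sigma q b -> coefficients_close Sigma q 1 a b -> coefB q M r b.
  move=> hb cl; have cb := coefficients_coefA hb; apply: (coefB_add ca cb ba).
  apply: (coefB_le Sig0 (coefA_sub ca cb)) => j hj; exact: ltW (cl j hj).
have ba' : coefB q M r a.
  move=> j hj k; apply: Cbd_leM (ba j hj k).
  by rewrite ler_wpM2r ?exprn_ge0// /M lerDl.
(* Product of the comparison factors between [Nr] and [Hq_norm] with the factor 2 of [energy]; the
   final 1 makes it positive. *)
pose C := 2 * Q.+1%:R * (3 ^+ Q + s ^+ 2 * B * 3 ^+ q) + 1.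
have C0 : 0 < C.
  by rewrite /C ltr_wpDl// !mulr_ge0// addr_ge0 ?exprn_ge0// !mulr_ge0 ?exprn_ge0// ltW.
(* Stated for every [b] with the bound [M], so that it serves [a] and its perturbations alike. *)
have data f phiIC : analytic sigma0 (Hq_space R q) f -> analytic sigma0 (Hq_space R Q) phiIC -> extremal_modes phiIC ->
  exists SF SI : R, [/\ 0 <= SF, 0 <= SI, analytic_norm sigma0 (Hq_space R q) f = SF%:E,
    analytic_norm sigma0 (Hq_space R Q) phiIC = SI%:E &
    forall b, coefficients Sigma q b -> coefB q M r b ->
      [/\ exists X, vsol D q P (fun m => cls (f m)) (fun m => cls (phiIC m)) b X,
          forall X, vsol D q P (fun m => cls (f m)) (fun m => cls (phiIC m)) b X ->
            forall m, s ^+ m * Nr Q (X m) <= 2 * (3 ^+ Q * SI + s ^+ 2 * B * 3 ^+ q * SF) &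
          forall phi, (forall m, is_Hq Q (phi m)) -> (near_axis_solution D P b f phiIC phi <->
            vsol D q P (fun m => cls (f m)) (fun m => cls (phiIC m)) b (fun m => cls (phi m)))]].
  move=> [hf mf _ finf] [hI mI _ finI] ext.
  have [SF SF0 eF] := @analytic_norm_fin R sigma0 (Hq_space R q) f (ltW sigma0_gt0) (fun m => Hq_norm_ge0 q (f m)) finf.
  have [SI SI0 eI] := @analytic_norm_fin R sigma0 (Hq_space R Q) phiIC (ltW sigma0_gt0) (fun m => Hq_norm_ge0 Q (phiIC m)) finI.
  exists SF, SI; split=> // b hb bb; have cb := coefficients_coefA hb.
  have lf m : is_L2 (f m) by have /is_HqP [] := hf m.
  have lI m : is_L2 (phiIC m) by have /is_HqP [] := hI m.
  have hF m : Hr q (cls (f m)) /\ modes m (cls (f m)).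
    by split; [have /is_HqP [] := hf m|apply: (hm_modes (lf m)); exact: mf m].
  have hII m : Hr Q (cls (phiIC m)) /\ Pk m (cls (phiIC m)) = cls (phiIC m).
    by split; [have /is_HqP [] := hI m|exact: extremal_Pk (lI m) (ext m)].
  have pw m : s ^+ m <= sigma0 ^+ m by apply: lerXn2r; rewrite ?nnegrE// ltW.
  have bF m : s ^+ m * Nr q (cls (f m)) <= 3 ^+ q * SF.
    apply: le_trans (ler_pM _ _ (pw m) (Nr_le_Hq_norm (lf m) (hF m).1)) _; rewrite ?Nr_ge0// ?exprn_ge0 ?(ltW s0)//.
    rewrite mulrCA ler_wpM2l ?exprn_ge0//.
    by apply: (analytic_norm_leP sigma0 SF (Hq_space R q) f).1; rewrite eF.
  have bI m : s ^+ m * Nr Q (cls (phiIC m)) <= 3 ^+ Q * SI.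
    apply: le_trans (ler_pM _ _ (pw m) (Nr_le_Hq_norm (lI m) (hII m).1)) _; rewrite ?Nr_ge0// ?exprn_ge0 ?(ltW s0)//.
    rewrite mulrCA ler_wpM2l ?exprn_ge0//.
    by apply: (analytic_norm_leP sigma0 SI (Hq_space R Q) phiIC).1; rewrite eI.
  split.
  - exact: (vsol_exists q0 D0 cP B0 onto cb hF hII).
  - move=> X hX; apply: (energy q0 D0 cP B0 apri cb bb r0 M1 (ltW s0) hs1 hs2 hF hII hX bI) => m.
    have -> : s ^+ m.+2 * (B / m.+1%:R * Nr q (cls (f m))) = (s ^+ 2 * B) * (m.+1%:R^-1 * (s ^+ m * Nr q (cls (f m)))).
      by rewrite -addn2 exprD; ring.
    rewrite -[leRHS]mulrA; apply: ler_wpM2l; first by rewrite mulr_ge0// exprn_ge0// ltW.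
    apply: le_trans (bF m); rewrite ler_piMl ?mulr_ge0 ?Nr_ge0 ?exprn_ge0 ?(ltW s0)//.
    by rewrite invf_le1 ?ltr0n// ler1n.
  by move=> phi hphi; exact: (near_axisP q0 cP cb hphi lf lI).
have sol f phiIC (hf : analytic sigma0 (Hq_space R q) f) (hI : analytic sigma0 (Hq_space R Q) phiIC)
    (ext : extremal_modes phiIC) b : coefficients Sigma q b -> coefB q M r b ->
  exists phi, [/\ analytic_solution s q D P b f phiIC phi,
    forall psi, analytic_solution s q D P b f phiIC psi -> forall m, aeeq (psi m) (phi m) &
    (analytic_norm s (Hq_space R Q) phi <= C%:E * analytic_norm sigma0 (Hq_space R q) f +
       C%:E * analytic_norm sigma0 (Hq_space R Q) phiIC)%E].
  move=> hb bb; have [SF [SI [SF0 SI0 eF eI /(_ b hb bb) [[X hX] bnd equiv]]]] := data f phiIC hf hI ext.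
  have cb := coefficients_coefA hb.
  pose phi m := repr2 (X m).
  have eX : (fun m => cls (phi m)) = X by apply/funext => m; exact: repr2K.
  have hphi m : is_Hq Q (phi m).
    by apply/is_HqP; rewrite repr2K; split; [exact: repr2_L2|case: (hX m)].
  have bX := bnd X hX.
  have sphi : analytic_solution s q D P b f phiIC phi.
    split; last by apply: (equiv phi hphi).2; rewrite eX.
    apply: analytic_of_bound s0 hphi _ _ => [m|m]; first by rewrite repr2K; case: (hX m).
    by rewrite repr2K; exact: bX.
  exists phi; split=> //.
    move=> psi [[hpsi _ _ _] spsi] m.
    have vpsi := (equiv psi hpsi).1 spsi.
    have := vsol_uniq q0 D0 cP B0 apri cb bb r0 M1 s0 hs1 hs2 hX vpsi bX m => e.
    have /is_HqP [l1 _] := hpsi m; have /is_HqP [l2 _] := hphi m.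
    by apply: (cls_inj l1 l2); rewrite e repr2K.
  rewrite eF eI -!EFinM -EFinD; apply/analytic_norm_leP => m /=.
  have /is_HqP [l2 _] := hphi m.
  apply: le_trans (ler_wpM2l _ (Hq_norm_le Q l2)) _; first by rewrite exprn_ge0// ltW.
  rewrite mulrCA repr2K; apply: le_trans (ler_wpM2l _ (bX m)) _; first by [].
  have p1 : 0 <= (3 : R) ^+ Q by rewrite exprn_ge0.
  have p2 : 0 <= s ^+ 2 * B * 3 ^+ q by rewrite !mulr_ge0 ?exprn_ge0// ltW.
  have u1 : 3 ^+ Q * SI <= (3 ^+ Q + s ^+ 2 * B * 3 ^+ q) * SI by rewrite ler_wpM2r// lerDl.
  have u2 : s ^+ 2 * B * 3 ^+ q * SF <= (3 ^+ Q + s ^+ 2 * B * 3 ^+ q) * SF by rewrite ler_wpM2r// lerDr.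
  have n0 : 0 <= 2 * Q.+1%:R :> R by rewrite mulr_ge0.
  have u3 := ler_wpM2l n0 (lerD u1 u2).
  have -> : C * SF + C * SI = 2 * Q.+1%:R * ((3 ^+ Q + s ^+ 2 * B * 3 ^+ q) * SI + (3 ^+ Q + s ^+ 2 * B * 3 ^+ q) * SF) + (SF + SI).
    by rewrite /C; ring.
  rewrite mulrA [Q.+1%:R * 2]mulrC; apply: le_trans u3 _; by rewrite lerDl addr_ge0.
exists s, C; split=> //.
- by rewrite s0.
- by move=> f phiIC hf hI ext; exact: (sol f phiIC hf hI ext a a_analytic ba').
exists 1 => // f phiIC hf hI ext b hb clb.
have bb := cB b hb clb; have cb := coefficients_coefA hb.
have [phi [sphi uphi _]] := sol f phiIC hf hI ext b hb bb.
exists phi; split=> // eps eps0.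
have [SF [SI [SF0 SI0 eF eI hdata]]] := data f phiIC hf hI ext.
have [_ bnd equiv] := hdata b hb bb.
have [[hphi _ _ _] nphi] := sphi.
have vphi := (equiv phi hphi).1 nphi; have bX := bnd _ vphi.
set S := 2 * (3 ^+ Q * SI + _) in bX.
have S0 : 0 <= S by apply: le_trans (bX 0%N); rewrite mulr_ge0 ?Nr_ge0.
pose K := Q.+1%:R * (2 * (B * (9 * 3 ^+ q) * (2 * (s * (4 * r + 1))) * S)).
have q3 : 0 <= 9 * 3 ^+ q :> R by rewrite mulr_ge0// exprn_ge0.
have K0 : 0 <= K.
  apply: mulr_ge0 => //; apply: mulr_ge0 => //; apply: mulr_ge0 => //.
  by apply: mulr_ge0; [exact: mulr_ge0|rewrite mulr_ge0].
(* [diff_bound], expressed in [Hq_norm], gives the bound [K eta], and this choice makes it smaller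
   than [eps] even for [K = 0]. *)
exists (eps / (2 * (K + 1))); first by rewrite divr_gt0// mulr_gt0// ltr_wpDl.
set eta := eps / _.
have eta0 : 0 <= eta by rewrite divr_ge0 ?(ltW eps0)// mulr_ge0// addr_ge0.
move=> b' phi' hb' clb' close [[hphi' _ _ _] nphi'].
have bb' := cB b' hb' clb'; have cb' := coefficients_coefA hb'.
have [_ _ equiv'] := hdata b' hb' bb'.
have vphi' := (equiv' phi' hphi').1 nphi'.
have be : coefB q eta r (fun j => series_sub (b' j) (b j)).
  by apply: (coefB_le Sig0 (coefA_sub cb cb')) => j hj; exact: ltW (close j hj).
have db := diff_bound q0 D0 cP B0 apri cb cb' bb' be r0 M1 eta0 (ltW s0) hs1 hs2 vphi vphi' bX.
apply: (@le_lt_trans _ _ (K * eta)%:E); last first.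
  rewrite lte_fin /eta mulrA ltr_pdivrMr ?mulr_gt0 ?ltr_wpDl//.
  by rewrite mulrC ltr_pM2l//; move: K0; lra.
apply/analytic_norm_leP => m /=.
have /is_HqP [l1 _] := hphi m; have /is_HqP [l2 _] := hphi' m.
have ld : is_L2 (series_sub phi' phi m) := L2B l2 l1.
apply: le_trans (ler_wpM2l _ (Hq_norm_le Q ld)) _; first by rewrite exprn_ge0// ltW.
rewrite mulrCA /series_sub (clsB l2 l1) /K -mulrA ler_wpM2l//.
apply: le_trans (db m) _; rewrite le_eqVlt; apply/orP; left; apply/eqP; ring.
Qed.
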